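(* Let $\mu,\nu\in\mathbb C$. For any two elements $\mathcal P,\mathcal Q\in\Gamma_\bullet(\mathcal A)$, $$\Delta_{\mu,\nu}(\mathcal P)\circ\Delta_{\mu,\nu}(\mathcal Q)=\Delta_{\mu,\nu}(\mathcal P\mathcal Q),$$ where the left-hand side is the product of relations.
   Context: **Phantom constants.** $\mathcal A$ is the complex Grassmann algebra with generators $\mathfrak a_1,\mathfrak a_2,\dots$ (finite linear combinations of monomials), $\mathcal A_{\bar0},\mathcal A_{\bar1}$ its even and odd parts; the subscript $\downarrow$ means putting all $\mathfrak a_j=0$. The odd coordinate $\theta$, $\theta^2=0$, commutes with all $\mathfrak a_j$. Substitutions are computed by Taylor expansion in nilpotent parts. **Relations.** A relation $X\rightrightarrows Y$ is a subset of $X\times Y$; for $H:X\rightrightarrows Y$, $G:Y\rightrightarrows Z$, $G\circ H$ is the set of $(x,z)$ such that $(x,y)\in H$, $(y,z)\in G$ for some $y\in Y$. **The space $\mathcal W$.** $\mathcal W$ consists of $f(\phi)+g(\phi)\theta$, where $f,g$ are smooth complex functions on $\mathbb R/2\pi\mathbb Z$, $f(\phi+\pi)=f(\phi)$, $g(\phi+\pi)=-g(\phi)$, and $f$ is defined up to addition of constants; $\mathcal W[\mathcal A]=\mathcal W\otimes\mathcal A$. **The supercircle.** $S^{1|1}$ is the circle $\phi\in\mathbb R/2\pi\mathbb Z$ with the odd coordinate $\theta$ and contact form $d\phi+\theta\,d\theta$; $\sigma:(\phi,\theta)\mapsto(\phi+\pi,-\theta)$. **The semigroup $\Gamma_\bullet(\mathcal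 A)$.** An element $\mathcal Q$ is a one-dimensional complex manifold $Q$ with boundary, equivalent to an annulus, with an additional Grassmann coordinate $\theta$ and a contact structure (a 1-form up to multiplication by functions) equivalent to $\frac{dz}{iz}+\theta\,d\theta$, smooth up to the boundary, together with two $\mathcal A$-contactomorphisms $q_+,q_-$ from $S^{1|1}$ to the two boundary components (entry $(\partial Q)_+$ and exit $(\partial Q)_-$) with the restricted contact structure. Here an $\mathcal A$-contactomorphism is an $\mathcal A$-valued change of variables (even coordinate $\mapsto$ $Q+q\theta$, odd coordinate $\mapsto R\theta+r$, with $Q,R$ even and $q,r$ odd in the $\mathfrak a$'s) sending the contact form to a multiple of the contact form. It is required that $(\kappa\circ\iota)\circ q_\pm=q_\pm\circ\sigma$, where $\kappa$ is the rotation of the annulus by $180$ degrees and $\iota:(z,\theta)\mapsto(z,-\theta)$. Two such data define the same element if there is a contactomorphism $h$ of the superannuli with $h\circ q_\pm=q'_\pm$. The product $\mathcal P\mathcal Q$ is obtained by gluing the exit of $\mathcal Q$ to the entry of $\mathcal P$, identifying $q_-$ with $p_+$ (fiberwise in $\theta$). **Logarithmic densities.** Let $U\subset\mathbb C$ be a topological annulus surrounding $0$ ($0\notin U$). A logarithmic density of type $(\mu,\nu)$ in $U$ is a formal expression $$f(z,\theta)-i\mu\ln z+\nu\ln(dz\,d\theta)$$ defined up to addition of a complex-valued constant function. Under a contact change of variables $z=\mathbf Q(u,\xi;\mathfrak a)=Q+q\xi$, $\theta=\mathbf R(u,\xi;\mathfrak a)=R\xi+r$ it changes to $$\Bigl(f(\mathbf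 Q,\mathbf R)-i\mu\ln(\mathbf Q/u)+\nu\ln\mathrm{Ber}\begin{pmatrix}\partial_u\mathbf Q&\partial_\xi\mathbf Q\\\partial_u\mathbf R&\partial_\xi\mathbf R\end{pmatrix}\Bigr)-i\mu\ln u+\nu\ln(du\,d\xi),$$ according to the usual manipulations with the symbols $d$; here $\mathrm{Ber}\begin{pmatrix}A&B\\C&D\end{pmatrix}=\det A\cdot\det(D-CA^{-1}B)^{-1}$. **The relation $\Delta_{\mu,\nu}$.** For $\mathcal Q\in\Gamma_\bullet(\mathcal A)$ consider a holomorphic logarithmic density of type $(\mu,\nu)$ on the contact superannulus, smooth up to the boundary. Its inverse images under $q_\pm$ are written as $$f_\pm(\phi,\theta)+\mu\phi+\nu\ln(d\phi\,d\theta),$$ which gives an element $f_+\oplus f_-\in\mathcal W[\mathcal A]\oplus\mathcal W[\mathcal A]$. The set of all $f_+\oplus f_-$ obtained from all such densities is the relation $\Delta_{\mu,\nu}(\mathcal Q):\mathcal W[\mathcal A]\rightrightarrows\mathcal W[\mathcal A]$.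
   Formalization: In Ber, D−CA⁻¹B is replaced by D+BA⁻¹C: with θ commuting with the 𝔞_j the stated order breaks the chain rule and Δ would depend on the representative. Inverse images are computed with u=e^{iφ}, which drops the non-periodic term iνφ so that f_± can lie in W[A]. *)

(* Defs.v *)
From HB Require Import structures.
From mathcomp Require Import all_boot all_order all_algebra.
From mathcomp Require Import finmap complex.
From mathcomp Require Import all_classical all_reals all_analysis.
Set Implicit Arguments.
Unset Strict Implicit.
Unset Printing Implicit Defensive.
Import Order.TTheory GRing.Theory Num.Theory.
Import numFieldNormedType.Exports.

Local Open Scope classical_set_scope.
Local Open Scope complex_scope.
Local Open Scope ring_scope.

(* The set of equivalence classes of an equivalence relation E on T. *)
Definition quot (T : Type) (E : T -> T -> Prop) : Type :=
  {X : set T | exists x, X = E x}.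

Definition class (T : Type) (E : T -> T -> Prop) (x : T) : quot E :=
  exist _ (E x : set T) (ex_intro _ x erefl).

Definition relation (X Y : Type) : Type := set (X * Y).

Definition rel_comp (X Y Z : Type) (G : relation Y Z) (H : relation X Y) :
    relation X Z :=
  [set p | exists y, H (p.1, y) /\ G (y, p.2)].

Section Calculus.
Variable R : realType.
Local Notation C := R[i].

Definition expi (x : R) : C := cos x +i* sin x.

Definition cexp (z : C) : C := (expR (complex.Re z))%:C * expi (complex.Im z).

(* Smooth complex-valued functions of a real variable. *)
Definition rsmooth (f : R -> R) : Prop :=
  forall n x, derivable (derive1n n f) x 1.

Definition csmooth (f : R -> C) : Prop :=
  rsmooth (fun x => complex.Re (f x)) /\ rsmooth (fun x => complex.Im (f x)).

Definition rderive (f : R -> C) (x : R) : C :=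
  derive1 (fun t => complex.Re (f t)) x +i* derive1 (fun t => complex.Im (f t)) x.

(* Complex derivative relative to a set K: at z in K, the limit of the
   difference quotients over w in K. *)
Definition cquotient (f : C -> C) (z w : C) : C^o := (f w - f z) / (w - z).

Definition cderivable (K : set C) (f : C -> C) (z : C) : Prop :=
  cvg (cquotient f z w @[w --> within K (z : C^o)^']).

Definition cderive (K : set C) (f : C -> C) (z : C) : C :=
  lim (cquotient f z w @[w --> within K (z : C^o)^']).

(* Holomorphic on K and smooth up to the boundary: for K the closure of a
   domain with smooth boundary, f has complex derivatives of all orders at all
   points of K, one-sided at the boundary points. *)
Definition holomorphic (K : set C) (f : C -> C) : Prop :=
  forall n z, K z -> cderivable K (iter n (cderive K) f) z.

End Calculus.

Section Grassmann.
Variable R : realType.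
Local Notation C := R[i].

(* The coefficient of x : gr at {j1 < ... < jk} is that of the monomial
   a_j1 ... a_jk. Finiteness of the support is imposed separately, uniformly
   for a family of elements, by fin_gen below. *)
Definition gr : Type := {fset nat} -> C.

Definition inversions (I J : {fset nat}) : nat :=
  (\sum_(i <- I) \sum_(j <- J) (j < i)%N)%N.

Definition gmul (x y : gr) : gr := fun S =>
  \sum_(I <- fpowerset S)
    (-1) ^+ inversions I (S `\` I)%fset * x I * y (S `\` I)%fset.

Definition gconst (c : C) : gr := fun S => if S == fset0 then c else 0.

Definition gscale (c : C) (x : gr) : gr := fun S => c * x S.

Definition geven (x : gr) : Prop := forall S, odd #|` S| -> x S = 0.

Definition godd (x : gr) : Prop := forall S, ~~ odd #|` S| -> x S = 0.

(* The family F (x), x in D, takes values in the subalgebra generated by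
   finitely many of the a_j. *)
Definition fin_gen (X : Type) (D : set X) (F : X -> gr) : Prop :=
  exists n, forall x (S : {fset nat}) j,
    D x -> j \in S -> (n <= j)%N -> F x S = 0.

(* A[theta], theta ^ 2 = 0, theta commuting with the a_j:
   (a, b) stands for a + b theta. *)
Definition sgr : Type := (gr * gr)%type.

Definition sadd (X Y : sgr) : sgr :=
  (fun S => X.1 S + Y.1 S, fun S => X.2 S + Y.2 S).

Definition smul (X Y : sgr) : sgr :=
  (gmul X.1 Y.1, fun S => gmul X.1 Y.2 S + gmul X.2 Y.1 S).

Definition sscale (c : C) (X : sgr) : sgr := (gscale c X.1, gscale c X.2).

Definition sconst (c : C) : sgr := (gconst c, gconst 0).

Definition theta : sgr := (gconst 0, gconst 1).

Definition spow (X : sgr) (n : nat) : sgr := iter n (smul X) (sconst 1).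

Definition body (X : sgr) : C := X.1 fset0.

Definition nilpart (X : sgr) : sgr := sadd X (sconst (- body X)).

Definition dtheta (X : sgr) : sgr := (X.2, gconst 0).

(* Taylor expansion \sum_k J k / k! * (nilpart X) ^ k, where J k is the k-th
   derivative at body X. At the monomials S and S theta the terms with
   k > #|S| + 1 vanish, so the sums below are the whole series. *)
Definition taylor_term (J : nat -> gr) (X : sgr) (k : nat) : sgr :=
  smul (gscale (k`!%:R)^-1 (J k), gconst 0) (spow (nilpart X) k).

Definition taylor (J : nat -> gr) (X : sgr) : sgr :=
  (fun S => \sum_(k < #|` S|.+2) (taylor_term J X k).1 S,
   fun S => \sum_(k < #|` S|.+2) (taylor_term J X k).2 S).

Definition sexp (X : sgr) : sgr :=
  taylor (fun=> gconst (cexp (body X))) X.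

Definition sinv (X : sgr) : sgr :=
  taylor (fun k => gconst ((-1) ^+ k * k`!%:R / body X ^+ k.+1)) X.

End Grassmann.

Declare Scope sgr_scope.
Delimit Scope sgr_scope with S.
Infix "+" := sadd : sgr_scope.
Infix "*" := smul : sgr_scope.

Section Superfunctions.
Variable R : realType.
Local Notation C := R[i].
Local Notation sgr := (sgr R).
Local Notation gr := (gr R).

Definition smoothA (F : R -> sgr) : Prop :=
  [/\ fin_gen setT (fun x => (F x).1), fin_gen setT (fun x => (F x).2) &
      forall S, csmooth (fun x => (F x).1 S) /\ csmooth (fun x => (F x).2 S)].

Definition sderive (F : R -> sgr) (x : R) : sgr :=
  (fun S => rderive (fun t => (F t).1 S) x,
   fun S => rderive (fun t => (F t).2 S) x).

Definition holomorphicA (K : set C) (F : C -> sgr) : Prop :=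
  [/\ fin_gen K (fun z => (F z).1), fin_gen K (fun z => (F z).2) &
      forall S, holomorphic K (fun z => (F z).1 S) /\
                holomorphic K (fun z => (F z).2 S)].

Definition jet (K : set C) (f : C -> gr) (z : C) (n : nat) : gr :=
  fun S => iter n (cderive K) (fun w => f w S) z.

Definition scderive (K : set C) (F : C -> sgr) (z : C) : sgr :=
  (jet K (fun w => (F w).1) z 1, jet K (fun w => (F w).2) z 1).

(* The value at z = X, theta = Y of f(z) + g(z) theta, F z = (f z, g z). *)
Definition ssubst (K : set C) (F : C -> sgr) (X Y : sgr) : sgr :=
  (taylor (jet K (fun w => (F w).1) (body X)) X +
   taylor (jet K (fun w => (F w).2) (body X)) X * Y)%S.

(* An A-valued change of variables on X: the even coordinate goes to
   ev = Q + q theta, the odd one to od = r + R theta. *)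
Record smap (X : Type) : Type := SMap { ev : X -> sgr; od : X -> sgr }.

Definition smap_parity (X : Type) (D : set X) (m : smap X) : Prop :=
  forall x, D x -> [/\ geven (ev m x).1, godd (ev m x).2,
                       godd (od m x).1 & geven (od m x).2].

Definition scomp (X : Type) (K : set C) (m2 : smap C) (m1 : smap X) : smap X :=
  SMap (fun x => ssubst K (ev m2) (ev m1 x) (od m1 x))
       (fun x => ssubst K (od m2) (ev m1 x) (od m1 x)).

Definition smap_eq (X : Type) (D : set X) (m m' : smap X) : Prop :=
  forall x, D x -> ev m x = ev m' x /\ od m x = od m' x.

Definition sid : smap C := SMap (fun z => sconst z) (fun=> theta R).

(* The pullback of dz/(iz) + theta d theta under z = Q, theta = T, where Q' and
   T' are the derivatives along the even coordinate x of the source, is a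
   multiple of (a dx + theta d theta). Both sides are expanded as
   (...) dx + (...) d theta. *)
Definition contact (a : C) (Q Q' T T' : sgr) : Prop :=
  exists L : sgr,
    (Q' * sinv (sscale 'i Q) + T * T' = L * sconst a)%S /\
    (dtheta Q * sinv (sscale 'i Q) + T * dtheta T = L * theta R)%S.

(* Ber (A, B; C, D) = A (D - C A^-1 B)^-1. The entries B and C are odd, and by
   the sign rule - C A^-1 B = B A^-1 C. As theta commutes with the a_j here, the
   two orders give different results, and it is the latter that agrees with the
   usual Berezinian (computed with theta odd with respect to the a_j); with the
   former the chain rule fails. *)
Definition Ber (A B Cc D : sgr) : sgr := (A * sinv (D + B * sinv A * Cc))%S.

Definition annulus (r1 r2 : R) : set C :=
  [set z | r1%:C <= `|z| /\ `|z| <= r2%:C].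

(* Holomorphic contact maps between regions of C \ {0}, each with the contact
   form dz/(iz) + theta d theta. *)
Definition contact_map (K L : set C) (m : smap C) : Prop :=
  [/\ holomorphicA K (ev m) /\ holomorphicA K (od m),
      smap_parity K m,
      forall z, K z -> L (body (ev m z)) &
      forall z, K z ->
        contact ('i * z)^-1 (ev m z) (scderive K (ev m) z)
                            (od m z) (scderive K (od m) z)].

Definition contactomorphism (K L : set C) (m : smap C) : Prop :=
  contact_map K L m /\
  exists m' : smap C,
    [/\ contact_map L K m',
        smap_eq K (scomp L m' m) sid & smap_eq L (scomp K m m') sid].

(* Contactomorphisms of the supercircle onto the circle |z| = r. The body is
   a diffeomorphism of degree 1, phi |-> r exp(i alpha(phi)); the nilpotent
   parts are arbitrary complex. *)
Definition circle_contactomorphism (r : R) (m : smap R) : Prop :=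
  [/\ smoothA (ev m) /\ smoothA (od m),
      smap_parity setT m,
      forall phi, ev m (phi + 2 * pi) = ev m phi /\
                  od m (phi + 2 * pi) = od m phi,
      exists alpha : R -> R,
        [/\ rsmooth alpha, forall phi, 0 < derive1 alpha phi,
            forall phi, alpha (phi + 2 * pi) = alpha phi + 2 * pi &
            forall phi, body (ev m phi) = r%:C * expi (alpha phi)] &
      forall phi, contact 1 (ev m phi) (sderive (ev m) phi)
                            (od m phi) (sderive (od m) phi)].

(* (kappa o iota) o m = m o sigma, where kappa o iota : (z, theta) |->
   (- z, - theta) and sigma : (phi, theta) |-> (phi + pi, - theta). *)
Definition sigma_equivariant (m : smap R) : Prop :=
  forall phi,
    [/\ (ev m (phi + pi)).1 = gscale (-1) (ev m phi).1,
        gscale (-1) (ev m (phi + pi)).2 = gscale (-1) (ev m phi).2,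
        (od m (phi + pi)).1 = gscale (-1) (od m phi).1 &
        gscale (-1) (od m (phi + pi)).2 = gscale (-1) (od m phi).2].

(* An annulus r_entry <= |z| <= r_exit with the contact form
   dz/(iz) + theta d theta and parametrized boundary circles. *)
Record superannulus : Type := Superannulus {
  r_entry : R;
  r_exit : R;
  q_entry : smap R;
  q_exit : smap R;
  r_entry_gt0 : 0 < r_entry;
  r_entry_lt_exit : r_entry < r_exit;
  q_entryP : circle_contactomorphism r_entry q_entry;
  q_exitP : circle_contactomorphism r_exit q_exit;
  q_entry_sigma : sigma_equivariant q_entry;
  q_exit_sigma : sigma_equivariant q_exit
}.

Definition carrier (x : superannulus) : set C :=
  annulus (r_entry x) (r_exit x).

Definition same_element (x y : superannulus) : Prop :=
  exists h : smap C,
    [/\ contactomorphism (carrier x) (carrier y) h,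
        smap_eq setT (scomp (carrier x) h (q_entry x)) (q_entry y) &
        smap_eq setT (scomp (carrier x) h (q_exit x)) (q_exit y)].

Definition Gamma : Type := quot same_element.

(* t is obtained from q and p by identifying q_exit with p_entry: it is the
   union of contactomorphic copies L of q and M of p, which meet along the
   common image of the glued circles. *)
Definition glued (p q t : superannulus) : Prop :=
  exists (L M : set C) (f g : smap C),
    [/\ contactomorphism (carrier q) L f /\ contactomorphism (carrier p) M g,
        L `|` M = carrier t,
        L `&` M = range (fun phi => body (ev (scomp (carrier q) f (q_exit q)) phi)),
        smap_eq setT (scomp (carrier q) f (q_exit q))
                     (scomp (carrier p) g (q_entry p)) &
        smap_eq setT (scomp (carrier q) f (q_entry q)) (q_entry t) /\
        smap_eq setT (scomp (carrier p) g (q_exit p)) (q_exit t)].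

(* T is the product P Q in Gamma. *)
Definition is_product (P Q T : Gamma) : Prop :=
  exists p q t, [/\ sval P p, sval Q q, sval T t & glued p q t].

(* The space W[A]: w phi = (f phi, g phi) stands for f(phi) + g(phi) theta,
   and f is defined up to a constant. *)
Definition is_W (w : R -> sgr) : Prop :=
  [/\ smoothA w,
      forall phi, w (phi + 2 * pi) = w phi &
      forall phi, (w (phi + pi)).1 = (w phi).1 /\
                  (w (phi + pi)).2 = gscale (-1) (w phi).2].

Definition preW : Type := {w : R -> sgr | is_W w}.

Definition eqW (v w : preW) : Prop :=
  exists c : gr, forall phi,
    sval v phi = (sval w phi + (c, gconst 0))%S.

Definition WA : Type := quot eqW.

(* w is the part f_pm of the inverse image f_pm + mu phi + nu ln(d phi d theta),
   up to a constant, of the logarithmic density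
   F - i mu ln z + nu ln(dz d theta) on K under m. The source has the coordinate
   u = exp(i phi), so that - i mu ln u = mu phi and
   d/du = (i u)^-1 d/d phi; thus E = ln (Q / u) and B = ln Ber, where Ber is
   taken with respect to (u, theta) and has a body of winding number 0. *)
Definition inverse_image (mu nu : C) (K : set C) (F : C -> sgr) (m : smap R)
    (w : R -> sgr) : Prop :=
  exists E B : R -> sgr,
    [/\ smoothA E /\ smoothA B,
        forall phi, sexp (E phi) = sscale (expi phi)^-1 (ev m phi),
        forall phi,
          let d X := sscale ('i * expi phi)^-1 (sderive X phi) in
          sexp (B phi) = Ber (d (ev m)) (dtheta (ev m phi))
                             (d (od m)) (dtheta (od m phi)) &
        forall phi,
          w phi = (ssubst K F (ev m phi) (od m phi) +
                   (sscale (- ('i * mu)) (E phi) + sscale nu (B phi)))%S].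

Definition Delta_data (mu nu : C) (x : superannulus) : relation WA WA :=
  [set p | exists (F : C -> sgr) (v w : preW),
    [/\ holomorphicA (carrier x) F,
        inverse_image mu nu (carrier x) F (q_entry x) (sval v),
        inverse_image mu nu (carrier x) F (q_exit x) (sval w) &
        p = (class eqW v, class eqW w)]].

Definition Delta (mu nu : C) (X : Gamma) : relation WA WA :=
  [set p | exists2 x, sval X x & Delta_data mu nu x p].

End Superfunctions.

(* Main.v *)
From HB Require Import structures.
From mathcomp Require Import all_boot all_order all_algebra.
From mathcomp Require Import finmap complex ring lra zify.
From mathcomp Require Import all_classical all_reals all_analysis.
Require Import Defs.
Set Implicit Arguments.
Unset Strict Implicit.
Unset Printing Implicit Defensive.
Import Order.TTheory GRing.Theory Num.Theory.
Import numFieldNormedType.Exports.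
Local Open Scope classical_set_scope.
Local Open Scope complex_scope.
Local Open Scope ring_scope.

(* A contact map z = Q + q theta, theta -> r + P theta satisfies
   q = - i Q P r and z Q' = Q (P^2 - i z r r'), so substitution along it is an
   algebra morphism and the Berezinian obeys a chain rule. On a round annulus
   ln (Q / z) and ln Ber exist, since they exist on a boundary circle and extend
   radially; up to additive constants, logarithmic densities can therefore be
   pulled back and pushed forward along contactomorphisms without changing their
   inverse images under the boundary circles. In particular the relation does not
   depend on the choice of a representative.
   A density on the glued annulus restricts to densities on the two pieces that
   have the same inverse image on the seam; this inverse image lies in W[A]
   because a density that is sigma-invariant on one boundary circle is
   sigma-invariant, by the identity theorem. Conversely, two densities on the
   pieces whose inverse images agree on the seam agree there with all their
   derivatives along the seam, and so form a holomorphic density on the union. *)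

(** * The Grassmann algebra *)

(** Since theta commutes with the a_j, substitution is not multiplicative for arbitrary odd data:
    the cross terms carry the product q r, which vanishes on contact maps because q is a multiple of
    r. The contact relations are therefore kept through every composition, and identities that
    combine them with anticommuting coefficients are checked by a normal form for supercommutative
    polynomials. In the product the seam need not be round, so the two pieces need not be round
    annuli. Derivatives are therefore taken relative to an arbitrary set without isolated points;
    the annuli, the pieces, the seam and the real line are all instances, and real smoothness
    becomes holomorphy relative to the line. Path integrals are avoided: identities between Taylor
    substitutions reduce to vanishing derivatives on the line, logarithms are continued in small
    radial steps, and the identity theorem comes from the maximum principle. On a boundary
    parametrization the body of P has a positive square but no prescribed sign; hence ln Ber is
    found as half a logarithm of a square. *)

Section GrassmannRing.
Variable R : realType.
Local Notation C := R[i].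
Local Notation gr := (gr R).
Implicit Types (x y z : gr) (S I J : {fset nat}).

HB.instance Definition _ := gen_eqMixin gr.
HB.instance Definition _ := gen_choiceMixin gr.

Fact gr_addA : associative (fun x y : gr => (fun S => x S + y S) : gr).
Proof. by move=> x y z; apply/funext => S; rewrite addrA. Qed.
Fact gr_addC : commutative (fun x y : gr => (fun S => x S + y S) : gr).
Proof. by move=> x y; apply/funext => S; rewrite addrC. Qed.
Fact gr_add0 : left_id ((fun=> 0) : gr) (fun x y : gr => (fun S => x S + y S) : gr).
Proof. by move=> x; apply/funext => S; rewrite add0r. Qed.
Fact gr_addN : left_inverse ((fun=> 0) : gr) (fun x : gr => (fun S => - x S) : gr)
  (fun x y : gr => (fun S => x S + y S) : gr).
Proof. by move=> x; apply/funext => S; rewrite addNr. Qed.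

HB.instance Definition _ :=
  GRing.isZmodule.Build gr gr_addA gr_addC gr_add0 gr_addN.

Lemma grP x y : (forall S, x S = y S) -> x = y.
Proof. by move=> xy; apply/funext. Qed.

Lemma gr0E S : (0 : gr) S = 0. Proof. by []. Qed.
Lemma grDE x y S : (x + y) S = x S + y S. Proof. by []. Qed.
Lemma grNE x S : (- x) S = - x S. Proof. by []. Qed.
Lemma grBE x y S : (x - y) S = x S - y S. Proof. by []. Qed.

Lemma gr_sumE (T : Type) (r : seq T) (P : pred T) (F : T -> gr) S :
  (\sum_(i <- r | P i) F i) S = \sum_(i <- r | P i) F i S.
Proof. by elim/big_rec2: _ => // i a b _ <-. Qed.

Lemma perm_fsetU I J : [disjoint I & J]%fset ->
  perm_eq (I `|` J)%fset (enum_fset I ++ enum_fset J).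
Proof.
move=> IJ; apply: uniq_perm; first exact: fset_uniq.
  rewrite cat_uniq !fset_uniq /= andbT; apply/hasPn => j jJ.
  by move: IJ; rewrite fdisjoint_sym => /fdisjointP/(_ j jJ).
by move=> j; rewrite inE mem_cat.
Qed.

Lemma inversionsUl I J S : [disjoint I & J]%fset ->
  inversions (I `|` J)%fset S = (inversions I S + inversions J S)%N.
Proof. by move=> IJ; rewrite /inversions (perm_big _ (perm_fsetU IJ)) big_cat. Qed.

Lemma inversionsUr I J S : [disjoint I & J]%fset ->
  inversions S (I `|` J)%fset = (inversions S I + inversions S J)%N.
Proof.
move=> IJ; rewrite /inversions -big_split /=; apply: eq_bigr => i _.
by rewrite (perm_big _ (perm_fsetU IJ)) big_cat.
Qed.

Lemma inversions0l J : inversions fset0 J = 0%N.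
Proof. by rewrite /inversions big_seq_fset0. Qed.
Lemma inversions0r J : inversions J fset0 = 0%N.
Proof. by rewrite /inversions big1 // => i _; rewrite big_seq_fset0. Qed.

(** Two distinct indices form an inversion in exactly one of the two orders. This is the source of
    the sign of supercommutativity. *)
Lemma inversions_sym I J : [disjoint I & J]%fset ->
  (inversions I J + inversions J I)%N = (#|` I| * #|` J|)%N.
Proof.
move=> IJ; rewrite /inversions [X in (_ + X)%N]exchange_big -big_split /=.
rewrite -sum1_size -[RHS]/(_ * _)%N big_distrl /=.
rewrite big_seq [RHS]big_seq; apply: eq_bigr => i iI; rewrite mul1n -sum1_size -big_split /=.
rewrite big_seq [RHS]big_seq; apply: eq_bigr => j jJ.
case: ltngtP => // eij; move/fdisjointP: IJ => /(_ i iI); by rewrite -eij jJ.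
Qed.

Lemma disjointDr I J : [disjoint I & J `\` I]%fset.
Proof. by apply/fdisjointP => i iI; rewrite inE iI. Qed.

Lemma fsetU_subD I J : (I `<=` J)%fset -> (I `|` (J `\` I))%fset = J.
Proof.
move=> /fsubsetP IJ; apply/fsetP => i; rewrite !inE.
by case: (boolP (i \in I)) => //= /IJ ->.
Qed.

Lemma perm_fpowersetU I S : (I `<=` S)%fset ->
  perm_eq [seq J <- fpowerset S | (I `<=` J)%fset]
          [seq (I `|` J)%fset | J <- fpowerset (S `\` I)%fset].
Proof.
move=> IS; apply: uniq_perm.
- by rewrite filter_uniq // fset_uniq.
- rewrite map_inj_in_uniq ?fset_uniq // => A B.
  rewrite !fpowersetE !fsubsetD => /andP[_ dA] /andP[_ dB] e.
  have h X : [disjoint X & I]%fset -> ((I `|` X) `\` I)%fset = X.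
    by move=> d; rewrite fsetDUl fsetDv fset0U; apply/fsetDidPl.
  by rewrite -(h _ dA) e h.
move=> J; rewrite mem_filter fpowersetE; apply/andP/mapP.
  move=> [IJ JS]; exists (J `\` I)%fset; first by rewrite fpowersetE fsetSD.
  by rewrite fsetU_subD.
move=> [B]; rewrite fpowersetE => BS ->; split; first exact: fsubsetUl.
by rewrite fsubUset IS (fsubset_trans BS) // fsubsetDl.
Qed.

Lemma big_fpowersetU I S (F : {fset nat} -> C) : (I `<=` S)%fset ->
  \sum_(J <- fpowerset S | (I `<=` J)%fset) F J =
  \sum_(J <- fpowerset (S `\` I)%fset) F (I `|` J)%fset.
Proof. by move=> IS; rewrite -big_filter (perm_big _ (perm_fpowersetU IS)) big_map. Qed.

Lemma fpowerset_filter J S : (J `<=` S)%fset ->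
  perm_eq (fpowerset J) [seq I <- fpowerset S | (I `<=` J)%fset].
Proof.
move=> JS; apply: uniq_perm; rewrite ?filter_uniq ?fset_uniq // => I.
rewrite mem_filter !fpowersetE; case: (boolP (I `<=` J)%fset) => //= IJ.
by rewrite (fsubset_trans IJ JS).
Qed.

(** Both triple products are sums over decompositions of S into three disjoint subsets. On one side
    they appear as chains I, J of subsets, reindexed by replacing J with its part outside I; the
    signs agree because inversions are additive in each argument. *)
Lemma gmulA : associative (@gmul R).
Proof.
move=> x y z; apply: grP => S; rewrite /gmul; apply/esym.
transitivity (\sum_(J <- fpowerset S) \sum_(I <- fpowerset S | (I `<=` J)%fset)
  (-1) ^+ (inversions J (S `\` J)%fset + inversions I (J `\` I)%fset) *
    x I * y (J `\` I)%fset * z (S `\` J)%fset).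
  rewrite big_seq [RHS]big_seq; apply: eq_bigr => J; rewrite fpowersetE => JS.
  rewrite (perm_big _ (fpowerset_filter JS)) big_filter mulr_sumr mulr_suml.
  by apply: eq_bigr => I _; rewrite exprD !mulrA.
rewrite (exchange_big_dep xpredT) //=.
rewrite big_seq [RHS]big_seq; apply: eq_bigr => I; rewrite fpowersetE => IS.
rewrite big_fpowersetU // mulr_sumr big_seq [RHS]big_seq; apply: eq_bigr => J.
rewrite fpowersetE fsubsetD => /andP[JS dJI].
have -> : ((I `|` J) `\` I = J)%fset.
  by rewrite fsetDUl fsetDv fset0U; apply/fsetDidPl.
have -> : (S `\` (I `|` J) = (S `\` I) `\` J)%fset by rewrite fsetDDl.
have JSI : (J `<=` S `\` I)%fset by rewrite fsubsetD JS.
have -> : inversions I (S `\` I)%fset =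
  (inversions I J + inversions I (S `\` I `\` J)%fset)%N.
  rewrite -inversionsUr ?disjointDr //; congr inversions.
  by rewrite fsetU_subD.
rewrite inversionsUl 1?fdisjoint_sym //.
rewrite -!mulrA [in RHS](mulrCA (x I)) !mulrA -exprD.
by do 3 congr (_ * _); congr (_ ^+ _); rewrite addnC addnA -!addnA; congr addn; rewrite addnC.
Qed.

Lemma gconstE (c : C) S : gconst c S = if S == fset0 then c else 0.
Proof. by []. Qed.

Lemma gmul_const (c : C) x S : gmul (gconst c) x S = c * x S.
Proof.
rewrite /gmul (big_fsetD1 fset0) /=; last by rewrite fpowersetE fsub0set.
rewrite big_seq big1 ?addr0 => [|I]; last first.
  by rewrite !inE gconstE => /andP[/negPf -> _]; rewrite mulr0 mul0r.
by rewrite gconstE eqxx inversions0l fsetD0 mul1r.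
Qed.

Lemma gmul_constr (c : C) x S : gmul x (gconst c) S = c * x S.
Proof.
rewrite /gmul (big_fsetD1 S) /=; last by rewrite fpowersetE.
rewrite big_seq big1 ?addr0 => [|I]; last first.
  rewrite !inE fpowersetE => /andP[nIS IS]; rewrite gconstE ifN ?mulr0 //.
  by rewrite fsetD_eq0; apply: contra nIS => SI; rewrite eqEfsubset IS.
by rewrite fsetDv gconstE eqxx inversions0r mul1r mulrC.
Qed.

Fact gmul1l : left_id (gconst 1) (@gmul R).
Proof. by move=> x; apply: grP => S; rewrite gmul_const mul1r. Qed.
Fact gmul1r : right_id (gconst 1) (@gmul R).
Proof. by move=> x; apply: grP => S; rewrite gmul_constr mul1r. Qed.
Fact gmulDl : left_distributive (@gmul R) +%R.
Proof.
move=> x y z; apply: grP => S; rewrite grDE /gmul -big_split /=.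
by apply: eq_bigr => I _; rewrite grDE mulrDr mulrDl.
Qed.
Fact gmulDr : right_distributive (@gmul R) +%R.
Proof.
move=> x y z; apply: grP => S; rewrite grDE /gmul -big_split /=.
by apply: eq_bigr => I _; rewrite grDE mulrDr.
Qed.
Fact gone_neq0 : gconst 1 != 0 :> gr.
Proof.
apply/eqP => /(congr1 (fun x : gr => x fset0)); rewrite gconstE eqxx gr0E.
by apply/eqP; rewrite oner_eq0.
Qed.
HB.instance Definition _ := GRing.Zmodule_isNzRing.Build gr
  gmulA gmul1l gmul1r gmulDl gmulDr gone_neq0.

Fact gscaleA (a b : C) x : gscale a (gscale b x) = gscale (a * b) x.
Proof. by apply: grP => S; rewrite /gscale mulrA. Qed.
Fact gscale1 : left_id 1 (@gscale R).
Proof. by move=> x; apply: grP => S; rewrite /gscale mul1r. Qed.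
Fact gscaleDr : right_distributive (@gscale R) +%R.
Proof. by move=> a x y; apply: grP => S; rewrite /gscale grDE mulrDr. Qed.
Fact gscaleDl x : {morph (@gscale R)^~ x : a b / a + b}.
Proof. by move=> a b; apply: grP => S; rewrite /gscale mulrDl. Qed.
HB.instance Definition _ := GRing.Zmodule_isLmodule.Build C gr
  gscaleA gscale1 gscaleDr gscaleDl.
Fact gscaleAl (a : C) x y : a *: (x * y) = a *: x * y.
Proof.
apply: grP => S; rewrite -[LHS]/(a * gmul x y S) -[RHS]/(gmul (gscale a x) y S).
by rewrite /gmul mulr_sumr; apply: eq_bigr => I _; rewrite /gscale !mulrA (mulrC a).
Qed.
HB.instance Definition _ := GRing.Lmodule_isLalgebra.Build C gr gscaleAl.
Fact gscaleAr (a : C) x y : a *: (x * y) = x * (a *: y).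
Proof.
apply: grP => S; rewrite -[LHS]/(a * gmul x y S) -[RHS]/(gmul x (gscale a y) S).
by rewrite /gmul mulr_sumr; apply: eq_bigr => I _; rewrite /gscale [RHS]mulrCA.
Qed.
HB.instance Definition _ := GRing.Lalgebra_isAlgebra.Build C gr gscaleAr.

Lemma gscaleE (a : C) x : gscale a x = a *: x. Proof. by []. Qed.
Lemma grZE (a : C) x S : (a *: x) S = a * x S. Proof. by []. Qed.
Lemma gconst1 : gconst 1 = 1 :> gr. Proof. by []. Qed.
Lemma gconst0 : gconst 0 = 0 :> gr.
Proof. by apply: grP => S; rewrite gconstE if_same. Qed.
Lemma gconstA (c : C) : gconst c = c%:A :> gr.
Proof.
by apply: grP => S; rewrite grZE -gconst1 !gconstE; case: ifP; rewrite ?mulr1 ?mulr0.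
Qed.

Lemma grME x y S : (x * y) S =
  \sum_(I <- fpowerset S) (-1) ^+ inversions I (S `\` I)%fset * x I * y (S `\` I)%fset.
Proof. by []. Qed.

Lemma grM0 x y : (x * y) fset0 = x fset0 * y fset0.
Proof.
rewrite grME fpowerset0 big_seq_fset1 fset0D inversions0l.
by rewrite mul1r.
Qed.
Lemma gr1_0 : (1 : gr) fset0 = 1. Proof. by rewrite -gconst1 gconstE eqxx. Qed.

Lemma cardfs_subD I S : I \in fpowerset S ->
  (#|` I| + #|` (S `\` I)%fset|)%N = #|` S|.
Proof.
by rewrite fpowersetE => IS; rewrite -(cardfsID I S); congr addn; congr #|` _|;
  rewrite fsetIC; apply/esym/fsetIidPl.
Qed.

Lemma geven1 : geven (1 : gr).
Proof. by move=> S; rewrite -gconst1 gconstE; case: eqP => // ->; rewrite cardfs0. Qed.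
Lemma gevenD x y : geven x -> geven y -> geven (x + y).
Proof. by move=> hx hy S h; rewrite grDE hx // hy // addr0. Qed.
Lemma goddD x y : godd x -> godd y -> godd (x + y).
Proof. by move=> hx hy S h; rewrite grDE hx // hy // addr0. Qed.
Lemma gevenN x : geven x -> geven (- x).
Proof. by move=> hx S h; rewrite grNE hx // oppr0. Qed.
Lemma goddN x : godd x -> godd (- x).
Proof. by move=> hx S h; rewrite grNE hx // oppr0. Qed.
Lemma gevenB x y : geven x -> geven y -> geven (x - y).
Proof. by move=> hx hy; apply: gevenD => //; exact: gevenN. Qed.
Lemma gevenZ (a : C) x : geven x -> geven (a *: x).
Proof. by move=> hx S h; rewrite grZE hx // mulr0. Qed.
Lemma goddZ (a : C) x : godd x -> godd (a *: x).
Proof. by move=> hx S h; rewrite grZE hx // mulr0. Qed.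

Lemma gevenM x y : geven x -> geven y -> geven (x * y).
Proof.
move=> hx hy S h; rewrite grME big_seq big1 // => I /cardfs_subD e.
move: h; rewrite -e oddD; case: (boolP (odd #|` I|)) => [/hx ->|_ /= /hy ->].
  by rewrite mulr0 mul0r.
by rewrite mulr0.
Qed.
Lemma goddM x y : godd x -> godd y -> geven (x * y).
Proof.
move=> hx hy S h; rewrite grME big_seq big1 // => I /cardfs_subD e.
move: h; rewrite -e oddD; case: (boolP (odd #|` I|)) => [_ /= /hy ->|/hx ->].
  by rewrite mulr0.
by rewrite mulr0 mul0r.
Qed.
Lemma goddMl x y : godd x -> geven y -> godd (x * y).
Proof.
move=> hx hy S h; rewrite grME big_seq big1 // => I /cardfs_subD e.
move: h; rewrite -e oddD; case: (boolP (odd #|` I|)) => [_ /=|/hx ->].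
  by rewrite negbK => /hy ->; rewrite mulr0.
by rewrite mulr0 mul0r.
Qed.
Lemma goddMr x y : geven x -> godd y -> godd (x * y).
Proof.
move=> hx hy S h; rewrite grME big_seq big1 // => I /cardfs_subD e.
move: h; rewrite -e oddD; case: (boolP (odd #|` I|)) => [/hx ->|_ /= /hy ->].
  by rewrite mulr0 mul0r.
by rewrite mulr0.
Qed.
Lemma gevenX x n : geven x -> geven (x ^+ n).
Proof.
by move=> hx; elim: n => [|n ih]; [exact: geven1|rewrite exprS; exact: gevenM].
Qed.

Lemma perm_fpowersetC S :
  perm_eq (fpowerset S) [seq (S `\` B)%fset | B : {fset nat} <- fpowerset S].
Proof.
have k (B : {fset nat}) : B \in fpowerset S -> (S `\` (S `\` B))%fset = B.
  by rewrite fpowersetE => BS; rewrite fsetDK.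
apply: uniq_perm; first exact: fset_uniq.
  by rewrite map_inj_in_uniq ?fset_uniq // => I J hI hJ e; rewrite -(k I) // e k.
move=> B; apply/idP/mapP => [BS|[J _ ->]]; last by rewrite fpowersetE fsubsetDl.
by exists (S `\` B)%fset; rewrite ?k // fpowersetE fsubsetDl.
Qed.

(** Summation over complements puts the second factor first. By [inversions_sym] the sign changes by
    the parity of the product of the two degrees, which yields commutation of even elements and
    anticommutation of odd ones. *)
Lemma grM_revE x y S : (x * y) S =
  \sum_(I <- fpowerset S) (-1) ^+ (inversions I (S `\` I)%fset +
     #|` I| * #|` (S `\` I)%fset|)%N * y I * x (S `\` I)%fset.
Proof.
rewrite grME (perm_big _ (perm_fpowersetC S)) big_map.
rewrite big_seq [RHS]big_seq; apply: eq_bigr => I IS.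
have -> : (S `\` (S `\` I))%fset = I.
  by move: IS; rewrite fpowersetE => IS; rewrite fsetDK.
rewrite -inversions_sym ?disjointDr // addnA addnn exprD -mul2n exprM sqrrN expr1n.
by rewrite expr1n mul1r mulrAC.
Qed.

Lemma geven_comm x y : geven x -> x * y = y * x.
Proof.
move=> hx; apply: grP => S; rewrite grM_revE grME; apply: eq_bigr => I _.
have [h|h] := boolP (odd #|` (S `\` I)%fset|); first by rewrite hx // !mulr0.
by rewrite exprD -(signr_odd _ (_ * _)) oddM (negPf h) andbF mulr1.
Qed.

Lemma godd_anticomm x y : godd x -> godd y -> x * y = - (y * x).
Proof.
move=> hx hy; apply: grP => S; rewrite grNE grM_revE grME -sumrN.
apply: eq_bigr => I _.
have [h|h] := boolP (odd #|` (S `\` I)%fset|); last by rewrite hx // !mulr0 oppr0.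
have [h'|h'] := boolP (odd #|` I|); last by rewrite hy // !mulr0 !mul0r oppr0.
by rewrite exprD -(signr_odd _ (_ * _)) oddM h h' mulrN1 !mulNr.
Qed.

Lemma godd_sqr x : godd x -> x * x = 0.
Proof.
move=> hx; have /eqP := godd_anticomm hx hx.
rewrite -addr_eq0 -mulr2n => /eqP e; apply: grP => S.
have := congr1 (fun z : gr => z S) e; rewrite mulr2n grDE gr0E -mulr2n => /eqP.
by rewrite mulrn_eq0 /= => /eqP.
Qed.

(** The filtration by degree in the generators, the analogue of the d-th power of the augmentation
    ideal. Inductions on d replace nilpotency, for which no uniform bound is available. *)
Definition fil (d : nat) x := forall S, (#|` S| < d)%N -> x S = 0.

Lemma filW d e x : (e <= d)%N -> fil d x -> fil e x.
Proof. by move=> ed hx S h; apply: hx; exact: leq_trans ed. Qed.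
Lemma filD d x y : fil d x -> fil d y -> fil d (x + y).
Proof. by move=> hx hy S h; rewrite grDE hx // hy // addr0. Qed.
Lemma filN d x : fil d x -> fil d (- x).
Proof. by move=> hx S h; rewrite grNE hx // oppr0. Qed.
Lemma filB d x y : fil d x -> fil d y -> fil d (x - y).
Proof. by move=> hx hy; apply: filD => //; exact: filN. Qed.
Lemma filZ d (a : C) x : fil d x -> fil d (a *: x).
Proof. by move=> hx S h; rewrite grZE hx // mulr0. Qed.
Lemma fil_sum d (T : Type) (r : seq T) (P : pred T) (F : T -> gr) :
  (forall i, P i -> fil d (F i)) -> fil d (\sum_(i <- r | P i) F i).
Proof. by move=> h; elim/big_ind: _ => //; exact: filD. Qed.
Lemma filM d e x y : fil d x -> fil e y -> fil (d + e) (x * y).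
Proof.
move=> hx hy S h; rewrite grME big_seq big1 // => I /cardfs_subD eS.
have [h'|h'] := ltnP #|` I| d; first by rewrite hx // mulr0 mul0r.
rewrite hy ?mulr0 //; move: h; rewrite -eS => h.
by rewrite -(ltn_add2l d); apply: leq_ltn_trans h; rewrite leq_add2r.
Qed.
Lemma filMl d x y : fil d x -> fil d (x * y).
Proof. by move=> hx; rewrite -[d]addn0; exact: filM. Qed.
Lemma filMr d x y : fil d y -> fil d (x * y).
Proof. by move=> hx; rewrite -[d]add0n; exact: filM. Qed.
Lemma filX d x n : fil d x -> fil (d * n) (x ^+ n).
Proof.
move=> hx; elim: n => [|n ih]; first by rewrite muln0.
by rewrite mulnS exprS; exact: filM.
Qed.
Lemma fil_eq0 x : (forall d, fil d x) -> x = 0.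
Proof. by move=> h; apply: grP => S; apply: (h #|` S|.+1). Qed.
Lemma fil1 x : x fset0 = 0 -> fil 1 x.
Proof. by move=> h S; rewrite ltnS leqn0 cardfs_eq0 => /eqP ->. Qed.
Lemma godd_body x : godd x -> x fset0 = 0.
Proof. by move=> h; apply: h; rewrite cardfs0. Qed.

End GrassmannRing.

(** * Complex derivatives relative to a set *)

Section Caratheodory.
Variable R : realType.
Local Notation C := R[i].
Implicit Types (K L : set C) (f g : C -> C) (z l : C).

Variant cont_at K f z : Prop :=
  ContAt of f w @[w --> within K (nbhs (z : C^o))] --> (f z : C^o).

Fact within_nbhs_filter K z : Filter (within K (nbhs (z : C^o))).
Proof. exact: within_filter. Qed.
Lemma cont_cst K l z : cont_at K (fun=> l) z.
Proof. by split; exact: (@cvg_cst C^o l C _ (within_nbhs_filter K z)). Qed.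

Lemma cont_id K z : cont_at K (fun w => w) z.
Proof. by split; exact: cvg_within. Qed.

Lemma cont_add K f g z : cont_at K f z -> cont_at K g z ->
  cont_at K (fun w => f w + g w) z.
Proof. by move=> [cf] [cg]; split; exact: (@cvgD C C^o _ _ (within_nbhs_filter K z) f g _ _ cf cg). Qed.

Lemma cont_opp K f z : cont_at K f z -> cont_at K (fun w => - f w) z.
Proof. by move=> [cf]; split; exact: (@cvgN C C^o _ _ (within_nbhs_filter K z) f _ cf). Qed.

Lemma cont_mul K f g z : cont_at K f z -> cont_at K g z ->
  cont_at K (fun w => f w * g w) z.
Proof. by move=> [cf] [cg]; split; exact: (@cvgM C _ _ (within_nbhs_filter K z) f g _ _ cf cg). Qed.

Lemma cont_inv K f z : f z != 0 -> cont_at K f z ->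
  cont_at K (fun w => (f w)^-1) z.
Proof. by move=> fz [cf]; split; exact: (@cvgV C _ _ (within_nbhs_filter K z) f _ fz cf). Qed.

Lemma cont_nbhs K f z : cont_at K f z <->
  (forall A, nbhs (f z : C^o) A -> nbhs (z : C^o) (fun w => K w -> A (f w))).
Proof. by split=> [[h] A /h|h]; [|split=> A /h]. Qed.

Lemma cont_comp K L f g z : (forall w, K w -> L (g w)) ->
  cont_at K g z -> cont_at L f (g z) -> cont_at K (fun w => f (g w)) z.
Proof.
move=> KL /cont_nbhs cg /cont_nbhs cf; apply/cont_nbhs => A /cf/cg.
by apply: filterS => w h Kw; exact: h Kw (KL _ Kw).
Qed.

Lemma cont_sub K L f z : K `<=` L -> cont_at L f z -> cont_at K f z.
Proof. by move=> KL; exact: (@cont_comp K L f id z KL (cont_id K z)). Qed.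

Lemma cont_ext K f g z : K z -> (forall w, K w -> f w = g w) ->
  cont_at K f z -> cont_at K g z.
Proof.
move=> Kz fg /cont_nbhs cf; apply/cont_nbhs => A; rewrite -fg // => /cf.
by apply: filterS => w h Kw; rewrite -fg //; exact: h.
Qed.

(** Without isolated points, a derivative relative to K is determined by the function. *)
Definition perfect K : Prop := forall z, K z ->
  forall U, nbhs (z : C^o) U -> exists w, [/\ K w, w <> z & U w].

Lemma cont_lim_uniq K f g z : K z -> perfect K ->
  (forall w, K w -> w <> z -> f w = g w) ->
  cont_at K f z -> cont_at K g z -> f z = g z.
Proof.
move=> Kz pK fg [cf] [cg].
have pF : ProperFilter (within K (z : C^o)^').
  split; last exact: within_filter.
  rewrite /within /= => h; have [w [Kw wz]] := pK z Kz _ h.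
  by move=> /(_ (introN eqP wz) Kw).
have sub (h : C -> C) (l : C^o) : h w @[w --> within K (nbhs (z : C^o))] --> l ->
    h w @[w --> within K (z : C^o)^'] --> l.
  move=> ch A hA; have := ch A hA; rewrite /within /dnbhs /within /= !nbhs_simpl /=.
  by move=> e; apply: filterS e => w /= Aw _; exact: Aw.
apply: (@cvg_unique C^o (@norm_hausdorff _ _) (f w @[w --> within K (z : C^o)^'])).
  exact: sub cf.
move=> A hA.
have e : nbhs (z : C^o) (fun w => w != z -> K w -> A (g w)) := sub _ _ cg A hA.
suff : nbhs (z : C^o) (fun w => w != z -> K w -> A (f w)) by [].
by apply: filterS e => w /= Aw wz Kw; rewrite fg //; [exact: Aw|exact/eqP].
Qed.

(** Caratheodory's form of differentiability: the difference quotient extends to a function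
    continuous at z with value l. The rules of calculus become algebra with these extensions,
    without division by w - z. *)
Definition hd K f z l : Prop := exists phi : C -> C,
  [/\ phi z = l, cont_at K phi z &
      forall w, K w -> f w - f z = (w - z) * phi w].

Lemma hd_cont K f z l : K z -> hd K f z l -> cont_at K f z.
Proof.
move=> Kz [phi [_ cphi e]].
apply: (@cont_ext K (fun w => f z + (w - z) * phi w) f z Kz).
  by move=> w Kw; rewrite -e // addrC subrK.
apply: cont_add; [exact: cont_cst|apply: cont_mul => //].
by apply: cont_add; [exact: cont_id|exact: cont_cst].
Qed.

Lemma hd_uniq K f z l l' : K z -> perfect K -> hd K f z l -> hd K f z l' -> l = l'.
Proof.
move=> Kz pK [phi [<- cphi e]] [psi [<- cpsi e']].
apply: cont_lim_uniq cphi cpsi => // w Kw wz.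
apply: (@mulfI _ (w - z)); first by rewrite subr_eq0; exact/eqP.
by rewrite -e // e'.
Qed.

Lemma hd_ext K f g z l : K z -> (forall w, K w -> f w = g w) -> hd K f z l -> hd K g z l.
Proof.
by move=> Kz fg [phi [pz cphi e]]; exists phi; split=> // w Kw; rewrite -!fg // e.
Qed.

Lemma hd_ext0 K f g z l : (forall w, f w = g w) -> hd K f z l -> hd K g z l.
Proof. by move=> fg; rewrite (_ : g = f) //; apply/funext => w. Qed.

Lemma hd_sub K L f z l : K `<=` L -> hd L f z l -> hd K f z l.
Proof.
move=> KL [phi [pz cphi e]]; exists phi; split => //; first exact: cont_sub cphi.
by move=> w /KL; exact: e.
Qed.

Lemma hd_cst K c z : hd K (fun=> c) z 0.
Proof.
exists (fun=> 0); split => //; first exact: cont_cst.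
by move=> w _; rewrite subrr mulr0.
Qed.

Lemma hd_id K z : hd K id z 1.
Proof. by exists (fun=> 1); split => //; [exact: cont_cst|move=> w _; rewrite mulr1]. Qed.

Lemma hd_add K f g z l m : hd K f z l -> hd K g z m -> hd K (fun w => f w + g w) z (l + m).
Proof.
move=> [p [<- cp ep]] [q [<- cq eq]]; exists (fun w => p w + q w); split=> //.
  exact: cont_add.
by move=> w Kw; rewrite mulrDr -ep // -eq // opprD addrACA.
Qed.

Lemma hd_mul K f g z l m : K z -> hd K f z l -> hd K g z m ->
  hd K (fun w => f w * g w) z (l * g z + f z * m).
Proof.
move=> Kz df dg; have cf := hd_cont Kz df; have cg := hd_cont Kz dg.
move: df dg => [p [<- cp ep]] [q [<- cq eq]].
exists (fun w => p w * g z + f w * q w); split => //.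
  apply: cont_add; apply: cont_mul => //; exact: cont_cst.
move=> w Kw; rewrite mulrDr mulrA -ep // mulrCA -eq // mulrBl mulrBr.
by rewrite [RHS]addrC subrKA.
Qed.

Lemma hd_opp K f z l : hd K f z l -> hd K (fun w => - f w) z (- l).
Proof.
move=> [p [<- cp ep]]; exists (fun w => - p w); split => //; first exact: cont_opp.
by move=> w Kw; rewrite mulrN -ep // opprB opprK addrC.
Qed.

Lemma hd_inv K f z l : K z -> (forall w, K w -> f w != 0) -> hd K f z l ->
  hd K (fun w => (f w)^-1) z (- l / f z ^+ 2).
Proof.
move=> Kz f0 df; have cf := hd_cont Kz df; move: df => [p [<- cp ep]].
exists (fun w => - p w / (f z * f w)); split; first by rewrite expr2.
  apply: cont_mul; first exact: cont_opp.
  apply: cont_inv; first by rewrite mulf_neq0 // f0.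
  by apply: cont_mul => //; exact: cont_cst.
move=> w Kw; rewrite mulrA mulrN -ep // opprB invfM mulrA [X in X / _]mulrBl.
by rewrite divff ?f0 // mulrBl mul1r mulrAC divff ?f0 // mul1r.
Qed.

Lemma hd_comp K L f g z l m : K z -> (forall w, K w -> L (g w)) ->
  hd K g z m -> hd L f (g z) l -> hd K (fun w => f (g w)) z (l * m).
Proof.
move=> Kz KL dg; have cg := hd_cont Kz dg; move: dg => [q [<- cq eq]] [p [<- cp ep]].
exists (fun w => p (g w) * q w); split => //.
  by apply: cont_mul => //; exact: cont_comp cp.
by move=> w Kw; rewrite mulrCA mulrA [X in X * _]mulrC mulrAC -eq // -ep //; exact: KL.
Qed.

Lemma hd_of_cvg K f z l :
  (forall A : set C, nbhs (l : C^o) A ->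
     nbhs (z : C^o) (fun w => w <> z -> K w -> A (cquotient f z w))) -> hd K f z l.
Proof.
move=> cl; exists (fun w => if w == z then l else cquotient f z w).
split; first by rewrite eqxx.
  apply/cont_nbhs => A; rewrite eqxx => hA.
  have := cl A hA; apply: filterS => w /= h Kw.
  by case: eqP => [_|wz]; [exact: nbhs_singleton hA|exact: h].
move=> w Kw; case: eqP => [->|/eqP wz]; first by rewrite !subrr mul0r.
by rewrite /cquotient mulrC divfK // subr_eq0.
Qed.

Lemma cderivable_hd K f z : cderivable K f z -> hd K f z (cderive K f z).
Proof.
rewrite /cderivable /cderive => /cvg_ex cf.
have [l cl] : exists l : C,
  cquotient f z w @[w --> within K (z : C^o)^'] --> (l : C^o) by exact: cf.
have [pF|nF] := pselect (ProperFilter (within K (z : C^o)^')).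
  have -> : lim (cquotient f z w @[w --> within K (z : C^o)^']) = l :> C.
    by apply: (@cvg_lim C^o) => //; exact: norm_hausdorff.
  apply: hd_of_cvg => A hA.
  have : nbhs (z : C^o) (fun w => w != z -> K w -> A (cquotient f z w)) := cl A hA.
  by apply: filterS => w /= h /eqP wz; exact: h.
(* Here z has no neighbours in K other than itself. The limit is then a meaningless default value,
   but every number is a derivative. *)
have h0 : within K (z : C^o)^' set0.
  apply: contrapT => h0; apply: nF; split => //; exact: within_filter.
apply: hd_of_cvg => A hA.
have : nbhs (z : C^o) (fun w => w != z -> K w -> set0 w) := h0.
by apply: filterS => w /= h /eqP wz Kw; case: (h wz Kw).
Qed.

Lemma hd_cvg K f z l : hd K f z l ->
  cquotient f z w @[w --> within K (z : C^o)^'] --> (l : C^o).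
Proof.
move=> [phi [<- /cont_nbhs cphi e]] A /cphi h.
suff : nbhs (z : C^o) (fun w => w != z -> K w -> A (cquotient f z w)) by [].
apply: filterS h => w /= h wz Kw; rewrite /cquotient e //.
by rewrite mulrAC divff ?mul1r ?subr_eq0 //; exact: h.
Qed.

Lemma hd_cderivable K f z l : hd K f z l -> cderivable K f z.
Proof. by move=> h; apply/cvg_ex; exists l; exact: hd_cvg h. Qed.

Lemma hd_cderive K f z l : K z -> perfect K -> hd K f z l -> cderive K f z = l.
Proof.
by move=> Kz pK h; apply: hd_uniq (cderivable_hd (hd_cderivable h)) h.
Qed.

(* C^n regularity on a perfect set, the derivative being an arbitrary function
   that is only determined on K. *)
Fixpoint hol (n : nat) K f : Prop :=
  if n is n'.+1 then exists f', (forall z, K z -> hd K f z (f' z)) /\ hol n' K f'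
  else True.

Lemma holS n K f : hol n.+1 K f -> hol n K f.
Proof.
elim: n f => // n ih f [f' [df hf]]; exists f'; split=> //; exact: ih.
Qed.

Lemma hol_ext n K f g : (forall w, K w -> f w = g w) -> hol n K f -> hol n K g.
Proof.
case: n => // n fg [f' [df hf]]; exists f'; split=> // z Kz.
exact: (hd_ext Kz fg (df z Kz)).
Qed.

Lemma hol_sub n K L f : K `<=` L -> hol n L f -> hol n K f.
Proof.
move=> KL; elim: n f => // n ih f [f' [df hf]]; exists f'; split; last exact: ih.
by move=> z Kz; apply: (hd_sub KL); exact: df (KL _ Kz).
Qed.

Lemma hol_cst n K c : hol n K (fun=> c).
Proof.
elim: n c => // n ih c; exists (fun=> 0); split=> // z Kz; exact: hd_cst.
Qed.

Lemma hol_id n K : hol n K id.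
Proof. case: n => // n; exists (fun=> 1); split=> [z _|]; [exact: hd_id|exact: hol_cst]. Qed.

Lemma hol_add n K f g : hol n K f -> hol n K g -> hol n K (fun w => f w + g w).
Proof.
elim: n f g => // n ih f g [f' [df hf]] [g' [dg hg]].
exists (fun w => f' w + g' w); split; last exact: ih.
by move=> z Kz; apply: hd_add; [exact: df|exact: dg].
Qed.

Lemma hol_opp n K f : hol n K f -> hol n K (fun w => - f w).
Proof.
elim: n f => // n ih f [f' [df hf]]; exists (fun w => - f' w); split; last exact: ih.
by move=> z Kz; apply: hd_opp; exact: df.
Qed.

Lemma hol_mul n K f g : hol n K f -> hol n K g -> hol n K (fun w => f w * g w).
Proof.
elim: n f g => // n ih f g [f' [df hf]] [g' [dg hg]].
exists (fun w => f' w * g w + f w * g' w); split.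
  by move=> z Kz; apply: hd_mul => //; [exact: df|exact: dg].
by apply: hol_add; apply: ih => //; apply: holS; [exists g'|exists f'].
Qed.

Lemma hol_exp n K f k : hol n K f -> hol n K (fun w => f w ^+ k).
Proof.
move=> hf; elim: k => [|k ih]; first exact: hol_cst.
by apply: hol_ext (hol_mul hf ih) => w _; rewrite exprS.
Qed.

Lemma hol_inv n K f : (forall w, K w -> f w != 0) -> hol n K f ->
  hol n K (fun w => (f w)^-1).
Proof.
move=> f0; elim: n => // n ih hf; have hn := ih (holS hf).
move: (hf) => [f' [df hf']]; exists (fun w => - f' w * ((f w)^-1 * (f w)^-1)); split.
  move=> z Kz; rewrite -invfM -expr2; apply: hd_inv => //; exact: df.
by apply: hol_mul; [exact: hol_opp|exact: hol_mul].
Qed.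

Lemma hol_comp n K L f g : (forall w, K w -> L (g w)) ->
  hol n K g -> hol n L f -> hol n K (fun w => f (g w)).
Proof.
move=> KL; elim: n f => // n ih f hg [f' [df hf]]; have [g' [dg hg']] := hg.
exists (fun w => f' (g w) * g' w); split.
  move=> z Kz; apply: (hd_comp Kz KL); [exact: dg|exact: df (KL _ Kz)].
by apply: hol_mul => //; apply: ih => //; exact: holS.
Qed.

Lemma hol_sum n K (T : Type) (r : seq T) (P : pred T) (F : T -> C -> C) :
  (forall i, P i -> hol n K (F i)) ->
  hol n K (fun w => \sum_(i <- r | P i) F i w).
Proof.
move=> hF; elim: r => [|i r ih].
  by apply: hol_ext (hol_cst _ _ 0) => w _; rewrite big_nil.
case: (boolP (P i)) => Pi; last by apply: hol_ext ih => w _; rewrite big_cons (negPf Pi).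
by apply: hol_ext (hol_add (hF i Pi) ih) => w _; rewrite big_cons Pi.
Qed.

(** The iterated [cderive] and the derivatives chosen in [hol] agree on K by uniqueness; closure
    properties are proved for [hol], where no particular derivative is imposed off K. *)
Lemma holomorphicP K f : perfect K ->
  holomorphic K f <-> forall n, hol n K f.
Proof.
move=> pK; split.
  move=> hf n; have : forall k, hol n K (iter k (cderive K) f); last by move=> /(_ 0%N).
  elim: n => // n ih k; exists (iter k.+1 (cderive K) f); split; last exact: ih.
  by move=> z Kz; apply: cderivable_hd; exact: hf.
move=> hf n; have : forall m, hol m K (iter n (cderive K) f).
  elim: n => [|n ih] m; first exact: hf.
  have [f' [df hf']] := ih m.+1; apply: hol_ext hf' => w Kw.
  by apply/esym/hd_cderive => //; exact: df.
by move=> /(_ 1%N)[f' [df _]] z Kz; exact: hd_cderivable (df z Kz).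
Qed.

Lemma holomorphic_hd K f k z : holomorphic K f -> K z ->
  hd K (iter k (cderive K) f) z (iter k.+1 (cderive K) f z).
Proof. by move=> hf Kz; apply: cderivable_hd; exact: hf. Qed.

End Caratheodory.

(** * Functions on the real line *)

Section RealLine.
Variable R : realType.
Local Notation C := R[i].

Lemma ltc_real (e : C) : 0 < e -> exists2 r : R, 0 < r & e = r%:C.
Proof.
case: e => a b; rewrite ltcE /= => /andP[/eqP -> a0]; exists a => //.
Qed.

Lemma Re_le_norm (z : C) (r : R) : `|z| < r%:C -> `|complex.Re z| < r.
Proof. by move=> h; rewrite -ltcR; apply: le_lt_trans (normc_ge_Re z) h. Qed.

Lemma Im_le_norm (z : C) (r : R) : `|z| < r%:C -> `|complex.Im z| < r.
Proof.
move=> h; rewrite -normrN -ReiNIm; apply: Re_le_norm.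
rewrite normrM; suff -> : `|'i%C| = 1 :> C by rewrite mulr1.
by rewrite normc_def /= expr0n /= add0r expr1n sqrtr1.
Qed.

Lemma ReB (z w : C) : complex.Re (z - w) = complex.Re z - complex.Re w.
Proof. by case: z => a b; case: w. Qed.
Lemma ImB (z w : C) : complex.Im (z - w) = complex.Im z - complex.Im w.
Proof. by case: z => a b; case: w. Qed.

Lemma norm_le_ReIm (z : C) : `|z| <= (`|complex.Re z| + `|complex.Im z|)%:C.
Proof.
have e : z = (complex.Re z)%:C + 'i%C * (complex.Im z)%:C by rewrite -complexE.
rewrite {1}e; apply: le_trans (ler_normD _ _) _; rewrite rmorphD /= lerD //.
  by rewrite normc_def /= expr0n /= addr0 sqrtr_sqr.
by rewrite normc_def /= !(mul0r, mul1r, subr0, sub0r, addr0, add0r, oppr0, expr0n) /=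
  ?add0r sqrtr_sqr.
Qed.

Lemma cvg_ReIm (T : Type) (F : set_system T) (f : T -> C) (l : C) : Filter F ->
  f t @[t --> F] --> (l : C^o) <->
  (complex.Re (f t) @[t --> F] --> complex.Re l) /\
  (complex.Im (f t) @[t --> F] --> complex.Im l).
Proof.
move=> FF; split.
  move=> /(@cvgrPdist_lt _ C^o) h; split; apply/cvgrPdist_lt => e e0.
    have := h e%:C; rewrite ltcR => /(_ e0) {}h; near=> t.
    by rewrite -ReB; apply: Re_le_norm; near: t.
  have := h e%:C; rewrite ltcR => /(_ e0) {}h; near=> t.
  by rewrite -ImB; apply: Im_le_norm; near: t.
move=> [/cvgrPdist_lt hR /cvgrPdist_lt hI]; apply/(@cvgrPdist_lt _ C^o) => e /ltc_real[r r0 ->].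
have r2 : 0 < r / 2 by rewrite divr_gt0.
have h1 := hR _ r2; have h2 := hI _ r2; near=> t.
apply: le_lt_trans (norm_le_ReIm _) _; rewrite ltcR ReB ImB [ltRHS]splitr.
by apply: ltrD; near: t.
Unshelve. all: by end_near. Qed.

(** The line as a subset of C: functions of a real variable are read as functions of the real part,
    so that the relative complex calculus serves the boundary parametrizations too. *)
Definition Rline : set C := [set z | complex.Im z = 0].

Lemma Rline_real (x : R) : Rline x%:C. Proof. by []. Qed.
Lemma RlineE (z : C) : Rline z -> z = (complex.Re z)%:C.
Proof. by case: z => a b; rewrite /Rline /= => ->. Qed.

Lemma cvg_real_complex (x : R) : (y%:C : C^o) @[y --> x] --> (x%:C : C^o).
Proof. by apply/cvg_ReIm; split; [exact: cvg_id|exact: cvg_cst]. Qed.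

Lemma cvg_Re (z : C) : complex.Re w @[w --> (z : C^o)] --> complex.Re z.
Proof.
have : (w : C^o) @[w --> (z : C^o)] --> (z : C^o) by exact: cvg_id.
by move=> /(cvg_ReIm _ z (nbhs_filter (z : C^o)))[].
Qed.

Lemma perfect_Rline : perfect Rline.
Proof.
move=> z /RlineE zE U; rewrite zE => hU.
have := cvg_real_complex hU; rewrite /= nbhs_simpl /= => /nbhs_ballP[e /= e0 he].
exists (complex.Re z + e / 2)%:C; split => //.
  by move=> /complexI /eqP; rewrite -subr_eq0 addrAC subrr add0r gt_eqF // divr_gt0.
apply: he; rewrite /ball /= opprD addNKr normrN gtr0_norm ?divr_gt0 //.
by rewrite gtr_pMr // invf_lt1 // ltr1n.
Qed.

Lemma hd_Rline (f : R -> C) (x : R) (l : C) :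
  hd Rline (fun z => f (complex.Re z)) x%:C l <->
  is_derive x 1 (fun t => complex.Re (f t)) (complex.Re l) /\
  is_derive x 1 (fun t => complex.Im (f t)) (complex.Im l).
Proof.
split.
  move=> [phi [phx /cont_nbhs cphi e]].
  have cq : phi (h + x)%:C @[h --> (0:R)^'] --> (l : C^o).
    rewrite -phx => A hA.
    have e1 : nbhs (x%:C : C^o) (fun w => Rline w -> A (phi w)) := cphi A hA.
    have e2 : nbhs x (fun y => Rline y%:C -> A (phi y%:C)) := cvg_real_complex e1.
    have e3 : (h + x) @[h --> (0:R)] --> x.
      by rewrite -[X in _ --> X]add0r; apply: cvgD; [exact: cvg_id|exact: cvg_cst].
    have e4 : nbhs (0:R) (fun h => Rline (h + x)%:C -> A (phi (h + x)%:C)) := e3 _ e2.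
    suff : nbhs (0:R) (fun h => h != 0 -> A (phi (h + x)%:C)) by [].
    by apply: filterS e4 => h /= k _; exact: k.
  have key (g : C -> R) : (forall w v : C, g (w - v) = g w - g v) ->
      (forall (r : R) w, g (r%:C * w) = r * g w) ->
      (g (phi (h + x)%:C) @[h --> (0:R)^'] --> g l) ->
      is_derive x 1 (fun t => g (f t)) (g l).
    move=> gB gM h0.
    have c : h^-1 *: (((fun t => g (f t)) \o shift x) (h *: 1) - g (f x))
             @[h --> (0:R)^'] --> g l.
      apply: cvg_trans h0; apply: near_eq_cvg.
      suff : nbhs (0:R) (fun h => h != 0 -> g (phi (h + x)%:C) =
        h^-1 *: (((fun t => g (f t)) \o shift x) (h *: 1) - g (f x))) by [].
      apply: (@filterS _ _ _ setT); last exact: filterT.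
      move=> h _ h0'; rewrite /= /shift /= -gB.
      have := e (h + x)%:C (Rline_real _); rewrite /= => e'.
      rewrite [h *: 1]mulr1 e' -rmorphB /= addrK gM.
      by rewrite -[RHS]/(h^-1 * _) mulKf.
    by split; [apply/cvg_ex; exists (g l)|apply: (@cvg_lim R) => //; exact: norm_hausdorff].
  have [cR cI] := (cvg_ReIm _ l _).1 cq.
  split; apply: key => //; first exact: ReB.
  - by move=> r [a b] /=; rewrite !mul0r subr0.
  - exact: ImB.
  - by move=> r [a b] /=; rewrite !mul0r addr0.
move=> [[dR eR] [dI eI]].
have cl (g : R -> R) : derivable g x 1 ->
    h^-1 * (g (h + x) - g x) @[h --> (0:R)^'] --> 'D_1 g x.
  move=> dg; have : h^-1 *: ((g \o shift x) (h *: 1) - g x) @[h --> (0:R)^'] --> 'D_1 g x.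
    exact: dg.
  apply: cvg_trans; apply: near_eq_cvg; near=> h.
  by rewrite /= /shift /= [h *: 1]mulr1.
pose Q (h : R) : C := if h == 0 then l else (h^-1)%:C * (f (h + x) - f x).
have cQ : Q h @[h --> (0:R)] --> (l : C^o).
  have : Q h @[h --> (0:R)^'] --> (l : C^o).
    have : (h^-1)%:C * (f (h + x) - f x) @[h --> (0:R)^'] --> (l : C^o).
      apply/cvg_ReIm; split.
        rewrite -eR; apply: cvg_trans (cl _ dR); apply: near_eq_cvg; near=> h.
        by case: (f (h + x)) => a b; case: (f x) => c d /=; rewrite !mul0r subr0.
      rewrite -eI; apply: cvg_trans (cl _ dI); apply: near_eq_cvg; near=> h.
      by case: (f (h + x)) => a b; case: (f x) => c d /=; rewrite !mul0r addr0.
    move=> c A hA; have := c A hA => hA'.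
    have e1 : nbhs (0:R) (fun h => h != 0 -> A ((h^-1)%:C * (f (h + x) - f x))) := hA'.
    suff : nbhs (0:R) (fun h => h != 0 -> A (Q h)) by [].
    by apply: filterS e1 => h k h0; rewrite /Q (negPf h0); exact: k.
  move=> c A hA.
  have e1 : nbhs (0:R) (fun h => h != 0 -> A (Q h)) := c A hA.
  suff : nbhs (0:R) (fun h => A (Q h)) by [].
  apply: filterS e1 => h k; have [->|/k //] := eqVneq h 0.
  by rewrite /Q eqxx; exact: nbhs_singleton hA.
exists (fun w => Q (complex.Re w - x)); split.
- by rewrite /= subrr /Q eqxx.
- apply/cont_nbhs => A; rewrite /= subrr {1}/Q eqxx => hA.
  have e1 : nbhs (0:R) (fun h => A (Q h)) := cQ A hA.
  have e2 : (complex.Re w - x) @[w --> (x%:C : C^o)] --> (0:R).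
    have c : complex.Re w - x @[w --> (x%:C : C^o)] --> complex.Re x%:C - x.
      exact: (cvgB (@cvg_Re x%:C) (cvg_cst x)).
    by rewrite subrr in c.
  have e3 : nbhs (x%:C : C^o) (fun w => A (Q (complex.Re w - x))) := e2 _ e1.
  by apply: filterS e3.
move=> w /RlineE {1 2}->; rewrite /= /Q; case: eqP => [/eqP|/eqP h0].
  by rewrite subr_eq0 => /eqP ->; rewrite !subrr mul0r.
rewrite subrK -rmorphB mulrA -rmorphM /= divff // mul1r.
Unshelve. all: by end_near. Qed.

End RealLine.

(** * Smooth functions of a real variable as holomorphic functions relative to the line *)

Section Smooth.
Variable R : realType.
Local Notation C := R[i].
Local Notation Rline := (@Rline R).

Lemma csmooth_holomorphic (f : R -> C) :
  csmooth f -> holomorphic Rline (fun z => f (complex.Re z)).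
Proof.
move=> [sR sI]; apply/(holomorphicP _ (@perfect_Rline R)) => n.
pose F k (x : R) : C := derive1n k (fun t => complex.Re (f t)) x +i*
                        derive1n k (fun t => complex.Im (f t)) x.
have : forall k, hol n Rline (fun z => F k (complex.Re z)).
  elim: n => // n ih k; exists (fun z => F k.+1 (complex.Re z)); split; last exact: ih.
  move=> z /RlineE ->; apply/hd_Rline; split.
    by rewrite /= derive1E; exact: (derivableP (sR k _)).
  by rewrite /= derive1E; exact: (derivableP (sI k _)).
move=> /(_ 0%N); apply: hol_ext => z _; rewrite /F !derive1n0.
by case: (f _).
Qed.

Lemma hd_Rline_fun (F : C -> C) (x : R) l : hd Rline F x%:C l ->
  is_derive x 1 (fun t => complex.Re (F t%:C)) (complex.Re l) /\
  is_derive x 1 (fun t => complex.Im (F t%:C)) (complex.Im l).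
Proof.
move=> h; apply/hd_Rline; apply: hd_ext h; first exact: Rline_real.
by move=> w /RlineE <-.
Qed.

Lemma holomorphic_derive1n (F : C -> C) : holomorphic Rline F -> forall k,
  derive1n k (fun t => complex.Re (F t%:C)) =
    (fun x => complex.Re (iter k (cderive Rline) F x%:C)) /\
  derive1n k (fun t => complex.Im (F t%:C)) =
    (fun x => complex.Im (iter k (cderive Rline) F x%:C)).
Proof.
move=> hF; elim=> [|k [ihR ihI]] //.
split; apply/funext => x; rewrite derive1nS ?ihR ?ihI derive1E;
  have [hR hI] := hd_Rline_fun (holomorphic_hd k hF (Rline_real x)).
- exact: (@derive_val _ _ _ _ _ _ _ hR).
- exact: (@derive_val _ _ _ _ _ _ _ hI).
Qed.

Lemma holomorphic_csmooth (F : C -> C) :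
  holomorphic Rline F -> csmooth (fun x => F x%:C).
Proof.
move=> hF; split=> k x; have [eR eI] := holomorphic_derive1n hF k;
  have [hR hI] := hd_Rline_fun (holomorphic_hd k hF (Rline_real x)).
- by rewrite eR; exact: (@ex_derive _ _ _ _ _ _ _ hR).
- by rewrite eI; exact: (@ex_derive _ _ _ _ _ _ _ hI).
Qed.

Lemma rderive_cderive (F : C -> C) x : holomorphic Rline F ->
  rderive (fun t => F t%:C) x = cderive Rline F x%:C.
Proof.
move=> hF; have [hR hI] := hd_Rline_fun (holomorphic_hd 0 hF (Rline_real x)).
rewrite /rderive !derive1E (@derive_val _ _ _ _ _ _ _ hR) (@derive_val _ _ _ _ _ _ _ hI).
by rewrite /=; case: (cderive _ _ _).
Qed.

End Smooth.

(** * Grassmann-valued functions *)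

Section GrFunctions.
Variable R : realType.
Local Notation C := R[i].
Local Notation gr := (gr R).
Implicit Types (K L : set C) (F G f g : C -> gr) (x y : gr) (z : C).

Definition ghd K F z (l : gr) : Prop := forall S, hd K (fun w => F w S) z (l S).

Definition gd K F : C -> gr := fun z S => cderive K (fun w => F w S) z.

Lemma hd_sum K (T : Type) (r : seq T) (P : pred T) (F : T -> C -> C) z (l : T -> C) :
  (forall i, P i -> hd K (F i) z (l i)) ->
  hd K (fun w => \sum_(i <- r | P i) F i w) z (\sum_(i <- r | P i) l i).
Proof.
move=> hF; elim: r => [|i r ih].
  by rewrite big_nil; apply: hd_ext0 (hd_cst K 0 z) => w; rewrite big_nil.
rewrite big_cons; case: (boolP (P i)) => Pi.
  by apply: hd_ext0 (hd_add (hF i Pi) ih) => w; rewrite big_cons Pi.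
by apply: hd_ext0 ih => w; rewrite big_cons (negPf Pi).
Qed.

Lemma ghd_cst K x z : ghd K (fun=> x) z 0.
Proof. by move=> S; exact: hd_cst. Qed.

Lemma ghd_add K F G z l m : ghd K F z l -> ghd K G z m ->
  ghd K (fun w => F w + G w) z (l + m).
Proof. by move=> hF hG S; exact: (hd_add (hF S) (hG S)). Qed.

Lemma ghd_opp K F z l : ghd K F z l -> ghd K (fun w => - F w) z (- l).
Proof. by move=> hF S; exact: (hd_opp (hF S)). Qed.

Lemma ghd_mul K F G z l m : K z -> ghd K F z l -> ghd K G z m ->
  ghd K (fun w => F w * G w) z (l * G z + F z * m).
Proof.
move=> Kz hF hG S; rewrite grDE !grME -big_split /=.
pose s I : C := (-1) ^+ inversions I (S `\` I)%fset.
have h I : hd K (fun w => s I * F w I * G w (S `\` I)%fset) z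
    (s I * l I * G z (S `\` I)%fset + s I * F z I * m (S `\` I)%fset).
  rewrite -!mulrA -mulrDr -[X in hd _ _ _ X]add0r.
  rewrite -[X in hd _ _ _ (X + _)](mul0r (F z I * G z (S `\` I)%fset)).
  have := hd_mul Kz (hd_cst K (s I) z) (hd_mul Kz (hF I) (hG (S `\` I)%fset)).
  by apply: hd_ext0 => w; rewrite mulrA.
apply: hd_ext0 (@hd_sum K _ (fpowerset S) xpredT
  (fun I w => s I * F w I * G w (S `\` I)%fset) z _ (fun I _ => h I)) => w.
by rewrite grME.
Qed.

Lemma ghd_scale K (c : C) F z l : K z -> ghd K F z l -> ghd K (fun w => c *: F w) z (c *: l).
Proof.
move=> Kz hF S; rewrite grZE -[X in hd _ _ _ X]add0r -[X in hd _ _ _ (X + _)](mul0r (F z S)).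
exact: (hd_mul Kz (hd_cst K _ z) (hF S)).
Qed.

Lemma ghd_const K (f : C -> C) z l : hd K f z l ->
  ghd K (fun w => gconst (f w)) z (gconst l).
Proof.
move=> hf S; rewrite /gconst; case: (S == fset0) => //; exact: hd_cst.
Qed.

Lemma ghd_sum K (T : Type) (r : seq T) (P : pred T) (F : T -> C -> gr) z (l : T -> gr) :
  (forall i, P i -> ghd K (F i) z (l i)) ->
  ghd K (fun w => \sum_(i <- r | P i) F i w) z (\sum_(i <- r | P i) l i).
Proof.
move=> hF S; rewrite gr_sumE.
apply: hd_ext0 (@hd_sum K T r P (fun i w => F i w S) z _ (fun i Pi => hF i Pi S)) => w.
by rewrite gr_sumE.
Qed.

Lemma ghd_exp K F z l k : K z -> (forall w, K w -> geven (F w)) -> ghd K F z l ->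
  ghd K (fun w => F w ^+ k) z (F z ^+ k.-1 * l *+ k).
Proof.
move=> Kz ev hF; elim: k => [|k ih]; first exact: ghd_cst.
have e : F z ^+ k * l *+ k.+1 = l * F z ^+ k + F z * (F z ^+ k.-1 * l *+ k).
  rewrite mulrS mulrnAr mulrA -exprS -(geven_comm l (gevenX k (ev z Kz))); congr (_ + _).
  by case: k {ih} => // k.
rewrite [_.+1.-1]/= e => S.
apply: hd_ext0 (ghd_mul Kz hF ih S) => w; by rewrite exprS.
Qed.

Lemma ghd_gd K F z l : K z -> perfect K -> ghd K F z l -> gd K F z = l.
Proof. by move=> Kz pK hl; apply: grP => S; exact: hd_cderive (hl S). Qed.

Lemma ghd_ext K F G z l : K z -> (forall w, K w -> F w = G w) -> ghd K F z l -> ghd K G z l.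
Proof. by move=> Kz FG h S; apply: hd_ext (h S) => // w Kw; rewrite FG. Qed.

Definition gfin n x : Prop := forall S j, j \in S -> (n <= j)%N -> x S = 0.

Lemma gfinW m n x : (m <= n)%N -> gfin m x -> gfin n x.
Proof. by move=> mn h S j jS nj; exact: h jS (leq_trans mn nj). Qed.
Lemma gfinD n x y : gfin n x -> gfin n y -> gfin n (x + y).
Proof. by move=> hx hy S j jS nj; rewrite grDE (hx S j) // (hy S j) // addr0. Qed.
Lemma gfinN n x : gfin n x -> gfin n (- x).
Proof. by move=> hx S j jS nj; rewrite grNE (hx S j) // oppr0. Qed.
Lemma gfinZ n (c : C) x : gfin n x -> gfin n (c *: x).
Proof. by move=> hx S j jS nj; rewrite grZE (hx S j) // mulr0. Qed.
Lemma gfin_const n (c : C) : gfin n (gconst c).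
Proof. by move=> S j jS nj; rewrite gconstE; case: eqP => // S0; rewrite S0 inE in jS. Qed.
Lemma gfinM n x y : gfin n x -> gfin n y -> gfin n (x * y).
Proof.
move=> hx hy S j jS nj; rewrite grME big1 // => I _.
have [jI|jI] := boolP (j \in I); first by rewrite (hx I j) // mulr0 mul0r.
by rewrite (hy _ j) ?mulr0 // inE jI.
Qed.
Lemma gfinX n x k : gfin n x -> gfin n (x ^+ k).
Proof.
move=> hx; elim: k => [|k ih]; first exact: gfin_const.
by rewrite exprS; exact: gfinM.
Qed.

(** One bound on the generators serves all points of K. Regularity is stated through [hol], so that
    sums and products stay in the class for any K. *)
Definition hA K F : Prop :=
  (exists n, forall z, K z -> gfin n (F z)) /\ forall n S, hol n K (fun z => F z S).

Lemma hA_fin2 K F G : hA K F -> hA K G ->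
  exists n, forall z, K z -> gfin n (F z) /\ gfin n (G z).
Proof.
move=> [[m hm] _] [[n hn] _]; exists (maxn m n) => z Kz; split.
  by apply: gfinW (hm z Kz); exact: leq_maxl.
by apply: gfinW (hn z Kz); exact: leq_maxr.
Qed.

Lemma hA_ext K F G : (forall z, K z -> F z = G z) -> hA K F -> hA K G.
Proof.
move=> FG [[n hn] hF]; split; first by exists n => z Kz; rewrite -FG //; exact: hn.
by move=> k S; apply: hol_ext (hF k S) => w Kw; rewrite FG.
Qed.

Lemma hA_add K F G : hA K F -> hA K G -> hA K (fun z => F z + G z).
Proof.
move=> hF hG; have [n hn] := hA_fin2 hF hG; split.
  by exists n => z /hn[]; exact: gfinD.
by move=> k S; apply: hol_add; [exact: hF.2|exact: hG.2].
Qed.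

Lemma hA_opp K F : hA K F -> hA K (fun z => - F z).
Proof.
move=> [[n hn] hF]; split; first by exists n => z /hn; exact: gfinN.
by move=> k S; apply: hol_opp; exact: hF.
Qed.

Lemma hA_sub K F G : hA K F -> hA K G -> hA K (fun z => F z - G z).
Proof. by move=> hF hG; apply: hA_add hF (hA_opp hG). Qed.

Lemma hA_cst K n x : gfin n x -> hA K (fun=> x).
Proof. by move=> hx; split; [exists n|move=> k S; exact: hol_cst]. Qed.

Lemma hA_const K (f : C -> C) : (forall n, hol n K f) -> hA K (fun z => gconst (f z)).
Proof.
move=> hf; split; first by exists 0%N => z _; exact: gfin_const.
by move=> n S; rewrite /gconst; case: (S == fset0) => //; exact: hol_cst.
Qed.

Lemma hA_mul K F G : hA K F -> hA K G -> hA K (fun z => F z * G z).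
Proof.
move=> hF hG; have [n hn] := hA_fin2 hF hG; split.
  by exists n => z /hn[]; exact: gfinM.
move=> k S; apply: (@hol_ext _ _ _ (fun z => \sum_(I <- fpowerset S)
    (-1) ^+ inversions I (S `\` I)%fset * F z I * G z (S `\` I)%fset)) => //.
apply: hol_sum => I _; apply: hol_mul; last exact: hG.2.
by apply: hol_mul; [exact: hol_cst|exact: hF.2].
Qed.

Lemma hA_scale K (c : C) F : hA K F -> hA K (fun z => c *: F z).
Proof.
move=> [[n hn] hF]; split; first by exists n => z /hn; exact: gfinZ.
by move=> k S; apply: hol_mul; [exact: hol_cst|exact: hF].
Qed.

Lemma hA_sub_dom K L F : K `<=` L -> hA L F -> hA K F.
Proof.
move=> KL [[n hn] hF]; split; first by exists n => z /KL; exact: hn.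
by move=> k S; exact: (hol_sub KL (hF k S)).
Qed.

Lemma hA_holo K F S : perfect K -> hA K F -> holomorphic K (fun z => F z S).
Proof. by move=> pK [_ hF]; apply/(holomorphicP _ pK) => n; exact: hF. Qed.

Lemma hA_ghd K F z : perfect K -> hA K F -> K z -> ghd K F z (gd K F z).
Proof. by move=> pK hF Kz S; apply: cderivable_hd; exact: ((@hA_holo K F S pK hF) 0%N z Kz). Qed.

Lemma cderive_const K (c : C) z : perfect K -> K z -> cderive K (fun=> c) z = 0.
Proof. by move=> pK Kz; apply: hd_cderive => //; exact: hd_cst. Qed.

Lemma gd_zero K F S : perfect K -> (forall z, K z -> F z S = 0) ->
  forall z, K z -> gd K F z S = 0.
Proof.
move=> pK F0 z Kz; apply: hd_cderive => //; apply: hd_ext (hd_cst K 0 z) => // w Kw.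
by rewrite F0.
Qed.

Lemma hA_gd K F : perfect K -> hA K F -> hA K (gd K F).
Proof.
move=> pK hF; split.
  have [[n hn] _] := hF; exists n => z Kz S j jS nj.
  by apply: gd_zero => // w Kw; exact: (hn w Kw S j).
move=> n S; have /(holomorphicP _ pK) := @hA_holo K F S pK hF => /(_ n.+1)[f' [df hf]].
by apply: hol_ext hf => w Kw; apply/esym/hd_cderive => //; exact: df.
Qed.

Lemma gd_even K F : perfect K -> (forall z, K z -> geven (F z)) ->
  forall z, K z -> geven (gd K F z).
Proof. by move=> pK ev z Kz S hS; apply: gd_zero => // w Kw; exact: ev. Qed.
Lemma gd_odd K F : perfect K -> (forall z, K z -> godd (F z)) ->
  forall z, K z -> godd (gd K F z).
Proof. by move=> pK ev z Kz S hS; apply: gd_zero => // w Kw; exact: ev. Qed.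

Lemma gd_ext K F G : perfect K -> (forall z, K z -> F z = G z) -> hA K F ->
  forall z, K z -> gd K F z = gd K G z.
Proof.
move=> pK FG hF z Kz; apply/esym/ghd_gd => //; apply: ghd_ext FG _ => //; exact: hA_ghd.
Qed.

Lemma gd_mul K F G z : perfect K -> hA K F -> hA K G -> K z ->
  gd K (fun w => F w * G w) z = gd K F z * G z + F z * gd K G z.
Proof. by move=> pK hF hG Kz; apply: ghd_gd => //; apply: ghd_mul => //; exact: hA_ghd. Qed.

Lemma gd_add K F G z : perfect K -> hA K F -> hA K G -> K z ->
  gd K (fun w => F w + G w) z = gd K F z + gd K G z.
Proof. by move=> pK hF hG Kz; apply: ghd_gd => //; apply: ghd_add => //; exact: hA_ghd. Qed.

Lemma gd_sub_dom K L F z : perfect K -> perfect L -> K `<=` L -> hA L F -> K z ->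
  gd K F z = gd L F z.
Proof.
move=> pK pL KL hF Kz; apply: ghd_gd => // S; apply: (hd_sub KL).
by have := hA_ghd pL hF (KL _ Kz) S.
Qed.

Lemma jetS K F z k : jet K F z k.+1 = jet K (gd K F) z k.
Proof. by apply: grP => S; rewrite /jet iterSr. Qed.
Lemma jet0 K F z : jet K F z 0 = F z. Proof. by []. Qed.

Lemma jet_ext K F G z k : perfect K -> (forall w, K w -> F w = G w) -> hA K F ->
  K z -> jet K F z k = jet K G z k.
Proof.
move=> pK; elim: k F G => [|k ih] F G FG hF Kz; first by rewrite !jet0 FG.
by rewrite !jetS; apply: ih => //; [exact: gd_ext|exact: hA_gd].
Qed.

Lemma jet_sub_dom K L F z k : perfect K -> perfect L -> K `<=` L -> hA L F -> K z ->
  jet K F z k = jet L F z k.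
Proof.
move=> pK pL KL; elim: k F => [//|k ih] F hF Kz.
rewrite !jetS -ih; [|exact: hA_gd|exact: Kz].
apply: jet_ext => // [w Kw|]; first exact: gd_sub_dom.
by apply: hA_gd => //; exact: hA_sub_dom hF.
Qed.

Lemma gd_opp K F z : perfect K -> hA K F -> K z ->
  gd K (fun w => - F w) z = - gd K F z.
Proof. by move=> pK hF Kz; apply: ghd_gd => //; apply: ghd_opp; exact: hA_ghd. Qed.

Lemma gd_scale K (c : C) F z : perfect K -> hA K F -> K z ->
  gd K (fun w => c *: F w) z = c *: gd K F z.
Proof. by move=> pK hF Kz; apply: ghd_gd => //; apply: ghd_scale => //; exact: hA_ghd. Qed.

End GrFunctions.

(** * Taylor substitution *)

Section Taylor.
Variable R : realType.
Local Notation C := R[i].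
Local Notation gr := (gr R).
Local Notation Rline := (@Rline R).
Implicit Types (K L : set C) (F G f g : C -> gr) (x y N : gr) (z : C) (J : nat -> gr).

Definition tay J N : gr := fun S =>
  \sum_(k < #|` S|.+2) ((k`!%:R)^-1 *: (J k * N ^+ k)) S.

Definition tayn n J N : gr := \sum_(k < n) (k`!%:R)^-1 *: (J k * N ^+ k).

(** The k-th power of a nilpotent part starts in degree k. The bound that depends on S is thus
    harmless, and a fixed truncation at n is exact in degrees below n. *)
Lemma tayn_tay n J N : fil 1 N -> fil n (tay J N - tayn n J N).
Proof.
move=> hN S hS; rewrite grBE /tayn gr_sumE /tay; apply/eqP; rewrite subr_eq0; apply/eqP.
have trunc m : (#|` S| < m)%N ->
    \sum_(k < m) ((k`!%:R)^-1 *: (J k * N ^+ k)) S =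
    \sum_(k < #|` S|.+1) ((k`!%:R)^-1 *: (J k * N ^+ k)) S.
  move=> hm; rewrite -!(big_mkord xpredT (fun k => ((k`!%:R)^-1 *: (J k * N ^+ k)) S)).
  rewrite (big_cat_nat _ hm) //= [X in _ + X]big_nat_cond [X in _ + X]big1 ?addr0 // => k.
  rewrite andbT => /andP[hk _]; rewrite grZE.
  have h : fil k (J k * N ^+ k) by apply: filMr; have := @filX _ 1 N k hN; rewrite mul1n.
  by rewrite (h S) ?mulr0.
by rewrite trunc // [RHS]trunc.
Qed.

Definition gsub K f x : gr :=
  tay (jet K f (x fset0)) (x - gconst (x fset0)).

Lemma nil_fil x : fil 1 (x - gconst (x fset0)).
Proof. by apply: fil1; rewrite grBE gconstE eqxx subrr. Qed.

Lemma nil_even x : geven x -> geven (x - gconst (x fset0)).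
Proof.
move=> hx; apply: gevenB => // S hS; rewrite gconstE; case: eqP => // S0.
by rewrite S0 cardfs0 in hS.
Qed.

Lemma gsub_body K f x : (gsub K f x) fset0 = f (x fset0) fset0.
Proof.
rewrite /gsub /tay cardfs0 !big_ord_recr big_ord0 /= add0r !grZE expr0 mulr1 expr1 grM0.
by rewrite [X in _ * (_ * X)]grBE gconstE eqxx subrr !mulr0 addr0 fact0 invr1 mul1r.
Qed.

Lemma gsub_const K f z : gsub K f (gconst z) = f z.
Proof.
apply: grP => S; rewrite /gsub gconstE eqxx subrr /tay big_ord_recl /= expr0 mulr1.
rewrite fact0 invr1 scale1r big1 ?addr0 ?jet0 // => k _.
by rewrite /bump /= expr0n /= mulr0 scaler0.
Qed.

Lemma gsub_ext K f g x : perfect K -> (forall z, K z -> f z = g z) -> hA K f ->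
  K (x fset0) -> gsub K f x = gsub K g x.
Proof.
move=> pK fg hf Kx; apply: grP => S; rewrite /gsub /tay; apply: eq_bigr => k _.
by rewrite (jet_ext _ pK fg).
Qed.

Lemma gsub_sub_dom K L f x : perfect K -> perfect L -> K `<=` L -> hA L f ->
  K (x fset0) -> gsub K f x = gsub L f x.
Proof.
move=> pK pL KL hf Kx; apply: grP => S; rewrite /gsub /tay; apply: eq_bigr => k _.
by rewrite (jet_sub_dom _ pK pL KL).
Qed.

Lemma gsub_gd K f x S n : (#|` S| < n)%N ->
  gsub K f x S = tayn n (jet K f (x fset0)) (x - gconst (x fset0)) S.
Proof.
move=> h; apply/eqP; rewrite -subr_eq0 -grBE; apply/eqP.
by apply: (tayn_tay (n := n)) => //; exact: nil_fil.
Qed.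

Lemma fil_eqM d x y a b : fil d (x - y) -> fil d (a - b) -> fil d (x * a - y * b).
Proof.
move=> h h'; have -> : x * a - y * b = (x - y) * a + y * (a - b).
  by rewrite mulrBl mulrBr addrA subrK.
by apply: filD; [exact: filMl|exact: filMr].
Qed.

Section Chain.
Variables (K L : set C) (pK : perfect K) (pL : perfect L) (Q : C -> gr).
Hypotheses (evQ : forall z, K z -> geven (Q z)) (bQ : forall z, K z -> L (Q z fset0)).

(** Chain rule. The derivative l splits into its body b' and the rest. The body moves the base point
    of the jets and contributes b' times the series of f'; the powers of the nilpotent part
    contribute l - b' times the same series. *)
Lemma gsub_ghd f z l : hA L f -> K z -> ghd K Q z l ->
  ghd K (fun w => gsub L f (Q w)) z (gsub L (gd L f) (Q z) * l).
Proof.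
move=> hf Kz hl; pose N w := Q w - gconst (Q w fset0).
have hb : hd K (fun w => Q w fset0) z (l fset0) by exact: hl.
set b' := l fset0 in hb *.
have hN : ghd K N z (l - gconst b').
  by apply: ghd_add; [exact: hl|apply: ghd_opp; exact: ghd_const].
have hJ k : ghd K (fun w => jet L f (Q w fset0) k) z
    (b' *: jet L (gd L f) (Q z fset0) k).
  move=> S; rewrite -jetS grZE mulrC.
  have := @hd_comp _ K L (fun w => jet L f w k S) (fun w => Q w fset0) z _ _ Kz bQ hb.
  apply; apply: cderivable_hd.
  exact: (@hA_holo _ L f S pL hf k _ (bQ Kz)).
move=> S; set n := #|` S|.+1.
pose d k : gr := (k`!%:R)^-1 *: (b' *: jet L (gd L f) (Q z fset0) k * N z ^+ k +
   jet L f (Q z fset0) k * (N z ^+ k.-1 * (l - gconst b') *+ k)).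
have h : ghd K (fun w => tayn n.+1 (jet L f (Q w fset0)) (N w)) z (\sum_(k < n.+1) d k).
  apply: ghd_sum => k _; apply: ghd_scale => //; apply: ghd_mul => //.
  by apply: ghd_exp => // w Kw; apply: nil_even; exact: evQ.
suff -> : (gsub L (gd L f) (Q z) * l) S = (\sum_(k < n.+1) d k) S.
  by apply: hd_ext (h S) => // w Kw; rewrite -gsub_gd.
apply/eqP; rewrite -subr_eq0 -grBE; apply/eqP.
suff : fil n (gsub L (gd L f) (Q z) * l - \sum_(k < n.+1) d k) by apply.
set J' := jet L (gd L f) (Q z fset0).
(* Differentiation of a power lowers its exponent, so the second truncation has one term less. With
   n = #|S| + 1 both are still exact at S. *)
have e : \sum_(k < n.+1) d k =
    tayn n.+1 J' (N z) * gconst b' + tayn n J' (N z) * (l - gconst b').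
  rewrite /d; under eq_bigr do rewrite scalerDr; rewrite big_split /=; congr (_ + _).
    rewrite mulr_suml; apply: eq_bigr => k _; rewrite gconstA -!scalerAr mulr1 -!scalerAl.
    by rewrite scalerA mulrC -scalerA.
  rewrite big_ord_recl /= mulr0n mulr0 scaler0 add0r mulr_suml; apply: eq_bigr => k _.
  rewrite /bump /= add1n add0n jetS -/(J' k) -scalerAl -mulrA /=.
  rewrite mulrnAr -[X in _ *: X = _]scaler_nat scalerA; congr (_ *: _).
  rewrite factS natrM invfM mulrAC mulVf ?mul1r // pnatr_eq0 //.
rewrite e; have -> : gsub L (gd L f) (Q z) * l =
   gsub L (gd L f) (Q z) * gconst b' + gsub L (gd L f) (Q z) * (l - gconst b').
  by rewrite -mulrDr addrC subrK.
rewrite opprD addrACA; apply: filD; apply: fil_eqM; rewrite ?subrr //.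
- by apply: (@filW _ n.+1) => //; apply: tayn_tay; exact: nil_fil.
- by apply: tayn_tay; exact: nil_fil.
Qed.

Lemma jet_vanish f S z k : (forall w, L w -> f w S = 0) -> L z -> jet L f z k S = 0.
Proof.
elim: k f z => [|k ih] f z f0 Lz; first exact: f0.
by rewrite jetS; apply: ih => // w Lw; exact: gd_zero.
Qed.

Lemma gsub_gfin f n z : (forall w, L w -> gfin n (f w)) -> gfin n (Q z) -> K z ->
  gfin n (gsub L f (Q z)).
Proof.
move=> hf hQz Kz S j jS nj; rewrite /gsub /tay big1 // => k _.
suff h : gfin n ((k`!%:R)^-1 *: (jet L f (Q z fset0) k *
    (Q z - gconst (Q z fset0)) ^+ k)) by exact: h jS nj.
apply: gfinZ; apply: gfinM.
  move=> T i iT ni; apply: jet_vanish; last exact: bQ.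
  by move=> w Lw; exact: (hf w Lw T i).
by apply: gfinX; apply: gfinD => //; apply: gfinN; exact: gfin_const.
Qed.

Hypothesis hQ : hA K Q.

(** The chain rule expresses the derivative through a substitution into f', so the induction on the
    order runs over all f at once. *)
Lemma hA_gsub f : hA L f -> hA K (fun z => gsub L f (Q z)).
Proof.
move=> hf; split.
  have [[m hm] _] := hf; have [[n hn] _] := hQ; exists (maxn m n) => z Kz.
  apply: gsub_gfin => //.
    by move=> w Lw; apply: gfinW (hm w Lw); exact: leq_maxl.
  by apply: gfinW (hn z Kz); exact: leq_maxr.
suff : forall n f S, hA L f -> hol n K (fun z => gsub L f (Q z) S) by move=> h n S; exact: h.
elim=> // n ih {hf} {}f S hf.
exists (fun z => (gsub L (gd L f) (Q z) * gd K Q z) S); split.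
  by move=> z Kz; apply: gsub_ghd => //; exact: hA_ghd.
have hg : hA K (gd K Q) by exact: hA_gd.
apply: (@hol_ext _ _ _ (fun z => \sum_(I <- fpowerset S)
    (-1) ^+ inversions I (S `\` I)%fset * gsub L (gd L f) (Q z) I
      * gd K Q z (S `\` I)%fset)) => //.
apply: hol_sum => I _; apply: hol_mul; last exact: hg.2.
by apply: hol_mul; [exact: hol_cst|apply: ih; exact: hA_gd].
Qed.

Lemma gd_gsub f z : hA L f -> K z ->
  gd K (fun w => gsub L f (Q w)) z = gsub L (gd L f) (Q z) * gd K Q z.
Proof. by move=> hf Kz; apply: ghd_gd => //; apply: gsub_ghd => //; exact: hA_ghd. Qed.

End Chain.

Lemma gsub_parity (p : bool) L f x : perfect L ->
  (forall z S, L z -> odd #|` S| != p -> f z S = 0) -> geven x -> L (x fset0) ->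
  forall S, odd #|` S| != p -> gsub L f x S = 0.
Proof.
move=> pL fp ex Lx S hS; rewrite /gsub /tay big1 // => k _; rewrite grZE.
have hJ T : odd #|` T| != p -> jet L f (x fset0) k T = 0.
  by move=> hT; apply: jet_vanish => // w Lw; exact: fp.
have hN : geven ((x - gconst (x fset0)) ^+ k) by apply: gevenX; exact: nil_even.
case: p hS hJ {fp} => hS hJ.
  have : godd (jet L f (x fset0) k * (x - gconst (x fset0)) ^+ k).
    apply: goddMl => // T hT; apply: hJ; by case: odd hT.
  by move=> ->; rewrite ?mulr0 //; case: odd hS.
have : geven (jet L f (x fset0) k * (x - gconst (x fset0)) ^+ k).
  apply: gevenM => // T hT; apply: hJ; by case: odd hT.
by move=> ->; rewrite ?mulr0 //; case: odd hS.
Qed.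

Lemma gsub_even L f x : perfect L -> (forall z, L z -> geven (f z)) -> geven x ->
  L (x fset0) -> geven (gsub L f x).
Proof.
move=> pL ef ex Lx S hS; apply: (@gsub_parity false) => //; last by rewrite hS.
by move=> z T Lz hT; apply: ef => //; case: odd hT.
Qed.
Lemma gsub_odd L f x : perfect L -> (forall z, L z -> godd (f z)) -> geven x ->
  L (x fset0) -> godd (gsub L f x).
Proof.
move=> pL ef ex Lx S hS; apply: (@gsub_parity true) => //; last by case: odd hS.
by move=> z T Lz hT; apply: ef => //; case: odd hT.
Qed.

(* The curve b + t N, with b and N the body and the nilpotent part of x, turns
   identities between Taylor substitutions into differential equations in t. *)
Definition ncurve x (t : C) : gr := gconst (x fset0) + t *: (x - gconst (x fset0)).

Lemma ncurve_body x t : ncurve x t fset0 = x fset0.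
Proof. by rewrite /ncurve grDE grZE grBE gconstE eqxx subrr mulr0 addr0. Qed.
Lemma ncurve0 x : ncurve x 0 = gconst (x fset0).
Proof. by rewrite /ncurve scale0r addr0. Qed.
Lemma ncurve1 x : ncurve x 1 = x.
Proof. by rewrite /ncurve scale1r addrC subrK. Qed.
Lemma ncurve_even x t : geven x -> geven (ncurve x t).
Proof.
move=> ex; apply: gevenD; last by apply: gevenZ; exact: nil_even.
by move=> S hS; rewrite gconstE; case: eqP => // S0; rewrite S0 cardfs0 in hS.
Qed.
Lemma ncurve_ghd K x z : K z -> ghd K (ncurve x) z (x - gconst (x fset0)).
Proof.
move=> Kz S; set N := x - _.
have h : hd K (fun w => gconst (x fset0) S + w * N S) z (0 + (1 * N S + z * 0)).
  by apply: hd_add; [exact: hd_cst|apply: (hd_mul Kz); [exact: hd_id|exact: hd_cst]].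
by move: h; rewrite mulr0 addr0 mul1r add0r.
Qed.

Lemma hd0_const (F : C -> C) (t : R) : (forall z, Rline z -> hd Rline F z 0) ->
  F t%:C = F 0.
Proof.
move=> h; have d (x : R) := hd_Rline_fun (h _ (Rline_real x)).
have eR := @is_derive_0_is_cst _ (fun y : R => complex.Re (F y%:C)) t 0 (fun y : R => (d y).1).
have eI := @is_derive_0_is_cst _ (fun y : R => complex.Im (F y%:C)) t 0 (fun y : R => (d y).2).
by apply/eqP; rewrite eq_complex; apply/andP; split; apply/eqP; [exact: eR|exact: eI].
Qed.

(* The order of vanishing in the nilpotent filtration improves by one at each
   integration. *)
Lemma nilpotent_ode (D : (C -> gr) -> Prop) :
  (forall F, D F -> F 0 = 0) ->
  (forall F, D F -> exists (n : nat) (G : 'I_n -> C -> gr) (H : 'I_n -> C -> gr),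
     (forall i, D (G i)) /\
     forall z, Rline z -> (forall i, fil 1 (H i z)) /\
       ghd Rline F z (\sum_(i < n) G i z * H i z)) ->
  forall F, D F -> forall t : R, F t%:C = 0.
Proof.
move=> D0 D' F DF t; apply: fil_eq0 => d.
suff : forall F, D F -> forall t : R, fil d (F t%:C) by apply.
elim: d => // d ih {}F {}DF {}t S hS.
have [n [G [H [DG hF]]]] := D' F DF.
rewrite (@hd0_const (fun z => F z S)); first by rewrite (D0 F DF).
move=> z Rz; have [fH /(_ S)] := hF z Rz.
rewrite gr_sumE big1 // => i _.
have : fil (d + 1) (G i z * H i z).
  by apply: filM => //; rewrite (RlineE Rz); exact: ih.
by apply; rewrite addn1.
Qed.

Section GsubMorphism.
Variables (K : set C) (pK : perfect K) (x : gr) (ex : geven x) (Kx : K (x fset0)).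

Lemma gsub_curve_ghd f z : hA K f -> Rline z ->
  ghd Rline (fun t => gsub K f (ncurve x t)) z
    (gsub K (gd K f) (ncurve x z) * (x - gconst (x fset0))).
Proof.
move=> hf Rz; have pR := @perfect_Rline R.
have := @gsub_ghd Rline K pK (ncurve x) _ _ f z _ hf Rz (ncurve_ghd x Rz).
apply.
- by move=> w _; exact: ncurve_even.
- by move=> w _; rewrite ncurve_body.
Qed.

Lemma gsub_add f g : hA K f -> hA K g ->
  gsub K (fun z => f z + g z) x = gsub K f x + gsub K g x.
Proof.
move=> hf hg.
have jD k z : K z -> forall f g, hA K f -> hA K g ->
    jet K (fun z => f z + g z) z k = jet K f z k + jet K g z k.
  move=> Kz; elim: k => [//|k ih] f1 g1 hf1 hg1; rewrite !jetS -ih; try exact: hA_gd.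
  apply: jet_ext => //; last by apply: hA_gd => //; exact: hA_add.
  by move=> w Kw; rewrite gd_add.
apply: grP => S; rewrite grDE /gsub /tay -big_split /=; apply: eq_bigr => k _.
by rewrite jD // mulrDl scalerDr.
Qed.

Lemma gsub_scale c f : hA K f -> gsub K (fun z => c *: f z) x = c *: gsub K f x.
Proof.
move=> hf.
have jD k z : K z -> forall f, hA K f ->
    jet K (fun z => c *: f z) z k = c *: jet K f z k.
  move=> Kz; elim: k => [//|k ih] f1 hf1; rewrite !jetS -ih; try exact: hA_gd.
  apply: jet_ext => //; last by apply: hA_gd => //; exact: hA_scale.
  by move=> w Kw; rewrite gd_scale.
apply: grP => S; rewrite grZE /gsub /tay mulr_sumr /=; apply: eq_bigr => k _.
by rewrite jD // -scalerAl !grZE mulrCA.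
Qed.

End GsubMorphism.

(** The defect E(f, g) of multiplicativity along the curve vanishes at t = 0, where substitution is
    evaluation, and satisfies E(f, g)' = (E(f', g) + E(f, g')) N. The family of all such defects is
    closed under this equation, so [nilpotent_ode] applies. *)
Lemma gsub_mul K f g x : perfect K -> geven x -> K (x fset0) -> hA K f -> hA K g ->
  gsub K (fun z => f z * g z) x = gsub K f x * gsub K g x.
Proof.
move=> pK ex Kx hf hg; set N := x - gconst (x fset0).
pose E f g t := gsub K f (ncurve x t) * gsub K g (ncurve x t)
  - gsub K (fun z => f z * g z) (ncurve x t).
suff h : E f g (1%:C) = 0.
  by apply/esym/eqP; rewrite -subr_eq0; move: h; rewrite /E ncurve1 => ->.
apply: (@nilpotent_ode (fun F => exists f g, [/\ hA K f, hA K g & F = E f g])); last first.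
- by exists f, g.
- move=> _ [f1 [g1 [hf1 hg1 ->]]].
  exists 2%N, (fun i => if i == 0 then E (gd K f1) g1 else E f1 (gd K g1)), (fun _ _ => N).
  split=> [i|z Rz].
    by case: ifP => _; [exists (gd K f1), g1|exists f1, (gd K g1)]; split => //; exact: hA_gd.
  split=> [i|]; first exact: nil_fil.
  have evz : geven (ncurve x z) := ncurve_even z ex.
  have Kz : K (ncurve x z fset0) by rewrite ncurve_body.
  have hf1' := hA_gd pK hf1; have hg1' := hA_gd pK hg1.
  have dm : gsub K (gd K (fun w => f1 w * g1 w)) (ncurve x z) =
    gsub K (fun w => gd K f1 w * g1 w) (ncurve x z) +
    gsub K (fun w => f1 w * gd K g1 w) (ncurve x z).
    rewrite -gsub_add //; try exact: hA_mul.
    by apply: gsub_ext => // [w Kw|]; [rewrite gd_mul|apply: hA_gd => //; exact: hA_mul].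
  have := ghd_add (ghd_mul Rz (gsub_curve_ghd pK ex Kx hf1 Rz) (gsub_curve_ghd pK ex Kx hg1 Rz))
     (ghd_opp (gsub_curve_ghd pK ex Kx (hA_mul hf1 hg1) Rz)).
  rewrite dm -/N; congr (ghd _ _ _ _); rewrite big_ord_recl big_ord1 /= /E.
  rewrite !mulrBl mulrDl opprD -!mulrA (geven_comm (gsub K g1 _) (nil_even ex)) -/N.
  by rewrite addrACA.
- move=> _ [f1 [g1 [hf1 hg1 ->]]]; rewrite /E ncurve0 !gsub_const subrr //.
Qed.

(** The defect E(f) of associativity vanishes at t = 0 and, by the chain rule on both sides,
    satisfies E(f)' = E(f') H N with H the value of Q' on the curve. *)
Lemma gsub_comp K L f Q x : perfect K -> perfect L -> hA K Q ->
  (forall z, K z -> geven (Q z)) -> (forall z, K z -> L (Q z fset0)) ->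
  geven x -> K (x fset0) -> hA L f ->
  gsub K (fun z => gsub L f (Q z)) x = gsub L f (gsub K Q x).
Proof.
move=> pK pL hQ eQ bQ ex Kx hf; set N := x - gconst (x fset0).
pose c t := gsub K Q (ncurve x t).
pose E f t := gsub L f (c t) - gsub K (fun z => gsub L f (Q z)) (ncurve x t).
suff h : E f (1%:C) = 0.
  by apply/esym/eqP; rewrite -subr_eq0; move: h; rewrite /E /c ncurve1 => ->.
apply: (@nilpotent_ode (fun F => exists2 f, hA L f & F = E f)); last first.
- by exists f.
- move=> _ [f1 hf1 ->].
  exists 1%N, (fun _ => E (gd L f1)), (fun _ t => gsub K (gd K Q) (ncurve x t) * N).
  have hf1' := hA_gd pL hf1.
  split=> [i|z Rz]; first by exists (gd L f1).
  split=> [i|]; first by apply: filMr; exact: nil_fil.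
  have evz : geven (ncurve x z) := ncurve_even z ex.
  have Kz : K (ncurve x z fset0) by rewrite ncurve_body.
  have hc := gsub_curve_ghd pK ex Kx hQ Rz.
  have hg : hA K (fun z => gsub L f1 (Q z)) by exact: hA_gsub.
  have hg' : hA K (fun z => gsub L (gd L f1) (Q z)) by exact: hA_gsub.
  have h1 : ghd Rline (fun t => gsub L f1 (c t)) z
      (gsub L (gd L f1) (c z) * (gsub K (gd K Q) (ncurve x z) * N)).
    apply: (@gsub_ghd Rline L pL c) => //.
      by move=> w _; apply: gsub_even => //; [exact: ncurve_even|rewrite ncurve_body].
    by move=> w _; rewrite /c gsub_body ncurve_body; exact: bQ.
  have := ghd_add h1 (ghd_opp (gsub_curve_ghd pK ex Kx hg Rz)).
  rewrite -/N; congr (ghd _ _ _ _); rewrite big_ord1 /E.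
  have -> : gsub K (gd K (fun z => gsub L f1 (Q z))) (ncurve x z) =
     gsub K (fun z => gsub L (gd L f1) (Q z)) (ncurve x z) * gsub K (gd K Q) (ncurve x z).
    rewrite -gsub_mul //; last exact: hA_gd.
    by apply: gsub_ext => // [w Kw|]; [rewrite gd_gsub|exact: hA_gd].
  by rewrite mulrBl !mulrA.
- by move=> _ [f1 hf1 ->]; rewrite /E /c ncurve0 !gsub_const subrr.
Qed.

End Taylor.

(** * The exponential *)

Section ComplexExponential.
Variable R : realType.
Local Notation C := R[i].
Local Notation Rline := (@Rline R).
Implicit Types (K L : set C) (z w : C).

Lemma nbhsC z (A : set C) : nbhs (z : C^o) A <->
  exists2 e : R, 0 < e & forall w, `|w - z| < e%:C -> A w.
Proof.
split.
  move=> /nbhs_ballP[e /= /ltc_real[r r0 ->] h]; exists r => // w hw.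
  by apply: h; rewrite /ball /= distrC.
move=> [e e0 h]; apply/nbhs_ballP; exists e%:C; first by rewrite /= ltcR.
by move=> w; rewrite /ball /= distrC => /h.
Qed.

Lemma cont_eps K (f : C -> C) z : cont_at K f z <->
  forall e : R, 0 < e -> exists2 d : R, 0 < d &
    forall w, K w -> `|w - z| < d%:C -> `|f w - f z| < e%:C.
Proof.
rewrite cont_nbhs; split.
  move=> h e e0; have /nbhsC[d d0 hd] : nbhs (z : C^o) (fun w => K w -> `|f w - f z| < e%:C).
    by apply: (h (fun v => `|v - f z| < e%:C)); apply/nbhsC; exists e.
  by exists d => // w Kw /hd; exact.
move=> h A /nbhsC[e e0 he]; have [d d0 hd] := h e e0; apply/nbhsC; exists d => // w hw Kw.
by apply: he; exact: hd.
Qed.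

Lemma is_derive_hd (f : R -> R) (x l : R) : is_derive x 1 f l ->
  hd Rline (fun z => (f (complex.Re z))%:C) x%:C l%:C.
Proof. by move=> h; apply/(hd_Rline (fun t => (f t)%:C)); split => //=; exact: is_derive_cst. Qed.

Lemma expiD (x y : R) : expi (x + y) = expi x * expi y :> C.
Proof. by rewrite /expi cosD sinD; apply/eqP; rewrite eq_complex /= eqxx addrC eqxx. Qed.
Lemma expi0 : expi 0 = 1 :> C.
Proof. by rewrite /expi cos0 sin0. Qed.
Lemma norm_expi (x : R) : `|expi x| = 1 :> C.
Proof. by rewrite normc_def /expi /= cos2Dsin2 sqrtr1. Qed.
Lemma expi_neq0 (x : R) : expi x != 0 :> C.
Proof. by rewrite -normr_gt0 norm_expi ltr01. Qed.
Lemma expiN (x : R) : expi (- x) = (expi x)^-1 :> C.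
Proof. by apply: (mulfI (expi_neq0 x)); rewrite -expiD subrr expi0 divff ?expi_neq0. Qed.
Lemma expi_pi : expi pi = -1 :> C.
Proof. by rewrite /expi cospi sinpi; apply/eqP; rewrite eq_complex /= oppr0 !eqxx. Qed.
Lemma expi_2pi : expi (2 * pi) = 1 :> C.
Proof. by rewrite mulr_natl mulr2n expiD expi_pi mulrN1 opprK. Qed.

Lemma hd_expi (x : R) : hd Rline (fun z => expi (complex.Re z)) x%:C ('i * expi x).
Proof.
apply/(hd_Rline (@expi R)); rewrite /expi /= !(mul0r, mul1r) sub0r add0r; split.
  exact: is_derive_cos.
exact: is_derive_sin.
Qed.

Lemma cexpD z w : cexp (z + w) = cexp z * cexp w.
Proof.
rewrite /cexp; have -> : complex.Re (z + w) = complex.Re z + complex.Re w by case: z; case: w.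
have -> : complex.Im (z + w) = complex.Im z + complex.Im w by case: z; case: w.
by rewrite expRD expiD rmorphM /= mulrACA.
Qed.
Lemma cexp0 : cexp 0 = 1 :> C.
Proof. by rewrite /cexp expR0 expi0 mulr1. Qed.
Lemma cexp_neq0 z : cexp z != 0.
Proof. by rewrite mulf_neq0 ?expi_neq0 // eq_complex /= eqxx andbT gt_eqF // expR_gt0. Qed.
Lemma cexpN z : cexp (- z) = (cexp z)^-1.
Proof. by apply: (mulfI (cexp_neq0 z)); rewrite -cexpD subrr cexp0 divff ?cexp_neq0. Qed.

Lemma norm_real (x : R) : `|x%:C| = `|x|%:C :> C.
Proof. by rewrite normc_def /= expr0n addr0 sqrtr_sqr. Qed.

Lemma cont_Re z : cont_at setT (fun w => (complex.Re w)%:C) z.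
Proof.
apply/cont_eps => e e0; exists e => // w _ h; rewrite -rmorphB /= -ReB.
by rewrite norm_real ltcR; exact: Re_le_norm.
Qed.
Lemma cont_Im z : cont_at setT (fun w => (complex.Im w)%:C) z.
Proof.
apply/cont_eps => e e0; exists e => // w _ h; rewrite -rmorphB /= -ImB.
by rewrite norm_real ltcR; exact: Im_le_norm.
Qed.

Lemma cont_Rline (f : C -> C) z : cont_at Rline f (complex.Re z)%:C ->
  cont_at setT (fun w => f (complex.Re w)%:C) z.
Proof. by apply: (@cont_comp _ setT Rline f (fun w => (complex.Re w)%:C)) => //; exact: cont_Re. Qed.
Lemma cont_RlineIm (f : C -> C) z : cont_at Rline f (complex.Im z)%:C ->
  cont_at setT (fun w => f (complex.Im w)%:C) z.
Proof. by apply: (@cont_comp _ setT Rline f (fun w => (complex.Im w)%:C)) => //; exact: cont_Im. Qed.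

Lemma norm_Im_le z : `|complex.Im z|%:C <= `|z|.
Proof.
rewrite -normrN -ReiNIm; apply: le_trans (normc_ge_Re _) _.
rewrite normrM; suff -> : `|'i%C| = 1 :> C by rewrite mulr1.
by rewrite normc_def /= expr0n /= add0r expr1n sqrtr1.
Qed.

(** The real derivatives of exp and of exp(iy) at 0 are combined in the form exp w - 1 - w = (Re w)
    h(w) + (Im w) k(w), with h and k continuous at 0 and zero there. Since |Re w| and |Im w| are at
    most |w|, the quotient by w tends to 0. *)
Lemma hd_cexp0 : hd setT (@cexp R) 0 1.
Proof.
have [al [al0 cal eal]] := is_derive_hd (is_derive_expR (0 : R)).
have [be [be0 cbe ebe]] := hd_expi 0.
rewrite expi0 mulr1 in be0.
pose h w := al (complex.Re w)%:C * expi (complex.Im w) - 1.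
pose k w := be (complex.Im w)%:C - 'i.
have cexpi : cont_at setT (fun w => expi (complex.Im w)) (0 : C).
  by apply: (@cont_RlineIm (fun w => expi (complex.Re w))); exact: hd_cont (hd_expi 0).
have ch : cont_at setT h 0.
  apply: cont_add; last exact: cont_cst.
  by apply: cont_mul cexpi; exact: cont_Rline.
have ck : cont_at setT k 0.
  by apply: cont_add; [exact: cont_RlineIm|exact: cont_cst].
have h0 : h 0 = 0 by rewrite /h /= al0 expR0 expi0 mulr1 subrr.
have k0 : k 0 = 0 by rewrite /k /= be0 subrr.
have key w : cexp w - 1 - w = (complex.Re w)%:C * h w + (complex.Im w)%:C * k w.
  have := eal (complex.Re w)%:C erefl; rewrite subr0 /= expR0 => e1.
  have := ebe (complex.Im w)%:C erefl; rewrite subr0 /= expi0 => e2.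
  rewrite /h /k !mulrBr mulr1 mulrA -e1 -e2 /cexp mulrBl mul1r.
  rewrite [X in _ - X = _](complexE w) (mulrC 'i%C) opprD.
  set a := (expR _)%:C; set b := expi _; set c := _%:C; set d := _ * 'i%C.
  by clearbody a b c d; ring.
apply: hd_of_cvg => A /nbhsC[e e0 he].
have e2 : 0 < e / 2 by rewrite divr_gt0.
move/cont_eps: ch => /(_ _ e2)[d1 d10 hd1].
move/cont_eps: ck => /(_ _ e2)[d2 d20 hd2].
apply/nbhsC; exists (Num.min d1 d2); first by rewrite lt_min d10.
move=> w; rewrite subr0 => hw w0 _; apply: he; rewrite /cquotient cexp0 subr0.
have w0' : w != 0 by apply/eqP.
have -> : (cexp w - 1) / w - 1 = (cexp w - 1 - w) / w by rewrite [in RHS]mulrBl divff.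
rewrite key normrM normfV ltr_pdivrMr ?normr_gt0 //.
apply: le_lt_trans (ler_normD _ _) _; rewrite !normrM !norm_real.
have hh : `|h w| < (e / 2)%:C.
  by have := hd1 w I; rewrite h0 !subr0; apply; apply: lt_le_trans hw _; rewrite lecR ge_min lexx.
have hk : `|k w| < (e / 2)%:C.
  by have := hd2 w I; rewrite k0 !subr0; apply; apply: lt_le_trans hw _; rewrite lecR ge_min lexx orbT.
apply: (@le_lt_trans _ _ (`|w| * `|h w| + `|w| * `|k w|)).
  by apply: lerD; apply: ler_wpM2r => //; [exact: normc_ge_Re|exact: norm_Im_le].
rewrite -mulrDr mulrC ltr_pM2r ?normr_gt0 // [e]splitr rmorphD /=.
exact: ltrD.
Qed.

Lemma hd_setT K (f : C -> C) z l : hd setT f z l -> hd K f z l.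
Proof. exact: hd_sub. Qed.

Lemma hd_cexp K z : hd K (@cexp R) z (cexp z).
Proof.
apply: hd_setT; have h : hd setT (fun w => w - z) z 1.
  by rewrite -[1]addr0; apply: hd_add; [exact: hd_id|exact: hd_cst].
have h2 : hd setT (fun w => cexp (w - z)) z (1 * 1).
  by apply: (@hd_comp _ setT setT _ _ _ _ _ _ _ h) => //; rewrite subrr; exact: hd_cexp0.
have := hd_mul (I : setT z) (hd_cst setT (cexp z) z) h2.
rewrite subrr mul0r add0r !mulr1; apply: hd_ext0 => w.
by rewrite -cexpD addrC subrK.
Qed.

Lemma hol_cexp n K : hol n K (@cexp R).
Proof. by elim: n => // n ih; exists (@cexp R); split=> // z _; exact: hd_cexp. Qed.

Lemma perfect_setT : perfect (setT : set C).
Proof.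
move=> z _ U /nbhsC[e e0 he]; exists (z + (e / 2)%:C); split => //.
  move=> /eqP; rewrite -subr_eq0 addrAC subrr add0r eq_complex /= eqxx andbT.
  by rewrite gt_eqF // divr_gt0.
apply: he; rewrite addrAC subrr add0r norm_real ltcR gtr0_norm ?divr_gt0 //.
by rewrite gtr_pMr // invf_lt1 // ltr1n.
Qed.

Lemma cos_eq1 (b : R) : 0 <= b < 2 * pi -> cos b = 1 -> b = 0.
Proof.
move=> /andP[b0 b2] hc; have pi0 := pi_gt0 R.
have [bpi|bpi] := leP b pi.
  by apply: cos_inj; rewrite ?in_itv /= ?b0 ?bpi ?lexx ?pi_ge0 ?hc ?cos0.
have e : 2 * pi - b = 0.
  apply: cos_inj; rewrite ?in_itv /= ?lexx ?pi_ge0 //; first by apply/andP; split; lra.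
  by rewrite cos0 cosB mulr_natl cos2pi sin2pi mul0r addr0 mul1r.
lra.
Qed.

Lemma expi_int (k : int) : expi (2 * pi * k%:~R) = 1 :> C.
Proof.
have h (n : nat) : expi (2 * pi * n%:R) = 1 :> C.
  elim: n => [|n ih]; first by rewrite mulr0 expi0.
  by rewrite -(addn1 n) natrD mulrDr mulr1 expiD ih expi_2pi mulr1.
case: k => n; first exact: h.
by rewrite NegzE mulrNz mulrN expiN h invr1.
Qed.

Lemma expi_eq1 (b : R) : expi b = 1 :> C -> exists k : int, b = 2 * pi * k%:~R.
Proof.
move=> hb; have pi0 : 0 < 2 * pi :> R by rewrite mulr_gt0 // pi_gt0.
pose k := Num.floor (b / (2 * pi)); exists k; apply/eqP; rewrite -subr_eq0; apply/eqP.
apply: cos_eq1.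
  have /andP[h1 h2] := floor_itv (b / (2 * pi)).
  have h1' : 2 * pi * k%:~R <= b by rewrite mulrC -ler_pdivlMr.
  have h2' : b < 2 * pi * (k + 1)%:~R by rewrite mulrC -ltr_pdivrMr.
  rewrite intrD mulrDr mulr1 in h2'.
  by rewrite subr_ge0 h1' ltrBlDl.
have : expi (b - 2 * pi * k%:~R) = 1 :> C by rewrite expiD expiN expi_int hb invr1 mulr1.
by case.
Qed.

Lemma cexp_eq1 z : cexp z = 1 -> exists k : int, z = 'i * (2 * pi * k%:~R)%:C.
Proof.
case: z => a b h; have ha : expR a = 1.
  have := congr1 (fun w : C => `|w|) h; rewrite /cexp normrM norm_expi mulr1 normr1 norm_real /=.
  by move=> /complexI; rewrite ger0_norm ?expR_ge0.
have a0 : a = 0 by have := ln1 R; rewrite -ha expRK.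
move: h; rewrite /cexp /= ha mul1r => /expi_eq1[k ->]; exists k.
by apply/eqP; rewrite eq_complex a0 /= !(mul0r,mulr0,mul1r,subr0,addr0,add0r,oppr0) !eqxx.
Qed.

End ComplexExponential.

(** * Superfunctions *)

Section Superalgebra.
Variable R : realType.
Local Notation C := R[i].
Local Notation gr := (gr R).
Local Notation sgr := (sgr R).
Implicit Types (K L : set C) (f g : C -> gr) (x y N : gr) (z : C) (J : nat -> gr) (X Y : sgr).

Lemma grMconst (c : C) x S : (gconst c * x) S = c * x S.
Proof. exact: gmul_const. Qed.

Lemma smulE X Y : (X * Y)%S = (X.1 * Y.1, X.1 * Y.2 + X.2 * Y.1).
Proof. by []. Qed.
Lemma saddE X Y : (X + Y)%S = (X.1 + Y.1, X.2 + Y.2).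
Proof. by []. Qed.
Lemma sscaleE (c : C) X : sscale c X = (c *: X.1, c *: X.2).
Proof. by []. Qed.
Lemma sconstE (c : C) : sconst c = (gconst c, 0) :> sgr.
Proof. by rewrite /sconst gconst0. Qed.
Lemma thetaE : theta R = (0, 1).
Proof. by rewrite /theta gconst0. Qed.
Lemma dthetaE X : dtheta X = (X.2, 0).
Proof. by rewrite /dtheta gconst0. Qed.

Lemma nilpartE X : nilpart X = (X.1 - gconst (body X), X.2).
Proof.
rewrite /nilpart saddE sconstE /= addr0; congr (_ + _, _).
by apply: grP => S; rewrite grNE !gconstE; case: ifP; rewrite ?oppr0.
Qed.

Lemma spow1E Y n : (spow Y n).1 = Y.1 ^+ n.
Proof. by elim: n => // n ih; rewrite /spow iterS -/(spow Y n) smulE /= ih exprS. Qed.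

Lemma spow2E Y n : geven Y.1 -> (spow Y n).2 = Y.1 ^+ n.-1 * Y.2 *+ n.
Proof.
move=> eY; elim: n => [|n ih]; first by rewrite /spow /= gconst0.
rewrite /spow iterS -/(spow Y n) smulE /= ih spow1E mulrS addrC; congr (_ + _).
  case: n {ih} => [|n]; first by rewrite !mulr0n mulr0.
  by rewrite mulrnAr mulrA -exprS.
by rewrite (@geven_comm _ (Y.1 ^+ n) Y.2) //; exact: gevenX.
Qed.

Lemma taylor_term1E J X k : (taylor_term J X k).1 =
  (k`!%:R)^-1 *: (J k * (X.1 - gconst (body X)) ^+ k).
Proof. by rewrite /taylor_term smulE /= spow1E nilpartE /= gscaleE -scalerAl. Qed.

Lemma taylor_term2E J X k : geven X.1 -> (taylor_term J X k).2 =
  (k`!%:R)^-1 *: (J k * (X.1 - gconst (body X)) ^+ k.-1 * X.2 *+ k).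
Proof.
move=> eX; rewrite /taylor_term smulE /= gconst0 mul0r addr0 gscaleE nilpartE spow2E.
  by rewrite /= -scalerAl mulrnAr mulrA.
exact: nil_even.
Qed.

Lemma taylor1E J X : (taylor J X).1 = tay J (X.1 - gconst (body X)).
Proof.
apply: grP => S; rewrite /taylor /tay; apply: eq_bigr => k _.
by rewrite taylor_term1E.
Qed.

Lemma taylor2E J X : geven X.1 ->
  (taylor J X).2 = tay (fun k => J k.+1) (X.1 - gconst (body X)) * X.2.
Proof.
move=> eX; set N := X.1 - _; have eN : geven N by exact: nil_even.
apply: grP => S.
transitivity ((tayn #|` S|.+1 (fun k => J k.+1) N * X.2) S).
  rewrite /taylor [LHS]big_ord_recl taylor_term2E // mulr0n scaler0 gr0E add0r.
  rewrite /tayn mulr_suml gr_sumE; apply: eq_bigr => k _.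
  rewrite lift0 taylor_term2E // -/N -[X in _ *: X]scaler_nat scalerA -scalerAl.
  congr ((_ *: _) S); rewrite factS natrM invfM mulrAC mulVf ?mul1r // pnatr_eq0 //.
apply/esym/eqP; rewrite -subr_eq0 -grBE -mulrBl; apply/eqP.
suff : fil #|` S|.+1 ((tay (fun k => J k.+1) N - tayn #|` S|.+1 (fun k => J k.+1) N) * X.2).
  by apply.
by apply: filMl; apply: tayn_tay; exact: nil_fil.
Qed.

Definition gexp x : gr := tay (fun=> gconst (cexp (x fset0))) (x - gconst (x fset0)).

Lemma sexp1E X : (sexp X).1 = gexp X.1.
Proof. by rewrite /sexp taylor1E. Qed.

Lemma sexpE X : geven X.1 -> sexp X = (gexp X.1, gexp X.1 * X.2).
Proof. by move=> eX; rewrite [LHS]surjective_pairing sexp1E /sexp taylor2E. Qed.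

Lemma tay_ext J J' N : J =1 J' -> tay J N = tay J' N.
Proof. by move=> e; apply: grP => S; rewrite /tay; apply: eq_bigr => k _; rewrite e. Qed.

Definition cexpG (z : C) : gr := gconst (cexp z).

Lemma hA_cexpG K : hA K cexpG.
Proof. by apply: hA_const => n; exact: hol_cexp. Qed.

Lemma gd_cexpG z : gd setT cexpG z = cexpG z.
Proof.
by apply: ghd_gd => //; [exact: perfect_setT|apply: ghd_const; exact: hd_cexp].
Qed.

(** All derivatives of the exponential coincide, so the constant jet in [sexp] is the jet of a
    function, and the general results on substitution apply. *)
Lemma gexpE x : gexp x = gsub setT cexpG x.
Proof.
apply: tay_ext => k; elim: k => // k ih; rewrite jetS.
by rewrite (_ : gd setT cexpG = cexpG) //; apply/funext => z; exact: gd_cexpG.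
Qed.

Lemma gexp_body x : gexp x fset0 = cexp (x fset0).
Proof. by rewrite gexpE gsub_body. Qed.

Lemma gsub_id K x : perfect K -> geven x -> K (x fset0) -> gsub K (@gconst R) x = x.
Proof.
move=> pK ex Kx; have hg : hA K (@gconst R) by apply: hA_const => n; exact: hol_id.
have j0 k z : K z -> jet K (fun=> gconst 0 : gr) z k = 0.
  move=> Kz; apply: grP => S; apply: jet_vanish => // w _.
  by rewrite gconst0.
have j1 z : K z -> gd K (@gconst R) z = 1.
  by move=> Kz; apply: ghd_gd => //; apply: ghd_const; exact: hd_id.
have j2 k : jet K (@gconst R) (x fset0) k =
  if k == 0%N then gconst (x fset0) else if k == 1%N then 1 else 0.
  case: k => // k; rewrite jetS (@jet_ext _ K _ (fun=> gconst 1)) //; last exact: hA_gd.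
  case: k => // k; rewrite jetS (@jet_ext _ K _ (fun=> gconst 0)) ?j0 //.
    by move=> w Kw; apply: ghd_gd => //; apply: ghd_const; exact: hd_cst.
  by apply: hA_gd => //; apply: hA_const => n; exact: hol_cst.
rewrite /gsub (tay_ext _ j2); apply: grP => S; rewrite /tay 2!big_ord_recl /= big1 => [|k _].
  by rewrite addr0 fact0 expr0 mulr1 expr1 mul1r invr1 !scale1r -grDE addrC subrK.
by rewrite /bump /= mul0r scaler0.
Qed.

Lemma gsub_cst K x y : perfect K -> K (x fset0) -> gsub K (fun=> y) x = y.
Proof.
move=> pK Kx; apply: grP => S; rewrite /gsub /tay big_ord_recl big1 => [|k _].
  by rewrite /= addr0 fact0 invr1 scale1r expr0 mulr1.
rewrite lift0 /= [jet _ _ _ _](_ : _ = 0) ?mul0r ?scaler0 //.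
apply: grP => T; rewrite jetS; apply: jet_vanish => // w Kw.
exact: cderive_const.
Qed.

Lemma geven_const (c : C) : geven (gconst c : gr).
Proof. by move=> S hS; rewrite gconstE; case: eqP => // S0; rewrite S0 cardfs0 in hS. Qed.

(** Substitution of x into z |-> exp(z + y). For a number z only the body of the argument moves, so
    the series factors directly; [gsub_comp] and [gsub_mul] carry the identity over to x. Finiteness
    of y makes it an admissible constant function. *)
Lemma gexpD n x y : geven x -> geven y -> gfin n y -> gexp (x + y) = gexp x * gexp y.
Proof.
move=> ex ey fy; have pT := @perfect_setT R.
pose Q z : gr := gconst z + y.
have hc : hA setT (@gconst R) by apply: hA_const => m; exact: hol_id.
have hy : hA setT (fun _ : C => y) by exact: hA_cst fy.
have hQ : hA setT Q by exact: hA_add.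
have eQ z : setT z -> geven (Q z) by move=> _; apply: gevenD => //; exact: geven_const.
have := @gsub_comp _ setT setT cexpG Q x pT pT hQ eQ (fun _ _ => I) ex I (hA_cexpG _).
rewrite (gsub_add pT I hc hy) gsub_id // gsub_cst // -gexpE => <-.
have e z : gsub setT cexpG (Q z) = cexpG z * gexp y.
  rewrite -gexpE /gexp /Q; have -> : (gconst z + y) fset0 = z + y fset0.
    by rewrite grDE gconstE eqxx.
  have -> : gconst z + y - gconst (z + y fset0) = y - gconst (y fset0).
    by rewrite !gconstA scalerDl opprD addrACA subrr add0r.
  apply: grP => S; rewrite /tay /cexpG grMconst mulr_sumr; apply: eq_bigr => k _.
  by rewrite !grZE !grMconst cexpD -mulrA mulrCA.
rewrite (@gsub_ext _ setT _ (fun z => cexpG z * gexp y)) //; last first.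
  by apply: hA_gsub => //; exact: hA_cexpG.
rewrite gsub_mul //; last first.
- apply: (@hA_cst _ _ n); rewrite gexpE; apply: (@gsub_gfin _ setT setT _ (fun=> y) _ cexpG n 0) => //.
  by move=> w _; exact: gfin_const.
- exact: hA_cexpG.
by rewrite gsub_cst // -gexpE.
Qed.

Lemma gexp0 : gexp 0 = 1.
Proof. by rewrite -gconst0 gexpE gsub_const /cexpG cexp0. Qed.

Lemma gexp_even x : geven x -> geven (gexp x).
Proof.
move=> ex; rewrite gexpE; apply: gsub_even => //; first exact: perfect_setT.
by move=> z _; exact: geven_const.
Qed.

Lemma gexpN n x : geven x -> gfin n x -> gexp (- x) * gexp x = 1.
Proof. by move=> ex fx; rewrite -(gexpD _ _ fx) ?addNr ?gexp0 //; exact: gevenN. Qed.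

Lemma fil_exprB d x y k : fil 1 x -> fil 1 y -> fil d (x - y) ->
  fil (d + k) (x ^+ k.+1 - y ^+ k.+1).
Proof.
move=> fx fy fxy; elim: k => [|k ih]; first by rewrite addn0 !expr1.
rewrite exprS [y ^+ _]exprS.
have -> : x * x ^+ k.+1 - y * y ^+ k.+1 =
    (x - y) * x ^+ k.+1 + y * (x ^+ k.+1 - y ^+ k.+1).
  by rewrite mulrBl mulrBr addrA subrK.
apply: filD; first by apply: filM => //; have := @filX _ 1 x k.+1 fx; rewrite mul1n.
by rewrite addnS -add1n; exact: filM.
Qed.

(** Induction on the degree: if the nilpotent parts agree below degree d, their higher powers agree
    below degree d + 1 by [fil_exprB], so in degree d the exponentials differ only by the linear
    term. *)
Lemma gexp_inj x y : x fset0 = y fset0 -> gexp x = gexp y -> x = y.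
Proof.
move=> xy0 exy; apply/eqP; rewrite -subr_eq0; apply/eqP; apply: fil_eq0 => d.
set Nx := x - gconst (x fset0); set Ny := y - gconst (y fset0).
have e : x - y = Nx - Ny by rewrite /Nx /Ny xy0 opprB addrA subrK.
rewrite e; elim: d => // d ih S hS.
have [h|h] := ltnP #|` S| d; first exact: ih.
have eNy : y - gconst (x fset0) = Ny by rewrite /Ny xy0.
have := congr1 (fun u : gr => u S) exy; rewrite /gexp /tay -xy0 -/Nx eNy.
move/eqP; rewrite -subr_eq0 -sumrB 2!big_ord_recl /= !expr0 subrr add0r.
rewrite big1 ?addr0 => [|k _].
  rewrite -grBE -scalerBr -mulrBr !expr1 invr1 scale1r grMconst mulf_eq0.
  by rewrite (negPf (cexp_neq0 _)) /= => /eqP.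
rewrite /bump /= !add1n -grBE -scalerBr -mulrBr grZE.
have h2 : fil (d + k.+1) (Nx ^+ k.+2 - Ny ^+ k.+2) by apply: fil_exprB => //; exact: nil_fil.
have h3 : fil (d + k.+1) (gconst (cexp (x fset0)) * (Nx ^+ k.+2 - Ny ^+ k.+2)).
  exact: filMr.
rewrite h3 ?mulr0 //; apply: leq_trans hS _; by rewrite -addSnnS leq_addr.
Qed.

Definition nonzero : set C := [set z | z != 0].

Lemma perfect_nonzero : perfect nonzero.
Proof.
move=> z z0 U /nbhsC[e e0 he].
have nz : `|z| = (complex.Re `|z|)%:C by rewrite normc_def.
have n0 : 0 < complex.Re `|z| by rewrite -ltcR -nz normr_gt0.
pose d := e / 2 / complex.Re `|z|; have d0 : 0 < d by rewrite !divr_gt0.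
have wz : z * (1 + d)%:C - z = z * d%:C.
  by rewrite rmorphD /= mulrDr mulr1 addrAC subrr add0r.
have dC (a : R) : 0 < a -> a%:C != 0 :> C.
  by move=> a0; rewrite eq_complex /= eqxx andbT gt_eqF.
exists (z * (1 + d)%:C); split.
- by rewrite /nonzero /= mulf_neq0 // dC // addr_gt0.
- move=> /eqP; rewrite -subr_eq0 wz mulf_eq0 (negPf z0) /=.
  by apply/negP; exact: dC.
- have e1 : `|z * d%:C| = (complex.Re `|z| * d)%:C.
    by rewrite normrM norm_real (gtr0_norm d0) [in LHS]nz [RHS]rmorphM.
  apply: he; rewrite wz e1 ltcR.
  by rewrite mulrC divfK ?gt_eqF // gtr_pMr // invf_lt1 // ltr1n.
Qed.

Definition invG (z : C) : gr := gconst z^-1.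
Definition ginv x : gr := gsub nonzero invG x.

Lemma hA_invG : hA nonzero invG.
Proof. by apply: hA_const => n; apply: hol_inv => //; exact: hol_id. Qed.

(** These are the coefficients written into [sinv]; the inverse thereby becomes the substitution
    into 1/z. *)
Lemma jet_invG z k : nonzero z ->
  jet nonzero invG z k = gconst ((-1) ^+ k * k`!%:R / z ^+ k.+1).
Proof.
elim: k z => [|k ih] z z0; first by rewrite jet0 expr0 fact0 mul1r expr1 mul1r.
apply: grP => S; rewrite /jet iterS.
set c : C := (-1) ^+ k * k`!%:R.
have hk : hd nonzero (fun w => gconst (c / w ^+ k.+1) S) z
    (gconst ((-1) ^+ k.+1 * k.+1`!%:R / z ^+ k.+2) S).
  suff : ghd nonzero (fun w => gconst (c / w ^+ k.+1)) z
    (gconst ((-1) ^+ k.+1 * k.+1`!%:R / z ^+ k.+2)) by apply.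
  apply: ghd_const.
  have hX m : hd nonzero (fun w => w ^+ m) z (z ^+ m.-1 *+ m).
    elim: m => [|m ihm]; first exact: hd_cst.
    have := hd_mul z0 (@hd_id _ nonzero z) ihm; rewrite mul1r => h.
    suff -> : z ^+ m *+ m.+1 = z ^+ m + z * (z ^+ m.-1 *+ m).
      by apply: hd_ext0 h => w; rewrite exprS.
    by rewrite mulrS; congr (_ + _); case: m {ihm h} => [|m]; rewrite ?mulr0 // mulrnAr -exprS.
  have hI := @hd_inv _ nonzero (fun w => w ^+ k.+1) z _ z0 _ (hX k.+1).
  have {}hI : hd nonzero (fun w => (w ^+ k.+1)^-1) z (- (z ^+ k *+ k.+1) / (z ^+ k.+1) ^+ 2).
    by apply: hI => w w0; exact: expf_neq0.
  have := hd_mul z0 (hd_cst nonzero c z) hI; rewrite mul0r add0r; congr (hd _ _ _ _).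
  rewrite /c factS natrM -[z ^+ k *+ k.+1]mulr_natr !exprS expr0 mulr1.
  have := expf_neq0 k z0; move: z0; rewrite /nonzero /=.
  move: (z ^+ k) ((-1) ^+ k) (k`!%:R) (k.+1%:R) => p a b n z0 p0.
  by field; rewrite z0 p0.
apply: (hd_cderive z0 perfect_nonzero); apply: hd_ext hk => // w w0.
by have := congr1 (fun u : gr => u S) (ih w w0).
Qed.

Lemma ginvM x : geven x -> x fset0 != 0 -> ginv x * x = 1.
Proof.
move=> ex x0; rewrite -{2}(gsub_id perfect_nonzero ex x0) /ginv.
rewrite -(gsub_mul perfect_nonzero ex x0 hA_invG); last by apply: hA_const => n; exact: hol_id.
rewrite (@gsub_ext _ _ _ (fun=> 1)) ?gsub_cst //; try exact: perfect_nonzero.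
  by move=> z z0; apply: grP => S; rewrite grMconst -gconst1 !gconstE; case: ifP => _; rewrite ?mulr0 ?mulVf.
by apply: hA_mul; [exact: hA_invG|apply: hA_const => n; exact: hol_id].
Qed.

Lemma ginv_even x : geven x -> x fset0 != 0 -> geven (ginv x).
Proof.
move=> ex x0; apply: gsub_even => //; first exact: perfect_nonzero.
by move=> z _; exact: geven_const.
Qed.

Lemma ginv_gd x : geven x -> x fset0 != 0 ->
  gsub nonzero (gd nonzero invG) x = - (ginv x * ginv x).
Proof.
move=> ex x0; have pN := perfect_nonzero.
have hV := hA_mul hA_invG hA_invG.
rewrite /ginv -(gsub_mul pN ex x0 hA_invG hA_invG) -[RHS]scaleN1r -gsub_scale //.
apply: gsub_ext => //; last by apply: hA_gd => //; exact: hA_invG.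
move=> z z0; have := jet_invG 1 z0; rewrite /jet /= => e.
apply: grP => S; have := congr1 (fun u : gr => u S) e; rewrite /gd /= => ->.
rewrite grZE grMconst !gconstE factS fact0 /invG gconstE; case: (S == fset0); last by rewrite !mulr0.
by rewrite mul1n; field; exact: z0.
Qed.

Lemma sinvE X : geven X.1 -> body X != 0 ->
  sinv X = (ginv X.1, - (ginv X.1 * ginv X.1 * X.2)).
Proof.
move=> eX X0; rewrite [LHS]surjective_pairing /sinv taylor1E taylor2E //.
congr pair; first by apply: tay_ext => k; rewrite jet_invG.
rewrite -mulNr -ginv_gd //; congr (_ * _); apply: tay_ext => k.
by rewrite -jetS jet_invG.
Qed.

Lemma ssubstE K (F : C -> sgr) X Y : geven X.1 ->
  ssubst K F X Y =
  (gsub K (fun w => (F w).1) X.1 + gsub K (fun w => (F w).2) X.1 * Y.1,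
   gsub K (gd K (fun w => (F w).1)) X.1 * X.2 +
   gsub K (fun w => (F w).2) X.1 * Y.2 +
   gsub K (gd K (fun w => (F w).2)) X.1 * X.2 * Y.1).
Proof.
move=> eX; rewrite /ssubst saddE smulE !taylor1E !taylor2E // addrA.
by congr (_, _ + _ + _); congr (_ * _); rewrite ?(mulrA); try congr (_ * _);
  apply: tay_ext => k; rewrite jetS.
Qed.

End Superalgebra.

(** * Normalization of supercommutative polynomials *)

Section SuperPolynomials.
Variable R : realType.
Local Notation gr := (gr R).

(** Syntax for proof by reflection: even atoms commute with everything, odd atoms anticommute with
    each other and square to zero. The tactic [sring] is built on it. *)
Inductive sexpr : Type :=
  | SEven of nat | SOdd of nat | SZero | SOne
  | SAdd of sexpr & sexpr | SMul of sexpr & sexpr | SOpp of sexpr.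

Variables (e o : nat -> gr).
Hypotheses (ev_e : forall i, geven (e i)) (od_o : forall i, godd (o i)).

Fixpoint seval (t : sexpr) : gr :=
  match t with
  | SEven i => e i | SOdd i => o i | SZero => 0 | SOne => 1
  | SAdd a b => seval a + seval b | SMul a b => seval a * seval b | SOpp a => - seval a
  end.

(* A monomial: integer coefficient, sorted even variables, strictly sorted odd
   variables. *)
Definition mono : Type := (int * seq nat * seq nat)%type.

Definition evE (s : seq nat) : gr := foldr (fun i x => e i * x) 1 s.
Definition evO (s : seq nat) : gr := foldr (fun i x => o i * x) 1 s.
Definition evm (m : mono) : gr := (evE m.1.2 * evO m.2) *~ m.1.1.
Definition evp (p : seq mono) : gr := foldr (fun m x => evm m + x) 0 p.

Fixpoint insE (i : nat) (s : seq nat) : seq nat :=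
  if s is j :: s' then if (i <= j)%N then i :: s else j :: insE i s' else [:: i].

(** Sorted insertion with sign: each transposition negates the coefficient, and a repeated odd
    variable gives coefficient 0. *)
Fixpoint insO (i : nat) (s : seq nat) : int * seq nat :=
  if s is j :: s' then
    if (i < j)%N then (1, i :: s) else
    if i == j then (0, [::]) else
    let: (k, s'') := insO i s' in (- k, j :: s'')
  else (1, [:: i]).

Definition mulE (s t : seq nat) : seq nat := foldr insE t s.
Definition mulO (s t : seq nat) : int * seq nat :=
  foldr (fun i ks => let: (k, u) := insO i ks.2 in (k * ks.1, u)) (1, t) s.

Definition mulm (m n : mono) : mono :=
  let: (k, s) := mulO m.2 n.2 in (m.1.1 * n.1.1 * k, mulE m.1.2 n.1.2, s).

Fixpoint addm (m : mono) (p : seq mono) : seq mono :=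
  if p is n :: p' then
    if (m.1.2 == n.1.2) && (m.2 == n.2) then (m.1.1 + n.1.1, n.1.2, n.2) :: p'
    else n :: addm m p'
  else [:: m].

Definition addp (p q : seq mono) : seq mono := foldr addm q p.
Definition mulp (p q : seq mono) : seq mono :=
  foldr (fun m r => foldr (fun n r' => addm (mulm m n) r') r q) [::] p.

Fixpoint snorm (t : sexpr) : seq mono :=
  match t with
  | SEven i => [:: (1, [:: i], [::])] | SOdd i => [:: (1, [::], [:: i])]
  | SZero => [::] | SOne => [:: (1, [::], [::])]
  | SAdd a b => addp (snorm a) (snorm b)
  | SMul a b => mulp (snorm a) (snorm b)
  | SOpp a => [seq (- m.1.1, m.1.2, m.2) | m <- snorm a]
  end.

Lemma evE_even s : geven (evE s).
Proof. by elim: s => [|i s ih] /=; [exact: geven1|exact: gevenM]. Qed.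

Lemma evE_ins i s : evE (insE i s) = e i * evE s.
Proof.
elim: s => [|j s ih] //=; case: ifP => // _; rewrite /= ih !mulrA.
by rewrite (geven_comm (e i) (ev_e j)).
Qed.

Lemma evE_mul s t : evE (mulE s t) = evE s * evE t.
Proof. by elim: s => [|i s ih] /=; rewrite ?mul1r // evE_ins ih mulrA. Qed.

Lemma evO_ins i s : evO (insO i s).2 *~ (insO i s).1 = o i * evO s.
Proof.
elim: s => [|j s ih] //=; case: ifP => // _; case: eqP => [->|_] /=.
  by rewrite mulr0z mulrA godd_sqr // mul0r.
case: (insO i s) ih => k u /= ih.
by rewrite mulrA (godd_anticomm (od_o i) (od_o j)) mulNr -mulrA -ih mulrNz mulrzAr.
Qed.

Lemma evO_mul s t : evO (mulO s t).2 *~ (mulO s t).1 = evO s * evO t.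
Proof.
elim: s => [|i s ih] /=; first by rewrite mul1r.
have := evO_ins i (mulO s t).2; case: (insO i _) => k u /= h.
by rewrite -mulrA -ih mulrzAr -h -mulrzA.
Qed.

Lemma evm_mul m n : evm (mulm m n) = evm m * evm n.
Proof.
rewrite /mulm /evm; have := evO_mul m.2 n.2; case: (mulO _ _) => k u /= h.
rewrite evE_mul mulrzAl mulrzAr -[in RHS]mulrA (mulrA (evO _)).
rewrite -(geven_comm (evO m.2) (evE_even n.1.2)) -(mulrA (evE n.1.2)) -h.
by rewrite !mulrzAr -!mulrzA !mulrA; congr (_ *~ _); ring.
Qed.

Lemma evp_addm m p : evp (addm m p) = evm m + evp p.
Proof.
elim: p => [|n p ih] //=; case: ifP => [/andP[/eqP e1 /eqP e2]|_] /=.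
  by rewrite addrA; congr (_ + _); rewrite /evm /= mulrzDr e1 e2.
by rewrite ih addrCA.
Qed.

Lemma evp_add p q : evp (addp p q) = evp p + evp q.
Proof. by elim: p => [|m p ih] /=; rewrite ?add0r // evp_addm ih addrA. Qed.

Lemma evp_mul p q : evp (mulp p q) = evp p * evp q.
Proof.
elim: p => [|m p ih] /=; first by rewrite mul0r.
rewrite mulrDl -ih; move: (mulp p q) => r.
elim: q {ih} => [|n q ihq] /=; first by rewrite mulr0 add0r.
by rewrite evp_addm ihq evm_mul mulrDr addrA.
Qed.

Lemma evp_norm t : evp (snorm t) = seval t.
Proof.
elim: t => [i|i|||a iha b ihb|a iha b ihb|a iha] /=.
- by rewrite addr0 /evm /= !mulr1.
- by rewrite addr0 /evm /= mul1r mulr1.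
- by [].
- by rewrite addr0 /evm /= mulr1.
- by rewrite evp_add iha ihb.
- by rewrite evp_mul iha ihb.
- rewrite -iha; elim: (snorm a) => [|m p ih] /=; first by rewrite oppr0.
  by rewrite ih opprD /evm /= mulrNz.
Qed.

Lemma evp_zero p : all (fun m : mono => m.1.1 == 0) p -> evp p = 0.
Proof.
by elim: p => [|m p ih] //= /andP[/eqP m0 /ih ->]; rewrite addr0 /evm m0 mulr0z.
Qed.

(** Cancelled monomials remain in the list with coefficient 0, hence a test of all coefficients
    rather than of emptiness. *)
Lemma snormP (a b : sexpr) :
  all (fun m : mono => m.1.1 == 0) (snorm (SAdd a (SOpp b))) -> seval a = seval b.
Proof.
move=> /evp_zero; rewrite evp_norm /= => /eqP; by rewrite subr_eq0 => /eqP.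
Qed.

End SuperPolynomials.

Lemma snorm_seqP (R : realType) (es os : seq (gr R)) (a b : sexpr) :
  foldr (fun x P => geven x /\ P) True es -> foldr (fun x P => godd x /\ P) True os ->
  all (fun m : mono => m.1.1 == 0) (snorm (SAdd a (SOpp b))) ->
  seval (nth 0 es) (nth 0 os) a = seval (nth 0 es) (nth 0 os) b.
Proof.
move=> he ho; apply: snormP => i.
  by elim: es i he => [|x es ih] [|i] //= [hx /ih].
by elim: os i ho => [|x os ih] [|i] //= [hx /ih].
Qed.

Ltac find_index x l k :=
  lazymatch l with
  | x :: _ => k
  | _ :: ?l' => find_index x l' (S k)
  end.

Ltac sreify es os t :=
  lazymatch t with
  | (?a + ?b)%R => let u := sreify es os a in let v := sreify es os b in constr:(SAdd u v)
  | (?a * ?b)%R => let u := sreify es os a in let v := sreify es os b in constr:(SMul u v)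
  | (- ?a)%R => let u := sreify es os a in constr:(SOpp u)
  | 0%R => constr:(SZero)
  | 1%R => constr:(SOne)
  | _ => match constr:(Set) with
         | _ => let i := find_index t es O in constr:(SEven i)
         | _ => let i := find_index t os O in constr:(SOdd i)
         | _ => fail 100 "unknown atom" t
         end
  end.

(** [es] and [os] list the even and the odd atoms, whose parities are taken from the context.
    Relations between atoms are unknown to the tactic, so its callers first regroup a goal around
    the product to be replaced. *)
Ltac sring es os :=
  lazymatch goal with
  | |- @eq _ ?a ?b =>
    let u := sreify es os a in let v := sreify es os b in
    change (seval (nth 0 es) (nth 0 os) u = seval (nth 0 es) (nth 0 os) v);
    apply: snorm_seqP; [by do ?split | by do ?split | vm_compute; reflexivity]
  end.

(** * Logarithms in the Grassmann algebra *)

Section GrLogarithm.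
Variable R : realType.
Local Notation C := R[i].
Local Notation gr := (gr R).
Local Notation sgr := (sgr R).
Implicit Types (K L : set C) (x y : gr) (z : C).

(** Pigeonhole: a monomial in n generators has degree at most n. *)
Lemma gfin_fil n x : gfin n x -> fil n.+1 x -> x = 0.
Proof.
move=> fx hx; apply: grP => S; have [h|h] := ltnP #|` S| n.+1; first exact: hx.
have [j jS nj] : exists2 j, j \in S & (n <= j)%N.
  apply: contrapT => nex; have sub : {subset enum_fset S <= iota 0 n}.
    move=> j jS; rewrite mem_iota add0n /=; rewrite ltnNge; apply/negP => nj.
    by apply: nex; exists j.
  have := uniq_leq_size (fset_uniq S) sub; rewrite size_iota => h'.
  by have := leq_trans h h'; rewrite ltnn.
exact: fx jS nj.
Qed.

(** The terms after the linear one have order at least 2d, which is at least d + 1 for positive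
    d. *)
Lemma gexp_fil d y : (0 < d)%N -> fil d y -> fil d.+1 (gexp y - (1 + y)).
Proof.
move=> d0 hy; have y0 : y fset0 = 0 by apply: hy; rewrite cardfs0.
have fy : fil 1 y by exact: filW hy.
rewrite /gexp y0 gconst0 subr0 cexp0.
have -> : (fun _ : nat => gconst 1) = (fun _ => 1 : gr) by [].
have -> : tay (fun=> 1) y - (1 + y) = (tay (fun=> 1) y - tayn d.+3 (fun=> 1) y) +
    (tayn d.+3 (fun=> 1) y - (1 + y)) by rewrite addrA subrK.
apply: filD; first by apply: filW (@tayn_tay _ d.+3 (fun=> 1) y fy); rewrite ltnW.
rewrite /tayn 2!big_ord_recl /= /bump /= !expr0 expr1 !mul1r invr1 !scale1r.
rewrite opprD addrACA subrr add0r addrAC subrr add0r.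
apply: fil_sum => k _; apply: filZ; rewrite mul1r.
have := @filX _ d y (1 + (1 + k)) hy; apply: filW.
by rewrite !add1n !mulnS; move: d0; clear; move: (d * k)%N; lia.
Qed.

Lemma gexp_const (c : C) : gexp (gconst c) = gconst (cexp c) :> gr.
Proof. by rewrite gexpE gsub_const. Qed.

Lemma hA_gexp K F : perfect K -> (forall z, K z -> geven (F z)) -> hA K F ->
  hA K (fun z => gexp (F z)).
Proof.
move=> pK eF hF; apply: (@hA_ext _ _ (fun z => gsub setT (@cexpG R) (F z))).
  by move=> z _; rewrite gexpE.
by apply: hA_gsub => //; [exact: perfect_setT|exact: hA_cexpG].
Qed.

Lemma gexp_gfin n x : gfin n x -> gfin n (gexp x).
Proof.
move=> fx; rewrite gexpE.
apply: (@gsub_gfin _ setT setT (@perfect_setT R) (fun=> x) _ (@cexpG R) n 0) => // w _.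
exact: gfin_const.
Qed.

(* Newton iteration for exp E = X: each step gains one degree in the generators,
   and finitely many generators make it stop. *)
Lemma glog_exists K (X : C -> gr) (l : C -> C) : perfect K -> hA K X ->
  (forall z, K z -> geven (X z)) -> (forall n, hol n K l) ->
  (forall z, K z -> cexp (l z) = X z fset0) ->
  exists E : C -> gr, [/\ hA K E, forall z, K z -> geven (E z) &
    forall z, K z -> E z fset0 = l z /\ gexp (E z) = X z].
Proof.
move=> pK hX eX hl bX; have [[n hn] _] := hX.
suff : forall k, exists E : C -> gr, [/\ hA K E, forall z, K z -> geven (E z),
    forall z, K z -> gfin n (E z), forall z, K z -> E z fset0 = l z &
    forall z, K z -> fil k.+1 (X z * gexp (- E z) - 1)].
  move=> /(_ n)[E [hE eE fE bE hf]]; exists E; split => // z Kz; split; first exact: bE.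
  have e1 : X z * gexp (- E z) = 1.
    apply/eqP; rewrite -subr_eq0; apply/eqP; apply: (@gfin_fil n); last exact: hf.
    apply: gfinD; last by apply: gfinN; exact: gfin_const.
    by apply: gfinM; [exact: hn|apply: gexp_gfin; apply: gfinN; exact: fE].
  by rewrite -[LHS]mul1r -e1 -mulrA (gexpN (eE z Kz) (fE z Kz)) mulr1.
elim=> [|k [E [hE eE fE bE hf]]].
  exists (fun z => gconst (l z)); split.
  - exact: hA_const.
  - by move=> z _; exact: geven_const.
  - by move=> z _; exact: gfin_const.
  - by move=> z _; rewrite gconstE eqxx.
  - move=> z Kz; apply: fil1; rewrite grBE grM0 gexp_body grNE gconstE eqxx gr1_0.
    by rewrite cexpN bX // divff ?subrr // -bX // cexp_neq0.
pose N z := X z * gexp (- E z) - 1.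
have eN z : K z -> geven (N z).
  move=> Kz; apply: gevenB; last exact: geven1.
  by apply: gevenM; [exact: eX|apply: gexp_even; apply: gevenN; exact: eE].
have fN z : K z -> gfin n (N z).
  move=> Kz; apply: gfinD; last by apply: gfinN; exact: gfin_const.
  by apply: gfinM; [exact: hn|apply: gexp_gfin; apply: gfinN; exact: fE].
exists (fun z => E z + N z); split.
- apply: hA_add => //; apply: hA_sub; last by apply: (@hA_cst _ _ n); exact: gfin_const.
  apply: hA_mul => //; apply: hA_gexp => //; last exact: hA_opp.
  by move=> z Kz; apply: gevenN; exact: eE.
- by move=> z Kz; apply: gevenD; [exact: eE|exact: eN].
- by move=> z Kz; apply: gfinD; [exact: fE|exact: fN].
- move=> z Kz; rewrite grDE bE //; have := hf z Kz; rewrite -/(N z) => ->.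
    by rewrite addr0.
  by rewrite cardfs0.
- move=> z Kz; rewrite opprD (@gexpD _ n) //; try apply: gevenN; try apply: gfinN;
    [|exact: eE|exact: eN|exact: fN].
  (* With X exp(-E) = 1 + N, the new error splits into two terms of order higher than that of N: the
     error of the linear approximation of exp(-N), and N squared. *)
  have -> : X z * (gexp (- E z) * gexp (- N z)) - 1 =
     (1 + N z) * (gexp (- N z) - (1 + - N z)) - N z * N z.
    rewrite mulrA [X z * _](_ : _ = 1 + N z); last by rewrite /N addrC subrK.
    rewrite [RHS](_ : _ = (1 + N z) * gexp (- N z) - (1 + N z) * (1 - N z) - N z * N z).
      rewrite -addrA -opprD; congr (_ - _).
      by have eNz := eN z Kz; move: (N z) eNz => a ea; sring (a :: nil) (@nil gr).
    by rewrite mulrBr.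
  apply: filB; first by apply: filMr; apply: gexp_fil => //; apply: filN; exact: hf.
  have := filM (hf z Kz) (hf z Kz); apply: filW; lia.
Qed.

Lemma gexp_Dconst x (c : C) : geven x -> gexp (x + gconst c) = gconst (cexp c) * gexp x.
Proof.
move=> ex; rewrite (@gexpD _ 0) //; [|exact: geven_const|exact: gfin_const].
by rewrite gexp_const; apply: geven_comm; exact: gexp_even.
Qed.

Lemma sexp_inj (X Y : sgr) : geven Y.1 -> sexp X = sexp Y ->
  exists k : int, X = (Y.1 + gconst ('i * (2 * pi * k%:~R)%:C), Y.2).
Proof.
move=> eY eXY; have e1 := congr1 fst eXY; rewrite !sexp1E in e1.
have e0 := congr1 (fun u : gr => u fset0) e1; rewrite !gexp_body in e0.
have [k hk] : exists k : int, X.1 fset0 - Y.1 fset0 = 'i * (2 * pi * k%:~R)%:C.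
  by apply: cexp_eq1; rewrite cexpD cexpN e0 divff // cexp_neq0.
have ck : cexp ('i * (2 * pi * k%:~R)%:C) = 1 :> C.
  by rewrite -hk cexpD cexpN e0 divff // cexp_neq0.
exists k; have eX : X.1 = Y.1 + gconst ('i * (2 * pi * k%:~R)%:C).
  apply: gexp_inj; first by rewrite grDE gconstE eqxx -hk addrC subrK.
  by rewrite gexp_Dconst // ck gconst1 mul1r.
have eX1 : geven X.1 by rewrite eX; apply: gevenD => //; exact: geven_const.
have := congr1 snd eXY; rewrite !sexpE //= e1 => e2.
have e3 : X.2 = Y.2.
  have g0 : gexp Y.1 fset0 != 0 by rewrite gexp_body cexp_neq0.
  have := congr1 (fun u => ginv (gexp Y.1) * u) e2.
  by rewrite !mulrA ginvM ?mul1r //; exact: gexp_even.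
by rewrite [LHS]surjective_pairing eX e3.
Qed.

End GrLogarithm.

(** * Contact maps *)

Section ContactAlgebra.
Variable R : realType.
Local Notation C := R[i].
Local Notation gr := (gr R).
Local Notation sgr := (sgr R).
Local Notation Rline := (@Rline R).
Implicit Types (K L M : set C) (f g : C -> gr) (x y : gr) (z : C).
Local Notation eps := (gconst 'i : gr).

Lemma gconstZ (c : C) x : c *: x = gconst c * x.
Proof. by rewrite gconstA mulr_algl. Qed.

Lemma gconstM (c d : C) : gconst (c * d) = gconst c * gconst d :> gr.
Proof. by apply: grP => S; rewrite grMconst !gconstE; case: ifP; rewrite ?mulr0. Qed.

Lemma gconstN (c : C) : gconst (- c) = - gconst c :> gr.
Proof. by apply: grP => S; rewrite grNE !gconstE; case: ifP; rewrite ?oppr0. Qed.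

Section Shift.
Variables (K : set C) (pK : perfect K) (x d : gr).
Hypotheses (ex : geven x) (ed : geven d) (dd : d * d = 0) (Kx : K (x fset0)).

Lemma shift_body : d fset0 = 0.
Proof.
have := congr1 (fun u : gr => u fset0) dd; rewrite grM0 gr0E => /eqP.
by rewrite mulf_eq0 orbb => /eqP.
Qed.

Lemma shift_curve f z : hA K f -> Rline z ->
  ghd Rline (fun t => gsub K f (x + t *: d)) z (gsub K (gd K f) (x + z *: d) * d).
Proof.
move=> hf Rz; apply: (@gsub_ghd _ Rline K pK (fun t => x + t *: d)) => //.
- by move=> w _; apply: gevenD => //; exact: gevenZ.
- by move=> w _; rewrite grDE grZE shift_body mulr0 addr0.
rewrite -[X in ghd _ _ _ X]add0r; apply: ghd_add; first exact: ghd_cst.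
move=> S; have := hd_mul Rz (@hd_id _ Rline z) (hd_cst Rline (d S) z).
by rewrite mul1r mulr0 addr0.
Qed.

(** A Taylor formula exact at first order. Along t |-> x + t d the derivative is f'(x + t d) d, and
    a further derivative would carry d squared, so this product is constant in t. *)
Lemma gsub_shift f : hA K f -> gsub K f (x + d) = gsub K f x + gsub K (gd K f) x * d.
Proof.
move=> hf.
have hc g (t : R) : hA K g -> gsub K g (x + t%:C *: d) * d = gsub K g x * d.
  move=> hg; apply: grP => S.
  have := @hd0_const _ (fun w => (gsub K g (x + w *: d) * d) S) t.
  rewrite scale0r addr0; apply => z Rz.
  have := ghd_mul Rz (shift_curve hg Rz) (ghd_cst Rline d z) S.
  by rewrite mulr0 addr0 -mulrA dd mulr0.
apply: grP => S; apply/eqP; rewrite grDE -subr_eq; apply/eqP.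
have := @hd0_const _ (fun w => (gsub K f (x + w *: d) - w *: (gsub K (gd K f) x * d)) S) 1.
rewrite !scale0r subr0 addr0 !scale1r; apply => z Rz.
have h := shift_curve hf Rz; rewrite (RlineE Rz) hc in h; last exact: hA_gd.
rewrite -(RlineE Rz) in h.
have h2 : ghd Rline (fun w => w *: (gsub K (gd K f) x * d)) z (gsub K (gd K f) x * d).
  move=> T; have := hd_mul Rz (@hd_id _ Rline z) (hd_cst Rline ((gsub K (gd K f) x * d) T) z).
  by rewrite mul1r mulr0 addr0.
by have := ghd_add h (ghd_opp h2) S; rewrite subrr.
Qed.

End Shift.

Definition mQ (m : smap R C) z := (ev m z).1.
Definition mq (m : smap R C) z := (ev m z).2.
Definition mr (m : smap R C) z := (od m z).1.
Definition mP (m : smap R C) z := (od m z).2.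

(* z = Q + q theta, theta -> r + P theta pulls dz/(iz) + theta d theta back to a
   multiple of (i c)^-1 dx + theta d theta. *)
Definition scm K (c : C -> C) (m : smap R C) : Prop :=
  [/\ (hA K (mQ m) /\ hA K (mq m)) /\ (hA K (mr m) /\ hA K (mP m)),
      smap_parity K m,
      forall z, K z -> mq m z = - (eps * mQ m z * mP m z * mr m z) &
      forall z, K z -> gconst (c z) * gd K (mQ m) z =
        mQ m z * (mP m z * mP m z - eps * gconst (c z) * (mr m z * gd K (mr m) z))].

(** Comparison of coefficients. The part of the d theta equation without theta gives q; inserted
    into its theta part, this shows that the multiplier has even component P^2. The dx equation
    without theta then gives Q'. Multiplication by iQ clears the inverse. *)
Lemma contact_relations (a : C) (Q Q' T T' : sgr) :
  geven Q.1 -> godd Q.2 -> godd T.1 -> geven T.2 -> body Q != 0 -> a != 0 ->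
  contact a Q Q' T T' ->
  Q.2 = - (eps * Q.1 * T.2 * T.1) /\
  gconst ('i * a)^-1 * Q'.1 =
    Q.1 * (T.2 * T.2 - eps * gconst ('i * a)^-1 * (T.1 * T'.1)).
Proof.
move=> eQ oq oT eT bQ a0 [Lm []].
have i0 : 'i != 0 :> C by rewrite -normr_gt0 normCi ltr01.
have eiQ : geven (sscale 'i Q).1 by apply: gevenZ.
have biQ : body (sscale 'i Q) != 0 by rewrite /body /= /gscale mulf_neq0.
rewrite !sinvE //; set g := ginv _.
have eg : geven g by exact: ginv_even.
have gQ : g * (eps * Q.1) = 1 by rewrite -gconstZ; exact: ginvM.
rewrite !smulE !saddE sconstE thetaE !dthetaE /= !mulr0 !mul0r !addr0 !add0r.
move=> [h1 _] [h2 h3].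
have eL : geven eps := @geven_const R 'i.
have {}h2 : Q.2 = - (eps * Q.1 * T.2 * T.1).
  have : Q.2 * g * (eps * Q.1) = - (T.1 * T.2) * (eps * Q.1).
    by congr (_ * _); apply/eqP; rewrite -addr_eq0 h2.
  rewrite -mulrA gQ mulr1 => ->.
  by sring (eps :: Q.1 :: T.2 :: nil) (T.1 :: nil).
split => //.
have h4 : T.2 * T.2 = Lm.1.
  rewrite mulr1 in h3; rewrite -h3 h2 gscaleE gconstZ.
  by sring (eps :: Q.1 :: T.2 :: g :: nil) (T.1 :: nil).
have h5 : Q'.1 = eps * Q.1 * (gconst a * T.2 * T.2 - T.1 * T'.1).
  have e1 : Q'.1 * g = gconst a * T.2 * T.2 - T.1 * T'.1.
    rewrite -mulrA h4; apply/eqP; rewrite eq_sym subr_eq h1; apply/eqP.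
    by apply: geven_comm; exact: geven_const.
  rewrite -e1 (geven_comm _ (gevenM eL eQ)) -mulrA gQ mulr1 //.
have ia : gconst ('i * a)^-1 * eps * gconst a = 1 :> gr.
  by rewrite -!gconstM -mulrA mulVf ?gconst1 // mulf_neq0.
set k := gconst _ in ia *; have ek : geven k := @geven_const R _.
rewrite h5; have -> : k * (eps * Q.1 * (gconst a * T.2 * T.2 - T.1 * T'.1)) =
   Q.1 * ((k * eps * gconst a) * (T.2 * T.2) - eps * k * (T.1 * T'.1)).
  have ea : geven (gconst a : gr) := @geven_const R a.
  rewrite !mulrBr !mulrA; congr (_ - _).
    by sring (eps :: k :: gconst a :: Q.1 :: T.2 :: nil) (@nil gr).
  congr (_ * _ * _).
  by sring (eps :: k :: Q.1 :: nil) (@nil gr).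
by rewrite ia mul1r.
Qed.

End ContactAlgebra.

(** * Composition of contact maps *)

Section Composition.
Variable R : realType.
Local Notation C := R[i].
Local Notation gr := (gr R).
Local Notation sgr := (sgr R).
Local Notation Rline := (@Rline R).
Local Notation eps := (gconst 'i : gr).
Implicit Types (K L M : set C) (f g : C -> gr) (x y : gr) (z : C) (F : C -> sgr).

Definition shA K F : Prop := hA K (fun z => (F z).1) /\ hA K (fun z => (F z).2).

Lemma eps_even : geven eps. Proof. exact: geven_const. Qed.

Section One.
Variables (K L : set C) (pK : perfect K) (pL : perfect L) (c : C -> C) (m : smap R C).
Hypotheses (hm : scm K c m) (bm : forall z, K z -> L (body (ev m z))).

Lemma scm_even z : K z -> [/\ geven (mQ m z), godd (mq m z), godd (mr m z) & geven (mP m z)].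
Proof. by move=> Kz; have [_ pm _ _] := hm; exact: pm. Qed.

(** q is a multiple of r, and odd elements square to 0. This removes the third summand of the theta
    component in [ssubstE], the one that obstructs multiplicativity. *)
Lemma scm_qr z : K z -> mq m z * mr m z = 0.
Proof.
move=> Kz; have [eQ oq or eP] := scm_even Kz; have [_ _ -> // _] := hm.
have ee := eps_even.
by sring (eps :: mQ m z :: mP m z :: nil) (mr m z :: nil).
Qed.

Lemma ssubst_scm F z : K z -> ssubst L F (ev m z) (od m z) =
  (gsub L (fun w => (F w).1) (mQ m z) + gsub L (fun w => (F w).2) (mQ m z) * mr m z,
   gsub L (gd L (fun w => (F w).1)) (mQ m z) * mq m z +
   gsub L (fun w => (F w).2) (mQ m z) * mP m z).
Proof.
move=> Kz; have [eQ _ _ _] := scm_even Kz; rewrite ssubstE //.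
have e : (ev m z).2 * (od m z).1 = 0 := scm_qr Kz.
by rewrite -(mulrA (gsub L (gd L (fun w => (F w).2)) _) (ev m z).2) e mulr0 addr0.
Qed.

Let hQ : hA K (mQ m). Proof. by have [[[h _] _] _ _ _] := hm. Qed.
Let hq : hA K (mq m). Proof. by have [[[_ h] _] _ _ _] := hm. Qed.
Let hr : hA K (mr m). Proof. by have [[_ [h _]] _ _ _] := hm. Qed.
Let hP : hA K (mP m). Proof. by have [[_ [_ h]] _ _ _] := hm. Qed.
Let eQ z : K z -> geven (mQ m z). Proof. by case/scm_even. Qed.

Lemma hA_gsub_scm f : hA L f -> hA K (fun z => gsub L f (mQ m z)).
Proof. by move=> hf; apply: hA_gsub. Qed.

Lemma shA_ssubst F : shA L F -> shA K (fun z => ssubst L F (ev m z) (od m z)).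
Proof.
move=> [h1 h2]; split.
  apply: (@hA_ext _ _ (fun z => gsub L (fun w => (F w).1) (mQ m z) +
      gsub L (fun w => (F w).2) (mQ m z) * mr m z)).
    by move=> z Kz; rewrite ssubst_scm.
  by apply: hA_add; [|apply: hA_mul => //]; exact: hA_gsub_scm.
apply: (@hA_ext _ _ (fun z => gsub L (gd L (fun w => (F w).1)) (mQ m z) * mq m z +
   gsub L (fun w => (F w).2) (mQ m z) * mP m z)).
  by move=> z Kz; rewrite ssubst_scm.
by apply: hA_add; apply: hA_mul => //; apply: hA_gsub_scm => //; exact: hA_gd.
Qed.

Lemma gd_ssubst1 F z : shA L F -> K z ->
  gd K (fun z => (ssubst L F (ev m z) (od m z)).1) z =
  gsub L (gd L (fun w => (F w).1)) (mQ m z) * gd K (mQ m) z +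
  (gsub L (gd L (fun w => (F w).2)) (mQ m z) * gd K (mQ m) z * mr m z +
   gsub L (fun w => (F w).2) (mQ m z) * gd K (mr m) z).
Proof.
move=> [h1 h2] Kz; have h1' := hA_gsub_scm h1; have h2' := hA_gsub_scm h2.
rewrite (@gd_ext _ _ _ (fun z => gsub L (fun w => (F w).1) (mQ m z) +
      gsub L (fun w => (F w).2) (mQ m z) * mr m z)) //; last first.
- by case: (shA_ssubst (conj h1 h2)).
- by move=> w Kw; rewrite ssubst_scm.
by rewrite gd_add ?gd_mul ?gd_gsub //; exact: hA_mul.
Qed.

Section Two.
Variables (n : smap R C).
Hypothesis hn : scm L id n.

Let hQ2 : hA L (mQ n). Proof. by have [[[h _] _] _ _ _] := hn. Qed.
Let hq2 : hA L (mq n). Proof. by have [[[_ h] _] _ _ _] := hn. Qed.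
Let hr2 : hA L (mr n). Proof. by have [[_ [h _]] _ _ _] := hn. Qed.
Let hP2 : hA L (mP n). Proof. by have [[_ [_ h]] _ _ _] := hn. Qed.

Section Point.
Variables (z : C) (Kz : K z).
Let x := mQ m z.
Let ex : geven x. Proof. exact: eQ. Qed.
Let Lx : L (x fset0). Proof. exact: bm. Qed.

Lemma gsub_neven f : (forall w, L w -> geven (f w)) -> geven (gsub L f x).
Proof. by move=> h; exact: gsub_even. Qed.
Lemma gsub_nodd f : (forall w, L w -> godd (f w)) -> godd (gsub L f x).
Proof. by move=> h; exact: gsub_odd. Qed.

Lemma scm_nparity w : L w -> [/\ geven (mQ n w), godd (mq n w), godd (mr n w) & geven (mP n w)].
Proof. by move=> Lw; have [_ pn _ _] := hn; exact: pn. Qed.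

Let gM f g : hA L f -> hA L g ->
  gsub L (fun w => f w * g w) x = gsub L f x * gsub L g x.
Proof. by move=> hf hg; exact: gsub_mul. Qed.
Let gD f g : hA L f -> hA L g ->
  gsub L (fun w => f w + g w) x = gsub L f x + gsub L g x.
Proof. by move=> hf hg; exact: gsub_add. Qed.
Let gN f : hA L f -> gsub L (fun w => - f w) x = - gsub L f x.
Proof.
move=> hf; rewrite -[RHS]scaleN1r -gsub_scale //; congr (gsub L _ x).
by apply/funext => w; rewrite scaleN1r.
Qed.
Let gE : gsub L (fun=> eps) x = eps. Proof. exact: gsub_cst. Qed.
Let gI : gsub L (@gconst R) x = x. Proof. exact: gsub_id. Qed.
Let hE : hA L (fun=> eps). Proof. by apply: (@hA_cst _ _ 0); exact: gfin_const. Qed.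
Let hI : hA L (@gconst R). Proof. by apply: hA_const => k; exact: hol_id. Qed.

Lemma gsub_q2 : gsub L (mq n) x = - (eps * gsub L (mQ n) x * gsub L (mP n) x * gsub L (mr n) x).
Proof.
have h1 := hA_mul hE hQ2; have h2 := hA_mul h1 hP2; have h3 := hA_mul h2 hr2.
have [_ _ hq' _] := hn; have := gsub_ext pL hq' hq2 Lx.
by rewrite gN // !gM // gE.
Qed.

Lemma gsub_Q2' : x * gsub L (gd L (mQ n)) x = gsub L (mQ n) x *
   (gsub L (mP n) x * gsub L (mP n) x - eps * x * (gsub L (mr n) x * gsub L (gd L (mr n)) x)).
Proof.
have hr' := hA_gd pL hr2; have hQ' := hA_gd pL hQ2.
have h1 := hA_mul hP2 hP2; have h2 := hA_mul hE hI; have h3 := hA_mul hr2 hr'.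
have h4 := hA_mul h2 h3; have h5 := hA_opp h4; have h6 := hA_add h1 h5.
have [_ _ _ hc'] := hn; have := gsub_ext pL hc' (hA_mul hI hQ') Lx.
by rewrite !gM // gD // gN // !gM // gE gI.
Qed.

Lemma gsub_q2' : gsub L (gd L (mq n)) x = - (eps *
   (gsub L (gd L (mQ n)) x * gsub L (mP n) x * gsub L (mr n) x +
    gsub L (mQ n) x * gsub L (gd L (mP n)) x * gsub L (mr n) x +
    gsub L (mQ n) x * gsub L (mP n) x * gsub L (gd L (mr n)) x)).
Proof.
have hr' := hA_gd pL hr2; have hQ' := hA_gd pL hQ2; have hP' := hA_gd pL hP2.
have a1 := hA_mul hQ' hP2; have a2 := hA_mul hQ2 hP'; have hQP := hA_mul hQ2 hP2.
have h1 := hA_mul a1 hr2; have h2 := hA_mul a2 hr2.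
have h3 := hA_mul hQP hr'; have h12 := hA_add h1 h2; have h := hA_add h12 h3.
have hQPr := hA_mul hQP hr2.
have e w : L w -> gd L (mq n) w = - (eps * (gd L (mQ n) w * mP n w * mr n w +
    mQ n w * gd L (mP n) w * mr n w + mQ n w * mP n w * gd L (mr n) w)).
  move=> Lw; rewrite (@gd_ext _ _ _ (fun w => - (eps * (mQ n w * mP n w * mr n w)))) //.
    rewrite gd_opp //; last exact: hA_mul.
    rewrite gd_mul //; rewrite (@ghd_gd _ _ (fun=> eps) w 0) //; last exact: ghd_cst.
    by rewrite mul0r add0r !gd_mul // mulrDl.
  by move=> v Lv; have [_ _ -> // _] := hn; rewrite !mulrA.
have := gsub_ext pL e (hA_gd pL hq2) Lx.
rewrite gN //; last exact: hA_mul.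
by rewrite gM // gE !gD // !gM.
Qed.

End Point.

Lemma scm_comp : scm K c (scomp L n m).
Proof.
have hev : shA L (ev n) by [].
have hod : shA L (od n) by [].
have vals z : K z -> [/\ mQ (scomp L n m) z = gsub L (mQ n) (mQ m z) + gsub L (mq n) (mQ m z) * mr m z,
   mq (scomp L n m) z = gsub L (gd L (mQ n)) (mQ m z) * mq m z + gsub L (mq n) (mQ m z) * mP m z,
   mr (scomp L n m) z = gsub L (mr n) (mQ m z) + gsub L (mP n) (mQ m z) * mr m z &
   mP (scomp L n m) z = gsub L (gd L (mr n)) (mQ m z) * mq m z + gsub L (mP n) (mQ m z) * mP m z].
  move=> Kz; split; [exact: (congr1 fst (ssubst_scm (ev n) Kz))|
    exact: (congr1 snd (ssubst_scm (ev n) Kz))|exact: (congr1 fst (ssubst_scm (od n) Kz))|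
    exact: (congr1 snd (ssubst_scm (od n) Kz))].
have par z : K z -> [/\ geven (gsub L (mQ n) (mQ m z)), godd (gsub L (mq n) (mQ m z)),
    godd (gsub L (mr n) (mQ m z)) & geven (gsub L (mP n) (mQ m z))].
  by move=> Kz; split; [apply: gsub_neven|apply: gsub_nodd|apply: gsub_nodd|apply: gsub_neven] => // w /scm_nparity[].
have par' z : K z -> [/\ geven (gsub L (gd L (mQ n)) (mQ m z)),
    godd (gsub L (gd L (mr n)) (mQ m z)) & geven (gsub L (gd L (mP n)) (mQ m z))].
  move=> Kz; split; [apply: gsub_neven|apply: gsub_nodd|apply: gsub_neven] => //;
    [apply: gd_even|apply: gd_odd|apply: gd_even] => // w /scm_nparity[] //.
have ee := eps_even.
split.
- split; split.
  + exact: (shA_ssubst hev).1.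
  + exact: (shA_ssubst hev).2.
  + exact: (shA_ssubst hod).1.
  + exact: (shA_ssubst hod).2.
- move=> z Kz; have [eA oq2 orho eB] := par z Kz; have [eA' orho' eB'] := par' z Kz.
  have [e1 o1 o2 e2] := scm_even Kz.
  have [] := vals z Kz; rewrite /mQ /mq /mr /mP => -> -> -> ->; split.
  + by apply: gevenD => //; exact: goddM.
  + by apply: goddD; [exact: goddMr|exact: goddMl].
  + by apply: goddD => //; exact: goddMr.
  + by apply: gevenD; [exact: goddM|exact: gevenM].
- move=> z Kz; have [eA oq2 orho eB] := par z Kz; have [eA' orho' eB'] := par' z Kz.
  have [e1 o1 o2 e2] := scm_even Kz.
  have [-> -> -> ->] := vals z Kz; rewrite gsub_q2 //; have [_ _ -> // _] := hm.
  have h' := gsub_Q2' Kz.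
  move: (gsub L (mQ n) (mQ m z)) (gsub L (mr n) (mQ m z)) (gsub L (mP n) (mQ m z))
    (gsub L (gd L (mQ n)) (mQ m z)) (gsub L (gd L (mr n)) (mQ m z)) eA orho eB eA' orho' h'
    => A rho B A' rho' eA orho eB eA' orho' h'.
  set x := mQ m z in e1 h' *; set r := mr m z in o2 *; set p := mP m z in e2 *.
  (* Grouped so that x A' can be replaced by the contact relation of the outer map. *)
  transitivity (- (eps * p * ((x * A') * r)) - eps * A * B * rho * p).
    by sring (eps :: x :: A :: A' :: B :: p :: nil) (rho :: rho' :: r :: nil).
  rewrite h'.
  by sring (eps :: x :: A :: A' :: B :: p :: nil) (rho :: rho' :: r :: nil).
move=> z Kz; have [eA oq2 orho eB] := par z Kz; have [eA' orho' eB'] := par' z Kz.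
have [e1 o1 o2 e2] := scm_even Kz.
have o3 : godd (gd K (mr m) z) by apply: gd_odd => // w /scm_even[].
have [-> _ -> ->] := vals z Kz.
have -> : gd K (mQ (scomp L n m)) z = _ := gd_ssubst1 hev Kz.
have -> : gd K (mr (scomp L n m)) z = _ := gd_ssubst1 hod Kz.
have h' := gsub_Q2' Kz; have [_ _ hq1 hc1] := hm; rewrite hq1 //.
have {hc1} := hc1 z Kz.
rewrite -/(mQ n) -/(mq n) -/(mr n) -/(mP n) (gsub_q2 Kz) (gsub_q2' Kz).
move: (gsub L (mQ n) (mQ m z)) (gsub L (mr n) (mQ m z)) (gsub L (mP n) (mQ m z))
    (gsub L (gd L (mQ n)) (mQ m z)) (gsub L (gd L (mr n)) (mQ m z))
    (gsub L (gd L (mP n)) (mQ m z)) eA orho eB eA' orho' eB' h'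
    => A rho B A' rho' B' eA orho eB eA' orho' eB' h'.
have ec : geven (gconst (c z) : gr) by exact: geven_const.
have eX : geven (gd K (mQ m) z) by apply: gd_even => // w /scm_even[].
move: (gconst (c z)) (gd K (mQ m) z) (gd K (mr m) z) (mQ m z) (mr m z) (mP m z)
  ec eX o3 e1 o2 e2 h' => k X r' x r p ec eX or' e1 or e2 h' hX.
pose q2 := - (eps * A * B * rho).
pose q2' := - (eps * (A' * B * rho + A * B' * rho + A * B * rho')).
pose s := p * p - eps * k * (r * r').
(* Both sides are grouped around k X, the left side of the contact relation of the inner map. After
   its replacement, x A' is exposed for the relation of the outer map; what remains is a polynomial
   identity. *)
transitivity ((k * X) * (A' + q2' * r) + k * q2 * r').
  by rewrite /q2 /q2';
     sring (eps :: k :: X :: x :: p :: A :: A' :: B :: B' :: nil) (r :: r' :: rho :: rho' :: nil).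
pose r21 := rho + B * r.
pose p21 := rho' * - (eps * x * p * r) + B * p.
transitivity ((A + q2 * r) * (p21 * p21 -
    eps * (r21 * (rho' * (k * X) + (B' * (k * X) * r + k * B * r'))))); last first.
  by rewrite /q2 /p21 /r21;
     sring (eps :: k :: X :: x :: p :: A :: A' :: B :: B' :: nil) (r :: r' :: rho :: rho' :: nil).
rewrite hX -/s.
transitivity (s * (x * A') - eps * s * ((x * A') * B * rho * r + A * x * B' * rho * r
    + x * A * B * rho' * r) + k * q2 * r').
  by rewrite /q2 /q2' /s;
     sring (eps :: k :: x :: p :: A :: A' :: B :: B' :: nil) (r :: r' :: rho :: rho' :: nil).
rewrite h' /q2 /p21 /r21 /s.
by sring (eps :: k :: x :: p :: A :: B :: B' :: nil) (r :: r' :: rho :: rho' :: nil).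
Qed.
End Two.
End One.
End Composition.

(** * Substitution along a contact map as an algebra morphism *)

Section Pullback.
Variable R : realType.
Local Notation C := R[i].
Local Notation gr := (gr R).
Local Notation sgr := (sgr R).
Local Notation Rline := (@Rline R).
Local Notation eps := (gconst 'i : gr).
Implicit Types (f g : C -> gr) (x y : gr) (z : C) (F G : C -> sgr).

Variables (K L : set C) (pK : perfect K) (pL : perfect L) (c : C -> C) (m : smap R C).
Hypotheses (hm : scm K c m) (bm : forall z, K z -> L (body (ev m z))).

Definition even_on (D : set C) F : Prop := forall z, D z -> geven (F z).1 /\ godd (F z).2.

Let ee : geven eps := @eps_even R.

Lemma ssubst_ext F G z : K z -> shA L F -> (forall w, L w -> F w = G w) ->
  ssubst L F (ev m z) (od m z) = ssubst L G (ev m z) (od m z).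
Proof.
move=> Kz [h1 h2] FG; rewrite !(ssubst_scm L hm) //; have Lz := bm Kz.
have e1 : forall w, L w -> (F w).1 = (G w).1 by move=> w /FG ->.
have e2 : forall w, L w -> (F w).2 = (G w).2 by move=> w /FG ->.
rewrite (gsub_ext pL e1 h1 Lz) (gsub_ext pL e2 h2 Lz).
by rewrite (gsub_ext pL (gd_ext pL e1 h1) (hA_gd pL h1) Lz).
Qed.

Lemma ssubst_even F z : even_on L F -> K z ->
  geven (ssubst L F (ev m z) (od m z)).1 /\ godd (ssubst L F (ev m z) (od m z)).2.
Proof.
move=> eF Kz; rewrite (ssubst_scm L hm) //=; have [e1 o1 o2 e2] := scm_even hm Kz.
have Lz := bm Kz; split.
  apply: gevenD; first by apply: gsub_even => // w /eF[].
  by apply: goddM => //; apply: gsub_odd => // w /eF[].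
apply: goddD.
  by apply: goddMr => //; apply: gsub_even => //; apply: gd_even => // w /eF[].
by apply: goddMl => //; apply: gsub_odd => // w /eF[].
Qed.

Lemma ssubst_add F G z : K z -> shA L F -> shA L G ->
  ssubst L (fun w => (F w + G w)%S) (ev m z) (od m z) =
  (ssubst L F (ev m z) (od m z) + ssubst L G (ev m z) (od m z))%S.
Proof.
move=> Kz [f1 f2] [g1 g2]; rewrite !(ssubst_scm L hm) // saddE /=.
have Lz := bm Kz; have [ex _ _ _] := scm_even hm Kz.
have gA f g : hA L f -> hA L g -> gsub L (fun w => f w + g w) (mQ m z) = gsub L f (mQ m z) + gsub L g (mQ m z).
  by move=> hf hg; exact: gsub_add.
have e := gsub_ext pL (fun w Lw => gd_add pL f1 g1 Lw) (hA_gd pL (hA_add f1 g1)) Lz.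
rewrite [gsub L (gd L _) _]e !gA //; try exact: hA_gd.
by congr pair; rewrite !mulrDl addrACA.
Qed.

Lemma ssubst_scale (a : C) F z : K z -> shA L F ->
  ssubst L (fun w => sscale a (F w)) (ev m z) (od m z) =
  sscale a (ssubst L F (ev m z) (od m z)).
Proof.
move=> Kz [f1 f2]; rewrite !(ssubst_scm L hm) // sscaleE /=.
have Lz := bm Kz; have [ex _ _ _] := scm_even hm Kz.
have gZ f : hA L f -> gsub L (fun w => a *: f w) (mQ m z) = a *: gsub L f (mQ m z).
  by move=> hf; exact: gsub_scale.
have e := gsub_ext pL (fun w Lw => gd_scale a pL f1 Lw) (hA_gd pL (hA_scale a f1)) Lz.
rewrite [gsub L (gd L _) _]e !gZ //; try exact: hA_gd.
by congr pair; rewrite scalerDr !scalerAl.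
Qed.

(** For F = f + phi theta and G = g + gamma theta the product of the substitutions has the extra
    terms phi r gamma P + phi P gamma r, which cancel because r and gamma anticommute, and terms
    with q and r, which vanish by q r = 0. *)
Lemma ssubst_mul F G z : K z -> shA L F -> shA L G -> even_on L F -> even_on L G ->
  ssubst L (fun w => (F w * G w)%S) (ev m z) (od m z) =
  (ssubst L F (ev m z) (od m z) * ssubst L G (ev m z) (od m z))%S.
Proof.
move=> Kz [f1 f2] [g1 g2] eF eG.
rewrite (_ : (fun w => (F w * G w)%S) = (fun w => ((F w).1 * (G w).1,
  (F w).1 * (G w).2 + (F w).2 * (G w).1))) // !(ssubst_scm L hm) // smulE /=.
have Lz := bm Kz; have [e1 o1 o2 e2] := scm_even hm Kz.
have gM f g : hA L f -> hA L g -> gsub L (fun w => f w * g w) (mQ m z) = gsub L f (mQ m z) * gsub L g (mQ m z).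
  by move=> hf hg; exact: gsub_mul.
have gA f g : hA L f -> hA L g -> gsub L (fun w => f w + g w) (mQ m z) = gsub L f (mQ m z) + gsub L g (mQ m z).
  by move=> hf hg; exact: gsub_add.
have f1' := hA_gd pL f1; have g1' := hA_gd pL g1.
have e := gsub_ext pL (fun w Lw => gd_mul pL f1 g1 Lw) (hA_gd pL (hA_mul f1 g1)) Lz.
have a1 := hA_mul f1' g1; have a2 := hA_mul f1 g1'.
have a3 := hA_mul f1 g2; have a4 := hA_mul f2 g1.
rewrite [gsub L (gd L _) _]e !gA // !gM //.
have E1 : geven (gsub L (fun w => (F w).1) (mQ m z)) by apply: gsub_even => // w /eF[].
have E2 : geven (gsub L (fun w => (G w).1) (mQ m z)) by apply: gsub_even => // w /eG[].
have O1 : godd (gsub L (fun w => (F w).2) (mQ m z)) by apply: gsub_odd => // w /eF[].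
have O2 : godd (gsub L (fun w => (G w).2) (mQ m z)) by apply: gsub_odd => // w /eG[].
have E1' : geven (gsub L (gd L (fun w => (F w).1)) (mQ m z)).
  by apply: gsub_even => //; apply: gd_even => // w /eF[].
have E2' : geven (gsub L (gd L (fun w => (G w).1)) (mQ m z)).
  by apply: gsub_even => //; apply: gd_even => // w /eG[].
have [_ _ -> // _] := hm.
move: (mQ m z) (mr m z) (mP m z)
  (gsub L (fun w => (F w).1) (mQ m z)) (gsub L (fun w => (G w).1) (mQ m z))
  (gsub L (fun w => (F w).2) (mQ m z)) (gsub L (fun w => (G w).2) (mQ m z))
  (gsub L (gd L (fun w => (F w).1)) (mQ m z)) (gsub L (gd L (fun w => (G w).1)) (mQ m z))
  E1 E2 O1 O2 E1' E2' e1 o2 e2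
  => q r p f g ph ga f' g' hf hg hph hga hf' hg' hq hr hp.
congr pair.
  by sring (f :: g :: eps :: q :: p :: nil) (ph :: ga :: r :: nil).
by sring (f :: g :: f' :: g' :: eps :: q :: p :: nil) (ph :: ga :: r :: nil).
Qed.

(** The shift phi r has square zero, so [gsub_shift] gives exp(f + phi r) = exp(f) (1 + phi r). The
    theta components then agree by the chain rule and q r = 0. *)
Lemma ssubst_sexp F z : K z -> shA L F -> even_on L F ->
  ssubst L (fun w => sexp (F w)) (ev m z) (od m z) =
  sexp (ssubst L F (ev m z) (od m z)).
Proof.
move=> Kz [f1 f2] eF; have [se1 se2] := ssubst_even eF Kz.
have Lz := bm Kz; have [e1 o1 o2 e2] := scm_even hm Kz.
have ef w : L w -> geven (F w).1 by case/eF.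
have hg : hA L (fun w => gexp (F w).1) by exact: hA_gexp.
have E1 : geven (gsub L (fun w => (F w).1) (mQ m z)) by exact: gsub_even.
have E1' : geven (gsub L (gd L (fun w => (F w).1)) (mQ m z)).
  by apply: gsub_even => //; exact: gd_even.
have O1 : godd (gsub L (fun w => (F w).2) (mQ m z)) by apply: gsub_odd => // w /eF[].
have pT := @perfect_setT R.
have eg x : geven x -> gsub L (fun w => gexp (F w).1) (mQ m z) =
    gexp (gsub L (fun w => (F w).1) (mQ m z)).
  move=> _; rewrite (_ : (fun w => gexp (F w).1) = fun w => gsub setT (@cexpG R) (F w).1).
    by rewrite (@gsub_comp _ L setT (@cexpG R)) // ?gexpE //; exact: hA_cexpG.
  by apply/funext => w; rewrite gexpE.
have eg' : gsub L (gd L (fun w => gexp (F w).1)) (mQ m z) =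
    gexp (gsub L (fun w => (F w).1) (mQ m z)) * gsub L (gd L (fun w => (F w).1)) (mQ m z).
  have f1' := hA_gd pL f1.
  rewrite (@gsub_ext _ L _ (fun w => gexp (F w).1 * gd L (fun w => (F w).1) w)) //.
  - by rewrite (gsub_mul pL e1 Lz hg f1') (eg 0).
  - move=> w Lw; rewrite (_ : (fun w => gexp (F w).1) = fun w => gsub setT (@cexpG R) (F w).1);
      last by apply/funext => v; rewrite gexpE.
    rewrite (gd_gsub pL pT ef (fun _ _ => I) f1 (hA_cexpG _) Lw); congr (_ * _).
    rewrite gexpE (_ : gd setT (@cexpG R) = @cexpG R) //.
    by apply/funext => v; exact: gd_cexpG.
  - exact: hA_gd.
rewrite [RHS]sexpE // (@ssubst_ext _ (fun w => (gexp (F w).1, gexp (F w).1 * (F w).2))) //;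
  last 2 first.
- split; first by apply: (@hA_ext _ _ (fun w => gexp (F w).1)) => // w /ef; rewrite sexp1E.
  apply: (@hA_ext _ _ (fun w => gexp (F w).1 * (F w).2)); last exact: hA_mul.
  by move=> w /ef h; rewrite sexpE.
- by move=> w /ef h; rewrite sexpE.
rewrite !(ssubst_scm L hm) //= (gsub_mul pL e1 Lz hg f2) (eg 0) // eg'.
have -> : gexp (gsub L (fun w => (F w).1) (mQ m z) + gsub L (fun w => (F w).2) (mQ m z) * mr m z)
  = gexp (gsub L (fun w => (F w).1) (mQ m z)) * (1 + gsub L (fun w => (F w).2) (mQ m z) * mr m z).
  rewrite !gexpE (@gsub_shift _ setT pT) //; last exact: hA_cexpG.
  - rewrite (_ : gd setT (@cexpG R) = @cexpG R) ?mulrDr ?mulr1 //.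
    by apply/funext => v; exact: gd_cexpG.
  - exact: goddM.
  - move: (gsub L (fun w => (F w).2) (mQ m z)) (mr m z) O1 o2 => a b ha hb.
    by sring (@nil gr) (a :: b :: nil).
have E3 := gexp_even E1; have [_ _ -> // _] := hm.
move: (mQ m z) (mr m z) (mP m z) (gexp _) (gsub L (fun w => (F w).2) (mQ m z))
  (gsub L (gd L (fun w => (F w).1)) (mQ m z)) E3 O1 E1' e1 o2 e2
  => q r p g ph f' hg' hph hf' hq hr hp.
congr pair; first by sring (g :: nil) (ph :: r :: nil).
by sring (g :: f' :: eps :: q :: p :: nil) (ph :: r :: nil).
Qed.

Section Assoc.
Variables (M : set C) (pM : perfect M) (n : smap R C).
Hypotheses (hn : scm L id n) (bn : forall z, L z -> M (body (ev n z))).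

(** Associativity. The even coordinate of the composite is the substituted Q of [n] plus a product
    of two odd elements, which squares to zero; [gsub_shift] expands the outer function around it to
    first order. *)
Lemma ssubst_comp F z : K z -> shA M F ->
  ssubst L (fun w => ssubst M F (ev n w) (od n w)) (ev m z) (od m z) =
  ssubst M F (ev (scomp L n m) z) (od (scomp L n m) z).
Proof.
move=> Kz hF; have hF' := shA_ssubst pL pM hn bn hF.
have hmn := scm_comp pK pL hm bm hn.
have [h1 h2] := hF; have Lz := bm Kz; have [e1 o1 o2 e2] := scm_even hm Kz.
have [[[hQ2 hq2] [hr2 hP2]] pn hqn _] := hn.
rewrite (ssubst_scm M hmn) // (ssubst_scm L hm) //.
have [pQ pq pr pP] : [/\ forall w, L w -> geven (mQ n w), forall w, L w -> godd (mq n w),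
    forall w, L w -> godd (mr n w) & forall w, L w -> geven (mP n w)].
  by split=> w /pn[].
set x := mQ m z.
have gM f g : hA L f -> hA L g -> gsub L (fun w => f w * g w) x = gsub L f x * gsub L g x.
  by move=> hf hg; exact: gsub_mul.
have gA f g : hA L f -> hA L g -> gsub L (fun w => f w + g w) x = gsub L f x + gsub L g x.
  by move=> hf hg; exact: gsub_add.
have bnM w : L w -> M (mQ n w fset0) by exact: bn.
have gC f : hA M f -> gsub L (fun w => gsub M f (mQ n w)) x = gsub M f (gsub L (mQ n) x).
  by move=> hf; exact: gsub_comp.
have hC f : hA M f -> hA L (fun w => gsub M f (mQ n w)) by move=> hf; exact: hA_gsub.
have h1' := hA_gd pM h1; have h2' := hA_gd pM h2.
set f1 := fun w => (F w).1 in h1 h1' *; set f2 := fun w => (F w).2 in h2 h2' *.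
have hQ2' := hA_gd pL hQ2; have hr2' := hA_gd pL hr2.
have ev1 w : L w -> (ssubst M F (ev n w) (od n w)).1 =
    gsub M f1 (mQ n w) + gsub M f2 (mQ n w) * mr n w.
  by move=> Lw; rewrite (ssubst_scm M hn).
have ev2 w : L w -> (ssubst M F (ev n w) (od n w)).2 =
    gsub M (gd M f1) (mQ n w) * mq n w + gsub M f2 (mQ n w) * mP n w.
  by move=> Lw; rewrite (ssubst_scm M hn).
have ev1' w : L w -> gd L (fun w => (ssubst M F (ev n w) (od n w)).1) w =
    gsub M (gd M f1) (mQ n w) * gd L (mQ n) w +
    (gsub M (gd M f2) (mQ n w) * gd L (mQ n) w * mr n w +
     gsub M f2 (mQ n w) * gd L (mr n) w).
  by move=> Lw; rewrite (gd_ssubst1 pL pM hn bn).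
rewrite (gsub_ext pL ev1 hF'.1 Lz) (gsub_ext pL ev2 hF'.2 Lz).
rewrite (gsub_ext pL ev1' (hA_gd pL hF'.1) Lz).
have a1 := hC _ h1; have a2 := hC _ h2; have a1' := hC _ h1'; have a2' := hC _ h2'.
have b1 := hA_mul a2 hr2; have b2 := hA_mul a1' hq2; have b3 := hA_mul a2 hP2.
have b4 := hA_mul a1' hQ2'; have b5 := hA_mul a2' hQ2'; have b6 := hA_mul b5 hr2.
have b7 := hA_mul a2 hr2'; have b8 := hA_add b6 b7.
rewrite !gA // !gM // !gC //.
have EA : geven (gsub L (mQ n) x) by exact: gsub_even.
have EB : geven (gsub L (mP n) x) by exact: gsub_even.
have OR : godd (gsub L (mr n) x) by exact: gsub_odd.
have EA' : geven (gsub L (gd L (mQ n)) x) by apply: gsub_even => //; exact: gd_even.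
have OR' : godd (gsub L (gd L (mr n)) x) by apply: gsub_odd => //; exact: gd_odd.
have eq2 := gsub_q2 pL hm bm hn Kz; have eQ2' := gsub_Q2' pL hm bm hn Kz.
rewrite -/x in eq2 eQ2'.
have vQ : mQ (scomp L n m) z = gsub L (mQ n) x + gsub L (mq n) x * mr m z :=
  congr1 fst (ssubst_scm L hm (ev n) Kz).
have vq : mq (scomp L n m) z = gsub L (gd L (mQ n)) x * mq m z + gsub L (mq n) x * mP m z :=
  congr1 snd (ssubst_scm L hm (ev n) Kz).
have vr : mr (scomp L n m) z = gsub L (mr n) x + gsub L (mP n) x * mr m z :=
  congr1 fst (ssubst_scm L hm (od n) Kz).
have vP : mP (scomp L n m) z = gsub L (gd L (mr n)) x * mq m z + gsub L (mP n) x * mP m z :=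
  congr1 snd (ssubst_scm L hm (od n) Kz).
have MA : M (gsub L (mQ n) x fset0) by rewrite gsub_body; exact: bn.
have ed : geven (gsub L (mq n) x * mr m z) by apply: goddM => //; exact: gsub_odd.
have dd : (gsub L (mq n) x * mr m z) * (gsub L (mq n) x * mr m z) = 0.
  have : godd (gsub L (mq n) x) by exact: gsub_odd.
  move: (gsub L (mq n) x) (mr m z) o2 => a b hb ha.
  by sring (@nil gr) (a :: b :: nil).
have sh f : hA M f -> gsub M f (mQ (scomp L n m) z) = gsub M f (gsub L (mQ n) x) +
    gsub M (gd M f) (gsub L (mQ n) x) * (gsub L (mq n) x * mr m z).
  by move=> hf; rewrite vQ; exact: gsub_shift.
rewrite !sh // vq vr vP eq2.
have hmq : mq m z = - (eps * x * mP m z * mr m z) by have [_ _ h _] := hm; exact: h.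
rewrite hmq.
move: (gsub M f1 (gsub L (mQ n) x)) (gsub M (gd M f1) (gsub L (mQ n) x))
  (gsub M (gd M (gd M f1)) (gsub L (mQ n) x)) (gsub M f2 (gsub L (mQ n) x))
  (gsub M (gd M f2) (gsub L (mQ n) x)) => F1 F1' F1'' F2 F2'.
move: (gsub L (mQ n) x) (gsub L (mr n) x) (gsub L (mP n) x)
    (gsub L (gd L (mQ n)) x) (gsub L (gd L (mr n)) x) EA OR EB EA' OR' eQ2'
    => A rho B A' rho' EA OR EB EA' OR' eQ2'.
set r := mr m z in o2 *; set p := mP m z in e2 *.
congr pair.
  have q0 : (- (eps * A * B * rho) * r) * (rho + B * r) = 0.
    by sring (eps :: A :: B :: nil) (rho :: r :: nil).
  rewrite [in RHS]mulrDl -(mulrA F2') q0 mulr0 addr0.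
  by rewrite [in LHS]mulrDl [in RHS]mulrDr !mulrA -!addrA; congr (_ + _); rewrite addrCA.
set d := - (eps * A * B * rho) * r.
have z1 : d * (A' * - (eps * x * p * r) + - (eps * A * B * rho) * p) = 0.
  by rewrite /d; sring (eps :: A :: A' :: B :: x :: p :: nil) (rho :: r :: nil).
(* The coefficients of F2' on the two sides: they coincide only through the contact relation of
   [n]. *)
have z2 : A' * rho * - (eps * x * p * r) = d * (rho' * - (eps * x * p * r) + B * p).
  transitivity (- (eps * (x * A') * p * rho * r)).
    by sring (eps :: x :: p :: A' :: nil) (r :: rho :: nil).
  by rewrite eQ2' /d; sring (eps :: x :: p :: A :: B :: nil) (rho :: rho' :: r :: nil).
rewrite [in RHS]mulrDl -(mulrA F1'') z1 mulr0 addr0.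
rewrite [in RHS]mulrDl -(mulrA F2' d) -z2 !(mulrDl, mulrDr) !mulrA -!addrA.
congr (_ + _); rewrite [LHS]addrC -!addrA.

by rewrite addrCA.
Qed.
End Assoc.
End Pullback.

(** * The Berezinian of a contact map and its chain rule *)

Section Berezinian.
Variable R : realType.
Local Notation C := R[i].
Local Notation gr := (gr R).
Local Notation sgr := (sgr R).
Local Notation eps := (gconst 'i : gr).
Implicit Types (f g : C -> gr) (x y : gr) (z : C) (F G : C -> sgr).

Let ee : geven eps := @eps_even R.

Lemma ginv_cancel x y y' : geven x -> x fset0 != 0 -> x * y = x * y' -> y = y'.
Proof.
move=> ex x0 e; have := congr1 (fun u => ginv x * u) e.
by rewrite !mulrA ginvM // !mul1r.
Qed.

(** On contact maps the Berezinian has no denominators other than that of v: with D0 the part of D +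
    B A^-1 C without theta, the contact relation says A = k Q' = (v Q P) D0 in the same sense, so D0
    cancels and v Q P is left. *)
Lemma Ber_contact (k v g Q Q' q q' r r' P P' : gr) :
  geven v -> geven g -> geven Q -> geven Q' -> godd r -> godd r' -> geven P -> geven P' ->
  v fset0 != 0 -> g fset0 != 0 -> Q fset0 != 0 -> P fset0 != 0 ->
  k = v * g -> q = - (eps * Q * P * r) -> g * Q' = Q * (P * P - eps * g * (r * r')) ->
  q' = - (eps * (Q' * P * r + Q * P' * r + Q * P * r')) ->
  Ber (k * Q', k * q') (q, 0) (k * r', k * P') (P, 0) =
  (v * Q * P, - (eps * v * (g * Q' * r + Q * (g * r')))).
Proof.
move=> ev eg eQ eQ' or or' eP eP' v0 g0 Q0 P0 hk hq hQ' hq'.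
have ek : geven k by rewrite hk; exact: gevenM.
have oq : godd q.
  by rewrite hq; apply: goddN; apply: goddMr => //; do 2 (apply: gevenM => //).
have eA : geven (k * Q') by exact: gevenM.
have kQ' : k * Q' = v * (Q * (P * P - eps * g * (r * r'))) by rewrite hk -mulrA hQ'.
have A0 : (k * Q') fset0 != 0.
  rewrite kQ' !grM0 grBE !grM0 (godd_body or) mul0r mulr0 subr0.
  by rewrite !mulf_neq0.
have sA : sinv (k * Q', k * q') = (ginv (k * Q'), - (ginv (k * Q') * ginv (k * Q') * (k * q'))).
  exact: sinvE.
rewrite /Ber sA {sA}; set a := ginv (k * Q').
have ea : geven a by exact: ginv_even.
have ha : k * Q' * a = 1 by rewrite (geven_comm _ eA); exact: ginvM.
set D0 := P + q * a * (k * r').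
set D1 := q * a * (k * P') + q * (- (a * a * (k * q'))) * (k * r').
have -> : ((P, 0%R) + (q, 0%R) * (a, (- (a * a * (k * q')))%R) * ((k * r')%R, (k * P')%R))%S
    = (D0, D1).
  by rewrite !smulE saddE /= mul0r !addr0 add0r.
have eD0 : geven D0.
  apply: gevenD => //; rewrite -mulrA; apply: goddM => //; apply: goddMr => //; exact: goddMr.
have D00 : D0 fset0 != 0.
  by rewrite /D0 grDE !grM0 (godd_body oq) !mul0r addr0.
have -> : sinv (D0, D1) = (ginv D0, - (ginv D0 * ginv D0 * D1)) by exact: sinvE.
set d := ginv D0; rewrite smulE /=.
have ed : geven d by exact: ginv_even.
have hd : D0 * d = 1 by rewrite (geven_comm _ eD0); exact: ginvM.
(* In front of r the relation k Q' a = 1 loses its term with r r', which turns a into an inverse of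
   v Q P^2. *)
have e2 : v * Q * P * P * a * r = r.
  rewrite -[RHS]mul1r -ha kQ'.
  by sring (eps :: v :: Q :: P :: g :: a :: nil) (r :: r' :: nil).
have e1 : k * Q' = v * Q * P * D0.
  rewrite kQ' /D0 hq hk.
  transitivity (v * Q * (P * P - eps * g * ((v * Q * P * P * a * r) * r'))).
    by rewrite e2; sring (eps :: v :: Q :: P :: g :: nil) (r :: r' :: nil).
  by sring (eps :: v :: Q :: P :: g :: a :: nil) (r :: r' :: nil).
have hD1 : D1 = q * a * (k * P').
  rewrite /D1 hq hq' hk.
  by sring (eps :: v :: Q :: Q' :: P :: P' :: g :: a :: nil) (r :: r' :: nil).
rewrite e1; congr pair.
  by rewrite -mulrA hd mulr1.
(* The factor D0 has invertible body; multiplication by it removes its inverse d and leaves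
   polynomial identities. *)
apply: (ginv_cancel eD0 D00).
have oq' : godd q'.
  rewrite hq'; apply: goddN; apply: goddMr => //.
  by apply: goddD; [apply: goddD|]; apply: goddMr => //; exact: gevenM.
have oD1 : godd D1 by rewrite hD1 -mulrA; apply: goddMl => //; apply: gevenM => //; exact: gevenM.
transitivity (- (v * Q * P * ((D0 * d) * (D0 * d) * D1)) + (D0 * d) * (k * q')).
  by sring (v :: Q :: P :: d :: D0 :: k :: nil) (q' :: D1 :: nil).
rewrite hd !mul1r hD1 /D0 hq hq' hk.
transitivity (eps * v * Q * P' * g * (v * Q * P * P * a * r) -
   eps * v * (g * Q' * P * r + g * Q * P' * r + g * Q * P * r')).
  by sring (eps :: v :: Q :: Q' :: P :: P' :: g :: a :: nil) (r :: r' :: nil).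
rewrite e2.
transitivity (- (eps * v * P * (g * Q' * r + Q * (g * r')))).
  by sring (eps :: v :: Q :: Q' :: P :: P' :: g :: nil) (r :: r' :: nil).
by sring (eps :: v :: Q :: Q' :: P :: P' :: g :: a :: nil) (r :: r' :: nil).
Qed.

(** The closed form from [Ber_contact]. The Berezinian is taken with respect to a coordinate u with
    u d/du = c d/dz: on annuli u = c = z, on the circle u = exp(i phi) and c = 1/i. *)
Definition BerF (K : set C) (c u : C -> C) (m : smap R C) (z : C) : sgr :=
  (gconst (u z)^-1 * mQ m z * mP m z,
   - (eps * gconst (u z)^-1 * (gconst (c z) * gd K (mQ m) z * mr m z +
        mQ m z * (gconst (c z) * gd K (mr m) z)))).

Section Maps.
Variables (K : set C) (pK : perfect K) (c : C -> C) (m : smap R C).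
Hypotheses (hm : scm K c m).

Lemma BerF_Ber (u : C -> C) z : K z -> u z != 0 -> c z != 0 -> body (ev m z) != 0 ->
  mP m z fset0 != 0 ->
  Ber (sscale (c z / u z) (gd K (mQ m) z, gd K (mq m) z)) (dtheta (ev m z))
      (sscale (c z / u z) (gd K (mr m) z, gd K (mP m) z)) (dtheta (od m z)) =
  BerF K c u m z.
Proof.
move=> Kz u0 c0 Q0 P0; have [eQ _ or eP] := scm_even hm Kz.
have [[[hQ hq] [hr hP]] _ hqm hc] := hm.
rewrite !sscaleE !dthetaE /= !gconstZ.
have par w : K w -> _ := fun Kw => scm_even hm Kw.
apply: Ber_contact => //; try exact: geven_const.
- by apply: gd_even => // w /par[].
- by apply: gd_odd => // w /par[].
- by apply: gd_even => // w /par[].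
- by rewrite /gconst eqxx invr_eq0.
- by rewrite -gconstM mulrC.
- exact: hqm.
- exact: hc.
- rewrite (@gd_ext _ _ _ (fun w => - (eps * (mQ m w * mP m w * mr m w)))) //; last first.
    by move=> w Kw; rewrite hqm // !mulrA.
  have hQP := hA_mul hQ hP; have hQPr := hA_mul hQP hr.
  have hE : hA K (fun=> eps) by apply: (@hA_cst _ _ 0); exact: gfin_const.
  rewrite gd_opp //; last exact: hA_mul.
  rewrite gd_mul //; rewrite (@ghd_gd _ _ (fun=> eps) z 0) //; last exact: ghd_cst.
  by rewrite mul0r add0r !gd_mul // mulrDl.
Qed.

Lemma BerF_even u : even_on K (BerF K c u m).
Proof.
move=> z Kz; have [eQ _ or eP] := scm_even hm Kz.
have ev : geven (gconst (u z)^-1 : gr) := @geven_const _ _.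
have ec : geven (gconst (c z) : gr) := @geven_const _ _.
have eQ' : geven (gd K (mQ m) z) by apply: gd_even => // w /(scm_even hm)[].
have or' : godd (gd K (mr m) z) by apply: gd_odd => // w /(scm_even hm)[].
split; first by apply: gevenM => //; exact: gevenM.
apply: goddN; apply: goddMr; first exact: gevenM.
by apply: goddD; apply: goddMr => //; [exact: gevenM|exact: goddMr].
Qed.

Lemma shA_BerF u : (forall k, hol k K c) -> (forall k, hol k K u) ->
  (forall z, K z -> u z != 0) -> shA K (BerF K c u m).
Proof.
move=> hc hu u0; have [[[hQ hq] [hr hP]] _ _ _] := hm.
have hv : hA K (fun z => gconst (u z)^-1 : gr) by apply: hA_const => k; exact: hol_inv.
have hg : hA K (fun z => gconst (c z) : gr) by exact: hA_const.
have hE : hA K (fun=> eps) by apply: (@hA_cst _ _ 0); exact: gfin_const.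
have hQ' := hA_gd pK hQ; have hr' := hA_gd pK hr.
split; first exact: hA_mul (hA_mul hv hQ) hP.
exact: hA_opp (hA_mul (hA_mul hE hv) (hA_add (hA_mul (hA_mul hg hQ') hr) (hA_mul hQ (hA_mul hg hr')))).
Qed.

End Maps.

Section Cocycle.
Variables (K L : set C) (pK : perfect K) (pL : perfect L) (c : C -> C) (m : smap R C).
Hypotheses (hm : scm K c m) (bm : forall z, K z -> L (body (ev m z))).
Variable (n : smap R C).
Hypotheses (hn : scm L id n) (L0 : forall z, L z -> z != 0).

(** The cocycle property; passing to logarithms, it makes the nu-terms of a density add under
    composition. *)
Lemma BerF_comp u z : K z ->
  BerF K c u (scomp L n m) z =
  (BerF K c u m z * ssubst L (BerF L id id n) (ev m z) (od m z))%S.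
Proof.
move=> Kz; have Lz := bm Kz; have [e1 o1 o2 e2] := scm_even hm Kz.
have [[[hQ2 hq2] [hr2 hP2]] pn _ _] := hn.
have hQ2' := hA_gd pL hQ2; have hr2' := hA_gd pL hr2.
have [pQ pq pr pP] : [/\ forall w, L w -> geven (mQ n w), forall w, L w -> godd (mq n w),
    forall w, L w -> godd (mr n w) & forall w, L w -> geven (mP n w)].
  by split=> w /pn[].
set x := mQ m z in e1 Lz *.
have Lx : L (x fset0) by exact: Lz.
have gM f g : hA L f -> hA L g -> gsub L (fun w => f w * g w) x = gsub L f x * gsub L g x.
  by move=> hf hg; exact: gsub_mul.
have gA f g : hA L f -> hA L g -> gsub L (fun w => f w + g w) x = gsub L f x + gsub L g x.
  by move=> hf hg; exact: gsub_add.
have gN f : hA L f -> gsub L (fun w => - f w) x = - gsub L f x.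
  move=> hf; rewrite -[RHS]scaleN1r -gsub_scale //; congr (gsub L _ x).
  by apply/funext => w; rewrite scaleN1r.
have hI : hA L (@gconst R) by apply: hA_const => k; exact: hol_id.
have hV : hA L (fun w => gconst w^-1 : gr).
  by apply: hA_const => k; apply: hol_inv => //; exact: hol_id.
have hE : hA L (fun=> eps) by apply: (@hA_cst _ _ 0); exact: gfin_const.
have gI : gsub L (@gconst R) x = x by exact: gsub_id.
(* The map enters [BerF] through Q/w. Writing Q = w p2 eliminates the inverse of the coordinate from
   the identities to be normalized. *)
pose p2 w := gconst w^-1 * mQ n w : gr.
have hp2 : hA L p2 by exact: hA_mul.
have hp2' := hA_gd pL hp2.
set Pi := gsub L p2 x; set Pi' := gsub L (gd L p2) x.
have ePi : geven Pi.
  by apply: gsub_even => // w Lw; apply: gevenM; [exact: geven_const|exact: pQ].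
have ePi' : geven Pi'.
  apply: gsub_even => //; apply: gd_even => // w Lw.
  by apply: gevenM; [exact: geven_const|exact: pQ].
have eIp w : L w -> mQ n w = gconst w * p2 w.
  by move=> Lw; rewrite /p2 mulrA -gconstM divff ?gconst1 ?mul1r // L0.
have hA1 : gsub L (mQ n) x = x * Pi.
  by rewrite (gsub_ext pL eIp hQ2 Lx) gM // gI.
have hA2 : gsub L (gd L (mQ n)) x = Pi + x * Pi'.
  have e w : L w -> gd L (mQ n) w = p2 w + gconst w * gd L p2 w.
    move=> Lw; rewrite (gd_ext pL eIp hQ2 Lw) gd_mul //.
    rewrite (@ghd_gd _ _ (@gconst R) w (gconst 1)) //; first by rewrite gconst1 mul1r.
    by apply: ghd_const; exact: hd_id.
  by have hIp := hA_mul hI hp2'; rewrite (gsub_ext pL e hQ2' Lx) gA // gM // gI.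
set rho := gsub L (mr n) x; set rho' := gsub L (gd L (mr n)) x.
set B := gsub L (mP n) x; set B' := gsub L (gd L (mP n)) x.
have oR : godd rho by exact: gsub_odd.
have oR' : godd rho' by apply: gsub_odd => //; exact: gd_odd.
have eB : geven B by exact: gsub_even.
have eB' : geven B' by apply: gsub_even => //; exact: gd_even.
(* The contact relation of [n] divided by x, whose body is nonzero on L. *)
have hA3 : Pi + x * Pi' = Pi * (B * B - eps * x * (rho * rho')).
  have x0 : x fset0 != 0 by exact: L0.
  apply: (ginv_cancel e1 x0); have := gsub_Q2' pL hm bm hn Kz.
  by rewrite -/x hA2 hA1 -/rho -/rho' -/B => ->; rewrite -mulrA.
have hBn : shA L (BerF L id id n).
  by apply: shA_BerF => // k; exact: hol_id.
have b1 w : L w -> (BerF L id id n w).1 = p2 w * mP n w by [].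
have b2 w : L w -> (BerF L id id n w).2 = - (eps * (gd L (mQ n) w * mr n w + mQ n w * gd L (mr n) w)).
  move=> Lw; rewrite /BerF /=; have [eQw _ orw ePw] := pn w Lw.
  have hw : gconst w^-1 * gconst w = 1 :> gr by rewrite -gconstM mulVf // L0.
  have eQw' : geven (gd L (mQ n) w) by exact: gd_even.
  have orw' : godd (gd L (mr n) w) by exact: gd_odd.
  have ew : geven (gconst w : gr) := @geven_const _ _.
  have ew' : geven (gconst w^-1 : gr) := @geven_const _ _.
  transitivity (- (eps * ((gconst w^-1 * gconst w) *
      (gd L (mQ n) w * mr n w + mQ n w * gd L (mr n) w)))).
    by sring (eps :: gd L (mQ n) w :: gconst w^-1 :: gconst w :: mQ n w :: nil)
      (gd L (mr n) w :: mr n w :: nil).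
  by rewrite hw mul1r.
have b1' w : L w -> gd L (fun w => (BerF L id id n w).1) w = gd L p2 w * mP n w + p2 w * gd L (mP n) w.
  by move=> Lw; rewrite (gd_ext pL b1 hBn.1 Lw) gd_mul.
have hP2' := hA_gd pL hP2.
clearbody p2.
have c1 := hA_mul hp2 hP2; have c2 := hA_mul hQ2' hr2; have c3 := hA_mul hQ2 hr2'.
have c4 := hA_add c2 c3; have c5 := hA_mul hE c4.
have c6 := hA_mul hp2' hP2; have c7 := hA_mul hp2 hP2'.
rewrite (ssubst_scm L hm) // -/x.
rewrite (gsub_ext pL b1 hBn.1 Lx) (gsub_ext pL b2 hBn.2 Lx).
rewrite (gsub_ext pL b1' (hA_gd pL hBn.1) Lx).
rewrite gN // !(gM, gA) // (gsub_cst _ pL Lx) -/Pi -/Pi' -/rho -/rho' -/B -/B'.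
have vQ : mQ (scomp L n m) z = gsub L (mQ n) x + gsub L (mq n) x * mr m z :=
  congr1 fst (ssubst_scm L hm (ev n) Kz).
have vr : mr (scomp L n m) z = gsub L (mr n) x + gsub L (mP n) x * mr m z :=
  congr1 fst (ssubst_scm L hm (od n) Kz).
have vP : mP (scomp L n m) z = gsub L (gd L (mr n)) x * mq m z + gsub L (mP n) x * mP m z :=
  congr1 snd (ssubst_scm L hm (od n) Kz).
have vQ' : gd K (mQ (scomp L n m)) z = _ :=
  @gd_ssubst1 _ K L pK pL c m hm bm (ev n) z (conj hQ2 hq2) Kz.
have vr' : gd K (mr (scomp L n m)) z = _ :=
  @gd_ssubst1 _ K L pK pL c m hm bm (od n) z (conj hr2 hP2) Kz.
rewrite /BerF smulE /= vQ vr vP vQ' vr'.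
rewrite -/(mQ n) -/(mq n) -/(mr n) -/(mP n) -/x -/rho -/rho' -/B -/B'.
rewrite (gsub_q2 pL hm bm hn Kz) (gsub_q2' pL hm bm hn Kz) -/x -/rho -/rho' -/B -/B'.
have hmq : mq m z = - (eps * x * mP m z * mr m z) by have [_ _ h _] := hm; exact: h.
have hmc : gconst (c z) * gd K (mQ m) z = x * (mP m z * mP m z -
   eps * gconst (c z) * (mr m z * gd K (mr m) z)) by have [_ _ _ h] := hm; exact: h.
have o3 : godd (gd K (mr m) z) by apply: gd_odd => // w /(scm_even hm)[].
have eX : geven (gd K (mQ m) z) by apply: gd_even => // w /(scm_even hm)[].
have ec : geven (gconst (c z) : gr) := @geven_const _ _.
have ev : geven (gconst (u z)^-1 : gr) := @geven_const _ _.
rewrite hmq hA1 hA2.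
move: (gconst (c z)) (gconst (u z)^-1) (gd K (mQ m) z) (gd K (mr m) z) (mr m z) (mP m z)
  ec ev eX o3 o2 e2 hmc => k v X r' r p ec ev eX or' or ep hX.
have hxP : x * Pi' = Pi * (B * B - eps * x * (rho * rho')) - Pi.
  by rewrite -hA3 addrAC subrr add0r.
pose T := Pi + x * Pi'; pose q2 := - (eps * (x * Pi) * B * rho).
congr pair.
  rewrite hA3.
  by sring (eps :: v :: x :: p :: Pi :: B :: nil) (rho :: rho' :: r :: nil).
transitivity (- (eps * v * ((T * (k * X) +
   (- (eps * (T * B * rho + x * Pi * B' * rho + x * Pi * B * rho')) * (k * X) * r + k * q2 * r')) *
   (rho + B * r) +
   (x * Pi + q2 * r) * (rho' * (k * X) + (B' * (k * X) * r + k * B * r'))))).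
  by rewrite /T /q2;
    sring (eps :: v :: k :: X :: x :: p :: Pi :: Pi' :: B :: B' :: nil) (rho :: rho' :: r :: r' :: nil).
transitivity (v * p * (- (eps * ((x * Pi') * B + x * Pi * B') * x * p * r) +
    - (eps * (T * rho + x * Pi * rho')) * x * p) +
   - (eps * v * ((k * X) * r + x * (k * r'))) *
   (Pi * B + - (eps * (T * rho + x * Pi * rho')) * r)); last first.
  by rewrite /T;
    sring (eps :: v :: k :: X :: x :: p :: Pi :: Pi' :: B :: B' :: nil) (rho :: rho' :: r :: r' :: nil).
rewrite hX hxP /T hA3 /q2.
by sring (eps :: v :: k :: x :: p :: Pi :: B :: B' :: nil) (rho :: rho' :: r :: r' :: nil).
Qed.
End Cocycle.
End Berezinian.

(** * The annulus and the identity theorem *)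

Section Annulus.
Variable R : realType.
Local Notation C := R[i].
Local Notation Rline := (@Rline R).
Implicit Types (K L : set C) (z w : C).

(** The norm of [C] takes values in [C]; order arguments and real analysis need it in [R]. *)
Definition cabs z : R := Num.sqrt (complex.Re z ^+ 2 + complex.Im z ^+ 2).

Lemma cabsE z : `|z| = (cabs z)%:C.
Proof. by rewrite normc_def. Qed.
Lemma cabs_ge0 z : 0 <= cabs z. Proof. exact: sqrtr_ge0. Qed.
Lemma cabs_gt0 z : (0 < cabs z) = (z != 0).
Proof. by rewrite -ltcR -cabsE normr_gt0. Qed.
Lemma cabsM z w : cabs (z * w) = cabs z * cabs w.
Proof. by apply/complexI; rewrite -[LHS]cabsE normrM !cabsE -rmorphM. Qed.
Lemma cabs_expi (x : R) : cabs (expi x) = 1.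
Proof. by apply/complexI; rewrite -[LHS]cabsE norm_expi. Qed.
Lemma cabs_real (x : R) : cabs x%:C = `|x|.
Proof. by apply/complexI; rewrite -[LHS]cabsE norm_real. Qed.
Lemma cabs_sqr z : cabs z ^+ 2 = complex.Re z ^+ 2 + complex.Im z ^+ 2.
Proof. by rewrite sqr_sqrtr // addr_ge0 // sqr_ge0. Qed.
Lemma cabs_triangle z w : cabs (z + w) <= cabs z + cabs w.
Proof. by rewrite -lecR -cabsE rmorphD /= -!cabsE ler_normD. Qed.

Lemma annulusE (r1 r2 : R) z : annulus r1 r2 z <-> r1 <= cabs z <= r2.
Proof. by rewrite /annulus /= cabsE !lecR; split=> [[-> ->]//|/andP[]]. Qed.

Lemma polar_ex z : exists2 t : R, 0 <= t <= 2 * pi & z = (cabs z)%:C * expi t.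
Proof.
have pi0 := pi_ge0 R.
have [->|z0] := eqVneq z 0.
  by exists 0; rewrite ?lexx ?mulr_ge0 // /cabs /= expr0n /= addr0 sqrtr0 mul0r.
have a0 : 0 < cabs z by rewrite cabs_gt0.
set a := complex.Re z / cabs z; set b := complex.Im z / cabs z.
have ab : a ^+ 2 + b ^+ 2 = 1.
  by rewrite !expr_div_n -mulrDl -cabs_sqr divff // expf_neq0 // gt_eqF.
have zE : z = (cabs z)%:C * (a +i* b).
  apply/eqP; rewrite eq_complex /= !mul0r subr0 addr0.
  have c0 : cabs z != 0 by rewrite gt_eqF.
  by rewrite /a /b !mulrA ![cabs z * _]mulrC !mulfK // !eqxx.
have a1 : -1 <= a <= 1.
  rewrite -ler_norml -(@expr_le1 _ 2) // real_normK ?num_real //.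
  by rewrite -ab lerDl sqr_ge0.
have sa : sin (acos a) = `|b|.
  by rewrite sin_acos // -ab addrAC subrr add0r sqrtr_sqr.
have [b0|b0] := leP 0 b.
  exists (acos a).
    by rewrite acos_ge0 //= (le_trans (acos_lepi a1)) // ler_peMl // ler1n.
  by rewrite {1}zE /expi acosK ?in_itv //= sa ger0_norm.
exists (2 * pi - acos a).
  have := acos_ge0 a1; have := acos_lepi a1; move: pi0; set p := pi; set q := acos a.
  by move=> *; apply/andP; split; lra.
rewrite {1}zE /expi cosB sinB mulr_natl cos2pi sin2pi !mul1r !mul0r addr0 sub0r.
by rewrite acosK ?in_itv //= sa ltr0_norm // opprK.
Qed.

Lemma cont_polar : continuous (fun p : R * R => (p.1%:C * expi p.2 : C^o)).
Proof.
move=> [r t]; apply/(@cvg_ReIm R _ _ (fun p : R * R => p.1%:C * expi p.2)).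
have h1 : p.1 @[p --> (r, t)] --> r by exact: cvg_fst.
have h2 : p.2 @[p --> (r, t)] --> t by exact: cvg_snd.
have hc : cos p.2 @[p --> (r, t)] --> cos t.
  by apply: (cvg_comp _ _ h2); exact: continuous_cos.
have hs : sin p.2 @[p --> (r, t)] --> sin t.
  by apply: (cvg_comp _ _ h2); exact: continuous_sin.
split => /=; rewrite !mul0r ?subr0 ?addr0.
  rewrite (_ : (fun x : R * R => _) = (fun p => p.1 * cos p.2)).
    exact: cvgM.
  by apply/funext => p; rewrite mul0r subr0.
rewrite (_ : (fun x : R * R => _) = (fun p => p.1 * sin p.2)).
  exact: cvgM.
by apply/funext => p; rewrite mul0r addr0.
Qed.

Lemma compact_annulus (r1 r2 : R) : 0 <= r1 -> compact (annulus r1 r2 : set C^o).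
Proof.
move=> r10.
have -> : annulus r1 r2 = (fun p : R * R => p.1%:C * expi p.2) @` (`[r1, r2] `*` `[0, 2 * pi]).
  apply/seteqP; split => [z /annulusE h|_ [[r t] [/= hr ht] <-]].
    have [t ht e] := polar_ex z; exists (cabs z, t) => //=.
  apply/annulusE; rewrite cabsM cabs_expi mulr1 cabs_real.
  move: hr; rewrite ?in_itv /= => hr; rewrite ger0_norm // (le_trans r10) //; by case/andP: hr.
apply: (@continuous_compact _ C^o).
  by apply: continuous_subspaceT => p; exact: cont_polar.
by apply: compact_setX; exact: segment_compact.
Qed.

Lemma compact_max K (f : C -> R) : K !=set0 -> compact (K : set C^o) ->
  (forall z, K z -> cont_at K (fun w => (f w)%:C) z) ->
  exists2 z, K z & forall w, K w -> f w <= f z.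
Proof.
move=> K0 cK cf.
have [|c cK' h] := @compact_EVT_max C^o R f K K0 cK.
  apply/subspace_continuousP => z Kz; have [h] := cf z Kz.
  by have /(@cvg_ReIm R _ _ (fun w => (f w)%:C))[] := h.
by exists c; [rewrite inE in cK'|move=> w Kw; apply: h; rewrite inE].
Qed.

Lemma cont_cabs K (f : C -> C) z : cont_at K f z -> cont_at K (fun w => (cabs (f w))%:C) z.
Proof.
move=> /cont_eps h; apply/cont_eps => e e0; have [d d0 hd] := h e e0.
exists d => // w Kw hw; apply: le_lt_trans (hd w Kw hw).
by rewrite -!cabsE; exact: ler_dist_dist.
Qed.

End Annulus.

(** * The maximum principle, from second derivatives along lines *)

Section MaximumPrinciple.
Variable R : realType.
Local Notation C := R[i].
Local Notation Rline := (@Rline R).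
Implicit Types (K L : set C) (z w : C).

Lemma hd_interior K (f : C -> C) z l : nbhs (z : C^o) K -> hd K f z l -> hd setT f z l.
Proof.
move=> nK [phi [<- /cont_nbhs cphi e]]; apply: hd_of_cvg => A /cphi h.
near=> w => wz _; have Kw : K w by near: w.
rewrite /cquotient e // mulrAC divff ?mul1r; last by rewrite subr_eq0; exact/eqP.
by move: Kw; near: w.
Unshelve. all: by end_near. Qed.

Definition D2 (d : R) (f f1 : R -> R) (f2 : R) : Prop :=
  (forall t : R, `|t| < d -> is_derive t 1 f (f1 t)) /\ is_derive (0 : R) 1 f1 f2.

Lemma D2_add d f f1 f2 g g1 g2 : D2 d f f1 f2 -> D2 d g g1 g2 ->
  D2 d (fun t => f t + g t) (fun t => f1 t + g1 t) (f2 + g2).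
Proof.
move=> [hf hf1] [hg hg1]; split; last exact: is_deriveD.
by move=> t ht; have := hf t ht; have := hg t ht => *; exact: is_deriveD.
Qed.

Lemma D2_scale d (c : R) f f1 f2 : D2 d f f1 f2 ->
  D2 d (fun t => c * f t) (fun t => c * f1 t) (c * f2).
Proof.
move=> [hf hf1]; split; last exact: is_deriveZ.
by move=> t ht; have := hf t ht => *; exact: is_deriveZ.
Qed.

Lemma D2_sqr d f f1 f2 : 0 < d -> D2 d f f1 f2 ->
  D2 d (fun t => f t * f t) (fun t => 2 * (f t * f1 t)) (2 * (f1 0 * f1 0 + f 0 * f2)).
Proof.
move=> d0 [hf hf1]; split.
  move=> t ht; have h := hf t ht.
  have h2 : is_derive t 1 (fun t => f t * f t) (f t * f1 t + f t * f1 t) := is_deriveM h h.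
  by rewrite mulrDl mul1r.
have h0 : is_derive (0:R) 1 f (f1 0) by apply: hf; rewrite normr0.
have h : is_derive (0:R) 1 (fun t => f t * f1 t) (f 0 * f2 + f1 0 * f1 0) := is_deriveM h0 hf1.
by rewrite [f1 0 * f1 0 + _]addrC; exact: is_deriveZ.
Qed.

Lemma D2_not_max d f f1 f2 : 0 < d -> 0 < f2 -> D2 d f f1 f2 ->
  (forall t, `|t| < d -> f t <= f 0) -> False.
Proof.
move=> d0 f20 [hf hf1] hmax.
have ioo (t : R) : t \in `]- d, d[ -> `|t| < d by rewrite in_itv /= ltr_norml.
have h0 : is_derive (0:R) 1 f 0.
  apply: (@derive1_at_max _ f (- d) d 0).
  - by rewrite ge0_cp // ltW.
  - by move=> t /ioo /hf [].
  - by rewrite in_itv /= oppr_lt0 d0.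
  - by move=> t /ioo; exact: hmax.
have f10 : f1 0 = 0.
  have h1 : is_derive (0:R) 1 f (f1 0) by apply: hf; rewrite normr0.
  by rewrite -(@derive_val _ _ _ _ _ _ _ h1) (@derive_val _ _ _ _ _ _ _ h0).
have [phi [p0 /cont_eps cp e]] := is_derive_hd hf1.
have [dd dd0 hd'] := cp f2 f20.
have pos (t : R) : 0 < t -> t < dd -> 0 < f1 t.
  move=> t0 tdd; have := hd' t%:C (Rline_real t); rewrite p0 subr0 norm_real ltcR gtr0_norm //.
  move=> /(_ tdd) /Re_le_norm; rewrite ReB /= ltr_norml => /andP[h _].
  have := e t%:C (Rline_real t); rewrite /= f10 !subr0.
  case: (phi _) h => a b /= h /eqP; rewrite eq_complex /= mul0r subr0 => /andP[/eqP -> _].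
  by rewrite mulr_gt0 //; lra.
set t := Num.min d dd / 2.
have m0 : 0 < Num.min d dd by rewrite lt_min d0.
have t0 : 0 < t by rewrite divr_gt0.
have tm : t < Num.min d dd by rewrite gtr_pMr // invf_lt1 // ltr1n.
have [td tdd] : t < d /\ t < dd by move: tm; rewrite lt_min => /andP.
have dom (x : R) : 0 <= x <= t -> `|x| < d.
  by move=> /andP[h1 h2]; rewrite ger0_norm //; exact: le_lt_trans td.
have [||c hc] := @MVT R f f1 0 t t0.
- by move=> x; rewrite in_itv /= => /andP[h1 h2]; apply: hf; apply: dom; rewrite !ltW.
- apply: derivable_within_continuous => x; rewrite in_itv /= => hx.
  by have [] := hf x (dom x hx).
rewrite subr0 => h; move: hc; rewrite in_itv /= => /andP[c0 ct].
have : 0 < f1 c * t by rewrite mulr_gt0 // pos // (lt_trans ct).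
rewrite -h subr_gt0 ltNge => /negP; apply; apply: hmax.
by rewrite gtr0_norm.
Qed.

Lemma hd_line (f : C -> C) z a (t : R) l : hd setT f (z + t%:C * a) l ->
  hd Rline (fun w => f (z + w * a)) t%:C (l * a).
Proof.
move=> h; apply: (@hd_comp _ Rline setT f (fun w => z + w * a)) => //.
rewrite -[a in hd _ _ _ a]add0r; apply: hd_add; first exact: hd_cst.
have := hd_mul (Rline_real t) (@hd_id _ Rline t%:C) (hd_cst Rline a t%:C).
by rewrite mul1r mulr0 addr0.
Qed.

Lemma D2_line (g g' g'' : C -> C) z (a : C) (d : R) : 0 < d ->
  (forall w, `|w - z| < d%:C -> hd setT g w (g' w) /\ hd setT g' w (g'' w)) -> `|a| = 1 ->
  D2 d (fun t => complex.Re (g (z + t%:C * a))) (fun t => complex.Re (g' (z + t%:C * a) * a))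
    (complex.Re (g'' z * a * a)) /\
  D2 d (fun t => complex.Im (g (z + t%:C * a))) (fun t => complex.Im (g' (z + t%:C * a) * a))
    (complex.Im (g'' z * a * a)).
Proof.
move=> d0 h a1.
have e (t : R) : `|t| < d -> `|z + t%:C * a - z| < d%:C.
  by move=> ht; rewrite addrAC subrr add0r normrM a1 mulr1 norm_real ltcR.
have g0 : hd Rline (fun w => g' (z + w * a) * a) (0:R)%:C (g'' z * a * a).
  have [_ hz] : hd setT g z (g' z) /\ hd setT g' z (g'' z).
    by apply: h; rewrite subrr normr0 ltcR.
  have hl : hd Rline (fun w => g' (z + w * a)) (0:R)%:C (g'' z * a).
    by apply: hd_line; rewrite mul0r addr0.
  by have := hd_mul (Rline_real 0) hl (hd_cst Rline a (0:R)%:C); rewrite mulr0 addr0.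
have [gR gI] := hd_Rline_fun g0.
by split; split => // t ht; have [ht1 _] := h _ (e t ht);
  have [] := hd_Rline_fun (hd_line ht1).
Qed.

Lemma i_norm : `|'i| = 1 :> C. Proof. by rewrite normCi. Qed.

(** Adding e |z|^2 to |g|^2 makes the Laplacian strictly positive. At an interior maximum the second
    derivatives along the directions 1 and i would have a nonpositive sum. *)
Lemma max_principle (r1 r2 : R) (g g' g'' : C -> C) (B : R) : 0 < r1 ->
  (forall z, annulus r1 r2 z -> hd (annulus r1 r2) g z (g' z) /\
                                hd (annulus r1 r2) g' z (g'' z)) ->
  (forall z, cabs z = r1 -> cabs (g z) ^+ 2 <= B) ->
  (forall z, cabs z = r2 -> cabs (g z) ^+ 2 <= B) ->
  forall z, annulus r1 r2 z -> cabs (g z) ^+ 2 <= B.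
Proof.
move=> r10 hg b1 b2 z0 Kz0; rewrite leNgt; apply/negP => Bz.
have r20 : 0 < r2.
  by move: Kz0 => /annulusE/andP[h1 h2]; apply: lt_le_trans r10 (le_trans h1 h2).
(* The perturbation is at most half of the excess of |g(z0)|^2 over B, so on both circles u stays
   below |g(z0)|^2 and its maximum is interior. *)
pose e := (cabs (g z0) ^+ 2 - B) / (2 * r2 ^+ 2).
have e0 : 0 < e by rewrite divr_gt0 ?subr_gt0 // mulr_gt0 // exprn_gt0.
have er : e * r2 ^+ 2 < cabs (g z0) ^+ 2 - B.
  have -> : e * r2 ^+ 2 = (cabs (g z0) ^+ 2 - B) / 2 by rewrite /e; field; rewrite gt_eqF.
  by rewrite gtr_pMr ?subr_gt0 // invf_lt1 // ltr1n.
pose u z := cabs (g z) ^+ 2 + e * cabs z ^+ 2.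
have cu z : annulus r1 r2 z -> cont_at (annulus r1 r2) (fun w => (u w)%:C) z.
  move=> Kz; have cg : cont_at (annulus r1 r2) g z := hd_cont Kz (hg z Kz).1.
  have c1 := cont_cabs cg; have c2 := cont_cabs (@cont_id _ (annulus r1 r2) z).
  have := cont_add (cont_mul c1 c1) (cont_mul (@cont_cst _ (annulus r1 r2) e%:C z) (cont_mul c2 c2)).
  by apply: cont_ext => // w _; rewrite /u !expr2 [RHS]rmorphD /= !rmorphM.
have [zs Ks hmax] := compact_max (ex_intro _ z0 Kz0) (@compact_annulus _ r1 r2 (ltW r10)) cu.
have uz : cabs (g z0) ^+ 2 <= u zs.
  apply: le_trans (hmax z0 Kz0); rewrite /u lerDl mulr_ge0 //; first exact: ltW.
  by rewrite exprn_ge0 // cabs_ge0.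
have /annulusE/andP[s1 s2] := Ks.
have bd : cabs (g zs) ^+ 2 <= B -> False.
  move=> h; have : u zs < cabs (g z0) ^+ 2.
    apply: (@le_lt_trans _ _ (B + e * r2 ^+ 2)); last by rewrite -ltrBrDl.
    apply: lerD => //; rewrite ler_pM2l // lerXn2r // nnegrE ?cabs_ge0 ?ltW //.
  by rewrite ltNge uz.
have [es1|ns1] := eqVneq (cabs zs) r1; first by apply: bd; exact: b1.
have [es2|ns2] := eqVneq (cabs zs) r2; first by apply: bd; exact: b2.
have {}s1 : r1 < cabs zs by rewrite lt_neqAle eq_sym ns1.
have {}s2 : cabs zs < r2 by rewrite lt_neqAle ns2.
(* Half of the distance to the boundary: the ball of radius 2d lies in the annulus, so every point
   within d of zs is interior. *)
pose d := Num.min (cabs zs - r1) (r2 - cabs zs) / 2.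
have m0 : 0 < Num.min (cabs zs - r1) (r2 - cabs zs) by rewrite lt_min !subr_gt0 s1.
have d0 : 0 < d by rewrite divr_gt0.
have dm : d + d <= Num.min (cabs zs - r1) (r2 - cabs zs) by rewrite -splitr.
have [d1 d2] : d + d <= cabs zs - r1 /\ d + d <= r2 - cabs zs.
  by move: dm; rewrite le_min => /andP.
have ballK w : `|w - zs| < (d + d)%:C -> annulus r1 r2 w.
  rewrite cabsE ltcR => hw; apply/annulusE.
  have t1 := cabs_triangle zs (w - zs); rewrite addrC subrK in t1.
  have t2 := cabs_triangle w (zs - w); rewrite addrC subrK in t2.
  have e1 : cabs (zs - w) = cabs (w - zs).
    by apply/complexI; rewrite -!cabsE distrC.
  by rewrite e1 in t2; apply/andP; split; lra.
have loc w : `|w - zs| < d%:C -> hd setT g w (g' w) /\ hd setT g' w (g'' w).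
  move=> hw; have nK : nbhs (w : C^o) (annulus r1 r2).
    apply/nbhsC; exists d => // v hv; apply: ballK; rewrite rmorphD /=.
    by rewrite -[v - zs](subrKA w); apply: le_lt_trans (ler_normD _ _) _; exact: ltrD.
  have Kw : annulus r1 r2 w by exact: nbhs_singleton nK.
  by have [h1 h2] := hg w Kw; split; exact: hd_interior nK _.
have [R1 I1] := D2_line d0 loc (normr1 _).
have [R2 I2] := D2_line d0 loc i_norm.
have id2 (a : C) : `|a| = 1 -> _ := fun ha =>
  @D2_line id (fun=> 1) (fun=> 0) zs a d d0 (fun w _ => conj (@hd_id _ setT w) (hd_cst setT 1 w)) ha.
have [R3 I3] := id2 1 (normr1 _); have [R4 I4] := id2 'i i_norm.
have S1 := D2_add (D2_add (D2_sqr d0 R1) (D2_sqr d0 I1)) (D2_scale e (D2_add (D2_sqr d0 R3) (D2_sqr d0 I3))).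
have S2 := D2_add (D2_add (D2_sqr d0 R2) (D2_sqr d0 I2)) (D2_scale e (D2_add (D2_sqr d0 R4) (D2_sqr d0 I4))).
apply: (D2_not_max d0 _ (D2_add S1 S2)); last first.
  move=> t ht; have k a : `|a| = 1 -> u (zs + t%:C * a) <= u zs.
    move=> a1; apply: hmax; apply: ballK; rewrite addrAC subrr add0r normrM a1 mulr1 norm_real ltcR.
    by apply: lt_le_trans ht _; rewrite lerDl ltW.
  have := lerD (k 1 (normr1 _)) (k 'i i_norm); rewrite /u !cabs_sqr !expr2.
  by rewrite !mul0r !addr0.
rewrite !mul0r !addr0 !mulr1 !mul0r.
move: (g'' zs) (g' zs) (g zs) => G2 G1 G0.
have ReiN w : complex.Re (w * 'i) = - complex.Im w by rewrite -complexiE ReiNIm.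
have ImiR w : complex.Im (w * 'i) = complex.Re w by rewrite -complexiE ImiRe.
rewrite !(ReiN, ImiR) /=.
have p1 : 0 <= complex.Re G1 * complex.Re G1 by rewrite -expr2 sqr_ge0.
have p2 : 0 <= complex.Im G1 * complex.Im G1 by rewrite -expr2 sqr_ge0.
(* The terms with g'' cancel because the squares of the two directions are 1 and -1; what remains is
   4 |g'|^2 + 4 e. *)
rewrite [ltRHS](_ : _ = 4 * (complex.Re G1 * complex.Re G1 + complex.Im G1 * complex.Im G1) + 4 * e).
  by apply: ltr_wpDl; [rewrite mulr_ge0 // addr_ge0|rewrite mulr_gt0].
by ring.
Qed.

Lemma cabs_exp z n : cabs (z ^+ n) = cabs z ^+ n.
Proof.
elim: n => [|n ih]; first by rewrite !expr0 (cabs_real 1) normr1.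
by rewrite !exprS cabsM ih.
Qed.
Lemma cabsV z : cabs z^-1 = (cabs z)^-1.
Proof.
have [->|z0] := eqVneq z 0.
  by rewrite !invr0 /cabs /= expr0n /= addr0 sqrtr0 invr0.
have c0 : cabs z != 0 by rewrite gt_eqF // cabs_gt0.
by apply: (mulfI c0); rewrite -cabsM !divff // (cabs_real 1) normr1.
Qed.

Lemma annulus_neq0 (r1 r2 : R) z : 0 < r1 -> annulus r1 r2 z -> z != 0.
Proof. by move=> r10 /annulusE/andP[h _]; rewrite -cabs_gt0 (lt_le_trans r10). Qed.

(** The function f/z^n vanishes on the inner circle and is at most M/r2^n on the outer one, hence
    |f(z0)| <= M (|z0|/r2)^n for all n. *)
Lemma identity_interior (r1 r2 : R) (f : C -> C) : 0 < r1 ->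
  (forall n, hol n (annulus r1 r2) f) -> (forall z, cabs z = r1 -> f z = 0) ->
  forall z, annulus r1 r2 z -> cabs z < r2 -> f z = 0.
Proof.
move=> r10 hf f0 z0 Kz0 z02; set K := annulus r1 r2 in hf Kz0.
have z0K : z0 != 0 := annulus_neq0 r10 Kz0.
have cz0 : 0 < cabs z0 by rewrite cabs_gt0.
have r20 : 0 < r2 by apply: lt_trans z02.
apply: contrapT => /eqP fz0.
have A0 : 0 < cabs (f z0) ^+ 2 by rewrite exprn_gt0 // cabs_gt0.
have cf z : K z -> cont_at K (fun w => (cabs (f w))%:C) z.
  by move=> Kz; apply: cont_cabs; have [f' [df _]] := hf 1%N; exact: hd_cont (df z Kz).
have [zm Km hmax] := compact_max (ex_intro _ z0 Kz0) (@compact_annulus _ r1 r2 (ltW r10)) cf.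
set M := cabs (f zm) in hmax.
pose q := (cabs z0 / r2) ^+ 2.
have bound n : cabs (f z0) ^+ 2 <= M ^+ 2 * q ^+ n.
  pose g w := f w * (w ^+ n)^-1.
  have hg : hol 2 K g.
    apply: hol_mul => //; apply: hol_inv; last exact: hol_exp (hol_id _ _).
    by move=> w Kw; rewrite expf_neq0 // (annulus_neq0 r10 Kw).
  have [g' [dg [g'' [dg' _]]]] := hg.
  have c2 : cabs (g z0) ^+ 2 <= M ^+ 2 / (r2 ^+ n) ^+ 2.
    apply: (@max_principle r1 r2 g g' g'' _ r10) => //.
    - by move=> z Kz; split; [exact: dg|exact: dg'].
    - move=> z hz; rewrite /g f0 // mul0r (cabs_real 0) normr0 expr0n /=.
      by rewrite divr_ge0 // exprn_ge0 // ?cabs_ge0 // exprn_ge0 // ltW.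
    - move=> z hz; rewrite /g cabsM cabsV cabs_exp hz expr_div_n.
      have Kz : K z.
        apply/annulusE; rewrite hz lexx andbT; move: Kz0 => /annulusE/andP[h _].
        exact: le_trans h (ltW z02).
      rewrite ler_pM2r ?invr_gt0 ?exprn_gt0 // lerXn2r ?nnegrE ?cabs_ge0 //.
      exact: hmax.
  move: c2; rewrite /g cabsM cabsV cabs_exp expr_div_n ler_pdivrMr ?exprn_gt0 //.
  move=> h; apply: le_trans h _; rewrite -mulrA ler_wpM2l ?exprn_ge0 ?cabs_ge0 //.
  by rewrite /q !expr_div_n -!exprM mulnC mulrC.
have q1 : `|q| < 1.
  rewrite ger0_norm ?exprn_ge0 ?divr_ge0 ?cabs_ge0 ?(ltW r20) //.
  by rewrite exprn_ilt1 ?divr_ge0 ?cabs_ge0 ?(ltW r20) // ltr_pdivrMr // mul1r.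
have cq : M ^+ 2 * q ^+ n @[n --> \oo] --> M ^+ 2 * 0.
  by apply: cvgMr; exact: cvg_expr.
rewrite mulr0 in cq; move/cvgrPdist_lt: cq => /(_ _ A0)[N _ /(_ N (leqnn N))].
rewrite sub0r normrN ger0_norm; first by rewrite ltNge bound.
have q0 : 0 <= q by apply: exprn_ge0; rewrite divr_ge0 ?cabs_ge0 // ltW.
by apply: mulr_ge0; apply: exprn_ge0; [exact: cabs_ge0|].
Qed.

(* The maximum principle for f / z^n, n -> oo. *)
Lemma annulus_identity (r1 r2 : R) (f : C -> C) : 0 < r1 -> r1 < r2 ->
  (forall n, hol n (annulus r1 r2) f) -> (forall z, cabs z = r1 -> f z = 0) ->
  forall z, annulus r1 r2 z -> f z = 0.
Proof.
move=> r10 r12 hf f0 z Kz; have /annulusE/andP[z1 z2] := Kz.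
have [zr|zr] := ltP (cabs z) r2; first exact: identity_interior Kz zr.
have {zr}ez : cabs z = r2 by apply/eqP; rewrite eq_le z2.
apply: contrapT => /eqP fz0.
have [f' [df _]] := hf 1%N; have /cont_eps := hd_cont Kz (df z Kz).
have c0 : 0 < cabs (f z) by rewrite cabs_gt0.
move=> /(_ _ c0)[d d0 hd'].
have r20 : 0 < r2 by exact: lt_trans r12.
(* A point on the outer circle is moved inward by e r2: little enough to stay in the annulus and
   within d, so that continuity of f applies. *)
pose e := Num.min (d / 2) (r2 - r1) / r2.
have m0 : 0 < Num.min (d / 2) (r2 - r1) by rewrite lt_min divr_gt0 //= subr_gt0.
have e0 : 0 < e by rewrite divr_gt0.
have er : e * r2 = Num.min (d / 2) (r2 - r1) by rewrite /e divfK // gt_eqF.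
pose w := z * (1 - e)%:C.
have e1 : e * r2 <= r2 - r1 by rewrite er ge_min lexx orbT.
have ee : 0 <= 1 - e by rewrite subr_ge0 -(ler_pM2r r20) mul1r; apply: le_trans e1 _; rewrite gerBl ltW.
have cw : cabs w = r2 - e * r2 by rewrite /w cabsM ez cabs_real ger0_norm // mulrBr mulr1 mulrC.
have Kw : annulus r1 r2 w.
  by apply/annulusE; rewrite cw; apply/andP; split; [rewrite lerBrDr addrC -lerBrDr|rewrite gerBl mulr_ge0 ?ltW].
have fw : f w = 0.
  by apply: (identity_interior r10 hf f0 Kw); rewrite cw gtrBl mulr_gt0.
suff dw : `|w - z| < d%:C.
  by have := hd' w Kw dw; rewrite fw sub0r normrN cabsE ltcR ltxx.
have -> : w - z = z * (- e)%:C.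
  by rewrite /w rmorphB /= mulrBr mulr1 rmorphN /= mulrN addrAC subrr add0r.
rewrite cabsE cabsM ez cabs_real normrN gtr0_norm // ltcR mulrC er.
by apply: (@le_lt_trans _ _ (d / 2)); [rewrite ge_min lexx|rewrite gtr_pMr // invf_lt1 // ltr1n].
Qed.

End MaximumPrinciple.

(** * Logarithms on the annulus *)

Section Logarithm.
Variable R : realType.
Local Notation C := R[i].
Local Notation Rline := (@Rline R).
Implicit Types (K L : set C) (z w : C).

Lemma cont_ext_near K (f g : C -> C) z : K z -> f z = g z ->
  (exists2 d : R, 0 < d & forall w, K w -> `|w - z| < d%:C -> f w = g w) ->
  cont_at K f z -> cont_at K g z.
Proof.
move=> Kz fg [d d0 h] /cont_eps cf; apply/cont_eps => e e0; have [d' d'0 h'] := cf e e0.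
exists (Num.min d d'); first by rewrite lt_min d0.
move=> w Kw hw; have h1 : `|w - z| < d%:C.
  by apply: lt_le_trans hw _; rewrite lecR ge_min lexx.
rewrite -fg -h //; apply: h' => //.
by apply: lt_le_trans hw _; rewrite lecR ge_min lexx orbT.
Qed.

Lemma cont_neq0 K (f : C -> C) z : f z != 0 -> cont_at K f z ->
  nbhs (z : C^o) (fun w => K w -> f w != 0).
Proof.
move=> f0 /cont_eps; have c0 : 0 < cabs (f z) by rewrite cabs_gt0.
move=> /(_ _ c0)[d d0 h]; apply/nbhsC; exists d => // w hw Kw.
by apply/eqP => e; have := h w Kw hw; rewrite e sub0r normrN cabsE ltxx.
Qed.

(** Along a curve with nonzero velocity the points near a parameter are distinct from its image, so
    a union of such curves has no isolated points. *)
Lemma perfect_curve (Z : set C) :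
  (forall z, Z z -> exists (s : C -> C) (x l : C),
    [/\ Rline x, hd Rline s x l, l != 0, s x = z & forall w, Rline w -> Z (s w)]) ->
  perfect Z.
Proof.
move=> h z /h[s [x [l [Lx ds l0 <- hs]]]] U nU.
have /cont_nbhs cs := hd_cont Lx ds; have nsU := cs _ nU.
have [phi [el cphi e]] := ds.
have n2 : nbhs (x : C^o) (fun w => Rline w -> phi w != 0).
  by apply: cont_neq0 => //; rewrite el.
have [w [Lw wx [h1 h2]]] := perfect_Rline Lx (filterI nsU n2).
exists (s w); split; [exact: hs| |exact: h1].
move=> /eqP; rewrite -subr_eq0 e // mulf_eq0 subr_eq0 => /orP[/eqP//|].
by rewrite (negPf (h2 Lw)).
Qed.

Lemma hd_rot (z : C) : hd Rline (fun w => z * expi (complex.Re w)) 0 (z * 'i).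
Proof.
have -> : z * 'i = 0 * expi (complex.Re (0 : C)) + z * ('i * expi 0) by rewrite mul0r add0r expi0 mulr1.
by apply: hd_mul => //; [exact: hd_cst|exact: hd_expi].
Qed.

Lemma perfect_rot (Z : set C) : (forall z (t : R), Z z -> z != 0 /\ Z (z * expi t)) -> perfect Z.
Proof.
move=> hZ; apply: perfect_curve => z Zz; exists (fun w => z * expi (complex.Re w)), 0, (z * 'i).
have [z0 _] := hZ z 0 Zz.
split => //; first exact: hd_rot.
- by rewrite mulf_neq0 // neq0Ci.
- by rewrite expi0 mulr1.
- by move=> w _; have [_] := hZ z (complex.Re w) Zz.
Qed.

Lemma perfect_annulus (r1 r2 : R) : 0 < r1 -> perfect (annulus r1 r2).
Proof.
move=> r10; apply: perfect_rot => z t Kz; split; first exact: annulus_neq0 Kz.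
by apply/annulusE; rewrite cabsM cabs_expi mulr1; apply/annulusE.
Qed.

Lemma perfect_image K L (f g : C -> C) : perfect K -> (forall z, K z -> cont_at K f z) ->
  (forall z, K z -> L (f z)) -> (forall z, L z -> K (g z)) ->
  (forall z, K z -> g (f z) = z) -> (forall z, L z -> f (g z) = z) -> perfect L.
Proof.
move=> pK cf fL gK gf fg z Lz U nU.
have Kg := gK z Lz; have /cont_nbhs := cf _ Kg; rewrite fg // => /(_ U nU) h.
have [w [Kw wg hw]] := pK _ Kg _ h; exists (f w); split; [exact: fL| |exact: hw].
by move=> fw; apply: wg; rewrite -fw gf.
Qed.

Lemma cont_real (h : C -> R) (psi : R -> R) K z : {for h z, continuous psi} ->
  cont_at K (fun w => (h w)%:C) z -> cont_at K (fun w => (psi (h w))%:C) z.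
Proof.
move=> cpsi /cont_eps ch; apply/cont_eps => e e0.
have /cvgrPdist_lt/(_ _ e0)/nbhs_ballP[d /= d0 hd'] := cpsi; have [d' d'0 h'] := ch d d0.
exists d' => // w Kw hw; rewrite -rmorphB norm_real ltcR distrC.
apply: hd'; rewrite /ball /= distrC.
by have := h' w Kw hw; rewrite -rmorphB norm_real ltcR.
Qed.

(** The principal logarithm on the right half-plane. The modulus is written as x sqrt(1 + (y/x)^2)
    to match the cosine of the arctangent. *)
Definition plog z : C :=
  (ln (complex.Re z * Num.sqrt (1 + (complex.Im z / complex.Re z) ^+ 2)))%:C
  + 'i * (atan (complex.Im z / complex.Re z))%:C.

Lemma Re_plog z : complex.Re (plog z) = ln (complex.Re z * Num.sqrt (1 + (complex.Im z / complex.Re z) ^+ 2)).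
Proof. by rewrite /plog /=; ring. Qed.
Lemma Im_plog z : complex.Im (plog z) = atan (complex.Im z / complex.Re z).
Proof. by rewrite /plog /=; ring. Qed.

Lemma plogK z : 0 < complex.Re z -> cexp (plog z) = z.
Proof.
case: z => x y /= x0; rewrite /cexp Re_plog Im_plog /= /expi.
set t := y / x; set s := Num.sqrt _.
have s0 : 0 < s by rewrite sqrtr_gt0 ltr_pwDl // sqr_ge0.
have ca : cos (atan t) = s^-1 by rewrite cos_atan.
have sa : sin (atan t) = t / s.
  have c0 : cos (atan t) != 0 by rewrite ca invr_neq0 // gt_eqF.
  by rewrite -[sin _](divfK c0) -/(tan _) atanK ca.
rewrite lnK ?posrE ?mulr_gt0 // ca sa.
have s1 : s != 0 by rewrite gt_eqF.
have x1 : x != 0 by rewrite gt_eqF.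
by apply/eqP; rewrite eq_complex /= /t; apply/andP; split; apply/eqP; field; rewrite x1 s1.
Qed.

Lemma cont_plog K z : K z -> 0 < complex.Re z -> cont_at K plog z.
Proof.
move=> Kz x0.
have cr : cont_at K (fun w => (complex.Re w)%:C) z by apply: cont_sub (cont_Re z).
have ct : cont_at K (fun w => (complex.Im w / complex.Re w)%:C) z.
  apply: (@cont_ext _ _ (fun w => (complex.Im w)%:C * ((complex.Re w)%:C)^-1)) => //.
    by move=> w _; rewrite -fmorphV -rmorphM.
  apply: cont_mul; first by apply: cont_sub (cont_Im z).
  by apply: cont_inv => //; rewrite fmorph_eq0 gt_eqF.
apply: cont_add.
  apply: (@cont_real _ (@ln R)); first by apply: continuous_ln; rewrite mulr_gt0 // sqrtr_gt0 ltr_pwDl // sqr_ge0.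
  apply: (@cont_ext _ _ (fun w => (complex.Re w)%:C * (Num.sqrt (1 + (complex.Im w / complex.Re w) ^+ 2))%:C)) => //.
    by move=> w _; rewrite -rmorphM.
  apply: cont_mul => //; apply: (@cont_real _ (@Num.sqrt R)); first exact: sqrt_continuous.
  apply: (@cont_ext _ _ (fun w => 1 + (complex.Im w / complex.Re w)%:C * (complex.Im w / complex.Re w)%:C)) => //.
    by move=> w _; move: (complex.Im w / complex.Re w) => t; rewrite rmorphD rmorph1 expr2 rmorphM.
  by apply: cont_add; [exact: cont_cst|exact: cont_mul].
apply: cont_mul; first exact: cont_cst.
by apply: (@cont_real _ (@atan R)) => //; exact: continuous_atan.
Qed.

(** With phi and gam the extended difference quotients of exp at f(z) and of g at z, (f(w) - f(z))
    phi(f(w)) = (w - z) gam(w); division by phi differentiates f. The derivative g'/g gives the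
    higher orders. *)
Lemma log_hol K (f g : C -> C) : perfect K -> (forall z, K z -> cont_at K f z) ->
  (forall z, K z -> cexp (f z) = g z) -> (forall n, hol n K g) -> forall n, hol n K f.
Proof.
move=> pK cf fg hg.
have g0 z : K z -> g z != 0 by move=> Kz; rewrite -fg // cexp_neq0.
have [g' [dg hg']] : exists g', (forall z, K z -> hd K g z (g' z)) /\ forall n, hol n K g'.
  have [g' [dg _]] := hg 1%N; exists g'; split=> // n; have [g2 [dg2 hg2]] := hg n.+1.
  by apply: hol_ext hg2 => w Kw; exact: hd_uniq (dg2 w Kw) (dg w Kw).
have dlog z : K z -> hd K f z (g' z * (g z)^-1).
  move=> Kz; have [phi [ephi cphi e]] := @hd_cexp _ setT (f z).
  have [gam [egam cgam e']] := dg z Kz.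
  have p0 : phi (f z) != 0 by rewrite ephi cexp_neq0.
  have cpf : cont_at K (fun w => phi (f w)) z by apply: (@cont_comp _ K setT phi f) => //; exact: cf.
  have key w : K w -> (f w - f z) * phi (f w) = (w - z) * gam w.
    by move=> Kw; rewrite -e // -e' // !fg.
  (* Far from z the factor phi(f(w)) may vanish; there the plain difference quotient is used. Near z
     only the last branch occurs. *)
  exists (fun w => if phi (f w) == 0 then (if w == z then g' z / g z else (f w - f z) / (w - z)) else gam w / phi (f w)).
  split.
  - by rewrite (negPf p0) ephi fg // egam.
  - apply: (@cont_ext_near _ (fun w => gam w / phi (f w))) => //; last first.
    + by apply: cont_mul => //; exact: cont_inv.
    + have /cont_eps := cpf; have : 0 < cabs (phi (f z)) by rewrite cabs_gt0.
      move=> h /(_ _ h)[d d0 hd']; exists d => // w Kw hw; case: eqP => // p1.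
      by have := hd' w Kw hw; rewrite p1 sub0r normrN cabsE ltxx.
    + by rewrite (negPf p0).
  - move=> w Kw; have := key w Kw; case: eqP => [-> |/eqP p1] h.
      case: eqP => [->|/eqP wz]; first by rewrite !subrr mul0r.
      by rewrite mulrCA divff ?mulr1 // subr_eq0.
    by apply: (mulIf p1); rewrite h -mulrA divfK.
case=> // n; exists (fun z => g' z * (g z)^-1); split; first exact: dlog.
by apply: hol_mul; [exact: hg'|apply: hol_inv].
Qed.

Lemma unif_cont K (g : C -> C) (e : R) : compact (K : set C^o) ->
  (forall z, K z -> cont_at K g z) -> 0 < e ->
  exists2 d : R, 0 < d & forall z w, K z -> K w -> `|w - z| < d%:C -> `|g w - g z| < e%:C.
Proof.
move=> /compact_near_coveringP cK cg e0.
have e20 : 0 < e / 2 by rewrite divr_gt0.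
have /= := cK R (0 : R)^'+ (fun d z => K z -> forall w, K w -> `|w - z| < d%:C -> `|g w - g z| < e%:C) _.
case.
  move=> z Kz; have /cont_eps/(_ _ e20)[d d0 h] := cg z Kz.
  have d20 : 0 < d / 2 by rewrite divr_gt0.
  exists ([set w | `|w - z| < (d / 2)%:C] : set C^o, [set x : R | x < d / 2]) => /=.
    split; first by apply/nbhsC; exists (d / 2).
    by apply: nbhs_right_lt.
  move=> [w x] [hw hx] Kw v Kv hv; rewrite /= in hw hx.
  have -> : g v - g w = (g v - g z) - (g w - g z) by ring.
  apply: le_lt_trans (ler_normB _ _) _; rewrite [e]splitr rmorphD ltrD //; apply: h => //.
    have -> : v - z = (v - w) + (w - z) by ring.
    apply: le_lt_trans (ler_normD _ _) _; rewrite [d]splitr rmorphD ltrD //.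
    by apply: lt_trans hv _; rewrite ltcR.
  by apply: lt_trans hw _; rewrite ltcR ltr_pdivrMr // mulr_natr mulr2n ltrDl.
move=> d /= d0 hd'; exists (d / 2); first by rewrite divr_gt0.
move=> z w Kz Kw hw; apply: (hd' (d / 2)) => //=; last by rewrite divr_gt0.
by rewrite sub0r normrN gtr0_norm ?divr_gt0 // ltr_pdivrMr // mulr_natr mulr2n ltrDl.
Qed.

End Logarithm.

(** * Logarithms continued from a circle to the annulus *)

Section Circle.
Variable R : realType.
Local Notation C := R[i].
Local Notation Rline := (@Rline R).
Implicit Types (K L : set C) (z w : C).

Lemma Rline_eps (f : R -> C) (x e : R) : 0 < e ->
  cont_at Rline (fun w => f (complex.Re w)) x%:C ->
  exists2 d : R, 0 < d & forall t : R, `|t - x| < d -> `|f t - f x| < e%:C.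
Proof.
move=> e0 /cont_eps/(_ _ e0)[d d0 h]; exists d => // t ht.
by apply: (h t%:C) => //; rewrite -rmorphB norm_real ltcR.
Qed.

(** The lifts to the line of orientation-preserving diffeomorphisms of the circle. *)
Definition diffeo1 (alpha : R -> R) : Prop :=
  [/\ rsmooth alpha, forall t : R, 0 < derive1 alpha t &
      forall t : R, alpha (t + 2 * pi) = alpha t + 2 * pi].

Lemma diffeo1_derive alpha (t : R) : diffeo1 alpha -> is_derive t 1 alpha (derive1 alpha t).
Proof.
move=> [h _ _]; have := h 0%N t => /= /derivableP; by rewrite derive1E.
Qed.

Lemma diffeo1_cont alpha (t : R) : diffeo1 alpha -> {for t, continuous alpha}.
Proof. by move=> [h _ _]; apply: differentiable_continuous; apply/derivable1_diffP; exact: (h 0%N t). Qed.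

Lemma diffeo1_lt alpha (x y : R) : diffeo1 alpha -> x < y -> alpha x < alpha y.
Proof.
move=> ha xy; have [ha1 ha2 _] := ha; apply: (@gtr0_derive1_incr _ _ x y) => //.
- by move=> t _; exact: (ha1 0%N t).
- by apply: continuous_subspaceT => t; exact: diffeo1_cont.
Qed.

Lemma diffeo1_inj alpha : diffeo1 alpha -> injective alpha.
Proof.
move=> ha x y e; have [xy|yx|//] := ltgtP x y.
  by have := diffeo1_lt ha xy; rewrite e ltxx.
by have := diffeo1_lt ha yx; rewrite e ltxx.
Qed.

Lemma periodic_int (T : Type) (l : R -> T) : (forall t : R, l (t + 2 * pi) = l t) ->
  forall (k : int) (t : R), l (t + 2 * pi * k%:~R) = l t.
Proof.
move=> hl; have hn (n : nat) (t : R) : l (t + 2 * pi * n%:R) = l t.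
  elim: n t => [|n ih] t; first by rewrite mulr0 addr0.
  by rewrite -(addn1 n) natrD mulrDr mulr1 addrA hl ih.
case=> n t; first exact: hn.
rewrite -(hn n.+1); congr l; rewrite NegzE mulrNz mulrN.
by rewrite subrK.
Qed.

Lemma quasi_int alpha : diffeo1 alpha ->
  forall (k : int) (t : R), alpha (t + 2 * pi * k%:~R) = alpha t + 2 * pi * k%:~R.
Proof.
move=> [_ _ hl] k t; apply/eqP; rewrite -subr_eq; apply/eqP.
have hp (s : R) : alpha (s + 2 * pi) - (s + 2 * pi) = alpha s - s by rewrite hl; ring.
have := periodic_int hp k t => /= h; rewrite -(addrNK t (alpha t)) -h; ring.
Qed.

Lemma diffeo1_expi alpha (T : Type) (l : R -> T) : diffeo1 alpha ->
  (forall t : R, l (t + 2 * pi) = l t) ->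
  forall x y : R, expi (alpha x) = expi (alpha y) :> C -> l x = l y.
Proof.
move=> ha hl x y e; have /expi_eq1[k hk] : expi (alpha x - alpha y) = 1 :> C.
  by rewrite expiD expiN e divff // expi_neq0.
have -> : x = y + 2 * pi * k%:~R.
  by apply: (diffeo1_inj ha); rewrite quasi_int // -hk addrC subrK.
exact: periodic_int.
Qed.

Lemma diffeo1_surj alpha z : diffeo1 alpha ->
  exists2 t : R, 0 <= t <= 2 * pi & z = (cabs z)%:C * expi (alpha t).
Proof.
move=> ha; have [s hs ez] := polar_ex z.
have p0 : 0 < 2 * pi :> R by rewrite mulr_gt0 // pi_gt0.
pose k := Num.floor ((s - alpha 0) / (2 * pi)); pose v := s - 2 * pi * k%:~R.
have h0 := floor_le_tmp ((s - alpha 0) / (2 * pi)).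
have h1 := floorD1_gt ((s - alpha 0) / (2 * pi)).
have v1 : alpha 0 <= v <= alpha 0 + 2 * pi.
  rewrite /v; move: h0 h1; rewrite -/k ler_pdivlMr // ltr_pdivrMr // rmorphD /=.
  by move=> h0 h1; apply/andP; split; lra.
have a2 : alpha (2 * pi) = alpha 0 + 2 * pi by case: ha => _ _ <-; rewrite add0r.
have [t ht e] : exists2 t, t \in `[0, 2 * pi] & alpha t = v.
  apply: (IVT (ltW p0)).
    by apply: continuous_subspaceT => t; exact: diffeo1_cont.
  by rewrite a2 min_l ?max_r // lerDl ltW.
exists t; first by move: ht; rewrite in_itv.
by rewrite e /v expiD -mulrN -rmorphN expi_int mulr1.
Qed.

Lemma cont_expi_comp (f : R -> R) (x : R) : {for x, continuous f} ->
  cont_at Rline (fun w => expi (f (complex.Re w))) x%:C.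
Proof.
move=> cf; apply: (@cont_comp _ Rline Rline (fun w => expi (complex.Re w)) (fun w => (f (complex.Re w))%:C)) => //.
  apply: (@cont_real _ _ f) => //; apply: cont_sub (cont_Re _) => //.
by have := hd_expi (f x); apply: hd_cont.
Qed.

(** A periodic function of the parameter descends to the circle. The chosen parameter [tau] may jump
    by a period, but the descended function does not: by compactness of one period, parameters whose
    points approach z0 have values approaching that at z0. *)
Lemma circle_log (r : R) alpha (l : R -> C) : 0 < r -> diffeo1 alpha ->
  (forall t : R, l (t + 2 * pi) = l t) ->
  (forall t : R, cont_at Rline (fun w => l (complex.Re w)) t%:C) ->
  exists H : C -> C, (forall z, cabs z = r -> cont_at [set z | cabs z = r] H z) /\
    forall t : R, H (r%:C * expi (alpha t)) = l t.
Proof.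
move=> r0 ha hl cl.
have cb (t : R) : cabs (r%:C * expi (alpha t)) = r by rewrite cabsM cabs_expi mulr1 cabs_real gtr0_norm.
have rC : r%:C != 0 :> C by rewrite fmorph_eq0 gt_eqF.
have /choice[tau htau] z : exists t : R, (0 <= t <= 2 * pi) /\ z = (cabs z)%:C * expi (alpha t).
  by have [t ? ?] := diffeo1_surj z ha; exists t.
pose H z := l (tau z).
have Hb (t : R) : H (r%:C * expi (alpha t)) = l t.
  apply: (diffeo1_expi ha hl); apply: (mulfI rC).
  by have [_] := htau (r%:C * expi (alpha t)); rewrite cb => <-.
exists H; split => // z0 cz0.
have ez0 : z0 = r%:C * expi (alpha (tau z0)) by have [_] := htau z0; rewrite cz0.
apply/cont_eps => e e0.
have /compact_near_coveringP/(_ R (0 : R)^'+ (fun d t => `|r%:C * expi (alpha t) - z0| < d%:C -> `|l t - H z0| < e%:C) _) := @segment_compact R 0 (2 * pi).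
case.
  move=> t ht; have [bt|bt] := eqVneq (r%:C * expi (alpha t)) z0.
    have [d d0 h] := Rline_eps e0 (cl t).
    exists ([set s : R | `|s - t| < d], setT) => /=.
      split; last exact: filterT.
      by apply/nbhs_ballP; exists d => // s; rewrite /ball /= distrC.
    by move=> [s x] /= [hs _] _; rewrite -bt Hb; apply: h.
  pose rho := cabs (r%:C * expi (alpha t) - z0) / 2.
  have rho0 : 0 < rho by rewrite divr_gt0 // cabs_gt0 subr_eq0.
  have cf : cont_at Rline (fun w => r%:C * expi (alpha (complex.Re w))) t%:C.
    by apply: cont_mul; [exact: cont_cst|apply: cont_expi_comp; exact: diffeo1_cont].
  have [d d0 h] := @Rline_eps (fun s => r%:C * expi (alpha s)) t _ rho0 cf.
  exists ([set s : R | `|s - t| < d], [set x : R | x < rho]) => /=.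
    split; last exact: nbhs_right_lt.
    by apply/nbhs_ballP; exists d => // s; rewrite /ball /= distrC.
  move=> [s x] [/= hs hx] hb; exfalso; have := h s hs; rewrite !cabsE !ltcR in hb *.
  move=> hh; have : cabs (r%:C * expi (alpha t) - z0) <= cabs (r%:C * expi (alpha s) - z0)
      + cabs (r%:C * expi (alpha s) - r%:C * expi (alpha t)).
    rewrite -lecR rmorphD /= -!cabsE.
    have -> : r%:C * expi (alpha t) - z0 = (r%:C * expi (alpha s) - z0)
      - (r%:C * expi (alpha s) - r%:C * expi (alpha t)) by ring.
    exact: ler_normB.
  have -> : cabs (r%:C * expi (alpha t) - z0) = rho + rho by rewrite -splitr.
  by move: hx hh hb => *; lra.
move=> d /= d0 hd'; exists (d / 2); first by rewrite divr_gt0.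
move=> w /= cw hw; have [tw ew] := htau w; rewrite cw in ew.
apply: (hd' (d / 2) _ _ (tau w)) => //=; last by rewrite -ew.
  by rewrite sub0r normrN gtr0_norm ?divr_gt0 // ltr_pdivrMr // mulr_natr mulr2n ltrDl.
by rewrite divr_gt0.
Qed.

(** The logarithm given on one circle is continued radially in N steps. Each step changes g by less
    than the minimum of |g|, so the quotient of consecutive values lies in the right half-plane,
    where [plog] is a continuous logarithm. *)
Lemma annulus_log (r1 r2 r : R) alpha (l : R -> C) (g : C -> C) :
  0 < r1 -> r1 <= r <= r2 -> diffeo1 alpha ->
  (forall t : R, l (t + 2 * pi) = l t) ->
  (forall t : R, cont_at Rline (fun w => l (complex.Re w)) t%:C) ->
  (forall t : R, cexp (l t) = g (r%:C * expi (alpha t))) ->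
  (forall z, annulus r1 r2 z -> cont_at (annulus r1 r2) g z) ->
  (forall z, annulus r1 r2 z -> g z != 0) ->
  exists H : C -> C, (forall z, annulus r1 r2 z -> cont_at (annulus r1 r2) H z) /\
     forall z, annulus r1 r2 z -> cexp (H z) = g z.
Proof.
move=> r10 /andP[rr1 rr2] ha hl cl hexp cg g0; set K := annulus r1 r2 in cg g0 *.
have r0 : 0 < r by exact: lt_le_trans rr1.
have [H0 [cH0 H0l]] := circle_log r0 ha hl cl.
have cK : compact (K : set C^o) := compact_annulus (ltW r10).
have Kr : K r%:C by apply/annulusE; rewrite cabs_real gtr0_norm // rr1.
have [zm Kzm hm] : exists2 z, K z & forall w, K w -> cabs (g z) <= cabs (g w).
  have [|z Kz h] := @compact_max _ K (fun z => - cabs (g z)) (ex_intro _ _ Kr) cK.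
    move=> z Kz; apply: (@cont_ext _ _ (fun w => - (cabs (g w))%:C)) => //.
      by move=> w _; rewrite rmorphN.
    by apply: cont_opp; apply: cont_cabs; exact: cg.
  by exists z => // w /h; rewrite lerN2.
have m0 : 0 < cabs (g zm) by rewrite cabs_gt0 g0.
have [d d0 hd'] := unif_cont cK cg m0.
(* Enough steps for a radial step to be shorter than the modulus d of uniform continuity. *)
pose N := (Num.truncn ((r2 - r1) / d)).+1.
have N0 : 0 < N%:R :> R by rewrite ltr0n.
have NR : N%:R != 0 :> R by rewrite gt_eqF.
have Nd : (r2 - r1) / N%:R < d.
  rewrite ltr_pdivrMr // -ltr_pdivrMl // mulrC; exact: truncnS_gt.
(* A radial homotopy from the projection to the circle of radius r, at k = 0, to the identity, at k
   = N. *)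
pose rho (k : nat) z := r + k%:R / N%:R * (cabs z - r).
pose P k z := z * (rho k z / cabs z)%:C.
have zK z : K z -> 0 < cabs z by move=> Kz; rewrite cabs_gt0 (annulus_neq0 r10 Kz).
have rho_in k z : (k <= N)%N -> K z -> r1 <= rho k z <= r2.
  move=> kN /annulusE/andP[z1 z2]; rewrite /rho.
  have : 0 <= (k%:R / N%:R : R) <= 1.
    by rewrite divr_ge0 ?ler0n //= ler_pdivrMr // mul1r ler_nat.
  move: (k%:R / N%:R) (cabs z) z1 z2 => x c z1 z2 /andP[x0 x1].
  have -> : r + x * (c - r) = (1 - x) * r + x * c by ring.
  have x1' : 0 <= 1 - x by rewrite subr_ge0.
  apply/andP; split.
    have -> : r1 = (1 - x) * r1 + x * r1 by ring.
    by rewrite lerD // ler_wpM2l.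
  have -> : r2 = (1 - x) * r2 + x * r2 by ring.
  by rewrite lerD // ler_wpM2l.
have cabsP k z : (k <= N)%N -> K z -> cabs (P k z) = rho k z.
  move=> kN Kz; have /andP[h _] := rho_in k z kN Kz; have z0 := zK z Kz.
  by rewrite /P cabsM cabs_real ger0_norm ?divr_ge0 ?(le_trans _ h) ?ltW // mulrC divfK // gt_eqF.
have PK k z : (k <= N)%N -> K z -> K (P k z).
  by move=> kN Kz; apply/annulusE; rewrite cabsP //; exact: rho_in.
have P0 z : K z -> cabs (P 0%N z) = r.
  by move=> Kz; rewrite cabsP // /rho mul0r mul0r addr0.
have PN z : K z -> P N z = z.
  by move=> Kz; rewrite /P /rho divff // mul1r addrC subrK divff ?mulr1 // gt_eqF // zK.
have cP k z : (k <= N)%N -> K z -> cont_at K (P k) z.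
  move=> kN Kz; have cc : cont_at K (fun w => (cabs w)%:C) z by apply: cont_cabs; exact: cont_id.
  apply: cont_mul; first exact: cont_id.
  apply: (@cont_ext _ _ (fun w => (r%:C + (k%:R / N%:R)%:C * ((cabs w)%:C - r%:C)) * ((cabs w)%:C)^-1)) => //.
    by move=> w _; rewrite /rho -fmorphV -rmorphB -rmorphM -rmorphD -rmorphM.
  apply: cont_mul; last by apply: cont_inv => //; rewrite fmorph_eq0 gt_eqF // zK.
  apply: cont_add; first exact: cont_cst.
  apply: cont_mul; first exact: cont_cst.
  by apply: cont_add => //; exact: cont_cst.
have PP k z : (k < N)%N -> K z -> `|P k.+1 z - P k z| < d%:C.
  move=> kN Kz; have z0 := zK z Kz; rewrite /P -mulrBr -rmorphB -mulrBl.
  have -> : rho k.+1 z - rho k z = (cabs z - r) / N%:R.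
    by rewrite /rho -(addn1 k) natrD; field.
  rewrite cabsE ltcR cabsM cabs_real normrM normfV (gtr0_norm z0) mulrCA divff ?gt_eqF // mulr1.
  apply: le_lt_trans Nd; rewrite normrM normfV (gtr0_norm N0) ler_pM2r ?invr_gt0 //.
  have /annulusE/andP[z1 z2] := Kz.
  by rewrite ler_norml; apply/andP; split; move: rr1 rr2 z1 z2 => *; lra.
suff : forall k, (k <= N)%N -> exists H : C -> C, (forall z, K z -> cont_at K H z) /\
    forall z, K z -> cexp (H z) = g (P k z).
  by move=> /(_ N (leqnn N))[H [cH eH]]; exists H; split=> // z Kz; rewrite eH // PN.
elim=> [_|k ih kN].
  exists (fun z => H0 (P 0%N z)); split=> z Kz.
    apply: (@cont_comp _ K [set z | cabs z = r] H0 (P 0%N)) => //; first exact: cP.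
    by apply: cH0; exact: P0.
  have [t _ e] := diffeo1_surj (P 0%N z) ha; rewrite P0 // in e.
  by rewrite e H0l.
have kN' : (k <= N)%N := ltnW kN.
have [H [cH eH]] := ih kN'.
have gP j z : (j <= N)%N -> K z -> cont_at K (fun w => g (P j w)) z.
  move=> jN Kz; apply: (@cont_comp _ K K g (P j)) => //; first by move=> w; exact: PK.
    exact: cP.
  by apply: cg; exact: PK.
exists (fun z => H z + plog (g (P k.+1 z) * (g (P k z))^-1)).
have rp z : K z -> 0 < complex.Re (g (P k.+1 z) * (g (P k z))^-1).
  move=> Kz; have gk0 := g0 _ (PK k z kN' Kz).
  have := hd' _ _ (PK _ z kN' Kz) (PK _ z kN Kz) (PP k z kN Kz).
  rewrite cabsE ltcR => h1; have h2 := lt_le_trans h1 (hm _ (PK _ _ kN' Kz)).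
  have : cabs (g (P k.+1 z) * (g (P k z))^-1 - 1) < 1.
    have -> : g (P k.+1 z) * (g (P k z))^-1 - 1 = (g (P k.+1 z) - g (P k z)) * (g (P k z))^-1.
      by rewrite mulrBl divff.
    by rewrite cabsM cabsV ltr_pdivrMr ?mul1r // cabs_gt0.
  move: (_ * _^-1) => q hq.
  have : `|complex.Re (q - 1)| < 1 by apply: Re_le_norm; rewrite cabsE ltcR.
  rewrite ReB /= ltr_norml => /andP[+ _].
  by rewrite ltrBrDr addNr.
split=> z Kz; last first.
  rewrite cexpD eH // plogK; last exact: rp.
  by rewrite mulrCA divff ?mulr1 //; apply: g0; exact: PK.
apply: cont_add; first exact: cH.
apply: (@cont_comp _ K [set w | 0 < complex.Re w] (@plog R) (fun z => g (P k.+1 z) * (g (P k z))^-1)).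
- by move=> w; exact: rp.
- by apply: cont_mul; [exact: gP|apply: cont_inv; [apply: g0; exact: PK|exact: gP]].
- by apply: cont_plog => //=; exact: rp.
Qed.

(** If exp h = x^2 then x is exp(h/2) up to sign, and the sign decides whether i pi is added. *)
Definition half_log (h x : C) : C :=
  h / 2 + (if x * cexp (- (h / 2)) == 1 then 0 else 'i * pi%:C).

(* g * exp (- H / 2) is +-1, hence locally constant. *)
Lemma log_sqrt K (H g : C -> C) : (forall z, K z -> cont_at K H z) ->
  (forall z, K z -> cont_at K g z) -> (forall z, K z -> cexp (H z) = g z ^+ 2) ->
  (forall z, K z -> cont_at K (fun z => half_log (H z) (g z)) z) /\
  forall z, K z -> cexp (half_log (H z) (g z)) = g z.
Proof.
move=> cH cg e; pose s z := g z * cexp (- (H z / 2)).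
have s1 z : K z -> s z = 1 \/ s z = -1.
  move=> Kz; have : s z ^+ 2 == 1.
    rewrite /s exprMn -e // expr2 -!cexpD.
    by rewrite -opprD -splitr subrr cexp0.
  by rewrite sqrf_eq1 => /orP[/eqP->|/eqP->]; [left|right].
have cs z : K z -> cont_at K s z.
  move=> Kz; apply: cont_mul; first exact: cg.
  apply: (@cont_comp _ K setT (@cexp R) (fun w => - (H w / 2))) => //.
    by apply: cont_opp; apply: cont_mul; [exact: cH|exact: cont_cst].
  by apply: hd_cont (hd_cexp _ _).
split=> z Kz; rewrite /half_log -/(s _); last first.
  have -> : g z = cexp (H z / 2) * s z by rewrite /s mulrCA -cexpD subrr cexp0 mulr1.
  rewrite cexpD; congr (_ * _).
  have [->|e1] := s1 z Kz; first by rewrite eqxx cexp0.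
  rewrite e1 ifF; last first.
    by apply/negbTE; rewrite eq_sym -addr_eq0 -mulr2n pnatr_eq0.
  have -> : 'i * pi%:C = (0 +i* pi : C).
    by rewrite /real_complex_def /=; apply/eqP; rewrite eq_complex /=; apply/andP; split; apply/eqP; ring.
  by rewrite /cexp /= expR0 rmorph1 mul1r expi_pi.
apply: cont_add; first by apply: cont_mul; [exact: cH|exact: cont_cst].
apply: (@cont_ext_near _ _ (fun=> if s z == 1 then 0 else 'i * pi%:C)) => //; last exact: cont_cst.
have /cont_eps/(_ _ ltr01)[d d0 h] := cs z Kz; exists d => // w Kw hw.
rewrite -/(s w); have := h w Kw hw; have [->|->] := s1 z Kz; have [->|->] := s1 w Kw => //.
  rewrite -opprD normrN -mulr2n normr_nat rmorph1.
  by rewrite -[X in _ < X]/(1%:R) ltr_nat.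
rewrite opprK -mulr2n normr_nat rmorph1.
by rewrite -[X in _ < X]/(1%:R) ltr_nat.
Qed.

End Circle.

(** * Inverse images under circles *)

Section Translation.
Variable R : realType.
Local Notation C := R[i].
Local Notation gr := (gr R).
Local Notation sgr := (sgr R).
Local Notation Rline := (@Rline R).
Local Notation eps := (gconst 'i : gr).
Implicit Types (K L M : set C) (x y : gr) (z w : C) (F G : C -> sgr) (X Y : sgr).

Lemma holomorphicA_shA K F : perfect K -> holomorphicA K F <-> shA K F.
Proof.
move=> pK; split.
  move=> [[n hn] [m hm] h]; split; (split; last first).
  - by move=> k S; have [/(holomorphicP _ pK)/(_ k)] := h S.
  - by exists n => z Kz S j hj nj; exact: hn Kz hj nj.
  - by move=> k S; have [_ /(holomorphicP _ pK)/(_ k)] := h S.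
  - by exists m => z Kz S j hj nj; exact: hm Kz hj nj.
move=> [[[n hn] h1] [[m hm] h2]]; split.
- by exists n => z S j Kz hj nj; exact: (hn z Kz S j).
- by exists m => z S j Kz hj nj; exact: (hm z Kz S j).
- by move=> S; split; apply/(holomorphicP _ pK) => k.
Qed.

Lemma smoothA_shA (F : R -> sgr) : smoothA F <-> shA Rline (fun z => F (complex.Re z)).
Proof.
rewrite -(@holomorphicA_shA Rline) //; last exact: perfect_Rline.
split.
  move=> [[n hn] [m hm] h]; split.
  - by exists n => z S j _; exact: hn.
  - by exists m => z S j _; exact: hm.
  - by move=> S; have [h1 h2] := h S; split; exact: (csmooth_holomorphic (f := fun t => _ (F t) S)).
move=> [[n hn] [m hm] h]; split.
- by exists n => t S j _; apply: (hn t%:C).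
- by exists m => t S j _; apply: (hm t%:C).
- move=> S; have [h1 h2] := h S; split.
    exact: (holomorphic_csmooth h1).
  exact: (holomorphic_csmooth h2).
Qed.

Lemma sderive_gd (F : R -> sgr) (t : R) : smoothA F -> sderive F t =
  (gd Rline (fun z => (F (complex.Re z)).1) t%:C, gd Rline (fun z => (F (complex.Re z)).2) t%:C).
Proof.
move=> /smoothA_shA [h1 h2]; have pR := @perfect_Rline R; congr pair; apply/funext => S.
  exact: (rderive_cderive t (@hA_holo _ _ _ S pR h1)).
exact: (rderive_cderive t (@hA_holo _ _ _ S pR h2)).
Qed.

Lemma sexpD n X Y : geven X.1 -> geven Y.1 -> gfin n Y.1 ->
  sexp (X + Y)%S = (sexp X * sexp Y)%S.
Proof.
move=> eX eY fY; rewrite !saddE !sexpE //=; last exact: gevenD.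
rewrite smulE /= (gexpD eX eY fY); congr pair.
by rewrite mulrDr [RHS]addrC mulrA; congr (_ + _); rewrite -!mulrA (geven_comm _ (gexp_even eY)).
Qed.

Definition islog (D : set C) (X E : C -> sgr) : Prop :=
  [/\ shA D E, even_on D E & forall z, D z -> sexp (E z) = X z].

Lemma islog_exists K (X : C -> sgr) (l : C -> C) : perfect K -> shA K X -> even_on K X ->
  (forall n, hol n K l) -> (forall z, K z -> cexp (l z) = body (X z)) ->
  exists2 E, islog K X E & forall z, K z -> body (E z) = l z.
Proof.
move=> pK [h1 h2] eX hl el.
have [|E [hE eE bE]] := glog_exists pK h1 _ hl el; first by move=> z /eX[].
exists (fun z => (E z, gexp (- E z) * (X z).2)); last by move=> z /bE[].
have e' z : K z -> geven (- E z) by move=> Kz; apply: gevenN; exact: eE.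
split.
- split=> //=; apply: hA_mul => //; apply: hA_gexp => //; exact: hA_opp.
- move=> z Kz /=; split; first exact: eE.
  by apply: goddMr; [apply: gexp_even; exact: e'|case: (eX z Kz)].
- move=> z Kz; rewrite sexpE /=; last exact: eE.
  have [_ e2] := bE z Kz; have [[n fE] _] := hE.
  have e1 : gexp (E z) * gexp (- E z) = 1.
    by rewrite (geven_comm _ (gexp_even (eE z Kz))) (gexpN (eE z Kz) (fE z Kz)).
  by rewrite mulrA e1 mul1r e2 -surjective_pairing.
Qed.

(** Pointwise the two logarithms differ by a multiple of 2 pi i; the difference of their bodies has
    derivative 0, so the multiple is constant. No parity is asked of E', because [inverse_image]
    imposes none. *)
Lemma islog_uniq (X E E' : C -> sgr) : islog Rline X E -> shA Rline E' ->
  (forall z, Rline z -> sexp (E' z) = X z) ->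
  exists c : C, forall t : R, E' t%:C = (E t%:C + sconst c)%S.
Proof.
move=> [[hE1 _] eE bE] [hE'1 _] bE'; have pR := @perfect_Rline R.
pose e z := (E z).1 fset0; pose e' z := (E' z).1 fset0.
have ee z : Rline z -> cexp (e z) = cexp (e' z).
  move=> Lz; rewrite -!gexp_body -!sexp1E bE // bE' //.
have [_ /(_ 1%N fset0)[de [hde _]]] := hE1; have [_ /(_ 1%N fset0)[de' [hde' _]]] := hE'1.
have dz z : Rline z -> hd Rline (fun w => e' w - e w) z 0.
  move=> Lz; have -> : 0 = de' z - de z.
    apply/esym/eqP; rewrite subr_eq0; apply/eqP; apply: (mulfI (cexp_neq0 (e z))).
    apply: (@hd_uniq _ Rline (fun w => cexp (e' w)) z) => //.
      rewrite ee //; apply: (@hd_comp _ Rline setT (@cexp R) e') => //; [exact: hde'|exact: hd_cexp].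
    apply: (@hd_ext _ _ (fun w => cexp (e w))) => //.
    by apply: (@hd_comp _ Rline setT (@cexp R) e) => //; [exact: hde|exact: hd_cexp].
  by apply: hd_add; [exact: hde'|apply: hd_opp; exact: hde].
exists (e' 0 - e 0) => t.
have [e1 _] := eE t%:C (Rline_real t).
have := bE t%:C (Rline_real t); rewrite -(bE' t%:C (Rline_real t)) => /esym.
move=> /(sexp_inj e1)[k hk]; rewrite hk saddE sconstE addr0; congr (_ + _, _).
have := congr1 (fun X : sgr => X.1 fset0) hk => /=.
rewrite grDE -/(e' _) -/(e _) gconstE /= => h.
congr gconst; have := hd0_const t dz; rewrite h => <-.
by rewrite addrC addrA addNr add0r.
Qed.

Definition rmap (s : smap R R) : smap R C :=
  SMap (fun z => ev s (complex.Re z)) (fun z => od s (complex.Re z)).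

(** On the circle u d/du = (1/i) d/d phi. The factor 1 is the coefficient of d phi in the contact
    form, left in the shape produced by [contact_relations]. *)
Definition cR : C -> C := fun=> ('i * 1)^-1.
Definition uR : C -> C := fun z => expi (complex.Re z).

Lemma cR_neq0 z : cR z != 0.
Proof. by rewrite /cR mulr1 invr_neq0 // neq0Ci. Qed.

(* A contact immersion of the supercircle into the domain K. *)
Definition cparam K (s : smap R R) : Prop :=
  [/\ scm Rline cR (rmap s), forall t : R, K (body (ev s t)),
      forall t : R, body (ev s t) != 0 & forall t : R, (od s t).2 fset0 != 0].

Lemma hol_cR k : hol k Rline cR. Proof. exact: hol_cst. Qed.

Lemma hol_uR k : hol k Rline uR.
Proof.
have h : forall (k : nat) (a : C), hol k Rline (fun z => a * uR z).
  elim=> // n ih a; exists (fun z => a * 'i * uR z); split; last exact: ih.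
  move=> z /RlineE ->; have -> : a * 'i * uR (complex.Re z)%:C = 0 * uR (complex.Re z)%:C + a * ('i * expi (complex.Re z)).
    by rewrite mul0r add0r mulrA.
  by apply: hd_mul => //; [exact: hd_cst|exact: hd_expi].
by apply: hol_ext (h k 1) => z _; rewrite mul1r.
Qed.

Lemma uR_neq0 z : uR z != 0. Proof. exact: expi_neq0. Qed.

(* The logarithms ln (Q / u) and ln Ber of inverse_image. *)
Definition slogs (s : smap R R) (EB : (C -> sgr) * (C -> sgr)) : Prop :=
  islog Rline (fun z => sscale (uR z)^-1 (ev s (complex.Re z))) EB.1 /\
  islog Rline (BerF Rline cR uR (rmap s)) EB.2.

(** The inverse image for one fixed choice of logarithms. Another choice adds a constant that
    depends neither on the density nor on its domain, by [inv0_logs]. *)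
Definition inv0 (mu nu : C) K F (s : smap R R) (EB : (C -> sgr) * (C -> sgr)) (t : R) : sgr :=
  (ssubst K F (ev s t) (od s t) +
    (sscale (- ('i * mu)) (EB.1 t%:C) + sscale nu (EB.2 t%:C)))%S.

Lemma cparam_Ber K s (t : R) : cparam K s ->
  let d (F : R -> sgr) := sscale ('i * expi t)^-1 (sderive F t) in
  Ber (d (ev s)) (dtheta (ev s t)) (d (od s)) (dtheta (od s t)) =
  BerF Rline cR uR (rmap s) t%:C.
Proof.
move=> [hs bs b0 p0] /=; have [[[hQ hq] [hr hP]] _ _ _] := hs.
have -> : ('i * expi t)^-1 = cR t%:C / uR t%:C by rewrite /cR /uR /= mulr1 invfM.
rewrite !sderive_gd; [|exact/smoothA_shA|exact/smoothA_shA].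
by apply: (BerF_Ber (@perfect_Rline R) hs) => //; [exact: uR_neq0|exact: cR_neq0|exact: b0|exact: p0].
Qed.

Lemma inv0_logs mu nu s (A B : (C -> sgr) * (C -> sgr)) : slogs s A ->
  shA Rline B.1 -> shA Rline B.2 ->
  (forall z, Rline z -> sexp (B.1 z) = sscale (uR z)^-1 (ev s (complex.Re z))) ->
  (forall z, Rline z -> sexp (B.2 z) = BerF Rline cR uR (rmap s) z) ->
  exists k : C, forall K F (t : R),
    inv0 mu nu K F s B t = (inv0 mu nu K F s A t + sconst k)%S.
Proof.
move=> [lA1 lA2] h1 h2 e1 e2.
have [c hc] := islog_uniq lA1 h1 e1; have [d hd'] := islog_uniq lA2 h2 e2.
exists (- ('i * mu) * c + nu * d) => K F t; rewrite /inv0 hc hd'.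
case: (ssubst _ _ _ _) => a b; rewrite !saddE !sscaleE !sconstE /= !addr0 !scalerDr; congr pair.
rewrite (_ : gconst (_ + _) = - ('i * mu) *: gconst c + nu *: gconst d); last first.
  by apply/funext => S; rewrite grDE !grZE !gconstE; case: eqP => _; rewrite ?mulr0 ?addr0.
by rewrite -!addrA; do 2!congr (_ + _); rewrite addrCA.
Qed.

Lemma inv0_slogs mu nu s (A B : (C -> sgr) * (C -> sgr)) : slogs s A -> slogs s B ->
  exists k : C, forall K F (t : R),
    inv0 mu nu K F s B t = (inv0 mu nu K F s A t + sconst k)%S.
Proof. by move=> lA [[h1 _ e1] [h2 _ e2]]; exact: inv0_logs. Qed.

Lemma inverse_imageP mu nu K F s EB (w : R -> sgr) : cparam K s -> slogs s EB ->
  inverse_image mu nu K F s w ->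
  exists c : C, forall t : R, w t = (inv0 mu nu K F s EB t + sconst c)%S.
Proof.
move=> cs lEB [E [B [[/smoothA_shA sE /smoothA_shA sB] eE eB ew]]].
have [|z /RlineE ->|k hk] := inv0_logs mu nu
  (B := ((fun z => E (complex.Re z)), (fun z => B (complex.Re z)))) lEB sE sB.
- by move=> z _ /=; rewrite eE.
- by rewrite /= eB; exact: cparam_Ber cs.
- by exists k => t; rewrite ew -hk.
Qed.

Lemma inverse_image_inv0 mu nu K F s EB (w : R -> sgr) : cparam K s -> slogs s EB ->
  (forall t : R, w t = inv0 mu nu K F s EB t) -> inverse_image mu nu K F s w.
Proof.
move=> hs [[hE _ bE] [hB _ bB]] ew.
exists (fun t => EB.1 t%:C), (fun t => EB.2 t%:C); split.
- split; apply/smoothA_shA.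
    by case: hE => h1 h2; split; [apply: hA_ext h1|apply: hA_ext h2] => z /RlineE {1}->.
  by case: hB => h1 h2; split; [apply: hA_ext h1|apply: hA_ext h2] => z /RlineE {1}->.
- by move=> t; rewrite bE.
- by move=> t; rewrite bB // -(cparam_Ber t hs).
- exact: ew.
Qed.

End Translation.

(** * Parametrized circles and their logarithms *)

Section Circles.
Variable R : realType.
Local Notation C := R[i].
Local Notation gr := (gr R).
Local Notation sgr := (sgr R).
Local Notation Rline := (@Rline R).
Local Notation cR := (@cR R).
Local Notation uR := (@uR R).
Local Notation eps := (gconst 'i : gr).
Implicit Types (K L M : set C) (x y : gr) (z w : C) (F G : C -> sgr) (X Y : sgr).

Lemma scm_body K (c : C -> C) m z : scm K c m -> K z ->
  c z * gd K (mQ m) z fset0 = mQ m z fset0 * mP m z fset0 ^+ 2.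
Proof.
move=> [_ par _ hii] Kz; have := congr1 (fun x : gr => x fset0) (hii z Kz).
have {par} o : godd (mr m z) by have [] := par z Kz.
by rewrite !grM0 grBE !grM0 !gconstE eqxx (godd_body o) mul0r mulr0 subr0 expr2.
Qed.

Lemma cexp_polar (a b : R) : cexp (a%:C + 'i * b%:C) = (expR a)%:C * expi b.
Proof.
have -> : a%:C + 'i * b%:C = a +i* b.
  by rewrite /real_complex_def /=; apply/eqP; rewrite eq_complex /=; apply/andP; split; apply/eqP; ring.
by [].
Qed.

(** On bodies the contact relation for r exp(i alpha) reads P^2 = alpha'. Thus P has invertible
    body, while its sign stays undetermined. *)
Lemma circle_data (r : R) s : 0 < r -> circle_contactomorphism r s ->
  exists alpha : R -> R, [/\ diffeo1 alpha, cparam [set z | cabs z = r] s,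
    forall t : R, body (ev s t) = r%:C * expi (alpha t),
    forall t : R, (od s t).2 fset0 ^+ 2 = (derive1 alpha t)%:C &
    forall t : R, ev s (t + 2 * pi) = ev s t /\ od s (t + 2 * pi) = od s t].
Proof.
move=> r0 [[sE sO] par per [alpha [a1 a2 a3 a4]] ct]; exists alpha.
have da : diffeo1 alpha by [].
have rC : r%:C != 0 :> C by rewrite fmorph_eq0 gt_eqF.
have b0 (t : R) : body (ev s t) != 0 by rewrite a4 mulf_neq0 // expi_neq0.
have hs : scm Rline cR (rmap s).
  have rel (t : R) : (ev s t).2 = - (eps * (ev s t).1 * (od s t).2 * (od s t).1) /\
      gconst ('i * 1)^-1 * (sderive (ev s) t).1 = (ev s t).1 * ((od s t).2 * (od s t).2 -
        eps * gconst ('i * 1)^-1 * ((od s t).1 * (sderive (od s) t).1)).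
    have [p1 p2 p3 p4] := par t Logic.I.
    exact: (contact_relations p1 p2 p3 p4 (b0 t) (oner_neq0 _) (ct t)).
  split.
  - by move/smoothA_shA: sE => [? ?]; move/smoothA_shA: sO => [? ?].
  - by move=> z _; exact: par.
  - by move=> z _; have [] := rel (complex.Re z).
  - by move=> z /RlineE ->; have [_] := rel (complex.Re z); rewrite !sderive_gd.
have P2 (t : R) : (od s t).2 fset0 ^+ 2 = (derive1 alpha t)%:C.
  apply: (mulfI (b0 t)); rewrite -[LHS]/(mQ (rmap s) t%:C fset0 * mP (rmap s) t%:C fset0 ^+ 2).
  rewrite -(scm_body hs (Rline_real t)).
  have h : hd Rline (fun z => body (ev s (complex.Re z))) t%:C (r%:C * ('i * expi (alpha t) * (derive1 alpha t)%:C)).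
    apply: (@hd_ext _ _ (fun z => r%:C * expi (alpha (complex.Re z)))) => //.
    have ha : hd Rline (fun z => expi (alpha (complex.Re z))) t%:C ('i * expi (alpha t) * (derive1 alpha t)%:C).
      apply: (@hd_comp _ Rline Rline (fun z => expi (complex.Re z)) (fun z => (alpha (complex.Re z))%:C)) => //.
        by apply: is_derive_hd; exact: diffeo1_derive.
      exact: hd_expi.
    by have := hd_mul (Rline_real t) (hd_cst Rline r%:C t%:C) ha; rewrite mul0r add0r.
  rewrite (_ : gd _ _ _ _ = r%:C * ('i * expi (alpha t) * (derive1 alpha t)%:C)); last first.
    exact: (hd_cderive (Rline_real t) (@perfect_Rline R) h).
  rewrite /cR mulr1 a4.
  have i0 : 'i != 0 :> C := neq0Ci _.
  have e3 (a b c : C) : 'i^-1 * (a * ('i * b * c)) = a * b * c.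
    by rewrite (_ : a * _ = 'i * (a * b * c)) ?mulKf //; ring.
  exact: e3.
split => //; split => //.
- by move=> t; rewrite /= a4 cabsM cabs_expi mulr1 cabs_real gtr0_norm.
- move=> t; have : (od s t).2 fset0 ^+ 2 != 0 by rewrite P2 fmorph_eq0 gt_eqF.
  by rewrite expf_eq0.
Qed.

Lemma cparam_sub K L s : K `<=` L -> cparam K s -> cparam L s.
Proof. by move=> KL [h1 h2 h3 h4]; split=> // t; apply: KL. Qed.

Lemma shA_sscale D (f : C -> C) F : (forall k, hol k D f) -> shA D F ->
  shA D (fun z => sscale (f z) (F z)).
Proof.
move=> hf [h1 h2]; split.
  by apply: hA_ext (hA_mul (hA_const hf) h1) => z _; rewrite sscaleE gconstZ.
by apply: hA_ext (hA_mul (hA_const hf) h2) => z _; rewrite sscaleE /= gconstZ.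
Qed.

Lemma even_sscale D (f : C -> C) F : even_on D F -> even_on D (fun z => sscale (f z) (F z)).
Proof.
by move=> h z Dz; have [h1 h2] := h z Dz; rewrite sscaleE /=; split; [exact: gevenZ|exact: goddZ].
Qed.

Lemma scm_ev K (c : C -> C) m : scm K c m -> shA K (ev m) /\ even_on K (ev m).
Proof. by move=> [[[? ?] _] par _ _]; split => // z Kz; have [] := par z Kz. Qed.

Lemma hol_inv0 D (f : C -> C) : (forall z, f z != 0) -> (forall k, hol k D f) ->
  forall k, hol k D (fun z => (f z)^-1).
Proof. by move=> f0 hf k; apply: hol_inv. Qed.

(** The bodies of Q/u and Ber have winding number 0: the first is r exp(i(alpha - t)), and the
    second is its product with P, whose sign is locally constant. The periodicity of the logarithms
    is what the invariance under sigma later rests on. *)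
Lemma circle_logs (r : R) s : 0 < r -> circle_contactomorphism r s ->
  exists EB, slogs s EB /\ forall t : R,
    body (EB.1 (t + 2 * pi)%:C) = body (EB.1 t%:C) /\
    body (EB.2 (t + 2 * pi)%:C) = body (EB.2 t%:C).
Proof.
move=> r0 cs; have [alpha [da [hs _ b0 p0] bs P2 per]] := circle_data r0 cs.
have pR := @perfect_Rline R.
have [hev eev] := scm_ev hs.
pose X z := sscale (uR z)^-1 (ev s (complex.Re z)).
have hX : shA Rline X by apply: shA_sscale hev; apply: hol_inv0; [exact: uR_neq0|exact: hol_uR].
have eX : even_on Rline X by apply: even_sscale eev.
pose lE z := (ln r)%:C + 'i * (alpha (complex.Re z) - complex.Re z)%:C.
have elE z : cexp (lE z) = body (X z).
  rewrite /X sscaleE /body /= grZE -/(body _) bs cexp_polar lnK //.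
  by rewrite expiD expiN [RHS]mulrC -mulrA.
have cRe z : Rline z -> cont_at Rline (fun w => (complex.Re w)%:C) z.
  by move=> _; apply: cont_sub (cont_Re _).
have clE z : Rline z -> cont_at Rline lE z.
  move=> Lz; apply: cont_add; first exact: cont_cst.
  apply: cont_mul; first exact: cont_cst.
  apply: (@cont_ext _ _ (fun w => (alpha (complex.Re w))%:C - (complex.Re w)%:C)) => //.
    by move=> w _; rewrite rmorphB.
  apply: cont_add; last by apply: cont_opp; exact: cRe.
  by apply: (@cont_real _ _ alpha); [exact: diffeo1_cont|exact: cRe].
have hlE k : hol k Rline lE.
  by apply: (log_hol pR clE (fun z _ => elE z)) => n; have [[_ h] _] := hX; exact: h.
have [E lgE bE] := islog_exists pR hX eX hlE (fun z _ => elE z).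
pose Y := BerF Rline cR uR (rmap s).
have hY : shA Rline Y.
  by apply: (shA_BerF pR hs); [exact: hol_cR|exact: hol_uR|move=> z _; exact: uR_neq0].
have eY : even_on Rline Y by exact: (BerF_even pR hs).
pose P0 z : C := (od s (complex.Re z)).2 fset0.
pose H z : C := (ln (complex.Re (P0 z ^+ 2)))%:C.
have P2R z : P0 z ^+ 2 = (complex.Re (P0 z ^+ 2))%:C by rewrite /P0 P2.
have P2p z : 0 < complex.Re (P0 z ^+ 2) by rewrite /P0 P2 /=; case: da.
have [[_ [_ hP]] _ _ _] := hs; have {}hP : forall k, hol k Rline P0.
  by move=> k; have [_ h] := hP; exact: h.
have cP z : Rline z -> cont_at Rline P0 z.
  by move=> Lz; have [P' [dP _]] := hP 1%N; exact: hd_cont Lz (dP z Lz).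
have eH z : cexp (H z) = P0 z ^+ 2.
  by rewrite /H -[_%:C]addr0 -(mulr0 'i) cexp_polar lnK ?expi0 ?mulr1 // posrE.
have cH z : Rline z -> cont_at Rline H z.
  move=> Lz; apply: (@cont_real _ (fun z => complex.Re (P0 z ^+ 2)) (@ln R)).
    exact: continuous_ln.
  apply: (@cont_ext _ _ (fun z => P0 z * P0 z)) => //; last by apply: cont_mul; exact: cP.
  by move=> w _; rewrite -P2R expr2.
have [chl ehl] := log_sqrt cH cP (fun z _ => eH z).
(* The body of Ber is Q P/u; since P^2 = alpha' is positive, the real logarithm H of P^2 supplies
   half of ln P, and [half_log] restores the sign. *)
pose lB z := half_log (H z) (P0 z) + lE z.
have elB z : Rline z -> cexp (lB z) = body (Y z).
  move=> Lz; rewrite cexpD ehl // elE.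
  rewrite -[body (Y z)]/((gconst (uR z)^-1 * mQ (rmap s) z * mP (rmap s) z) fset0).
  by rewrite !grM0 gconstE eqxx mulrC.
have hlB k : hol k Rline lB.
  apply: (log_hol pR _ elB) => [z Lz|n]; first by apply: cont_add; [exact: chl|exact: clE].
  by have [[_ h] _] := hY; exact: h.
have [B lgB bB] := islog_exists pR hY eY hlB elB.
exists (E, B); split=> // t; rewrite !bE ?bB //.
have plE : lE (t + 2 * pi)%:C = lE t%:C.
  by rewrite /lE /=; have [_ _ ->] := da; congr (_ + _ * _%:C); ring.
split=> //; rewrite /lB plE; congr (half_log _ _ + _).
  by rewrite /H /P0 /=; have [_ ->] := per t.
by rewrite /P0 /=; have [_ ->] := per t.
Qed.

End Circles.

(** * Pullbacks under contactomorphisms *)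

Section Contactomorphisms.
Variable R : realType.
Local Notation C := R[i].
Local Notation gr := (gr R).
Local Notation sgr := (sgr R).
Local Notation Rline := (@Rline R).
Local Notation cR := (@cR R).
Local Notation uR := (@uR R).
Local Notation eps := (gconst 'i : gr).
Implicit Types (K L M : set C) (x y : gr) (z w : C) (F G : C -> sgr) (X Y : sgr).

Lemma ssubst_body (D : set C) F X Y : geven X.1 -> godd Y.1 ->
  body (ssubst D F X Y) = body (F (body X)).
Proof.
by move=> eX oY; rewrite ssubstE // /body /= grDE grM0 (godd_body oY) mulr0 addr0 gsub_body.
Qed.

Lemma ssubst_od_body (D : set C) F X Y : geven X.1 -> godd X.2 -> godd Y.1 ->
  (ssubst D F X Y).2 fset0 = (F (body X)).2 fset0 * Y.2 fset0.
Proof.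
move=> eX oX oY; rewrite ssubstE //= !grDE !grM0 (godd_body oX) (godd_body oY) !mulr0 add0r addr0.
by rewrite gsub_body.
Qed.

Lemma body_sconst z : body (sconst z) = z.
Proof. by rewrite /body /= gconstE eqxx. Qed.

Record ciso K L (m n : smap R C) : Prop := Ciso {
  ciso_K : perfect K; ciso_L : perfect L;
  ciso_K0 : forall z, K z -> z != 0; ciso_L0 : forall z, L z -> z != 0;
  ciso_m : scm K id m; ciso_mL : forall z, K z -> L (body (ev m z));
  ciso_n : scm L id n; ciso_nK : forall z, L z -> K (body (ev n z));
  ciso_nm : smap_eq K (scomp L n m) (@sid R);
  ciso_mn : smap_eq L (scomp K m n) (@sid R) }.

Lemma ciso_sym K L m n : ciso K L m n -> ciso L K n m.
Proof. by case=> *; exact: Ciso. Qed.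

Lemma contact_map_scm K L m : perfect K -> (forall z, K z -> z != 0) ->
  (forall z, L z -> z != 0) -> contact_map K L m ->
  scm K id m /\ forall z, K z -> L (body (ev m z)).
Proof.
move=> pK K0 L0 [[hE hO] par bm ct]; split => //.
have rel z : K z -> mq m z = - (eps * mQ m z * mP m z * mr m z) /\
    gconst z * gd K (mQ m) z = mQ m z * (mP m z * mP m z - eps * gconst z * (mr m z * gd K (mr m) z)).
  move=> Kz; have [p1 p2 p3 p4] := par z Kz.
  have a0 : ('i * z)^-1 != 0 by rewrite invr_neq0 // mulf_neq0 ?neq0Ci // K0.
  have := contact_relations p1 p2 p3 p4 (L0 _ (bm z Kz)) a0 (ct z Kz).
  have -> : ('i * ('i * z)^-1)^-1 = z :> C by rewrite [('i * z)^-1]invfM mulrA divff ?neq0Ci // mul1r invrK.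
  by [].
split; last 1 first.
- by move=> z /rel[].
- by move/(holomorphicA_shA _ pK): hE => [? ?]; move/(holomorphicA_shA _ pK): hO.
- by [].
- by move=> z /rel[].
Qed.

(** The target is a priori any set. It is the image of K under a continuous bijection of bodies,
    hence without isolated points; only then do the contact equations of the inverse become
    relations between derivatives. *)
Lemma contactomorphism_ciso K L m : perfect K -> (forall z, K z -> z != 0) ->
  (forall z, L z -> z != 0) -> contactomorphism K L m -> exists n, ciso K L m n.
Proof.
move=> pK K0 L0 [cm [n [cn e1 e2]]]; exists n.
have [hm bm] := contact_map_scm pK K0 L0 cm.
have [_ parm _ _] := cm; have [_ parn bn _] := cn.
have pL : perfect L.
  apply: (@perfect_image _ K L (fun z => body (ev m z)) (fun z => body (ev n z))) => //.
  - move=> z Kz; have [[[[_ h] _] _] _ _ _] := hm.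
    by have [f' [df _]] := h 1%N fset0; exact: hd_cont Kz (df z Kz).
  - move=> z Kz; have [p1 p2 p3 p4] := parm z Kz.
    have [e _] := e1 z Kz; rewrite -(@ssubst_body L _ _ (od m z)) //.
    by rewrite (e : ssubst L (ev n) (ev m z) (od m z) = sconst z) body_sconst.
  - move=> z Lz; have [p1 p2 p3 p4] := parn z Lz.
    have [e _] := e2 z Lz; rewrite -(@ssubst_body K _ _ (od n z)) //.
    by rewrite (e : ssubst K (ev m) (ev n z) (od n z) = sconst z) body_sconst.
by have [hn _] := contact_map_scm pL L0 K0 cn; exact: Ciso.
Qed.

Section Iso.
Variables (K L : set C) (m n : smap R C).
Hypothesis im : ciso K L m n.
Let pK := ciso_K im.
Let pL := ciso_L im.
Let hm := ciso_m im.
Let bm := ciso_mL im.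
Let hn := ciso_n im.
Let bn := ciso_nK im.

Lemma ciso_body z : K z -> body (ev n (body (ev m z))) = z.
Proof.
move=> Kz; have [_ par _ _] := hm; have [p1 p2 p3 p4] := par z Kz.
have [e _] := ciso_nm im Kz; rewrite -(@ssubst_body L _ _ (od m z)) //.
by rewrite (e : ssubst L (ev n) (ev m z) (od m z) = sconst z) body_sconst.
Qed.

(** The theta-coefficient of the composite with the inverse is 1, and its body is a product with the
    body of P. *)
Lemma ciso_P z : K z -> mP m z fset0 != 0.
Proof.
move=> Kz; have [_ par _ _] := hm; have [p1 p2 p3 p4] := par z Kz.
have [_ e] := ciso_nm im Kz; have := @ssubst_od_body L (od n) _ (od m z) p1 p2 p3.
rewrite (e : ssubst L (od n) (ev m z) (od m z) = theta R) thetaE /= gr1_0 => e2.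
apply/eqP => e3; have := oner_neq0 C; rewrite e2.
by rewrite -[(od m z).2]/(mP m z) e3 mulr0 eqxx.
Qed.

Lemma scomp_P K' (s : smap R R) (t : R) : cparam K' s ->
  (od (scomp K m s) t).2 fset0 = mP m (body (ev s t)) fset0 * (od s t).2 fset0.
Proof.
move=> [[_ par _ _] _ _ _]; have [p1 p2 p3 p4] := par t%:C (Rline_real t).
by rewrite ssubst_od_body.
Qed.

Lemma scomp_evbody K' (s : smap R R) (t : R) : cparam K' s ->
  body (ev (scomp K m s) t) = body (ev m (body (ev s t))).
Proof.
move=> [[_ par _ _] _ _ _]; have [p1 p2 p3 p4] := par t%:C (Rline_real t).
by rewrite ssubst_body.
Qed.

Lemma rmap_body K' (s : smap R R) : cparam K' s -> forall z, Rline z -> K' (body (ev (rmap s) z)).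
Proof. by move=> [_ h _ _] z _; exact: h. Qed.

Lemma cparam_comp s : cparam K s -> cparam L (scomp K m s).
Proof.
move=> cs; have [hs bs b0 p0] := cs; split.
- exact: (scm_comp (@perfect_Rline R) pK hs (rmap_body cs) hm).
- by move=> t; rewrite (scomp_evbody _ cs); apply: bm.
- by move=> t; rewrite (scomp_evbody _ cs); apply: (ciso_L0 im); apply: bm.
- by move=> t; rewrite (scomp_P _ cs) mulf_neq0 // ciso_P.
Qed.

Definition mlogs (EB : (C -> sgr) * (C -> sgr)) : Prop :=
  islog K (fun z => sscale z^-1 (ev m z)) EB.1 /\ islog K (BerF K id id m) EB.2.

Definition comp_logs (s : smap R R) (EBs EBm : (C -> sgr) * (C -> sgr)) :=
  ((fun z => (EBs.1 z + ssubst K EBm.1 (ev (rmap s) z) (od (rmap s) z))%S),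
   (fun z => (EBs.2 z + ssubst K EBm.2 (ev (rmap s) z) (od (rmap s) z))%S)).

Lemma shA_add D F G : shA D F -> shA D G -> shA D (fun z => (F z + G z)%S).
Proof.
move=> [f1 f2] [g1 g2]; split.
  by apply: hA_ext (hA_add f1 g1) => z _; rewrite saddE.
by apply: hA_ext (hA_add f2 g2) => z _; rewrite saddE.
Qed.

Lemma even_add D F G : even_on D F -> even_on D G -> even_on D (fun z => (F z + G z)%S).
Proof.
move=> ef eg z Dz; have [f1 f2] := ef z Dz; have [g1 g2] := eg z Dz; rewrite saddE /=.
by split; [exact: gevenD|exact: goddD].
Qed.

Lemma ssubst_sconst s z : cparam K s -> Rline z ->
  ssubst K (@sconst R) (ev (rmap s) z) (od (rmap s) z) = ev (rmap s) z.
Proof.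
move=> cs Lz; have [hs bs _ _] := cs; have pR := @perfect_Rline R.
have [_ par _ _] := hs; have [p1 p2 p3 p4] := par z Lz.
have Kb : K ((ev (rmap s) z).1 fset0) := bs _.
rewrite ssubstE // gsub_id //.
have e2 f : (forall w, K w -> f w = 0) -> hA K f -> gsub K f (ev (rmap s) z).1 = 0.
  by move=> h hf; rewrite (gsub_ext pK h hf Kb) gsub_cst.
have h0 : hA K (fun w : C => (sconst w).2).
  by apply: (@hA_cst _ _ 0); rewrite gconst0.
have hI : hA K (fun w : C => (sconst w).1) by apply: hA_const => k; exact: hol_id.
have d0 : hA K (gd K (fun w : C => (sconst w).2)) := hA_gd pK h0.
have d1 : hA K (gd K (fun w : C => (sconst w).1)) := hA_gd pK hI.
rewrite (e2 (fun w : C => (sconst w).2)) //; last by move=> w _; rewrite sconstE.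
rewrite (e2 (gd K (fun w : C => (sconst w).2))) //; last first.
  move=> w Kw; apply: (ghd_gd Kw pK).
  by apply: (ghd_ext Kw) (ghd_cst K 0 w) => v _; rewrite sconstE.
rewrite (_ : gsub K (gd K (fun w => (sconst w).1)) _ = 1); last first.
  rewrite (@gsub_ext _ K _ (fun=> 1)) ?gsub_cst // => w Kw.
  by apply: (ghd_gd Kw pK); rewrite -gconst1; apply: ghd_const; exact: hd_id.
by rewrite !mul0r !addr0 mul1r -surjective_pairing.
Qed.

Lemma sscaleM (a b : C) X : sscale a (sscale b X) = sscale (a * b) X.
Proof. by rewrite !sscaleE /= !scalerA. Qed.

Lemma sscale_mull (a : C) X Y : (sscale a X * Y)%S = sscale a (X * Y)%S.
Proof. by rewrite !smulE !sscaleE /= scalerDr -!scalerAl. Qed.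

Lemma smul_const (a : C) X : (sconst a * X)%S = sscale a X.
Proof. by rewrite sconstE smulE sscaleE /= mul0r addr0 !gconstZ. Qed.

(** For the composite, Q(s)/u is s/u times the substitution of s into Q/z, and the Berezinian has
    the analogous cocycle rule; substitution commutes with the exponential, so logarithms add. *)
Lemma slogs_comp s EBs EBm : cparam K s -> slogs s EBs -> mlogs EBm ->
  slogs (scomp K m s) (comp_logs s EBs EBm).
Proof.
move=> cs [[hE eE lE] [hB eB lB]] [[hE' eE' lE'] [hB' eB' lB']].
have [hs bs b0 p0] := cs; have pR := @perfect_Rline R; have bR := rmap_body cs.
have [hev eev] := scm_ev hm.
have hI : forall k, hol k K (fun z => z^-1).
  by move=> k; apply: hol_inv; [exact: (ciso_K0 im)|exact: hol_id].
have hC : shA K (@sconst R).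
  split; first by apply: hA_const => k; exact: hol_id.
  by apply: (@hA_cst _ _ 0); rewrite gconst0.
have eC : even_on K (@sconst R).
  by move=> z _; rewrite sconstE; split; [exact: geven_const|].
have sfin (F : C -> sgr) z : shA K F -> Rline z -> exists k, gfin k (ssubst K F (ev (rmap s) z) (od (rmap s) z)).1.
  by move=> hF Lz; have [[[k hk] _] _] := shA_ssubst pR pK hs bR hF; exists k; exact: hk.
have xE (F : C -> sgr) EE z : shA K EE -> even_on K EE -> (forall w, K w -> sexp (EE w) = F w) -> Rline z ->
    shA K F ->
    sexp (ssubst K EE (ev (rmap s) z) (od (rmap s) z)) = ssubst K F (ev (rmap s) z) (od (rmap s) z).
  move=> h1 h2 h3 Lz hF; rewrite -(ssubst_sexp pK hs bR Lz h1 h2).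
  by symmetry; apply: (ssubst_ext pK hs bR Lz hF) => w Kw; rewrite h3.
split; split.
- by apply: shA_add => //; exact: (shA_ssubst pR pK hs bR).
- by apply: even_add => // z Lz; exact: (ssubst_even pK hs bR).
- move=> z Lz; have [k fk] := sfin _ z hE' Lz.
  rewrite (@sexpD _ k) //; [|by case: (eE z Lz)|by case: (ssubst_even pK hs bR eE' Lz)].
  have hF : shA K (fun z => sscale z^-1 (ev m z)) by apply: shA_sscale hev.
  rewrite lE // (xE _ _ _ hE' eE' lE' Lz hF) sscale_mull; congr (sscale _ _).
  rewrite -{1}[ev s _](ssubst_sconst cs Lz) -(ssubst_mul pK hs bR) //; last by apply: even_sscale.
  rewrite (@ssubst_ext _ Rline K pK cR (rmap s) hs bR _ (ev m)) //.
    have [hc1 hc2] := hC; have [f1 f2] := hF; split.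
      by apply: hA_ext (hA_mul hc1 f1) => w _; rewrite smulE.
    by apply: hA_ext (hA_add (hA_mul hc1 f2) (hA_mul hc2 f1)) => w _; rewrite smulE.
  move=> w Kw; rewrite smul_const sscaleM divff ?(ciso_K0 im) //.
  by rewrite sscaleE !scale1r -surjective_pairing.
- by apply: shA_add => //; exact: (shA_ssubst pR pK hs bR).
- by apply: even_add => // z Lz; exact: (ssubst_even pK hs bR).
- move=> z Lz; have [k fk] := sfin _ z hB' Lz.
  rewrite (@sexpD _ k) //; [|by case: (eB z Lz)|by case: (ssubst_even pK hs bR eB' Lz)].
  have hF : shA K (BerF K id id m).
    by apply: (shA_BerF pK hm) => // [k'|k'|]; [exact: hol_id|exact: hol_id|exact: (ciso_K0 im)].
  rewrite lB // (xE _ _ _ hB' eB' lB' Lz hF).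
  by rewrite -(BerF_comp pR pK hs bR hm (ciso_K0 im) _ Lz).
Qed.

Variables mu nu : C.

Definition twist (a b : C) (EB : (C -> sgr) * (C -> sgr)) z : sgr :=
  (sscale a (EB.1 z) + sscale b (EB.2 z))%S.

Lemma shA_twist D a b EB : shA D EB.1 -> shA D EB.2 -> shA D (twist a b EB).
Proof. by move=> h1 h2; apply: shA_add; apply: shA_sscale => // k; exact: hol_cst. Qed.

Definition pull F (EBm : (C -> sgr) * (C -> sgr)) z : sgr :=
  (ssubst L F (ev m z) (od m z) + twist (- ('i * mu))%R nu EBm z)%S.

(** The correction is subtracted on K with the logarithms of [m], not computed from logarithms of
    the inverse; thus [pull] undoes [push] exactly and not only up to a constant. *)
Definition push G (EBm : (C -> sgr) * (C -> sgr)) w : sgr :=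
  ssubst K (fun z => (G z + twist ('i * mu)%R (- nu) EBm z)%S) (ev n w) (od n w).

Lemma shA_pull F EBm : mlogs EBm -> shA L F -> shA K (pull F EBm).
Proof.
move=> [[h1 _ _] [h2 _ _]] hF; apply: shA_add; first exact: (shA_ssubst pK pL hm bm).
exact: shA_twist.
Qed.

Lemma shA_push G EBm : mlogs EBm -> shA K G -> shA L (push G EBm).
Proof.
move=> [[h1 _ _] [h2 _ _]] hG; apply: (shA_ssubst pL pK hn bn).
by apply: shA_add => //; exact: shA_twist.
Qed.

Lemma ssubst_sid (D : set C) F z : ssubst D F (sconst z) (theta R) = F z.
Proof.
rewrite sconstE thetaE ssubstE /=; last exact: geven_const.
by rewrite !gsub_const !mulr0 !addr0 add0r mulr1 -surjective_pairing.
Qed.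

Lemma saddA X Y Z : (X + (Y + Z))%S = ((X + Y) + Z)%S :> sgr.
Proof. by rewrite !saddE /= !addrA. Qed.

Lemma twistN a b EB z : (twist a b EB z + twist (- a) (- b) EB z)%S = (0, 0).
Proof.
by rewrite /twist !saddE !sscaleE /= !scaleNr; congr pair; rewrite addrACA !subrr addr0.
Qed.

Lemma pull_push G EBm z : mlogs EBm -> shA K G -> K z -> pull (push G EBm) EBm z = G z.
Proof.
move=> mE hG Kz; have [[h1 _ _] [h2 _ _]] := mE.
rewrite /pull /push (ssubst_comp pK pL hm bm pK hn bn Kz) //; last first.
  by apply: shA_add => //; exact: shA_twist.
have [-> ->] := ciso_nm im Kz; rewrite ssubst_sid -saddA.
rewrite -[nu in twist (- _) nu _ z]opprK twistN saddE !addr0 -surjective_pairing //.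
Qed.

Lemma inv0_pull F s EBs EBm (t : R) : cparam K s -> mlogs EBm -> shA L F ->
  inv0 mu nu K (pull F EBm) s EBs t =
  inv0 mu nu L F (scomp K m s) (comp_logs s EBs EBm) t.
Proof.
move=> cs [[h1 _ _] [h2 _ _]] hF; have [hs bs b0 p0] := cs; have pR := @perfect_Rline R.
have bR := rmap_body cs; have Lt := Rline_real t.
have hsc a H : shA K H -> shA K (fun z => sscale a (H z)).
  by move=> hH; apply: shA_sscale => // k; exact: hol_cst.
rewrite /inv0 /pull /comp_logs /=.
have -> := ssubst_add pK hs bR Lt (shA_ssubst pK pL hm bm hF) (shA_twist (- ('i * mu)) nu h1 h2).
have -> := ssubst_add pK hs bR Lt (hsc (- ('i * mu)) _ h1) (hsc nu _ h2).
rewrite (ssubst_scale pK hs bR _ Lt h1) (ssubst_scale pK hs bR _ Lt h2).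
rewrite (ssubst_comp pR pK hs bR pL hm bm Lt hF).
move: (ssubst L F _ _) (ssubst K EBm.1 _ _) (ssubst K EBm.2 _ _) => Z U V.
rewrite !saddE !sscaleE /= !scalerDr -!addrA; congr (_ + _, _ + _).
  by rewrite [LHS]addrA [LHS]addrC [LHS]addrACA -addrA.
by rewrite [LHS]addrA [LHS]addrC [LHS]addrACA -addrA.
Qed.

End Iso.

End Contactomorphisms.

(** * Independence of the relation from the representative *)

Section Invariance.
Variable R : realType.
Local Notation C := R[i].
Local Notation gr := (gr R).
Local Notation sgr := (sgr R).
Local Notation Rline := (@Rline R).
Local Notation cR := (@cR R).
Local Notation uR := (@uR R).
Local Notation eps := (gconst 'i : gr).
Implicit Types (K L M : set C) (x y : gr) (z w : C) (F G : C -> sgr) (X Y : sgr).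

Lemma smap_eqT (s s' : smap R R) : smap_eq setT s s' -> s = s'.
Proof.
case: s s' => [e o] [e' o'] h; congr SMap; apply/funext => t.
  by have [] := h t Logic.I.
by have [] := h t Logic.I.
Qed.

Lemma hA_cont D (f : C -> gr) z : hA D f -> D z -> cont_at D (fun w => f w fset0) z.
Proof. by move=> [_ /(_ 1%N fset0)[f' [df _]]] Dz; exact: hd_cont Dz (df z Dz). Qed.

(** The only obstruction to logarithms on the annulus is the winding number, and it is visible on
    one circle. There the contactomorphism carries the parametrization q to the parametrization p of
    a round circle, both of degree 1. *)
Lemma mlogs_exist (r1 r2 r r' : R) L m n q p : 0 < r1 -> r1 <= r <= r2 -> 0 < r' ->
  ciso (annulus r1 r2) L m n ->
  circle_contactomorphism r q -> circle_contactomorphism r' p ->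
  scomp (annulus r1 r2) m q = p ->
  exists EB, mlogs (annulus r1 r2) m EB.
Proof.
set K := annulus r1 r2 => r10 rr r'0 im cq cp ep.
have r0 : 0 < r by apply: lt_le_trans r10 _; case/andP: rr.
have [alpha [da cpq bq P2q perq]] := circle_data r0 cq.
have [beta [db cpp bp P2p perp]] := circle_data r'0 cp.
have pK := ciso_K im; have pR := @perfect_Rline R; have hm := ciso_m im.
have [hev eev] := scm_ev hm.
have hI : forall k, hol k K (fun z => z^-1).
  by move=> k; apply: hol_inv; [exact: (ciso_K0 im)|exact: hol_id].
have inK : [set z | cabs z = r] `<=` K by move=> z /= cz; apply/annulusE; rewrite cz.
have cq' : cparam K q := cparam_sub inK cpq.
have bm t : body (ev m (body (ev q t))) = r'%:C * expi (beta t).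
  by rewrite -bp -ep (@scomp_evbody _ K m _ _ _ cq').
have Pm t : mP m (body (ev q t)) fset0 * (od q t).2 fset0 = (od p t).2 fset0.
  by rewrite -ep (@scomp_P _ K m _ _ _ cq').
have rC : r%:C != 0 :> C by rewrite fmorph_eq0 gt_eqF.
pose X z := sscale z^-1 (ev m z).
have hX : shA K X by apply: shA_sscale hev.
have eX : even_on K X by apply: even_sscale eev.
pose g z := body (X z).
have gE z : g z = z^-1 * body (ev m z) by [].
have cg z : K z -> cont_at K g z by move=> Kz; have [h _] := hX; exact: (hA_cont h).
have g0 z : K z -> g z != 0.
  by move=> Kz; rewrite gE; apply: mulf_neq0; [apply: invr_neq0; exact: (ciso_K0 im)|apply: (ciso_L0 im); exact: (ciso_mL im)].
(* On the circle the body of Q/z is (r'/r) exp(i(beta - alpha)); the difference of the two lifts is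
   periodic. *)
pose l (t : R) : C := (ln (r' / r))%:C + 'i * (beta t - alpha t)%:C.
have el t : cexp (l t) = g (r%:C * expi (alpha t)).
  rewrite /l cexp_polar lnK ?posrE ?divr_gt0 // expiD expiN gE -{2}bq bm.
  rewrite rmorphM fmorphV /=; field.
  by rewrite rC expi_neq0.
have perl t : l (t + 2 * pi) = l t.
  by rewrite /l; have [_ _ ->] := da; have [_ _ ->] := db; congr (_ + _ * _%:C); ring.
have cRe (t : R) : cont_at Rline (fun w => (complex.Re w)%:C) t%:C by apply: cont_sub (cont_Re _).
have cl (t : R) : cont_at Rline (fun w => l (complex.Re w)) t%:C.
  apply: cont_add; first exact: cont_cst.
  apply: cont_mul; first exact: cont_cst.
  apply: (@cont_ext _ _ (fun w => (beta (complex.Re w))%:C - (alpha (complex.Re w))%:C)) => //.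
    by move=> w _; rewrite rmorphB.
  apply: cont_add; last apply: cont_opp.
    by apply: (@cont_real _ _ beta); [exact: diffeo1_cont|exact: cRe].
  by apply: (@cont_real _ _ alpha); [exact: diffeo1_cont|exact: cRe].
have [H [cH eH]] := annulus_log r10 rr da perl cl el cg g0.
have hH : forall k, hol k K H.
  by apply: (log_hol pK cH eH) => k; have [[_ h] _] := hX; exact: h.
have [E lgE _] := islog_exists pK hX eX hH eH.
pose Y := BerF K id id m.
have hY : shA K Y.
  by apply: (shA_BerF pK hm) => [k|k|]; [exact: hol_id|exact: hol_id|exact: (ciso_K0 im)].
have eY : even_on K Y := @BerF_even _ _ pK _ _ hm id.
pose g2 z := body (Y z).
have g2E z : g2 z = g z * mP m z fset0.
  rewrite -[g2 z]/((gconst z^-1 * mQ m z * mP m z) fset0).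
  by rewrite !grM0 gconstE eqxx.
have cg2 z : K z -> cont_at K g2 z by move=> Kz; have [h _] := hY; exact: (hA_cont h).
pose Pp (t : R) : C := (od p t).2 fset0; pose Pq (t : R) : C := (od q t).2 fset0.
pose ratio (t : R) : R := complex.Re (Pp t ^+ 2 / Pq t ^+ 2).
have ratioC t : (ratio t)%:C = Pp t ^+ 2 / Pq t ^+ 2.
  by rewrite /ratio /Pp /Pq P2p P2q -fmorphV -rmorphM.
have ratio0 t : 0 < ratio t.
  rewrite /ratio /Pp /Pq P2p P2q -fmorphV -rmorphM /=.
  by apply: divr_gt0; [case: db|case: da].
(* The P of the contactomorphism is a quotient of the theta-coefficients of p and q, so its square
   is beta'/alpha', which is positive. Therefore the square of Ber, rather than Ber, is given a
   logarithm and continued to the annulus. *)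
pose l2 (t : R) : C := l t + l t + (ln (ratio t))%:C.
have Pq0 t : Pq t != 0 by have [_ _ _ h] := cpq; exact: h.
have el2 t : cexp (l2 t) = g2 (r%:C * expi (alpha t)) ^+ 2.
  rewrite /l2 2!cexpD el -[(ln _)%:C]addr0 -(mulr0 'i) cexp_polar lnK ?posrE // expi0 mulr1 ratioC.
  rewrite g2E -bq exprMn [g _ ^+ 2]expr2; congr (_ * _).
  by rewrite /Pp -Pm exprMn -/(Pq t) mulfK //; apply: expf_neq0; exact: Pq0.
have perl2 t : l2 (t + 2 * pi) = l2 t.
  rewrite /l2 perl /ratio /Pp /Pq; have [_ ->] := perq t; by have [_ ->] := perp t.
have cl2 (t : R) : cont_at Rline (fun w => l2 (complex.Re w)) t%:C.
  apply: cont_add; first by apply: cont_add; exact: cl.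
  apply: (@cont_real _ (fun w => ratio (complex.Re w)) (@ln R)); first exact: continuous_ln.
  apply: (@cont_ext _ _ (fun w => Pp (complex.Re w) * Pp (complex.Re w) * (Pq (complex.Re w) * Pq (complex.Re w))^-1)) => //.
  have c1 s K' : cparam K' s -> cont_at Rline (fun w => (od s (complex.Re w)).2 fset0) t%:C.
    by move=> [[[_ [_ h]] _ _ _] _ _ _]; exact: (hA_cont h).
  apply: cont_mul; first by apply: cont_mul; exact: (c1 _ _ cpp).
  by apply: cont_inv; [rewrite mulf_neq0 // Pq0|apply: cont_mul; exact: (c1 _ _ cpq)].
have cg22 z : K z -> cont_at K (fun z => g2 z ^+ 2) z.
  move=> Kz; apply: (@cont_ext _ _ (fun w => g2 w * g2 w)); [by []|by []|by apply: cont_mul; exact: cg2].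
have g20 z : K z -> g2 z ^+ 2 != 0.
  by move=> Kz; apply: expf_neq0; rewrite g2E; apply: mulf_neq0; [exact: g0|exact: (ciso_P im)].
have [H2 [cH2 eH2]] := annulus_log (g := fun z => g2 z ^+ 2) r10 rr da perl2 cl2 el2 cg22 g20.
have [cH3 eH3] := log_sqrt cH2 cg2 eH2.
have hH3 : forall k, hol k K (fun z => half_log (H2 z) (g2 z)).
  by apply: (log_hol pK cH3 eH3) => k; have [[_ h] _] := hY; exact: h.
have [B lgB _] := islog_exists pK hY eY hH3 eH3.
by exists (E, B).
Qed.

Lemma carrier_perfect (x : superannulus R) : perfect (carrier x).
Proof. exact: perfect_annulus (r_entry_gt0 x). Qed.
Lemma carrier_neq0 (x : superannulus R) z : carrier x z -> z != 0.
Proof. exact: annulus_neq0 (r_entry_gt0 x). Qed.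
Lemma r_exit_gt0 (x : superannulus R) : 0 < r_exit x.
Proof. exact: lt_trans (r_entry_gt0 x) (r_entry_lt_exit x). Qed.
Lemma r_entry_in (x : superannulus R) : r_entry x <= r_entry x <= r_exit x.
Proof. by rewrite lexx ltW // r_entry_lt_exit. Qed.
Lemma r_exit_in (x : superannulus R) : r_entry x <= r_exit x <= r_exit x.
Proof. by rewrite lexx ltW // r_entry_lt_exit. Qed.

Lemma circle_cparam (x : superannulus R) (r : R) s : r_entry x <= r <= r_exit x ->
  circle_contactomorphism r s -> cparam (carrier x) s.
Proof.
move=> rr cs; have r0 : 0 < r by apply: lt_le_trans (r_entry_gt0 x) _; case/andP: rr.
have [_ [_ h _ _ _]] := circle_data r0 cs; apply: cparam_sub h.
by move=> z /= cz; apply/annulusE; rewrite cz.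
Qed.

Lemma entry_cparam (x : superannulus R) : cparam (carrier x) (q_entry x).
Proof. exact: circle_cparam (r_entry_in x) (q_entryP x). Qed.
Lemma exit_cparam (x : superannulus R) : cparam (carrier x) (q_exit x).
Proof. exact: circle_cparam (r_exit_in x) (q_exitP x). Qed.

Lemma eqW_sym (v w : preW R) : eqW v w -> eqW w v.
Proof.
move=> [c hc]; exists (- c) => t; rewrite hc !saddE /=.
by rewrite addrK gconst0 !addr0 -surjective_pairing.
Qed.

Lemma eqW_trans (u v w : preW R) : eqW u v -> eqW v w -> eqW u w.
Proof.
move=> [c hc] [d hd']; exists (d + c) => t; rewrite hc hd' !saddE /=.
by rewrite gconst0 !addr0 addrA.
Qed.

Lemma eqW_refl (v : preW R) : eqW v v.
Proof. by exists 0 => t; rewrite saddE gconst0 !addr0 -surjective_pairing. Qed.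

Lemma classP (v w : preW R) : class (@eqW R) v = class (@eqW R) w <-> eqW v w.
Proof.
split=> [h|h].
  have e : eqW v = eqW w := congr1 sval h.
  rewrite e; exact: eqW_refl.
apply: eq_exist; apply/seteqP; split=> u hu.
  exact: eqW_trans (eqW_sym h) hu.
exact: eqW_trans h hu.
Qed.

Lemma shA_inv0 mu nu K F s EB : perfect K -> shA K F -> cparam K s -> slogs s EB ->
  smoothA (inv0 mu nu K F s EB).
Proof.
move=> pK hF cs [[h1 _ _] [h2 _ _]]; have [hs bs b0 p0] := cs; have pR := @perfect_Rline R.
have h : shA Rline (fun z => (ssubst K F (ev (rmap s) z) (od (rmap s) z) + twist (- ('i * mu))%R nu EB z)%S).
  apply: shA_add; first exact: (shA_ssubst pR pK hs (rmap_body cs)).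
  exact: shA_twist.
apply/smoothA_shA; have [h3 h4] := h; split.
  by apply: hA_ext h3 => z Lz; rewrite /inv0 -(RlineE Lz).
by apply: hA_ext h4 => z Lz; rewrite /inv0 -(RlineE Lz).
Qed.

Lemma is_W_shift (v v0 : R -> sgr) (c : gr) : is_W v -> smoothA v0 ->
  (forall t : R, v t = (v0 t + (c, gconst 0))%S) -> is_W v0.
Proof.
move=> [_ per anti] sv e; split => // t.
  have := per t; rewrite !e !saddE /= gconst0 !addr0 => -[/addIr h1 h2].
  by rewrite (surjective_pairing (v0 _)) h1 h2 -surjective_pairing.
have := anti t; rewrite !e !saddE /= gconst0 !addr0 => -[/addIr h1 h2]; by split.
Qed.

(** [Delta_data] with the logarithms fixed. The constants c and d are independent of each other:
    they absorb both the choice of logarithms and that of representatives in W[A]. *)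
Definition Delta_inv0 mu nu (x : superannulus R) EBe EBx (p : WA R * WA R) : Prop :=
  exists F (v w : preW R) (c d : gr),
    [/\ shA (carrier x) F,
        forall t : R, sval v t = (inv0 mu nu (carrier x) F (q_entry x) EBe t + (c, gconst 0))%S,
        forall t : R, sval w t = (inv0 mu nu (carrier x) F (q_exit x) EBx t + (d, gconst 0))%S &
        p = (class (@eqW R) v, class (@eqW R) w)].

Lemma Delta_dataP mu nu (x : superannulus R) EBe EBx p :
  slogs (q_entry x) EBe -> slogs (q_exit x) EBx ->
  Delta_data mu nu x p <-> Delta_inv0 mu nu x EBe EBx p.
Proof.
move=> le lx; have ce := entry_cparam x; have cx := exit_cparam x; have pK := @carrier_perfect x.
split.
  move=> [F [v [w [/(holomorphicA_shA _ pK) hF iv iw ep]]]].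
  have [c hc] := inverse_imageP ce le iv; have [d hd'] := inverse_imageP cx lx iw.
  by exists F, v, w, (gconst c), (gconst d); split.
move=> [F [v [w [c [d [hF ev ew ep]]]]]].
(* The normalized inverse images differ from v and w by constants, so they lie in W[A] and represent
   the same classes. *)
have Wv := is_W_shift (proj2_sig v) (shA_inv0 mu nu pK hF ce le) ev.
have Ww := is_W_shift (proj2_sig w) (shA_inv0 mu nu pK hF cx lx) ew.
exists F, (exist _ _ Wv), (exist _ _ Ww); split.
- exact/(holomorphicA_shA _ pK).
- exact: inverse_image_inv0 ce le _.
- exact: inverse_image_inv0 cx lx _.
- by rewrite ep; congr pair; apply/classP; [exists c|exists d].
Qed.

Lemma inv0E mu nu K F s EB (t : R) : inv0 mu nu K F s EB t =
  (ssubst K F (ev s t) (od s t) + twist (- ('i * mu))%R nu EB t%:C)%S.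
Proof. by []. Qed.

Lemma inv0_ext mu nu K F G s EB (t : R) : perfect K -> shA K F ->
  (forall z, K z -> F z = G z) -> cparam K s ->
  inv0 mu nu K F s EB t = inv0 mu nu K G s EB t.
Proof.
move=> pK hF FG cs; have [hs _ _ _] := cs.
have e : ssubst K F (ev s t) (od s t) = ssubst K G (ev s t) (od s t) :=
  ssubst_ext pK hs (rmap_body cs) (Rline_real t) hF FG.
by rewrite /inv0 e.
Qed.

Lemma inv0_push mu nu K L m n G s EBs EBm (t : R) : ciso K L m n -> mlogs K m EBm ->
  shA K G -> cparam K s ->
  inv0 mu nu K G s EBs t =
  inv0 mu nu L (push K n mu nu G EBm) (scomp K m s) (comp_logs K s EBs EBm) t.
Proof.
move=> im mE hG cs; have pK := ciso_K im.
rewrite -(inv0_pull im mu nu EBs t cs mE (shA_push im mu nu mE hG)).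
by apply: inv0_ext => // z Kz; rewrite (pull_push im).
Qed.

(** The logarithms for y are chosen as the sums of those for x and those of the contactomorphism.
    With this choice [pull] and [push] preserve inverse images exactly, with the same constants. *)
Lemma Delta_same mu nu (x y : superannulus R) p : same_element x y ->
  Delta_data mu nu x p <-> Delta_data mu nu y p.
Proof.
move=> [h [ch /smap_eqT ee /smap_eqT ex]].
have [n im] := contactomorphism_ciso (@carrier_perfect x) (@carrier_neq0 x) (@carrier_neq0 y) ch.
have [EBm mE] := mlogs_exist (r_entry_gt0 x) (r_entry_in x) (r_entry_gt0 y) im (q_entryP x) (q_entryP y) ee.
have [EBe [le _]] := circle_logs (r_entry_gt0 x) (q_entryP x).
have [EBx [lx _]] := circle_logs (r_exit_gt0 x) (q_exitP x).
have ce := entry_cparam x; have cx := exit_cparam x.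
have le' := slogs_comp im ce le mE; have lx' := slogs_comp im cx lx mE.
rewrite ee in le'; rewrite ex in lx'.
apply: iff_trans (Delta_dataP mu nu p le lx) _; apply: iff_sym.
apply: iff_trans (Delta_dataP mu nu p le' lx') _; split.
  move=> [F [v [w [c [d [hF hv hw ep]]]]]].
  exists (pull (carrier y) h mu nu F EBm), v, w, c, d; split => //.
  - exact: (shA_pull im).
  - by move=> t; rewrite (inv0_pull im) // ee hv.
  - by move=> t; rewrite (inv0_pull im) // ex hw.
move=> [G [v [w [c [d [hG hv hw ep]]]]]].
exists (push (carrier x) n mu nu G EBm), v, w, c, d; split => //.
- exact: (shA_push im).
- by move=> t; rewrite hv (inv0_push mu nu EBe t im mE hG ce) ee.
- by move=> t; rewrite hw (inv0_push mu nu EBx t im mE hG cx) ex.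
Qed.

(** Two members of a class are compared through the element that generates it. *)
Lemma Delta_rep mu nu (Q : Gamma R) (q : superannulus R) p : sval Q q ->
  Delta mu nu Q p <-> Delta_data mu nu q p.
Proof.
case: Q => A [x eA] /=; subst A => Aq.
have hq := Delta_same mu nu p Aq; split.
  by move=> [y sy /(Delta_same mu nu p sy)/hq].
by move=> h; exists q.
Qed.

End Invariance.

(** * The seam and gluing *)

Section Seam.
Variable R : realType.
Local Notation C := R[i].
Local Notation gr := (gr R).
Local Notation sgr := (sgr R).
Local Notation Rline := (@Rline R).
Local Notation cR := (@cR R).
Local Notation uR := (@uR R).
Local Notation eps := (gconst 'i : gr).
Implicit Types (K L M : set C) (x y : gr) (z w : C) (F G : C -> sgr) (X Y : sgr).

(** Every term after the first carries the nilpotent part and gains a degree, so the lowest-order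
    part of a substitution is the value at the body. *)
Lemma gsub_fil K (f : C -> gr) n x : perfect K -> (forall z, K z -> fil n (f z)) ->
  K (x fset0) -> fil n.+1 (gsub K f x - f (x fset0)).
Proof.
move=> pK hf Kx S hS; rewrite grBE /gsub /tay big_ord_recl /= fact0 invr1 scale1r expr0 mulr1.
rewrite big1 ?addr0 ?subrr // => k _.
have fJ : fil n (jet K f (x fset0) (lift ord0 k)).
  by move=> S' hS'; apply: (jet_vanish pK) => // w Kw; exact: hf.
have fN : fil 1 ((x - gconst (x fset0)) ^+ (lift ord0 k)).
  have h := @filX R 1 _ (lift ord0 k) (nil_fil x).
  by apply: (@filW R (1 * lift ord0 k)%N 1 _ _ h).
have h := filM fJ fN; rewrite addn1 in h.
by rewrite grZE (h S hS) mulr0.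
Qed.

Lemma gsub_fil0 K (f : C -> gr) n x : perfect K -> (forall z, K z -> fil n (f z)) ->
  K (x fset0) -> fil n (gsub K f x).
Proof.
move=> pK hf Kx; rewrite -(subrK (f (x fset0)) (gsub K f x)); apply: filD; last exact: hf.
by apply: filW (gsub_fil pK hf Kx).
Qed.

(* By induction on the degree: the lowest-order part of D o s is
   (D1 o b, (D2 o b) P0), with b the body of s and P0 != 0. *)
Lemma seam_vanish K s D : perfect K -> shA K D -> cparam K s ->
  (forall f : C -> C, (forall n, hol n K f) -> (forall t : R, f (body (ev s t)) = 0) ->
    forall z, K z -> f z = 0) ->
  (forall t : R, ssubst K D (ev s t) (od s t) = (0, 0)) ->
  forall z, K z -> D z = (0, 0).
Proof.
move=> pK [[_ h1] [_ h2]] cs hid hD.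
have [hs bs b0 p0] := cs.
suff key n : forall z, K z -> fil n (D z).1 /\ fil n (D z).2.
  move=> z Kz; rewrite [LHS]surjective_pairing; congr pair; apply: fil_eq0 => d; by have [] := key d z Kz.
elim: n => [|n ih]; first by [].
have f1 z : K z -> fil n (D z).1 by move=> /ih[].
have f2 z : K z -> fil n (D z).2 by move=> /ih[].
have step t : fil n.+1 (D (body (ev s t))).1 /\ fil n.+1 (D (body (ev s t))).2.
  have [_ par _ _] := hs; have [p1 p2 p3 p4] := par t%:C (Rline_real t).
  have Kb : K ((ev s t).1 fset0) := bs t.
  have := hD t.
  have -> := ssubst_scm K hs D (Rline_real t).
  rewrite -[mQ _ _]/(ev s t).1 -[mr _ _]/(od s t).1 -[mq _ _]/(ev s t).2 -[mP _ _]/(od s t).2 => -[e1 e2].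
  have fr : fil 1 (od s t).1 by apply: fil1; exact: godd_body.
  have fq : fil 1 (ev s t).2 by apply: fil1; exact: godd_body.
  have fd z : K z -> fil n (gd K (fun w => (D w).1) z).
    move=> Kz S hS; apply: (@gd_zero _ K (fun w => (D w).1)) => // w Kw; exact: f1.
  have g1 := gsub_fil pK f1 Kb; have g2 := gsub_fil pK f2 Kb.
  have g20 := gsub_fil0 pK f2 Kb; have gd0 := gsub_fil0 pK fd Kb.
  split.
    have -> : (D (body (ev s t))).1 = - (gsub K (fun w => (D w).1) (ev s t).1 - (D (body (ev s t))).1)
        - gsub K (fun w => (D w).2) (ev s t).1 * (od s t).1.
      by rewrite opprB -addrA -opprD e1 subr0.
    by apply: filB; [exact: filN|rewrite -addn1; exact: filM].
  have fP : fil 1 ((od s t).2 - gconst ((od s t).2 fset0)) := nil_fil _.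
  have h : fil n.+1 ((D (body (ev s t))).2 * gconst ((od s t).2 fset0)).
    (* The theta component of the equation, solved for its lowest-order part. Each subtracted term
       gains a degree: from q, from [gsub_fil], or from the nilpotent part of P. *)
    have -> : (D (body (ev s t))).2 * gconst ((od s t).2 fset0) =
        - (gsub K (gd K (fun w => (D w).1)) (ev s t).1 * (ev s t).2)
        - (gsub K (fun w => (D w).2) (ev s t).1 - (D (body (ev s t))).2) * (od s t).2
        - (D (body (ev s t))).2 * ((od s t).2 - gconst ((od s t).2 fset0)).
      rewrite -[X in _ = X - _ - _]addr0 -e2 addrA addNr add0r mulrBl mulrBr.
      by rewrite subKr subKr.
    apply: filB; last by rewrite -addn1; apply: filM => //; apply: f2; exact: bs.
    apply: filB; first by apply: filN; rewrite -addn1; exact: filM.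
    by rewrite -[n.+1]addn0; apply: filM.
  move=> S hS; have := h S hS; rewrite -(geven_comm _ (geven_const _)) grMconst => /eqP.
  by rewrite mulf_eq0 (negPf (p0 t)) => /eqP.
move=> z Kz; split=> S hS.
  by apply: (hid (fun z => (D z).1 S)) => // t; have [h _] := step t; exact: h.
by apply: (hid (fun z => (D z).2 S)) => // t; have [_ h] := step t; exact: h.
Qed.

Lemma ssubst_sub_dom K L F X Y : perfect K -> perfect L -> K `<=` L -> shA L F ->
  geven X.1 -> K (body X) -> ssubst K F X Y = ssubst L F X Y.
Proof.
move=> pK pL KL [h1 h2] eX KX; rewrite (@ssubstE _ K F X Y eX) (@ssubstE _ L F X Y eX).
have e f : hA L f -> gsub K (gd K f) X.1 = gsub L (gd L f) X.1.
  move=> hf; rewrite -(gsub_sub_dom pK pL KL (hA_gd pL hf) KX).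
  apply: gsub_ext => //; last by apply: hA_gd => //; exact: hA_sub_dom hf.
  by move=> z Kz; apply: gd_sub_dom.
by rewrite (gsub_sub_dom pK pL KL h1 KX) (gsub_sub_dom pK pL KL h2 KX) (e _ h1) (e _ h2).
Qed.

Lemma inv0_sub_dom mu nu K L F s EB (t : R) : perfect K -> perfect L -> K `<=` L -> shA L F ->
  cparam K s -> inv0 mu nu K F s EB t = inv0 mu nu L F s EB t.
Proof.
move=> pK pL KL hF [[_ par _ _] bs _ _]; have [eX _ _ _] := par t%:C (Rline_real t).
by rewrite /inv0 (@ssubst_sub_dom K L F (ev s t) (od s t) pK pL KL hF eX (bs t)).
Qed.

Lemma shA_sub_dom K L F : K `<=` L -> shA L F -> shA K F.
Proof. by move=> KL [h1 h2]; split; [exact: hA_sub_dom h1|exact: hA_sub_dom h2]. Qed.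

Definition sepclosed L : Prop := forall z, ~ L z -> nbhs (z : C^o) (~` L).

Lemma ciso_closed K L m n : compact (K : set C^o) -> ciso K L m n -> sepclosed L.
Proof.
move=> cK im z Lz.
have eL : L = (fun z => body (ev m z)) @` K.
  apply/seteqP; split=> [w Lw|_ [w Kw <-]]; last exact: (ciso_mL im).
  exists (body (ev n w)); first exact: (ciso_nK im).
  exact: (ciso_body (ciso_sym im)).
have cb : compact (L : set C^o).
  rewrite eL; apply: (@continuous_compact C^o C^o) => //.
  apply/subspace_continuousP => w Kw.
  have [[[h _] _] _ _ _] := ciso_m im.
  by have [] := hA_cont h Kw.
have cl : closed (L : set C^o) by apply: compact_closed => //; exact: norm_hausdorff.
by apply: open_nbhs_nbhs; split => //; exact: closed_openC.
Qed.

Section Glue.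
Variables L M : set C.
Hypotheses (cL : sepclosed L) (cM : sepclosed M) (pZ : perfect (L `&` M)).

Definition glue (T : Type) (f g : C -> T) z : T := if asbool (L z) then f z else g z.

Lemma glueL (T : Type) (f g : C -> T) z : L z -> glue f g z = f z.
Proof. by move=> Lz; rewrite /glue asboolT. Qed.
Lemma glueM (T : Type) (f g : C -> T) z : (forall w, L w -> M w -> f w = g w) -> M z ->
  glue f g z = g z.
Proof. by move=> h Mz; rewrite /glue; case: asboolP => // Lz; exact: h. Qed.

Lemma hd_near K K' f f' z l : hd K f z l -> f' z = f z ->
  nbhs (z : C^o) (fun w => K' w -> K w /\ f' w = f w) -> hd K' f' z l.
Proof.
move=> [phi [<- /cont_nbhs cphi e]] fz nz; apply: hd_of_cvg => A /cphi h.
apply: filterS (filterI h nz) => w [h1 h2] wz Kw; have [Kw' fw] := h2 Kw.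
rewrite /cquotient fw fz e // mulrAC divff ?mul1r; last by rewrite subr_eq0; exact/eqP.
exact: h1.
Qed.

(** At a seam point each nearby difference quotient is computed on one of the two sides, and the
    limits on both sides are the same l. *)
Lemma hd_glue f g z l : (forall w, L w -> M w -> f w = g w) -> L z -> M z ->
  hd L f z l -> hd M g z l -> hd (L `|` M) (glue f g) z l.
Proof.
move=> fg Lz Mz [phi [ep /cont_nbhs cphi e]] [psi [eq /cont_nbhs cpsi e']].
apply: hd_of_cvg => A nA.
have h1 : nbhs (z : C^o) (fun w => L w -> A (phi w)) by apply: cphi; rewrite ep.
have h2 : nbhs (z : C^o) (fun w => M w -> A (psi w)) by apply: cpsi; rewrite eq.
apply: filterS (filterI h1 h2) => w [hl hm] wz.
have nz : w - z != 0 by rewrite subr_eq0; exact/eqP.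
case=> [Lw|Mw]; rewrite /cquotient.
  by rewrite !glueL // e // mulrAC divff ?mul1r //; exact: hl.
by rewrite !glueM // e' // mulrAC divff ?mul1r //; exact: hm.
Qed.

(** Functions equal on the seam have equal derivatives there, since both are the derivative relative
    to the seam, which has no isolated points; hence the induction. Off the seam, closedness of the
    other piece makes the problem local to one side. *)
Lemma hol_glue n f g : (forall w, L w -> M w -> f w = g w) ->
  hol n L f -> hol n M g -> hol n (L `|` M) (glue f g).
Proof.
elim: n f g => // n ih f g fg [f' [df hf]] [g' [dg hg]].
have fg' w : L w -> M w -> f' w = g' w.
  move=> Lw Mw; apply: (@hd_uniq _ (L `&` M) f w) => //.
    by apply: hd_sub (df w Lw); exact: subIsetl.
  apply: (@hd_ext _ _ g) => //; first by move=> v [Lv Mv]; rewrite fg.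
  by apply: hd_sub (dg w Mw); exact: subIsetr.
exists (glue f' g'); split; last exact: ih.
move=> z LMz; have [Lz|Lz] := pselect (L z).
  rewrite glueL //; have [Mz|Mz] := pselect (M z).
    by apply: hd_glue => //; [exact: df|rewrite fg' //; exact: dg].
  apply: (hd_near (df z Lz)); first by rewrite glueL.
  by apply: filterS (cM Mz) => w Mw [Lw|//]; rewrite glueL.
have Mz : M z by case: LMz.
rewrite glueM //; apply: (hd_near (dg z Mz)); first by rewrite glueM.
by apply: filterS (cL Lz) => w Lw [//|Mw]; rewrite glueM.
Qed.

Lemma hA_glue (f g : C -> gr) : (forall w, L w -> M w -> f w = g w) ->
  hA L f -> hA M g -> hA (L `|` M) (glue f g).
Proof.
move=> fg [[n fn] hf] [[m fm] hg]; split.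
  exists (maxn n m) => z [Lz|Mz].
    by rewrite glueL //; apply: gfinW (fn z Lz); exact: leq_maxl.
  by rewrite glueM //; apply: gfinW (fm z Mz); exact: leq_maxr.
move=> k S; apply: (@hol_ext _ _ _ (glue (fun z => f z S) (fun z => g z S))).
  by move=> z _; rewrite /glue; case: ifP.
by apply: hol_glue => // w Lw Mw; rewrite fg.
Qed.

Lemma shA_glue F G : (forall w, L w -> M w -> F w = G w) ->
  shA L F -> shA M G -> shA (L `|` M) (glue F G).
Proof.
move=> fg [f1 f2] [g1 g2]; split.
  apply: (@hA_ext _ _ (glue (fun z => (F z).1) (fun z => (G z).1))).
    by move=> z _; rewrite /glue; case: ifP.
  by apply: hA_glue => // w Lw Mw; rewrite fg.
apply: (@hA_ext _ _ (glue (fun z => (F z).2) (fun z => (G z).2))).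
  by move=> z _; rewrite /glue; case: ifP.
by apply: hA_glue => // w Lw Mw; rewrite fg.
Qed.

End Glue.

(** The seam is an immersed curve: by [scm_body] its velocity is a nonzero multiple of Q P^2. *)
Lemma perfect_seam K s : cparam K s -> perfect (range (fun t : R => body (ev s t))).
Proof.
move=> [hs bs b0 p0]; apply: perfect_curve => _ [t _ <-].
have [[[h _] _] _ _ _] := hs; have pR := @perfect_Rline R.
exists (fun w => body (ev s (complex.Re w))), t%:C, (gd Rline (mQ (rmap s)) t%:C fset0); split => //.
- exact: (hA_ghd pR h (Rline_real t) fset0).
- have := scm_body hs (Rline_real t) => e; apply/eqP => e0; move: e; rewrite e0 mulr0 => /esym/eqP.
  by rewrite mulf_eq0 expf_eq0 /= (negPf (p0 t)) orbF; apply/negP; exact: b0.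
Qed.

End Seam.

(** * Invariance under sigma *)

Section Sigma.
Variable R : realType.
Local Notation C := R[i].
Local Notation gr := (gr R).
Local Notation sgr := (sgr R).
Local Notation Rline := (@Rline R).
Local Notation cR := (@cR R).
Local Notation uR := (@uR R).
Local Notation eps := (gconst 'i : gr).
Implicit Types (K L M : set C) (x y : gr) (z w : C) (F G : C -> sgr) (X Y : sgr).

(* The substitution theta |-> - theta. *)
Definition tau X : sgr := (X.1, - X.2).

Lemma tauK X : tau (tau X) = X.
Proof. by rewrite /tau /= opprK -surjective_pairing. Qed.
Lemma tauD X Y : tau (X + Y)%S = (tau X + tau Y)%S.
Proof. by rewrite !saddE /tau /= opprD. Qed.
Lemma tauZ (a : C) X : tau (sscale a X) = sscale a (tau X).
Proof. by rewrite !sscaleE /tau /= scalerN. Qed.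
Lemma sexp_tau X : geven X.1 -> sexp (tau X) = tau (sexp X).
Proof. by move=> eX; rewrite !sexpE // /tau /= mulrN. Qed.

Lemma gscaleN1 x : gscale (-1) x = - x.
Proof. by apply/funext => S; rewrite /gscale mulN1r. Qed.

Lemma sigmaE (s : smap R R) (t : R) : sigma_equivariant s ->
  ev s (t + pi) = (- (ev s t).1, (ev s t).2) /\ od s (t + pi) = (- (od s t).1, (od s t).2).
Proof.
move=> /(_ t)[]; rewrite !gscaleN1 => h1 /oppr_inj h2 h3 /oppr_inj h4.
by rewrite -h1 -h2 -h3 -h4 -!surjective_pairing.
Qed.

Lemma hd_affine K L (f : C -> C) (a b : C) z l : K z -> (forall w, K w -> L (a * w + b)) ->
  hd L f (a * z + b) l -> hd K (fun w => f (a * w + b)) z (a * l).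
Proof.
move=> Kz KL df; rewrite mulrC; apply: (@hd_comp _ K L f (fun w => a * w + b)) => //.
have := hd_add (hd_mul Kz (hd_cst K a z) (hd_id K z)) (hd_cst K b z).
by rewrite mul0r add0r mulr1 addr0.
Qed.

Lemma hol_affine k K L (f : C -> C) (a b : C) : (forall w, K w -> L (a * w + b)) ->
  hol k L f -> hol k K (fun w => f (a * w + b)).
Proof.
move=> KL; apply: hol_comp => //.
by apply: hol_add; [apply: hol_mul; [exact: hol_cst|exact: hol_id]|exact: hol_cst].
Qed.

Lemma hA_affine K L (f : C -> gr) (a b : C) : (forall w, K w -> L (a * w + b)) ->
  hA L f -> hA K (fun w => f (a * w + b)).
Proof.
move=> KL [[n fn] hf]; split; first by exists n => z /KL; exact: fn.
by move=> k S; exact: (@hol_affine k K L (fun w => f w S)).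
Qed.

Lemma gd_affine K L (f : C -> gr) (a b : C) z : perfect K -> perfect L ->
  (forall w, K w -> L (a * w + b)) -> hA L f -> K z ->
  gd K (fun w => f (a * w + b)) z = a *: gd L f (a * z + b).
Proof.
move=> pK pL KL hf Kz; apply: (ghd_gd Kz pK) => S.
exact: (@hd_affine K L (fun w => f w S) _ _ _ _ Kz KL (hA_ghd pL hf (KL z Kz) S)).
Qed.

Lemma Rline_shift (b : R) w : Rline w -> Rline (1 * w + b%:C).
Proof. by move=> /RlineE ->; rewrite mul1r -rmorphD; exact: Rline_real. Qed.

(** The translate of E by pi with theta reversed is another logarithm of X, so it differs from E by
    a constant c. *)
Lemma islog_sigma (X E : C -> sgr) : islog Rline X E ->
  (forall t : R, tau (X (t + pi)%:C) = X t%:C) ->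
  (forall t : R, body (E (t + 2 * pi)%:C) = body (E t%:C)) ->
  forall t : R, E (t + pi)%:C = tau (E t%:C).
Proof.
move=> lE hX per; have [[h1 h2] eE bE] := lE.
pose E' z := tau (E (1 * z + pi%:C)).
have hE' : shA Rline E'.
  split; first by apply: (@hA_affine Rline Rline (fun z => (E z).1)) => // w; exact: Rline_shift.
  apply: (@hA_opp _ _ (fun w => (E (1 * w + pi%:C)).2)).
  by apply: (@hA_affine Rline Rline (fun z => (E z).2)) => // w; exact: Rline_shift.
have sh (t : R) : 1 * t%:C + pi%:C = (t + pi)%:C :> C by rewrite mul1r -rmorphD.
have [|c hc] := islog_uniq lE hE'.
  move=> z /RlineE ->; rewrite /E' sh sexp_tau; last by case: (eE (complex.Re z + pi)%:C (Rline_real _)).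
  by rewrite bE //; exact: Rline_real.
have hb (t : R) : body (E (t + pi)%:C) = body (E t%:C) + c.
  have := congr1 (@body R) (hc t); rewrite /E' sh saddE /body /= => ->.
  by rewrite grDE /= gconstE eqxx.
(* Two translations by pi give one period, so 2c = 0. This excludes a jump by a multiple of 2 pi
   i. *)
have c0 : c = 0.
  have := hb pi; have := hb 0; rewrite add0r => ->.
  have -> : pi + pi = 0 + 2 * pi :> R by ring.
  rewrite per -addrA -[X in X = _]addr0 => /addrI/esym/eqP.
  by rewrite -mulr2n -mulr_natr mulf_eq0 pnatr_eq0 orbF => /eqP.
by move=> t; have := hc t; rewrite /E' sh c0 sconstE gconst0 saddE /= !addr0 -surjective_pairing => <-; rewrite tauK.
Qed.

Lemma uR_pi (t : R) : uR (t + pi)%:C = - uR t%:C.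
Proof. by rewrite /uR /= expiD expi_pi mulrN1. Qed.

Lemma slogs_sigma K s EB : cparam K s -> slogs s EB -> sigma_equivariant s ->
  (forall t : R, body (EB.1 (t + 2 * pi)%:C) = body (EB.1 t%:C) /\
                 body (EB.2 (t + 2 * pi)%:C) = body (EB.2 t%:C)) ->
  forall t : R, EB.1 (t + pi)%:C = tau (EB.1 t%:C) /\ EB.2 (t + pi)%:C = tau (EB.2 t%:C).
Proof.
move=> cs [l1 l2] sg per t; have [hs _ _ _] := cs; have pR := @perfect_Rline R.
have [[[hQ _] [hr _]] _ _ _] := hs.
have shR w : Rline w -> Rline (1 * w + (pi : R)%:C) by exact: Rline_shift.
have sh (s' : R) : 1 * s'%:C + pi%:C = (s' + pi)%:C :> C by rewrite mul1r -rmorphD.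
have gdN (f : C -> gr) (s' : R) : hA Rline f -> (forall u : R, f (u + pi)%:C = - f u%:C) ->
    gd Rline f (s' + pi)%:C = - gd Rline f s'%:C.
  move=> hf fN; have Ls := Rline_real s'.
  rewrite -(gd_opp pR hf Ls) -sh -[LHS]scale1r -(gd_affine pR pR shR hf Ls).
  apply: gd_ext => //; last exact: hA_affine hf.
  by move=> z /RlineE ->; rewrite sh fN.
split.
  apply: (islog_sigma l1); last by move=> u; case: (per u).
  move=> u; rewrite tauZ uR_pi; have [e _] := sigmaE u sg.
  rewrite e /tau /= invrN !sscaleE /=; congr pair; first by rewrite scalerN scaleNr opprK.
  by rewrite scaleNr scalerN opprK.
apply: (islog_sigma l2); last by move=> u; case: (per u).
move=> u; rewrite /BerF /tau /= uR_pi.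
have [e1 e2] := sigmaE u sg.
have eQ (v : R) : mQ (rmap s) (v + pi)%:C = - mQ (rmap s) v%:C.
  by rewrite /mQ /=; have [-> _] := sigmaE v sg.
have er (v : R) : mr (rmap s) (v + pi)%:C = - mr (rmap s) v%:C.
  by rewrite /mr /=; have [_ ->] := sigmaE v sg.
have eP : mP (rmap s) (u + pi)%:C = mP (rmap s) u%:C by rewrite /mP /= e2.
rewrite eQ er eP (gdN _ _ hQ eQ) (gdN _ _ hr er) invrN gconstN.
rewrite -[cR (u + pi)%:C]/(cR u%:C).
congr pair; first by rewrite mulrNN.
by rewrite !(mulrN, mulNr, opprK).
Qed.

(** The pullback under (z, theta) |-> (-z, -theta), in the affine form expected by [hA_affine] and
    [gd_affine]. *)
Definition reflect F z : sgr := tau (F (-1 * z + 0)).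

Lemma carrier_opp (x : superannulus R) z : carrier x z -> carrier x (-1 * z + 0).
Proof.
rewrite mulN1r addr0 => /annulusE h; apply/annulusE.
by have -> : cabs (- z) = cabs z by apply: complexI; rewrite -[LHS]cabsE normrN cabsE.
Qed.

Lemma shA_reflect (x : superannulus R) F : shA (carrier x) F -> shA (carrier x) (reflect F).
Proof.
move=> [h1 h2]; split.
  by apply: (@hA_affine _ (carrier x) (fun z => (F z).1)) => // w; exact: carrier_opp.
apply: (@hA_opp _ _ (fun w => (F (-1 * w + 0)).2)).
by apply: (@hA_affine _ (carrier x) (fun z => (F z).2)) => // w; exact: carrier_opp.
Qed.

Lemma ssubst_reflect (x : superannulus R) F s (t : R) : shA (carrier x) F ->
  cparam (carrier x) s -> sigma_equivariant s ->
  ssubst (carrier x) (reflect F) (ev s t) (od s t) =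
  tau (ssubst (carrier x) F (ev s (t + pi)) (od s (t + pi))).
Proof.
set K := carrier x => hF cs sg; have [h1 h2] := hF; have [hs bs _ _] := cs.
have pK : perfect K := @carrier_perfect _ x.
have [_ par _ _] := hs; have [eQ _ _ _] := par t%:C (Rline_real t).
have Kb : K ((ev s t).1 fset0) := bs t.
have KN w : K w -> K (-1 * w + 0) by exact: carrier_opp.
have hc : hA K (fun z => gconst (-1 * z + 0) : gr).
  apply: hA_const => k; apply: hol_add; last exact: hol_cst.
  by apply: hol_mul; [exact: hol_cst|exact: hol_id].
have cN : gsub K (fun z => gconst (-1 * z + 0)) (ev s t).1 = - (ev s t).1.
  rewrite (@gsub_ext _ K _ (fun z => (-1) *: gconst z)) //; last first.
    by move=> z Kz; rewrite addr0 mulN1r gconstN scaleN1r.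
  rewrite gsub_scale //; last by apply: hA_const => k; exact: hol_id.
  by rewrite gsub_id // scaleN1r.
have gN (f : C -> gr) : hA K f -> gsub K (fun z => f (-1 * z + 0)) (ev s t).1 = gsub K f (- (ev s t).1).
  move=> hf; rewrite -cN -(gsub_comp pK pK hc) //.
  - by apply: gsub_ext => // [z Kz|]; [rewrite gsub_const|exact: hA_affine hf].
  - by move=> z Kz; exact: geven_const.
have [e1 e2] := sigmaE t sg.
have ss G (u : R) : ssubst K G (ev s u) (od s u) =
    (gsub K (fun w => (G w).1) (ev s u).1 + gsub K (fun w => (G w).2) (ev s u).1 * (od s u).1,
     gsub K (gd K (fun w => (G w).1)) (ev s u).1 * (ev s u).2 +
     gsub K (fun w => (G w).2) (ev s u).1 * (od s u).2) := ssubst_scm K hs G (Rline_real u).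
have gopp (f : C -> gr) : hA K f -> gsub K (fun z => - f z) (ev s t).1 = - gsub K f (ev s t).1.
  move=> hf; rewrite -scaleN1r -gsub_scale //.
  by apply: gsub_ext => //; [move=> z Kz; rewrite scaleN1r|exact: hA_opp].
have hd1 := hA_gd pK h1.
have a1 := hA_affine KN h1; have a2 := hA_affine KN h2; have a3 := hA_affine KN hd1.
have g1 : gsub K (fun w => (reflect F w).1) (ev s t).1 = gsub K (fun w => (F w).1) (- (ev s t).1) := gN _ h1.
have g2 : gsub K (fun w => (reflect F w).2) (ev s t).1 = - gsub K (fun w => (F w).2) (- (ev s t).1).
  by rewrite -(gN _ h2); exact: gopp a2.
have g3 : gsub K (gd K (fun w => (reflect F w).1)) (ev s t).1 = - gsub K (gd K (fun w => (F w).1)) (- (ev s t).1).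
  rewrite -(gN _ hd1) -(gopp _ a3).
  apply: (gsub_ext pK _ _ Kb); last exact: (hA_gd pK a1).
  by move=> z Kz; rewrite -scaleN1r; exact: (gd_affine pK pK KN h1 Kz).
rewrite (ss (reflect F) t) (ss F (t + pi)) g1 g2 g3 e1 e2.
by congr pair => /=; rewrite ?mulNr ?mulrN ?opprD.
Qed.

Lemma tau_inv0 mu nu K F s EB (t : R) :
  (forall t : R, EB.1 (t + pi)%:C = tau (EB.1 t%:C) /\ EB.2 (t + pi)%:C = tau (EB.2 t%:C)) ->
  ssubst K F (ev s (t + pi)) (od s (t + pi)) = tau (ssubst K F (ev s t) (od s t)) ->
  inv0 mu nu K F s EB (t + pi) = tau (inv0 mu nu K F s EB t).
Proof. by move=> hE hF; rewrite /inv0 hF !tauD !tauZ; have [-> ->] := hE t. Qed.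

(* If the inverse image on the entry is sigma-invariant, so is the density
   itself, by the identity theorem, hence its inverse image on the exit. *)
Lemma exit_is_W mu nu (x : superannulus R) F EBe EBx (v : preW R) (c : gr) :
  shA (carrier x) F -> slogs (q_entry x) EBe -> slogs (q_exit x) EBx ->
  (forall t : R, body (EBe.1 (t + 2 * pi)%:C) = body (EBe.1 t%:C) /\
                 body (EBe.2 (t + 2 * pi)%:C) = body (EBe.2 t%:C)) ->
  (forall t : R, body (EBx.1 (t + 2 * pi)%:C) = body (EBx.1 t%:C) /\
                 body (EBx.2 (t + 2 * pi)%:C) = body (EBx.2 t%:C)) ->
  (forall t : R, sval v t = (inv0 mu nu (carrier x) F (q_entry x) EBe t + (c, gconst 0))%S) ->
  is_W (inv0 mu nu (carrier x) F (q_exit x) EBx).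
Proof.
set K := carrier x => hF le lx pe px hv.
have ce := entry_cparam x; have cx := exit_cparam x; have pK : perfect K := @carrier_perfect _ x.
have se := slogs_sigma ce le (@q_entry_sigma _ x) pe.
have sx := slogs_sigma cx lx (@q_exit_sigma _ x) px.
have [_ _ anti] := proj2_sig v.
have We := is_W_shift (proj2_sig v) (shA_inv0 mu nu pK hF ce le) hv.
(* The inverse image and the logarithms both have the sigma-symmetry, so the substituted density has
   it as well. *)
have Fe t : ssubst K F (ev (q_entry x) (t + pi)) (od (q_entry x) (t + pi)) =
    tau (ssubst K F (ev (q_entry x) t) (od (q_entry x) t)).
  have [_ _ /(_ t)[]] := We; rewrite gscaleN1 /inv0; have [-> ->] := se t.
  move: (ssubst K F (ev _ (t + pi)) _) (ssubst K F (ev _ t) _) => A A'.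
  rewrite !saddE !sscaleE /tau /= !scalerN -!opprD => /addIr h1 h2.
  rewrite [LHS]surjective_pairing h1; congr pair.
  by move: h2; rewrite [RHS]opprD => /addIr.
(* The failure of the density to be invariant: it vanishes along the entry, hence on the whole
   annulus. *)
pose D z := (reflect F z + sscale (-1) (F z))%S.
have hR := shA_reflect hF.
have hD : shA K D.
  by apply: shA_add => //; apply: shA_sscale => // k; exact: hol_cst.
have [alpha [da _ be _ _]] := circle_data (r_entry_gt0 x) (@q_entryP _ x).
have DE z : K z -> D z = (0, 0).
  apply: (seam_vanish pK hD ce) => [f hf f0 w Kw|t].
    apply: (annulus_identity (r_entry_gt0 x) (r_entry_lt_exit x) hf) => // u cu.
    by have [t _ ->] := diffeo1_surj u da; rewrite cu -be.
  have [hs bs _ _] := ce.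
  have e1 := ssubst_add pK hs (rmap_body ce) (Rline_real t) hR (shA_sscale (fun k => @hol_cst _ k K (-1)) hF).
  have e2 := ssubst_scale pK hs (rmap_body ce) (-1) (Rline_real t) hF.
  have e3 := ssubst_reflect t hF ce (@q_entry_sigma _ x).
  rewrite -[LHS]/(ssubst K D (ev (rmap (q_entry x)) t%:C) (od (rmap (q_entry x)) t%:C)).
  rewrite e1 e2 -[ssubst K (reflect F) _ _]/(ssubst K (reflect F) (ev (q_entry x) t) (od (q_entry x) t)).
  rewrite e3 Fe tauK -[ssubst K F (ev (rmap _) _) _]/(ssubst K F (ev (q_entry x) t) (od (q_entry x) t)).
  by rewrite saddE sscaleE /= !scaleN1r !subrr.
have RF z : K z -> reflect F z = F z.
  move=> Kz; have := DE z Kz; rewrite /D saddE sscaleE /= !scaleN1r => -[/eqP + /eqP].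
  by rewrite !subr_eq0 => /eqP h1 /eqP h2; exact: injective_projections.
have Fx t : ssubst K F (ev (q_exit x) (t + pi)) (od (q_exit x) (t + pi)) =
    tau (ssubst K F (ev (q_exit x) t) (od (q_exit x) t)).
  rewrite -[LHS]tauK -(ssubst_reflect t hF cx (@q_exit_sigma _ x)); congr tau.
  have [hs _ _ _] := cx.
  exact: (ssubst_ext pK hs (rmap_body cx) (Rline_real t) hR RF).
have anti' t := tau_inv0 mu nu sx (Fx t).
split; first exact: shA_inv0.
- move=> t; have -> : t + 2 * pi = t + pi + pi by ring.
  by rewrite !anti' tauK.
- by move=> t; rewrite anti' /tau /= gscaleN1.
Qed.

End Sigma.

(** * The product *)

Section Gluing.
Variable R : realType.
Local Notation C := R[i].
Local Notation gr := (gr R).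
Local Notation sgr := (sgr R).
Local Notation Rline := (@Rline R).
Local Notation logs := ((C -> sgr) * (C -> sgr))%type.
Implicit Types (K L M : set C) (x y : gr) (z w : C) (F G : C -> sgr) (X Y : sgr).

Lemma shA_cst K n x : gfin n x -> shA K (fun=> (x, 0)).
Proof. by move=> fx; split; [exact: (@hA_cst _ _ n)|exact: (@hA_cst _ _ 0)]. Qed.

Lemma ssubst_cst K x X Y : perfect K -> geven X.1 -> K (body X) ->
  ssubst K (fun=> (x, 0)) X Y = (x, 0).
Proof.
move=> pK eX KX; have h0 (f : C -> gr) : (forall z, K z -> f z = 0) -> hA K f -> gsub K f X.1 = 0.
  by move=> f0 hf; rewrite (gsub_ext pK f0 hf KX) gsub_cst.
have gc (y : gr) z : K z -> gd K (fun=> y) z = 0.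
  by move=> Kz; apply: (ghd_gd Kz pK); exact: ghd_cst.
have hA0 (y : gr) : hA K (gd K (fun=> y)).
  by apply: (@hA_ext _ _ (fun=> 0)); [move=> z Kz; rewrite gc|exact: (@hA_cst _ _ 0)].
rewrite (@ssubstE _ K (fun=> (x, 0)) X Y eX) /= !gsub_cst //.
by rewrite !(h0 (gd K _)) // => [|z Kz|z Kz]; rewrite ?gc // !mul0r !addr0.
Qed.

Lemma inv0_addc mu nu K F s EB n x (t : R) : perfect K -> shA K F -> gfin n x -> cparam K s ->
  inv0 mu nu K (fun z => (F z + (x, 0))%S) s EB t = (inv0 mu nu K F s EB t + (x, 0))%S.
Proof.
move=> pK hF fx cs; have [hs bs _ _] := cs.
have [_ par _ _] := hs; have [eX _ _ _] := par t%:C (Rline_real t).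
have e : ssubst K (fun z => (F z + (x, 0))%S) (ev s t) (od s t) =
    (ssubst K F (ev s t) (od s t) + ssubst K (fun=> (x, 0)) (ev s t) (od s t))%S :=
  ssubst_add pK hs (rmap_body cs) (Rline_real t) hF (shA_cst K fx).
rewrite /inv0 e (ssubst_cst x (od s t) pK eX (bs t)).
case: (ssubst _ _ _ _) => a b; rewrite !saddE /= !addr0; congr pair.
by rewrite addrAC.
Qed.

(** A case of [seam_vanish] in which K consists of points of the curve itself, so that the scalar
    identity property is immediate. *)
Lemma seam_eq K s F G : perfect K -> cparam K s -> K `<=` range (fun t : R => body (ev s t)) ->
  shA K F -> shA K G ->
  (forall t : R, ssubst K F (ev s t) (od s t) = ssubst K G (ev s t) (od s t)) ->
  forall z, K z -> F z = G z.
Proof.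
move=> pK cs Ks hF hG FG z Kz; have [hs _ _ _] := cs.
have hN : shA K (fun z => sscale (-1) (G z)) by apply: shA_sscale => // k; exact: hol_cst.
suff : (F z + sscale (-1) (G z))%S = (0, 0).
  rewrite saddE sscaleE /= !scaleN1r => -[/eqP + /eqP].
  by rewrite !subr_eq0 => /eqP h1 /eqP h2; exact: injective_projections.
apply: (@seam_vanish R K s (fun z => (F z + sscale (-1) (G z))%S)) => //; first exact: shA_add.
  by move=> f _ f0 w /Ks[t _ <-].
move=> t.
have e1 : ssubst K (fun z => (F z + sscale (-1) (G z))%S) (ev s t) (od s t) =
    (ssubst K F (ev s t) (od s t) + ssubst K (fun z => sscale (-1) (G z)) (ev s t) (od s t))%S :=
  ssubst_add pK hs (rmap_body cs) (Rline_real t) hF hN.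
have e2 : ssubst K (fun z => sscale (-1) (G z)) (ev s t) (od s t) =
    sscale (-1) (ssubst K G (ev s t) (od s t)) :=
  ssubst_scale pK hs (rmap_body cs) (-1) (Rline_real t) hG.
by rewrite e1 e2 FG; case: (ssubst _ _ _ _) => a b; rewrite saddE sscaleE /= !scaleN1r !subrr.
Qed.

Lemma Delta_glued mu nu (p q t : superannulus R) a b : glued p q t ->
  Delta_data mu nu t (a, b) <->
  exists y : WA R, Delta_data mu nu q (a, y) /\ Delta_data mu nu p (y, b).
Proof.
move=> [L [M [f [g [[cf cg] eT eZ /smap_eqT es [/smap_eqT ee /smap_eqT ex]]]]]].
set T := carrier t in eT; have pT : perfect T := @carrier_perfect _ t.
have LT : L `<=` T by rewrite -eT; exact: subsetUl.
have MT : M `<=` T by rewrite -eT; exact: subsetUr.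
have T0 z : T z -> z != 0 by exact: carrier_neq0.
set Kq := carrier q in cf eZ es ee; set Kp := carrier p in cg es ex.
have [nf imf] := contactomorphism_ciso (@carrier_perfect _ q) (@carrier_neq0 _ q) (fun z Lz => T0 z (LT z Lz)) cf.
have [ng img] := contactomorphism_ciso (@carrier_perfect _ p) (@carrier_neq0 _ p) (fun z Mz => T0 z (MT z Mz)) cg.
have pL := ciso_L imf; have pM := ciso_L img.
have [EBf lf] := mlogs_exist (r_entry_gt0 q) (r_entry_in q) (r_entry_gt0 t) imf
  (@q_entryP _ q) (@q_entryP _ t) ee.
have [EBg lg] := mlogs_exist (r_entry_gt0 p) (r_exit_in p) (r_exit_gt0 t) img
  (@q_exitP _ p) (@q_exitP _ t) ex.
have [EBqe [lqe pqe]] := circle_logs (r_entry_gt0 q) (@q_entryP _ q).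
have [EBqx [lqx pqx]] := circle_logs (r_exit_gt0 q) (@q_exitP _ q).
have [EBpe [lpe _]] := circle_logs (r_entry_gt0 p) (@q_entryP _ p).
have [EBpx [lpx _]] := circle_logs (r_exit_gt0 p) (@q_exitP _ p).
have cqe := entry_cparam q; have cqx := exit_cparam q.
have cpe := entry_cparam p; have cpx := exit_cparam p.
set s := scomp Kq f (q_exit q) in eZ es.
have lte := slogs_comp imf cqe lqe lf; rewrite -/Kq ee in lte.
have ltx := slogs_comp img cpx lpx lg; rewrite -/Kp ex in ltx.
have l1 := slogs_comp imf cqx lqx lf; rewrite -/Kq -/s in l1.
have l2 := slogs_comp img cpe lpe lg; rewrite -/Kp -es in l2.
have cLe : cparam L (q_entry t) by rewrite -ee; exact: (cparam_comp imf cqe).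
have cMx : cparam M (q_exit t) by rewrite -ex; exact: (cparam_comp img cpx).
have cLs : cparam L s by exact: (cparam_comp imf cqx).
have cMs : cparam M s by rewrite es; exact: (cparam_comp img cpe).
(* The seam receives logarithms from the exit of q and from the entry of p; the two choices give
   inverse images that differ by the constant k. *)
have [k hk] := inv0_slogs mu nu l1 l2.
apply: iff_trans (Delta_dataP mu nu (a, b) lte ltx) _; split.
  move=> [F [v [w [c [d [hF ev' ew [ea eb]]]]]]].
  have hFL := shA_sub_dom LT hF; have hFM := shA_sub_dom MT hF.
  pose Fq := pull L f mu nu F EBf; pose Fp := pull M g mu nu F EBg.
  have hFq : shA Kq Fq := shA_pull imf mu nu lf hFL.
  have hFp : shA Kp Fp := shA_pull img mu nu lg hFM.
  have hv u : sval v u = (inv0 mu nu Kq Fq (q_entry q) EBqe u + (c, gconst 0))%S.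
    by rewrite ev' -(inv0_sub_dom mu nu _ u pL pT LT hF cLe) /Fq (inv0_pull imf) // -/Kq ee.
  have hw u : sval w u = (inv0 mu nu Kp Fp (q_exit p) EBpx u + (d, gconst 0))%S.
    by rewrite ew -(inv0_sub_dom mu nu _ u pM pT MT hF cMx) /Fp (inv0_pull img) // -/Kp ex.
  (* The intermediate element of the composition has to lie in W[A], which is not automatic for an
     inverse image on the seam; here it follows from the entry of q. *)
  pose y : preW R := exist _ _ (exit_is_W hFq lqe lqx pqe pqx hv).
  exists (class (@eqW R) y); split.
    apply/(Delta_dataP mu nu _ lqe lqx).
    exists Fq, v, y, c, 0; split=> //; last by rewrite ea.
    by move=> u /=; rewrite saddE gconst0 !addr0 -surjective_pairing.
  apply/(Delta_dataP mu nu _ lpe lpx).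
  (* Read from the side of p, the inverse image of the same density exceeds y by k. *)
  exists Fp, y, w, (- gconst k), d; split=> //; last by rewrite eb.
  move=> u /=; rewrite /Fq /Fp (inv0_pull imf) // (inv0_pull img) // -/Kq -/Kp -es -/s.
  rewrite (inv0_sub_dom mu nu _ u pL pT LT hF cLs) (inv0_sub_dom mu nu _ u pM pT MT hF cMs) hk.
  move: (inv0 _ _ _ _ _ _ _) => Z.
  by rewrite !saddE /= gconst0 !addr0 addrK -surjective_pairing.
move=> [y [/(Delta_dataP mu nu _ lqe lqx) [Fq [v [y1 [c1 [d1 [hFq hv hy1 [ea ey1]]]]]]]
  /(Delta_dataP mu nu _ lpe lpx) [Fp [y2 [w [c2 [d2 [hFp hy2 hw [ey2 eb]]]]]]]]].
have [e he] : eqW y1 y2 by apply/classP; rewrite -ey1 -ey2.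
pose FL := push Kq nf mu nu Fq EBf; pose FM := push Kp ng mu nu Fp EBg.
have hFL : shA L FL := shA_push imf mu nu lf hFq.
have hFM : shA M FM := shA_push img mu nu lg hFp.
(* The jump of the two densities across the seam: k from the logarithms, d1 and c2 from the inverse
   images, and e from the choice of representatives in the common class. *)
pose e' : gr := gconst k + (c2 + e - d1).
have seam u : ssubst L FL (ev s u) (od s u) = (ssubst M FM (ev s u) (od s u) + (e', 0))%S.
  have h1 := inv0_push mu nu EBqx u imf lf hFq cqx; rewrite -/Kq -/s -/FL in h1.
  have h2 := inv0_push mu nu EBpe u img lg hFp cpe; rewrite -/Kp -es -/FM (hk M FM u) in h2.
  have := hy1 u; rewrite he hy2 h1 h2 !inv0E sconstE gconst0.
  move: (ssubst L _ _ _) (ssubst M _ _ _) (twist _ _ _ _) => [A1 A2] [B1 B2] [Z1 Z2].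
  rewrite !saddE /= !addr0 => -[/eqP h3 /addIr ->]; congr pair.
  apply: (@addIr _ Z1); apply: (@addIr _ d1); move/eqP: h3 => <-; rewrite /e'.
  have -> : B1 + (gconst k + (c2 + e - d1)) + Z1 + d1 = B1 + Z1 + gconst k + c2 + e + (d1 - d1).
    by rewrite !addrA -!(addrAC _ Z1) -!(addrAC _ d1).
  by rewrite subrr addr0.
(* The constants of [eqW] are arbitrary elements of [gr], but e' is a difference of values of two
   finitely generated functions, so it may be added to a density. *)
have [n fe] : exists n, gfin n e'.
  have pR := @perfect_Rline R; have [hs _ _ _] := cLs; have [hs' _ _ _] := cMs.
  have [[[n hn] _] _] := shA_ssubst pR pL hs (rmap_body cLs) hFL.
  have [[[m hm] _] _] := shA_ssubst pR pM hs' (rmap_body cMs) hFM.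
  exists (maxn n m).
  have -> : e' = (ssubst L FL (ev s 0) (od s 0)).1 - (ssubst M FM (ev s 0) (od s 0)).1.
    rewrite seam; move: (ssubst M _ _ _) => Z; by rewrite saddE /= addrAC subrr add0r.
  apply: gfinD; first by apply: gfinW (hn (0 : R)%:C (Rline_real 0)); exact: leq_maxl.
  by apply: gfinN; apply: gfinW (hm (0 : R)%:C (Rline_real 0)); exact: leq_maxr.
pose FM' z := (FM z + (e', 0))%S.
have hFM' : shA M FM' by apply: shA_add => //; exact: shA_cst fe.
pose Z := L `&` M.
have pZ : perfect Z by rewrite /Z eZ; exact: perfect_seam cLs.
have ZL : Z `<=` L by exact: subIsetl.
have ZM : Z `<=` M by exact: subIsetr.
have cZ : cparam Z s.
  by have [h1 h2 h3 h4] := cLs; split=> // u; rewrite /Z eZ; exists u.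
have [hs _ _ _] := cMs; have [_ par _ _] := hs.
(* Equality after substitution of the parametrization is turned into equality of values and
   theta-coefficients on the seam, by calculus relative to the seam alone. *)
have FLM z : L z -> M z -> FL z = FM' z.
  move=> Lz Mz; apply: (seam_eq pZ cZ) => //.
  - by rewrite /Z eZ.
  - exact: shA_sub_dom ZL hFL.
  - exact: shA_sub_dom ZM hFM'.
  move=> u; have [eX _ _ _] := par u%:C (Rline_real u).
  have [_ bZ _ _] := cZ.
  rewrite (ssubst_sub_dom (od s u) pZ pL ZL hFL eX (bZ u)) (ssubst_sub_dom (od s u) pZ pM ZM hFM' eX (bZ u)) seam.
  have e1 : ssubst M FM' (ev s u) (od s u) =
      (ssubst M FM (ev s u) (od s u) + ssubst M (fun=> (e', 0)) (ev s u) (od s u))%S :=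
    ssubst_add pM hs (rmap_body cMs) (Rline_real u) hFM (shA_cst M fe).
  by rewrite e1 (ssubst_cst e' (od s u) pM eX (ZM _ (bZ u))).
have cl1 : sepclosed L := ciso_closed (compact_annulus (ltW (r_entry_gt0 q))) imf.
have cl2 : sepclosed M := ciso_closed (compact_annulus (ltW (r_entry_gt0 p))) img.
pose F := glue L FL FM'.
have hF : shA T F by rewrite -eT; exact: shA_glue.
(* The density on the side of p was raised by e', so the constant at the exit is lowered by it. *)
exists F, v, w, c1, (d2 - e'); split=> //.
- move=> u; rewrite hv (inv0_push mu nu EBqe u imf lf hFq cqe) -/Kq ee -/FL.
  rewrite -(inv0_sub_dom mu nu _ u pL pT LT hF cLe); congr (sadd _ _).
  by apply: inv0_ext => // z Lz; rewrite /F glueL.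
- move=> u; rewrite hw (inv0_push mu nu EBpx u img lg hFp cpx) -/Kp ex -/FM.
  rewrite -(inv0_sub_dom mu nu _ u pM pT MT hF cMx).
  rewrite -(inv0_ext mu nu _ u pM hFM' (fun z Mz => esym (glueM FLM Mz)) cMx).
  rewrite (inv0_addc mu nu _ u pM hFM fe cMx).
  move: (inv0 _ _ _ _ _ _ _) => [A1 A2].
  by rewrite !saddE /= gconst0 !addr0 -addrA (addrC e') subrK.
by rewrite ea eb.
Qed.

End Gluing.

Theorem theorem9p1 (R : realType) (mu nu : R[i]%C) (P Q PQ : Gamma R) :
  is_product P Q PQ ->
  rel_comp (Delta mu nu P) (Delta mu nu Q) = Delta mu nu PQ.
Proof.
move=> [p [q [t [Pp Qq Tt gl]]]]; apply/seteqP; split=> -[a b].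
  move=> [y [/(Delta_rep mu nu _ Qq) h1 /(Delta_rep mu nu _ Pp) h2]].
  by apply/(Delta_rep mu nu _ Tt)/(Delta_glued mu nu a b gl); exists y.
move=> /(Delta_rep mu nu _ Tt)/(Delta_glued mu nu a b gl)[y [h1 h2]].
by exists y; split; [apply/(Delta_rep mu nu _ Qq)|apply/(Delta_rep mu nu _ Pp)].
Qed.
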